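(* Let $(\bar x,\bar u)$ be a weak local minimizer of problem (P) with $\bar g(0)=0$ and $\bar g_u(0)=0$ (in the sense of essential limits). For $\varepsilon>0$ write $A_\varepsilon=\{t\in[0,1]:\bar g(t)\ge-\varepsilon\}$. Assume: (1) for every $0<a<b<1$ there exist $\varepsilon>0$ and $v_0\in L^\infty([a,b];\mathbb R^m)$ with $\bar g_u(t)v_0(t)\ge1$ for a.e. $t\in A_\varepsilon\cap[a,b]$; (2) there exist $\varepsilon_0\in(0,1)$, $\varepsilon>0$ and a non-decreasing $\omega:(0,\varepsilon_0]\to(0,\infty)$ with $\int_0^{\varepsilon_0}\omega(t)^{-1}\,dt<\infty$ and $|\bar g_u(t)|\ge\omega(t)$ for a.e. $t\in A_\varepsilon\cap[0,\varepsilon_0]$; (3) there exist $\varepsilon>0$ and $(y,v)\in W^{1,1}([0,1];\mathbb R^n)\times L^\infty([0,1];\mathbb R^m)$ solving $$\dot y(t)=\bar f_x(t)y(t)+\bar f_u(t)v(t)\ \text{ a.e.},\qquad y(0)=0,$$ such that, with $w:=\bar g_xy+\bar g_uv$, one has $w\le0$ a.e. on $A_\varepsilon$ and, for every $\eta\in(0,1)$, there is $\delta_\eta>0$ with $w(t)\le-\delta_\eta$ for a.e. $t\in A_\varepsilon\cap[\eta,1]$. Then there exists a multiplier tuple $(\lambda,\beta,\lambda_0,z,\zeta)$ for (P) at $(\bar x,\bar u)$ with $\lambda_0>0$ whose pure charge $\zeta$ either vanishes or is left-concentrated at $t=1$. Moreover, for every $\eta\in(0,1)$ (with $y,v,\delta_\eta$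 as in (3)), $$\zeta([0,1])+\int_{[\eta,1]}z(t)\,dt\ \le\ \frac{\lambda_0}{\delta_\eta}\int_0^1\bigl|\bar L_x(t)y(t)+\bar L_u(t)v(t)\bigr|\,dt .$$
   Context: Notation. $|\cdot|$ is the Euclidean norm; ''a.e.'' refers to Lebesgue measure $\mathrm{Leb}$; $\mathfrak L$ is the $\sigma$-algebra of Lebesgue measurable subsets of $[0,1]$. $BV([0,1];\mathbb R^n)$ denotes functions of bounded variation that are right-continuous on $(0,1)$. A measurable $k:[0,1]\to\mathbb R$ has essential limit $\alpha$ at $t$ if for every $\varepsilon>0$ there is a neighborhood $V$ of $t$ with $|k(s)-\alpha|<\varepsilon$ for a.e. $s\in V\cap[0,1]$; for $k$ in a Lebesgue space, ''$k(t)=\alpha$'' at a given instant $t$ means that the essential limit exists and equals $\alpha$ (componentwise for vector functions). Problem (P): minimize $J(x,u)=\int_0^1L(t,x(t),u(t))\,dt$ over $(x,u)\in W^{1,1}([0,1];\mathbb R^n)\times L^\infty([0,1];\mathbb R^m)$ subject to $\dot x(t)=f(t,x(t),u(t))$ a.e., $g(t,x(t),u(t))\le 0$ a.e., $x(0)=x_0$, where $x_0\in\mathbb R^n$ is fixed and $(L,f,g):[0,1]\times\mathbb R^n\times\mathbb R^m\to\mathbb R\times\mathbb R^n\times\mathbb R$ are continuous in $(t,x,u)$ and continuously differentiable in $(x,u)$ (derivatives jointly continuous in $(t,x,u)$). Pairs satisfying the constraints are admissible processes. A weak local minimizer is an admissible $(\bar x,\bar u)$ for which there is $\varepsilon>0$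 with $J(\bar x,\bar u)\le J(x,u)$ for all admissible $(x,u)$ with $\|x-\bar x\|_C<\varepsilon$, $\|u-\bar u\|_{L^\infty}<\varepsilon$. A bar denotes evaluation along $(\bar x,\bar u)$: $\bar k(t)=k(t,\bar x(t),\bar u(t))$; $\bar L_x,\bar L_u,\bar g_x,\bar g_u$ are row vectors and $\bar f_x,\bar f_u$ Jacobian matrices. Charges. A charge is a finitely additive set function on $\mathfrak L$ vanishing at $\emptyset$; $\operatorname{ba}$ denotes the bounded charges vanishing on Lebesgue null sets (isometric to $L^\infty([0,1];\mathbb R)^*$ with the total variation norm). A positive charge $\zeta$ is pure if the only countably additive measure $\mu$ with $0\le\mu\le\zeta$ is $\mu=0$. For $k\in L^\infty$, $\int_E k\,d\zeta$ is the limit of integrals of simple functions converging to $k\chi_E$ uniformly a.e. (componentwise for vectors). For $\zeta\ge0$, ''$k=0$ $\zeta$-a.e.'' means $\zeta(\{|k|>\varepsilon\})=0$ for all $\varepsilon>0$. $\zeta$ is left-concentrated at $t^*$ if $\zeta((t^*-\varepsilon,t^* ))=\zeta([0,1])$ for all $\varepsilon>0$ (interval intersected with $[0,1]$). Multiplier tuple for (P) at $(\bar x,\bar u)$: $(\lambda,\beta,\lambda_0,z,\zeta)$ with $\lambda_0\ge0$ a scalar, $z\in L^1([0,1];\mathbb R)$, $z\ge0$, $\zeta\in\operatorname{ba}$ a pure charge, $\zeta\ge0$, $\lambda,\beta\in BV([0,1];\mathbb R^n)$ such that: (a) $\lambda_0+\|z\|_{L^1}+\zeta([0,1])>0$; (b)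 $z(t)\bar g(t)=0$ a.e. and $\bar g=0$ $\zeta$-a.e.; (c) $\lambda(1)=\beta(1)=0$, $-d\lambda=[\bar f_x^T\lambda+\lambda_0\bar L_x^T+z\bar g_x^T]\,dt+d\beta$ (as measures on $[0,1]$), where $\beta(0)=-\int_0^1\bar g_x^T\,d\zeta$ and $\beta(t)=-\lim_{k\to\infty}\int_{t+1/k}^1\bar g_x^T\,d\zeta$ for $t\in(0,1)$; (d) $0=\bar f_u^T\lambda+\lambda_0\bar L_u^T+\bar g_u^Tz$ a.e., and $\int_E\bar g_u^T\,d\zeta=0$ for every $E\in\mathfrak L$. *)

(* Defs.v *)
From HB Require Import structures.
From mathcomp Require Import all_boot all_order all_algebra.
From mathcomp Require Import all_classical all_reals all_analysis.
From mathcomp Require Import ess_sup_inf.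

Set Implicit Arguments.
Unset Strict Implicit.
Unset Printing Implicit Defensive.

Import Order.TTheory GRing.Theory Num.Theory.
Import numFieldNormedType.Exports.
Import HBSimple.

Local Open Scope classical_set_scope.
Local Open Scope ring_scope.

(* The real line with the sigma-algebra of Lebesgue measurable sets (the
   carrier is R itself); [measurableTypeR R] is the line with Borel sets. *)
Definition lebT (R : realType) : measurableType _ :=
  caratheodory_type ((@wlength R idfun)^*)%mu.

Definition Leb (R : realType) : {measure set (lebT R) -> \bar R} :=
  @completed_lebesgue_measure R.

(* The property P t holds for almost every t in D. *)
Definition ae_on (R : realType) (D : set R) (P : R -> Prop) : Prop :=
  {ae @Leb R, forall t : lebT R, D t -> P t}.

Definition I01 (R : realType) : set R := [set` `[0%R, 1%R]].
Arguments I01 {R}.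

Section FunctionSpaces.
Context {R : realType}.

Definition enorm (p : nat) (v : 'cV[R]_p) : R :=
  Num.sqrt (\sum_i v i 0 ^+ 2).

Definition Linfty (p : nat) (a b : R) (u : R -> 'cV[R]_p) : Prop :=
  (forall i, measurable_fun (`[a, b] : set (lebT R))
               (fun t : lebT R => u t i 0)) /\
  exists M : R, ae_on `[a, b] (fun t => enorm (u t) <= M).

Definition L1 (z : R -> R) : Prop :=
  (@Leb R).-integrable I01 (fun t : lebT R => (z t)%:E).

(* x is in W^{1,1}([0,1];R^p) (absolutely continuous representative) and xdot
   is its derivative. *)
Definition W11 (p : nat) (x xdot : R -> 'cV[R]_p) : Prop :=
  forall i, L1 (fun t => xdot t i 0) /\
    forall t, I01 t ->
      x t i 0 = x 0 i 0 + \int[@Leb R]_(s in `[0, t]) xdot s i 0.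

Definition normC (p : nat) (x : R -> 'cV[R]_p) : R :=
  sup [set enorm (x t) | t in I01].

Definition normLinfty (p : nat) (u : R -> 'cV[R]_p) : \bar R :=
  ess_sup (@Leb R) ((fun t : lebT R => (enorm (u t))%:E) \_ I01).

Definition BV (p : nat) (F : R -> 'cV[R]_p) : Prop :=
  forall i, bounded_variation 0 1 (fun t => F t i 0) /\
    forall t, 0 < t < 1 -> (fun s => F s i 0) @ t^'+ --> F t i 0.

(* mu is the signed Borel measure dF on [0,1] of a function F of bounded
   variation, right-continuous on ]0,1[; the library calls "charge" a finite
   signed (countably additive) measure.  The point t = 0 is excluded, since
   dF({0}) = F(0+) - F(0) may be nonzero. *)
Definition stieltjes (F : R -> R)
    (mu : {charge set (measurableTypeR R) -> \bar R}) : Prop :=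
  forall t, 0 < t <= 1 -> mu [set` `[0%R, t]] = (F t - F 0)%:E.

Definition has_ess_lim (k : R -> R) (t alpha : R) : Prop :=
  forall e, 0 < e -> exists2 V : set R,
    nbhs t V & ae_on (V `&` I01) (fun s => `|k s - alpha| < e).

End FunctionSpaces.

Section Charges.
Context {R : realType}.
Local Open Scope ereal_scope.

(* Charges on the Lebesgue measurable subsets of [0,1] are encoded as charges
   on the Lebesgue measurable subsets of R that vanish on every set whose
   trace on [0,1] is Lebesgue null. *)
Definition ba (zeta : {additive_charge set (lebT R) -> \bar R}) : Prop :=
  (exists M : R, forall A : set (lebT R), measurable A ->
     `|zeta A| <= M%:E) /\
  (forall N : set (lebT R), measurable N -> @Leb R (N `&` I01) = 0 ->
     zeta N = 0).

Definition nonneg_charge (zeta : set (lebT R) -> \bar R) : Prop :=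
  forall A : set (lebT R), measurable A -> 0 <= zeta A.

Definition pure_charge (zeta : set (lebT R) -> \bar R) : Prop :=
  forall mu : {measure set (lebT R) -> \bar R},
    (forall A : set (lebT R), measurable A -> mu A <= zeta A) ->
    forall A : set (lebT R), measurable A -> mu A = 0.

Definition is_charge_integral (zeta : set (lebT R) -> \bar R)
    (E : set R) (k : R -> R) (c : R) : Prop :=
  exists s : nat -> {sfun lebT R >-> R},
    (forall e : R, (0 < e)%R -> \forall j \near \oo,
       ae_on I01 (fun t => (`|s j t - (k \_ E) t| <= e)%R)) /\
    (fun j => fine (sintegral zeta (s j))) @ \oo --> c.

(* Well defined for zeta in ba, k in L^infty and E Lebesgue measurable. *)
Definition charge_integral (zeta : set (lebT R) -> \bar R)
    (E : set R) (k : R -> R) : R :=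
  get (is_charge_integral zeta E k).

Definition charge_integral_vec (p : nat) (zeta : set (lebT R) -> \bar R)
    (E : set R) (k : R -> 'cV[R]_p) : 'cV[R]_p :=
  \col_i charge_integral zeta E (fun t => k t i 0%R).

Definition null_charge_ae (zeta : set (lebT R) -> \bar R) (k : R -> R) : Prop :=
  forall e : R, (0 < e)%R -> zeta [set t | I01 t /\ (`|k t| > e)%R] = 0.

Definition left_concentrated (zeta : set (lebT R) -> \bar R) (ts : R) : Prop :=
  forall e : R, (0 < e)%R ->
    zeta ([set` `](ts - e)%R, ts[] `&` I01) = zeta I01.

End Charges.

Section ControlProblem.
Context {R : realType} {n m : nat}.
Implicit Types (x : R -> 'cV[R]_n) (u : R -> 'cV[R]_m).

(* Only the values at times in [0,1] of the data are meaningful. *)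
Record problem := Problem {
  cost : R -> 'cV[R]_n -> 'cV[R]_m -> R ;
  dyn : R -> 'cV[R]_n -> 'cV[R]_m -> 'cV[R]_n ;
  constr : R -> 'cV[R]_n -> 'cV[R]_m -> R ;
  init : 'cV[R]_n }.

Definition dom : set (R * 'cV[R]_n * 'cV[R]_m) := [set q | I01 q.1.1].

(* F is continuous on [0,1] x R^n x R^m and continuously differentiable in
   (x,u), with differential jointly continuous in (t,x,u). *)
Definition C1_data (W : normedModType R)
    (F : R -> 'cV[R]_n -> 'cV[R]_m -> W) : Prop :=
  let Ft t := (fun p : 'cV[R]_n * 'cV[R]_m => F t p.1 p.2) in
  [/\ {within dom, continuous (fun q => F q.1.1 q.1.2 q.2)},
      forall t p, I01 t -> differentiable (Ft t) p
    & forall h : 'cV[R]_n * 'cV[R]_m,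
        {within dom, continuous (fun q => 'd (Ft q.1.1) (q.1.2, q.2) h)}].

Definition smooth_problem (P : problem) : Prop :=
  [/\ C1_data (cost P : _ -> _ -> _ -> R^o), C1_data (dyn P)
    & C1_data (constr P : _ -> _ -> _ -> R^o)].

Definition gradient (p : nat) (k : 'cV[R]_p -> R) (a : 'cV[R]_p) : 'rV[R]_p :=
  \row_j 'D_(delta_mx j 0) (k : _ -> R^o) a.

Definition jacobian_mx (p q : nat) (F : 'cV[R]_p -> 'cV[R]_q) (a : 'cV[R]_p) :
    'M[R]_(q, p) :=
  \matrix_(i, j) ('D_(delta_mx j 0) F a) i 0.

Definition admissible (P : problem) x u : Prop :=
  [/\ Linfty 0 1 u,
      exists2 xdot, W11 x xdot &
        ae_on I01 (fun t => xdot t = dyn P t (x t) (u t)),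
      ae_on I01 (fun t => constr P t (x t) (u t) <= 0)
    & x 0 = init P].

Definition objective (P : problem) x u : R :=
  \int[@Leb R]_(t in I01) cost P t (x t) (u t).

Definition weak_local_minimizer (P : problem) x u : Prop :=
  admissible P x u /\
  exists2 e : R, 0 < e & forall x' u', admissible P x' u' ->
    normC (fun t => x' t - x t) < e ->
    (normLinfty (fun t => u' t - u t)%R < e%:E)%E ->
    objective P x u <= objective P x' u'.

Section AlongProcess.
Variables (P : problem) (xb : R -> 'cV[R]_n) (ub : R -> 'cV[R]_m).

Definition g_bar (t : R) : R := constr P t (xb t) (ub t).
Definition Lx_bar (t : R) : 'rV[R]_n := gradient (cost P t ^~ (ub t)) (xb t).
Definition Lu_bar (t : R) : 'rV[R]_m := gradient (cost P t (xb t)) (ub t).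
Definition gx_bar (t : R) : 'rV[R]_n := gradient (constr P t ^~ (ub t)) (xb t).
Definition gu_bar (t : R) : 'rV[R]_m := gradient (constr P t (xb t)) (ub t).
Definition fx_bar (t : R) : 'M[R]_(n, n) :=
  jacobian_mx (dyn P t ^~ (ub t)) (xb t).
Definition fu_bar (t : R) : 'M[R]_(n, m) :=
  jacobian_mx (dyn P t (xb t)) (ub t).

Definition active (e : R) : set R := [set t | I01 t /\ g_bar t >= - e].

Definition lin_cost (y : R -> 'cV[R]_n) (v : R -> 'cV[R]_m) (t : R) : R :=
  (Lx_bar t *m y t + Lu_bar t *m v t) 0 0.

Definition lin_constr (y : R -> 'cV[R]_n) (v : R -> 'cV[R]_m) (t : R) : R :=
  (gx_bar t *m y t + gu_bar t *m v t) 0 0.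

Definition linearized_process (y : R -> 'cV[R]_n) (v : R -> 'cV[R]_m) : Prop :=
  [/\ Linfty 0 1 v,
      exists2 ydot, W11 y ydot &
        ae_on I01 (fun t => ydot t = fx_bar t *m y t + fu_bar t *m v t)
    & y 0 = 0].

Definition adjoint_density (lam : R -> 'cV[R]_n) (lam0 : R) (z : R -> R)
    (t : R) : 'cV[R]_n :=
  (fx_bar t)^T *m lam t + lam0 *: (Lx_bar t)^T + z t *: (gx_bar t)^T.

(* -d lam = density dt + d beta, as signed measures on [0,1]. *)
Definition adjoint_equation (lam beta : R -> 'cV[R]_n) (lam0 : R)
    (z : R -> R) : Prop :=
  forall i, exists dlam dbeta : {charge set (measurableTypeR R) -> \bar R},
    [/\ stieltjes (fun t => lam t i 0) dlam,
        stieltjes (fun t => beta t i 0) dbeta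
      & forall A : set (measurableTypeR R), measurable A -> A `<=` I01 ->
          (- dlam A = \int[@Leb R]_(t in A) (adjoint_density lam lam0 z t i 0)%:E
                      + dbeta A)%E].

Record multiplier (lam beta : R -> 'cV[R]_n) (lam0 : R) (z : R -> R)
    (zeta : {additive_charge set (lebT R) -> \bar R}) : Prop := Multiplier {
  mult_lam0 : 0 <= lam0 ;
  mult_zL1 : L1 z ;
  mult_z : ae_on I01 (fun t => 0 <= z t) ;
  mult_ba : ba zeta ;
  mult_pure : pure_charge zeta ;
  mult_zeta : nonneg_charge zeta ;
  mult_lamBV : BV lam ;
  mult_betaBV : BV beta ;
  mult_nontrivial :
    0 < lam0 + (\int[@Leb R]_(t in I01) `|z t|) + fine (zeta I01) ;
  mult_compl : ae_on I01 (fun t => z t * g_bar t = 0) ;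
  mult_compl_charge : null_charge_ae zeta g_bar ;
  mult_lam1 : lam 1 = 0 ;
  mult_beta1 : beta 1 = 0 ;
  mult_adjoint : adjoint_equation lam beta lam0 z ;
  mult_beta0 :
    beta 0 = - charge_integral_vec zeta I01 (fun t => (gx_bar t)^T) ;
  mult_beta : forall t, 0 < t < 1 ->
    (fun k : nat => - charge_integral_vec zeta
       [set` `[t + k.+1%:R^-1, 1]] (fun t => (gx_bar t)^T)) @ \oo --> beta t ;
  mult_stationary : ae_on I01 (fun t =>
    0 = (fu_bar t)^T *m lam t + lam0 *: (Lu_bar t)^T + z t *: (gu_bar t)^T) ;
  mult_stationary_charge : forall E : set (lebT R), measurable E ->
    E `<=` I01 ->
    charge_integral_vec zeta E (fun t => (gu_bar t)^T) = 0 }.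

End AlongProcess.
End ControlProblem.

Arguments problem R n m : clear implicits.

(* Main.v *)
(* Call a pair (y,v) solving the linearized dynamics a direction, let
   w = gx y + gu v, and let J' be the linearized cost.  For bounded measurable k
   put p(k) = inf { J'(y,v) : w <= -k a.e. on some set {g >= -e} }.  Adding a small
   multiple of the strictly feasible direction of hypothesis (3), cutting the
   control off near 0 and solving the nonlinear equation for the perturbed control
   shows p(0) >= 0, so p is a finite sublinear functional and Hahn-Banach gives a
   linear mu <= p: it is nonnegative, is carried by the sets {g >= -e}, and
   J' + mu(w) = 0 along directions; in particular the cost multiplier is 1.
   On [0,b] with b < 1, hypotheses (1) and (2) provide a feedback control that
   realizes w <= -k at a cost bounded by the integral of rho k with rho in L1;
   hence mu is absolutely continuous there, and mu = z dt + zeta with zeta living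
   on every interval ]b,1[.  Such a zeta is pure, and its only trace in the adjoint
   equation is a jump of lambda and beta at t = 1.  Controls acting near 1 give the
   stationarity of zeta, and Fubini turns J' + mu(w) = 0 into the adjoint system.
   The final bound is J' + mu(w) = 0 evaluated at the direction of (3). *)
Require Import Defs.
From HB Require Import structures.
From mathcomp Require Import all_boot all_order all_algebra.
From mathcomp Require Import all_classical all_reals all_analysis.
From mathcomp Require Import ring lra ess_sup_inf measurable_realfun.

Set Implicit Arguments.
Unset Strict Implicit.
Unset Printing Implicit Defensive.

Import Order.TTheory GRing.Theory Num.Theory.
Import numFieldNormedType.Exports.
Import HBSimple.

Local Open Scope classical_set_scope.
Local Open Scope ring_scope.

(** * Sublinear functionals *)

(** The obstacle is the endpoint 0, where the constraint gradient may degenerate: the gain of a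
    corrective control there is only known to be of order [1/omega], hence integrable but possibly
    unbounded. Directions are therefore allowed controls that are integrable and bounded only away
    from 0, whereas the nonlinear perturbation needs bounded ones. The passage goes through controls
    vanishing on some [[0,tau]]: there the perturbed process coincides with the nominal one and no
    strict decrease of the constraint is required. The correction is a feedback: subtracting
    [K0 * nrm (x - Y)] times a control [ch] with [b *m ch >= 1] dominates the effect of the state
    error without knowing that error in advance. The price is a Lipschitz modulus that is merely
    integrable, which is why Volterra equations are solved in a sup norm weighted so that the
    integral operator halves norms. Test functions are genuine functions satisfying [bmeas];
    identification almost everywhere enters only through the sign property of the functionals. Hence
    the Hahn-Banach theorem on a subset closed under the linear operations. *)

Section HahnBanach.
Context {R : realType} {V : lmodType R}.
Variable K : set V.
Hypothesis KD : forall x y, K x -> K y -> K (x + y).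
Hypothesis KZ : forall a x, K x -> K (a *: x).
Hypothesis K0 : K 0.

(** An inequality for positive factors is enough: used for [a] and for [a^-1] it gives equality, and
    the factors 2 and 1/2 at the origin force the value 0 there. *)
Definition sublinear_on (q : V -> R) : Prop :=
  (forall x y, K x -> K y -> q (x + y) <= q x + q y) /\
  (forall a x, 0 < a -> K x -> q (a *: x) <= a * q x).

Let KN x : K x -> K (- x).
Proof. by move=> Kx; rewrite -scaleN1r; exact: KZ. Qed.

Let sublin0 q : sublinear_on q -> q 0 = 0.
Proof.
case=> _ qZ; have := qZ 2%:R 0 _ K0; have := qZ 2%:R^-1 0 _ K0.
rewrite !scaler0 !invr_gt0 !ltr0n => /(_ isT) h1 /(_ isT) h2.
have aux (z : R) : z <= 2^-1 * z -> z <= 2 * z -> z = 0 by lra.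
exact: aux.
Qed.

Let sublinZ q : sublinear_on q -> forall a x, 0 <= a -> K x -> q (a *: x) = a * q x.
Proof.
move=> hq a x; rewrite le_eqVlt => /orP[/eqP <- _|a0 Kx].
  by rewrite scale0r sublin0// mul0r.
apply/eqP; rewrite eq_le hq.2//=.
have := hq.2 a^-1 (a *: x); rewrite invr_gt0 => /(_ a0 (KZ _ Kx)).
by rewrite scalerA mulVf ?gt_eqF// scale1r -(ler_pM2l a0) mulrA divff ?gt_eqF// mul1r.
Qed.

Let sublin_lb q x : sublinear_on q -> K x -> - q (- x) <= q x.
Proof.
move=> hq Kx; have := hq.1 x (- x) Kx (KN Kx).
by rewrite subrr (sublin0 hq); lra.
Qed.

(** Zorn's lemma for the reversed pointwise order on [K], which is only a preorder because values
    off [K] are ignored. Along a chain the values at [x] stay above [- p (- x)], so the pointwise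
    infimum exists and bounds the chain. *)
Lemma minimal_sublinear p : sublinear_on p -> exists q,
  [/\ sublinear_on q, (forall x, K x -> q x <= p x) &
    forall r, sublinear_on r -> (forall x, K x -> r x <= q x) ->
      forall x, K x -> r x = q x].
Proof.
move=> hp.
pose T := {q : V -> R | sublinear_on q /\ forall x, K x -> q x <= p x}.
pose r (a b : T) := `[< forall x, K x -> sval b x <= sval a x >].
have p0 : sublinear_on p /\ forall x, K x -> p x <= p x by [].
have [||A totA|[q [hq qp]] qmax] := @ZL_preorder T (exist _ p p0 : T) r.
- by move=> t; apply/asboolP.
- move=> a b c /asboolP ab /asboolP bc; apply/asboolP => x Kx.
  exact: le_trans (bc _ Kx) (ab _ Kx).
- have [[q0 Aq0]|A0] := pselect (exists q0, A q0); last first.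
    by exists (exist _ p p0 : T) => s As; exfalso; apply: A0; exists s.
  pose B x := [set sval q x | q in A].
  have Blb x : K x -> lbound (B x) (- p (- x)).
    move=> Kx _ [[q [hq qp]] Aq <-] /=; apply: le_trans (sublin_lb hq Kx).
    by rewrite lerN2 qp//; exact: KN.
  have hB x : K x -> has_inf (B x).
    by move=> Kx; split; [exists (sval q0 x); exists q0 | exists (- p (- x)); exact: Blb].
  have Ble x q : K x -> A q -> inf (B x) <= sval q x.
    by move=> Kx Aq; apply: ge_inf; [case: (hB x Kx)|exists q].
  have hs : sublinear_on (fun x => inf (B x)).
    split=> [x y Kx Ky|a x a0 Kx].
      rewrite /= -lerBlDr; apply: lb_le_inf; first by case: (hB x Kx).
      move=> _ [q1 Aq1 <-]; rewrite lerBlDr -lerBlDl.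
      apply: lb_le_inf; first by case: (hB y Ky).
      move=> _ [q2 Aq2 <-]; rewrite lerBlDl.
      (* Two members of a chain are comparable, and the smaller one already bounds the infimum at
         [x + y] by [q1 x + q2 y]. *)
      have [/asboolP h|/asboolP h] := totA _ _ Aq1 Aq2.
        apply: le_trans (Ble _ _ (KD Kx Ky) Aq2) _.
        have := (svalP q2).1.1 _ _ Kx Ky; have := h _ Kx; lra.
      apply: le_trans (Ble _ _ (KD Kx Ky) Aq1) _.
      have := (svalP q1).1.1 _ _ Kx Ky; have := h _ Ky; lra.
    rewrite /= -ler_pdivrMl//; apply: lb_le_inf; first by case: (hB x Kx).
    move=> _ [q Aq <-]; rewrite ler_pdivrMl//.
    apply: le_trans (Ble _ _ (KZ _ Kx) Aq) _.
    exact: (svalP q).1.2.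
  have hsp : forall x, K x -> inf (B x) <= p x.
    by move=> x Kx; apply: le_trans (Ble x q0 Kx Aq0) _; exact: (svalP q0).2.
  exists (exist _ (fun x => inf (B x)) (conj hs hsp) : T) => s As; apply/asboolP => x Kx /=.
  exact: Ble.
exists q; split => // s hs sq x Kx.
have sp : forall x, K x -> s x <= p x.
  by move=> z Kz; exact: le_trans (sq _ Kz) (qp _ Kz).
have /asboolP/= h : r (exist _ s (conj hs sp) : T) (exist _ q (conj hq qp) : T).
  by apply: qmax; apply/asboolP.
by apply/eqP; rewrite eq_le sq// h.
Qed.

(* A minimal sublinear functional is linear: otherwise it could be lowered to
   [y |-> inf_(t >= 0) q (y + t x) - t q x]. *)
Theorem Hahn_Banach p : sublinear_on p -> exists f : V -> R,
  [/\ forall x y, K x -> K y -> f (x + y) = f x + f y,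
      forall a x, K x -> f (a *: x) = a * f x &
      forall x, K x -> f x <= p x].
Proof.
move=> /minimal_sublinear[q [hq qp qmin]].
have qodd x : K x -> q (- x) = - q x.
  move=> Kx; apply/eqP; rewrite eq_le; apply/andP; split; last first.
    by rewrite lerNl; have := sublin_lb hq Kx; lra.
  pose B y := [set q (y + t *: x) - t * q x | t in [set t | 0 <= t]].
  (* The lower bound is subadditivity: [t * q x = q (t *: x) <= q (y + t *: x) + q (- y)]. *)
  have Blb y : K y -> lbound (B y) (- q (- y)).
    move=> Ky _ [t t0 <-]; rewrite -sublinZ//.
    have := hq.1 (y + t *: x) (- y) (KD Ky (KZ _ Kx)) (KN Ky).
    rewrite addrC addKr; lra.
  have hB y : K y -> has_inf (B y).
    move=> Ky; split; last by exists (- q (- y)); exact: Blb.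
    by exists (q (y + 0 *: x) - 0 * q x); exists 0 => /=.
  have Ble y t : K y -> 0 <= t -> inf (B y) <= q (y + t *: x) - t * q x.
    by move=> Ky t0; apply: ge_inf; [case: (hB y Ky)|exists t].
  have hs : sublinear_on (fun y => inf (B y)).
    split=> [y z Ky Kz|a y a0 Ky].
      rewrite /= -lerBlDr; apply: lb_le_inf; first by case: (hB y Ky).
      move=> _ [t1 t10 <-]; rewrite lerBlDr -lerBlDl.
      apply: lb_le_inf; first by case: (hB z Kz).
      move=> _ [t2 t20 <-]; rewrite lerBlDl.
      apply: le_trans (Ble _ (t1 + t2) (KD Ky Kz) (addr_ge0 t10 t20)) _.
      have := hq.1 (y + t1 *: x) (z + t2 *: x) (KD Ky (KZ _ Kx)) (KD Kz (KZ _ Kx)).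
      by rewrite addrACA -scalerDl mulrDl; lra.
    rewrite /= -ler_pdivrMl//; apply: lb_le_inf; first by case: (hB y Ky).
    move=> _ [t t0 <-]; rewrite ler_pdivrMl//.
    apply: le_trans (Ble _ (a * t) (KZ _ Ky) (mulr_ge0 (ltW a0) t0)) _.
    have := hq.2 a (y + t *: x) a0 (KD Ky (KZ _ Kx)).
    by rewrite scalerDr scalerA mulrBr mulrA; lra.
  have sq y : K y -> inf (B y) <= q y.
    move=> Ky; have := Ble y 0 Ky (lexx _).
    by rewrite scale0r addr0 mul0r subr0.
  rewrite -(qmin _ hs sq _ (KN Kx)).
  (* By minimality [q] equals the lowered functional; its value at [- x] is at most the term
     [t = 1], that is [q 0 - q x]. *)
  have := Ble (- x) 1 (KN Kx) ler01.
  by rewrite scale1r addNr (sublin0 hq) sub0r mul1r.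
exists q; split => //.
- move=> x y Kx Ky; apply/eqP; rewrite eq_le hq.1//=.
  have := hq.1 (x + y) (- y) (KD Kx Ky) (KN Ky).
  by rewrite addrK qodd//; lra.
- move=> a x Kx; have [a0|a0] := leP 0 a; first exact: sublinZ.
  have := sublinZ hq (_ : 0 <= - a) Kx.
  by rewrite scaleNr qodd ?oppr_ge0 1?ltW//; [lra|exact: KZ].
Qed.

End HahnBanach.

(** * Integration over the unit interval *)

Section Integration.
Context {R : realType}.
Implicit Types (f g : R -> R) (A D : set R).

(** Measurability is asked on the whole line although only [[0,1]] matters: sums, products and
    limits then need no bookkeeping of domains, and functions known only on [[0,1]] are first cut
    off. *)
Definition meas f : Prop := measurable_fun [set: lebT R] (f : lebT R -> R).
Definition mset A : Prop := measurable (A : set (lebT R)).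
Definition ig D f : R := \int[@Leb R]_(t in D) f t.

Lemma mset_borel A : @measurable _ (measurableTypeR R) A -> mset A.
Proof. exact: sub_caratheodory. Qed.

Lemma mset_itv (i : interval R) : mset [set` i].
Proof. by apply: mset_borel; exact: measurable_itv. Qed.

Lemma msetI A D : mset A -> mset D -> mset (A `&` D).
Proof. exact: measurableI. Qed.

Lemma msetC A : mset A -> mset (~` A).
Proof. exact: measurableC. Qed.

Lemma Leb_itv (a b : R) (ba bb : bool) : a <= b ->
  @Leb R [set` Interval (BSide ba a) (BSide bb b)] = (b - a)%:E.
Proof.
move=> ab; transitivity (@lebesgue_measure R [set` Interval (BSide ba a) (BSide bb b)]) => //.
rewrite lebesgue_measure_itv/= lte_fin; case: ltP => // ba'.
by have -> : b = a; [lra|rewrite subrr].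
Qed.

Lemma Leb_I01 : @Leb R I01 = 1%E.
Proof. by rewrite Leb_itv// subr0. Qed.

Lemma mset_I01 : mset I01. Proof. exact: mset_itv. Qed.

Lemma meas_cst (c : R) : meas (fun _ => c).
Proof. exact: measurable_cst. Qed.

Lemma measD f g : meas f -> meas g -> meas (fun t => f t + g t).
Proof. exact: measurable_funD. Qed.

Lemma measN f : meas f -> meas (fun t => - f t).
Proof. by move=> mf; exact: measurableT_comp. Qed.

Lemma measB f g : meas f -> meas g -> meas (fun t => f t - g t).
Proof. by move=> mf mg; apply: measD => //; exact: measN. Qed.

Lemma measM f g : meas f -> meas g -> meas (fun t => f t * g t).
Proof. exact: measurable_funM. Qed.

Lemma measZ (c : R) f : meas f -> meas (fun t => c * f t).
Proof. by move=> mf; apply: measM => //; exact: meas_cst. Qed.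

Lemma meas_norm f : meas f -> meas (fun t => `|f t|).
Proof. by move=> mf; exact: measurableT_comp. Qed.

Lemma meas_max f g : meas f -> meas g -> meas (fun t => Num.max (f t) (g t)).
Proof. exact: measurable_maxr. Qed.

Lemma meas_sum (I : Type) (s : seq I) (h : I -> R -> R) :
  (forall i, meas (h i)) -> meas (fun t => \sum_(i <- s) h i t).
Proof. by move=> mh; exact: measurable_sum. Qed.

Lemma meas_indic A : mset A -> meas (\1_A).
Proof. by move=> mA; exact: measurable_indic. Qed.

Lemma meas_restrict f A : mset A ->
  measurable_fun (A : set (lebT R)) (f : lebT R -> R) -> meas (f \_ A).
Proof.
by move=> mA mf; apply/(measurable_restrictT _ mA).
Qed.

Lemma meas_if A f g : mset A -> meas f -> meas g ->
  meas (fun t => if t \in A then f t else g t).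
Proof.
move=> mA mf mg.
have -> : (fun t => if t \in A then f t else g t) =
          (fun t => \1_A t * f t + (1 - \1_A t) * g t).
  by apply/funext => t; rewrite indicE; case: (t \in A); rewrite /=; ring.
apply: measD; apply: measM => //; first exact: meas_indic.
by apply: measB; [exact: meas_cst|exact: meas_indic].
Qed.

Lemma meas_lim (h : nat -> R -> R) f : (forall k, meas (h k)) ->
  (forall t, (fun k => h k t) @ \oo --> f t) -> meas f.
Proof.
move=> mh hf; apply: (measurable_fun_cvg mh) => t _; exact: hf.
Qed.

Lemma mset_le f g : meas f -> meas g -> mset [set t | f t <= g t].
Proof.
move=> mf mg; have := @measurable_fun_le _ (lebT R) R setT f g (@measurableT _ (lebT R)).
move=> /(_ mf mg); rewrite setTI; apply.
Qed.

Lemma mset_lt f g : meas f -> meas g -> mset [set t | f t < g t].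
Proof.
move=> mf mg.
have -> : [set t | f t < g t] = ~` [set t | g t <= f t].
  by apply/seteqP; split => t /=; rewrite ltNge => /negP.
by apply: msetC; exact: mset_le.
Qed.

Lemma ae_on_filter D (P Q : R -> Prop) :
  (forall t, D t -> P t -> Q t) -> ae_on D P -> ae_on D Q.
Proof. by rewrite /ae_on => PQ; apply: filterS => t h Dt; apply: PQ => //; exact: h. Qed.

Lemma ae_on_and D (P Q : R -> Prop) :
  ae_on D P -> ae_on D Q -> ae_on D (fun t => P t /\ Q t).
Proof. by rewrite /ae_on; apply: filterS2 => t h1 h2 Dt; split; [exact: h1|exact: h2]. Qed.

Lemma ae_on_sub D D' (P : R -> Prop) : D' `<=` D -> ae_on D P -> ae_on D' P.
Proof. by rewrite /ae_on => sub; apply: filterS => t h /sub. Qed.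

Lemma ae_onT D (P : R -> Prop) : (forall t, D t -> P t) -> ae_on D P.
Proof. by rewrite /ae_on => h; apply: nearW. Qed.

Lemma L1_bounded f (M : R) : meas f -> (forall t, I01 t -> `|f t| <= M) -> L1 f.
Proof.
move=> mf fM; apply: (@measurable_bounded_integrable _ _ _ (@Leb R) f I01).
- exact: mset_I01.
- by rewrite Leb_I01 ltry.
- exact: measurable_funTS.
- exists M; split; first exact: num_real.
  by move=> x Mx t It; apply: (le_trans (fM _ It)); exact: ltW.
Qed.

Lemma L1_cst (c : R) : L1 (fun _ => c).
Proof. by apply: (@L1_bounded _ `|c|) => //; exact: meas_cst. Qed.

Lemma L1D f g : L1 f -> L1 g -> L1 (fun t => f t + g t).
Proof. by move=> hf hg; have := integrableD mset_I01 hf hg. Qed.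

Lemma L1Z (c : R) f : L1 f -> L1 (fun t => c * f t).
Proof. by move=> hf; have := integrableZl mset_I01 c hf. Qed.

Lemma L1N f : L1 f -> L1 (fun t => - f t).
Proof. by move=> hf; have := integrableN hf. Qed.

Lemma L1B f g : L1 f -> L1 g -> L1 (fun t => f t - g t).
Proof. by move=> hf hg; apply: L1D => //; exact: L1N. Qed.

Lemma L1_norm f : L1 f -> L1 (fun t => `|f t|).
Proof. exact: integrable_norm. Qed.

Lemma L1_dom f g : meas f -> L1 g -> (forall t, I01 t -> `|f t| <= g t) -> L1 f.
Proof.
move=> mf hg fg; apply: (le_integrable mset_I01 _ _ hg) => /=.
  by apply/measurable_EFinP; exact: measurable_funTS.
by move=> t It /=; rewrite lee_fin (le_trans (fg _ It))// ler_norm.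
Qed.

Lemma L1_sum (I : Type) (s : seq I) (h : I -> R -> R) :
  (forall i, L1 (h i)) -> L1 (fun t => \sum_(i <- s) h i t).
Proof.
move=> mh; elim: s => [|i s ih].
  by under eq_fun do rewrite big_nil; exact: L1_cst.
by under eq_fun do rewrite big_cons; exact: L1D.
Qed.

Lemma L1_eq f g : (forall t, I01 t -> f t = g t) -> L1 f -> L1 g.
Proof.
move=> fg; apply: eq_integrable; first exact: mset_I01.
by move=> t /set_mem It /=; rewrite fg.
Qed.

Lemma L1_meas f : L1 f -> meas (f \_ I01).
Proof.
move=> hf; apply: meas_restrict; first exact: mset_I01.
by apply/measurable_EFinP; exact: measurable_int hf.
Qed.

Lemma L1_mulb f g (M : R) : meas f -> meas g -> L1 g ->
  (forall t, I01 t -> `|f t| <= M) -> L1 (fun t => f t * g t).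
Proof.
move=> mf mg hg fM; apply: (@L1_dom _ (fun t => M * `|g t|)).
- exact: measM.
- by apply: L1Z; exact: L1_norm.
- by move=> t It; rewrite normrM ler_wpM2r// fM.
Qed.

Lemma L1S D f : mset D -> D `<=` I01 -> L1 f -> (@Leb R).-integrable D (EFin \o f).
Proof. by move=> mD DI; apply: integrableS => //; exact: mset_I01. Qed.

Lemma igD D f g : mset D -> D `<=` I01 -> L1 f -> L1 g ->
  ig D (fun t => f t + g t) = ig D f + ig D g.
Proof. by move=> mD DI hf hg; rewrite /ig RintegralD//; exact: L1S. Qed.

Lemma igZ D (c : R) f : mset D -> D `<=` I01 -> L1 f ->
  ig D (fun t => c * f t) = c * ig D f.
Proof. by move=> mD DI hf; rewrite /ig RintegralZl//; exact: L1S. Qed.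

Lemma igN D f : mset D -> D `<=` I01 -> L1 f -> ig D (fun t => - f t) = - ig D f.
Proof.
move=> mD DI hf; rewrite -mulN1r -igZ//.
by congr (ig D _); apply/funext => t; rewrite mulN1r.
Qed.

Lemma igB D f g : mset D -> D `<=` I01 -> L1 f -> L1 g ->
  ig D (fun t => f t - g t) = ig D f - ig D g.
Proof. by move=> mD DI hf hg; rewrite igD ?igN//; exact: L1N. Qed.

Lemma ig_sum D (I : Type) (s : seq I) (h : I -> R -> R) : mset D -> D `<=` I01 ->
  (forall i, L1 (h i)) ->
  ig D (fun t => \sum_(i <- s) h i t) = \sum_(i <- s) ig D (h i).
Proof.
move=> mD DI mh; elim: s => [|i s ih].
  under eq_fun do rewrite big_nil.
  by rewrite big_nil /ig Rintegral_cst// mul0r.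
by under eq_fun do rewrite big_cons; rewrite igD ?ih ?big_cons//; exact: L1_sum.
Qed.

Lemma ig_norm D f : mset D -> D `<=` I01 -> L1 f -> `|ig D f| <= ig D (fun t => `|f t|).
Proof. by move=> mD DI hf; apply: le_normr_Rintegral => //; exact: L1S. Qed.

Lemma ig_ge0 D f : (forall t, D t -> 0 <= f t) -> 0 <= ig D f.
Proof. by move=> f0; rewrite /ig Rintegral_ge0. Qed.

Lemma ig_eq D f g : (forall t, D t -> f t = g t) -> ig D f = ig D g.
Proof. by move=> fg; apply: eq_Rintegral => t /set_mem; exact: fg. Qed.

Lemma ig_mkcond D f : D `<=` I01 -> ig D f = ig I01 (f \_ D).
Proof.
by move=> DI; rewrite /ig -Rintegral_mkcondr; congr Rintegral; rewrite setIidr.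
Qed.

Lemma ig_cst D (c : R) : mset D -> ig D (fun _ => c) = c * fine (@Leb R D).
Proof. by move=> mD; rewrite /ig Rintegral_cst. Qed.

Lemma ig_ae_eq D f g : mset D -> D `<=` I01 -> L1 f -> L1 g ->
  ae_on D (fun t => f t = g t) -> ig D f = ig D g.
Proof.
move=> mD DI hf hg fg; rewrite /ig /Rintegral; congr fine.
have h1 : measurable_fun (D : set (lebT R)) (EFin \o f).
  by case/integrableP: (L1S mD DI hf).
have h2 : measurable_fun (D : set (lebT R)) (EFin \o g).
  by case/integrableP: (L1S mD DI hg).
apply: (@ae_eq_integral _ _ _ (@Leb R) D (EFin \o g) (EFin \o f) mD h1 h2).
by move: fg; rewrite /ae_on; apply: filterS => t h Dt /=; rewrite h.
Qed.

(** The positive part of [f - g] vanishes almost everywhere and dominates [f - g]. Writing it with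
    an absolute value gives its integrability directly from that of [f] and [g]. *)
Lemma ig_le_ae D f g : mset D -> D `<=` I01 -> L1 f -> L1 g ->
  ae_on D (fun t => f t <= g t) -> ig D f <= ig D g.
Proof.
move=> mD DI hf hg fg.
have hm : L1 (fun t => Num.max (f t - g t) 0).
  apply: (@L1_eq (fun t => 2^-1 * ((f t - g t) + `|f t - g t|))) => [t _|].
    by case: (ltP (f t - g t) 0) => h; [rewrite ltr0_norm//|rewrite ger0_norm//]; lra.
  by apply: L1Z; apply: L1D; [|apply: L1_norm]; exact: L1B.
have e0 : ig D (fun t => Num.max (f t - g t) 0) = ig D (fun _ => 0).
  apply: ig_ae_eq => //; first exact: L1_cst.
  by apply: ae_on_filter fg => t _ h; rewrite max_r// subr_le0.
rewrite -subr_le0 -igB//; apply: (@le_trans _ _ (ig D (fun t => Num.max (f t - g t) 0))).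
  apply: le_Rintegral => //.
  - by apply: L1S => //; exact: L1B.
  - exact: L1S.
  - by move=> t _; rewrite le_max lexx.
by rewrite e0 ig_cst// mul0r.
Qed.

Lemma ig_le D f g : mset D -> D `<=` I01 -> L1 f -> L1 g ->
  (forall t, D t -> f t <= g t) -> ig D f <= ig D g.
Proof. by move=> *; apply: ig_le_ae => //; exact: ae_onT. Qed.

Lemma ig_norm_le D f g : mset D -> D `<=` I01 -> L1 f -> L1 g ->
  (forall t, D t -> `|f t| <= g t) -> `|ig D f| <= ig D g.
Proof.
move=> mD DI hf hg fg; apply: le_trans (ig_norm mD DI hf) _.
by apply: ig_le => //; exact: L1_norm.
Qed.

Lemma ig_setU A D f : mset A -> mset D -> A `<=` I01 -> D `<=` I01 -> L1 f ->
  A `&` D = set0 -> ig (A `|` D) f = ig A f + ig D f.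
Proof.
move=> mA mD AI DI hf AD; rewrite /ig Rintegral_setU//.
  by apply: L1S => //; [exact: measurableU|rewrite subUset].
by apply/eqP.
Qed.

Lemma ig_subset A D f : mset A -> mset D -> A `<=` D -> D `<=` I01 -> L1 f ->
  (forall t, D t -> 0 <= f t) -> ig A f <= ig D f.
Proof.
move=> mA mD AD DI hf f0.
have -> : D = A `|` (D `\` A) by rewrite setDUK.
have mDA : mset (D `\` A) by exact: measurableD.
rewrite ig_setU//.
- by rewrite lerDl ig_ge0// => t [Dt _]; exact: f0.
- by apply: subset_trans AD DI.
- by move=> t [/DI].
- by rewrite setDIK.
Qed.

Lemma ig_dominated (h : nat -> R -> R) f g D : mset D -> D `<=` I01 ->
  (forall k, meas (h k)) -> meas f -> L1 g ->
  (forall k t, D t -> `|h k t| <= g t) ->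
  ae_on D (fun t => (fun k => h k t) @ \oo --> f t) ->
  (fun k => ig D (h k)) @ \oo --> ig D f.
Proof.
move=> mD DI mh mf hg hhg hf.
have [|||||hfi _] := @dominated_convergence _ _ _ (@Leb R) D mD
    (fun k t => (h k t)%:E) (EFin \o f) (EFin \o g).
- by move=> k; apply/measurable_EFinP; apply: measurable_funTS; exact: mh.
- by apply/measurable_EFinP; apply: measurable_funTS; exact: mf.
- move: hf; rewrite /ae_on; apply: filterS => t ht Dt.
  by apply: cvg_EFin; [exact: nearW|exact: ht].
- exact: L1S.
- by apply: nearW => t k Dt /=; rewrite lee_fin hhg.
rewrite -(fineK (integrable_fin_num mD hfi)) => /fine_cvgP[_ h1].
exact: h1.
Qed.

(** Dominated convergence with [|f|] as bound; the sets need not be nested. The smallness of tails,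
    the absolute continuity of the integral and the continuity of the multiplier at the empty set
    all rest on it. *)
Lemma ig_vanish f (A : nat -> set R) : L1 f -> (forall k, mset (A k)) ->
  (forall t, I01 t -> \forall k \near \oo, ~ A k t) ->
  (fun k => ig (A k `&` I01) f) @ \oo --> (0 : R).
Proof.
move=> hf mA A0; rewrite -[X in _ --> X](_ : ig I01 (fun _ => 0) = 0); last first.
  by rewrite ig_cst ?mul0r//; exact: mset_I01.
pose F := f \_ I01.
have mF : meas F := L1_meas hf.
have FE t : I01 t -> F t = f t by move=> It; rewrite /F patchE mem_set.
have -> : (fun k => ig (A k `&` I01) f) = (fun k => ig I01 (fun t => \1_(A k) t * F t)).
  apply/funext => k; rewrite ig_mkcond//; apply: ig_eq => t It.
  rewrite patchE indicE in_setI (mem_set It) andbT (FE _ It).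
  by case: (t \in A k); rewrite ?mul1r ?mul0r.
apply: (@ig_dominated _ _ (fun t => `|F t|)) => //.
- exact: mset_I01.
- by move=> k; apply: measM => //; exact: meas_indic.
- exact: meas_cst.
- apply: L1_norm; apply: L1_eq hf => t It; rewrite FE//.
- move=> k t It; rewrite indicE; case: (t \in _); rewrite ?mul1r// mul0r normr0//.
- apply: ae_onT => t It; apply: cvg_near_cst.
  by move: (A0 _ It); apply: filterS => k nA; rewrite indicE memNset// mul0r.
Qed.

End Integration.

(** * Absolute continuity, integrals over moving intervals, exponential weights *)

Section Weights.
Context {R : realType}.
Implicit Types (f h l e W : R -> R) (S : R -> set R) (D : set R).

Lemma ig1D f g : L1 f -> L1 g -> ig I01 (fun t => f t + g t) = ig I01 f + ig I01 g.
Proof. by move=> hf hg; apply: igD => //; exact: mset_I01. Qed.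

Lemma ig1B f g : L1 f -> L1 g -> ig I01 (fun t => f t - g t) = ig I01 f - ig I01 g.
Proof. by move=> hf hg; apply: igB => //; exact: mset_I01. Qed.

Lemma ig1Z (c : R) f : L1 f -> ig I01 (fun t => c * f t) = c * ig I01 f.
Proof. by move=> hf; apply: igZ => //; exact: mset_I01. Qed.

Lemma ig1_cst (c : R) : ig I01 (fun _ => c) = c.
Proof. by rewrite ig_cst ?Leb_I01 ?mulr1//; exact: mset_I01. Qed.

Definition upto (t : R) : set R := I01 `&` [set` `]-oo, t]].
Definition from (t : R) : set R := I01 `&` [set` `[t, +oo[].

Lemma mset_upto t : mset (upto t).
Proof. by apply: msetI; [exact: mset_I01|exact: mset_itv]. Qed.

Lemma upto_sub t : upto t `<=` I01.
Proof. by move=> s []. Qed.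

Lemma mset_from t : mset (from t).
Proof. by apply: msetI; [exact: mset_I01|exact: mset_itv]. Qed.

Lemma upto_itv t : I01 t -> upto t = [set` `[0, t]].
Proof.
rewrite /I01 /= in_itv /= => /andP[t0 t1]; apply/seteqP; split=> s; rewrite /upto /I01 /= !in_itv /=.
  by move=> [/andP[-> _] ->].
by move=> /andP[s0 st]; rewrite s0 st (le_trans st t1).
Qed.

Lemma from_itv t : I01 t -> from t = [set` `[t, 1]].
Proof.
rewrite /I01 /= in_itv /= => /andP[t0 t1]; apply/seteqP; split=> s; rewrite /from /I01 /= !in_itv /=.
  by move=> [/andP[_ ->]]; rewrite andbT => ->.
by move=> /andP[ts s1]; rewrite s1 ts (le_trans t0 ts).
Qed.

(** The part of [D] where [|f|] exceeds a suitable level [k] contributes at most [e / 2] whatever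
    [D] is, and the rest at most [k] times the measure of [D]. *)
Lemma ig_abscont f (e : R) : L1 f -> 0 < e -> exists2 d : R, 0 < d &
  forall D, mset D -> D `<=` I01 -> fine (@Leb R D) <= d ->
    ig D (fun t => `|f t|) <= e.
Proof.
move=> hf e0.
pose A (k : nat) := [set t | k%:R <= `|(f \_ I01) t|].
have mA k : mset (A k).
  by apply: mset_le; [exact: meas_cst|apply: meas_norm; exact: L1_meas].
have h : (fun k => ig (A k `&` I01) (fun t => `|f t|)) @ \oo --> (0 : R).
  apply: ig_vanish => //; first exact: L1_norm.
  move=> t It; near=> k; rewrite /A /= patchE mem_set//; apply/negP; rewrite -ltNge.
  near: k; exact: nbhs_infty_gtr.
have [k hk] : exists k, ig (A k `&` I01) (fun t => `|f t|) <= e / 2.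
  have /cvgrPdist_le/(_ (e / 2)) : (fun k => ig (A k `&` I01) (fun t => `|f t|)) @ \oo --> (0 : R) by [].
  move=> /(_ (divr_gt0 e0 (ltr0Sn R 1))) [k _ /(_ k (leqnn k))].
  by rewrite /= sub0r normrN => hk; exists k; rewrite (le_trans (ler_norm _))//.
exists (e / 2 / k.+1%:R) => [|D mD DI Dd]; first by rewrite !divr_gt0.
have -> : D = (D `&` A k) `|` (D `&` ~` A k) by rewrite -setIUr setUv setIT.
have mDA : mset (D `&` A k) by exact: msetI.
have mDB : mset (D `&` ~` A k) by apply: msetI => //; exact: msetC.
rewrite ig_setU//; [|by move=> t [/DI]|by move=> t [/DI]|exact: L1_norm|]; last first.
  by rewrite setIACA setICr setI0.
rewrite [leRHS](splitr e); apply: lerD.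
  apply: le_trans hk; apply: ig_subset => //.
  - by apply: msetI => //; exact: mset_I01.
  - by move=> t [/DI It At].
  - exact: L1_norm.
apply: (@le_trans _ _ (ig (D `&` ~` A k) (fun _ => k%:R))).
  apply: ig_le => //; first by move=> t [/DI].
  - exact: L1_norm.
  - exact: L1_cst.
  - move=> t [/DI It]; rewrite /A /= patchE mem_set// => /negP; rewrite -ltNge => /ltW//.
rewrite ig_cst//; apply: (@le_trans _ _ (k.+1%:R * (e / 2 / k.+1%:R))); last first.
  by rewrite mulrC divfK// pnatr_eq0.
apply: ler_pM; [exact: ler0n|exact/fine_ge0|by rewrite ler_nat|].
apply: le_trans Dd; apply: fine_le.
- rewrite ge0_fin_numE//; apply: (@le_lt_trans _ _ (@Leb R I01)); last by rewrite Leb_I01 ltry.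
  by apply: le_measure; rewrite ?inE//; [exact: mset_I01|move=> t [/DI]].
- rewrite ge0_fin_numE//; apply: (@le_lt_trans _ _ (@Leb R I01)); last by rewrite Leb_I01 ltry.
  by apply: le_measure; rewrite ?inE//; exact: mset_I01.
- by apply: le_measure; rewrite ?inE//; move=> t [].
Unshelve. all: by end_near. Qed.

Lemma upto_split s t f : s <= t -> L1 f ->
  ig (upto t) f = ig (upto s) f + ig (I01 `&` [set` `]s, t]]) f.
Proof.
move=> st hf; have -> : upto t = upto s `|` (I01 `&` [set` `]s, t]]).
  rewrite /upto -setIUr; congr (_ `&` _); apply/seteqP; split => r; rewrite /= !in_itv/=.
    by move=> rt; have [rs|rs] := leP r s; [left|right].
  by case=> [rs|/andP[]//]; exact: le_trans rs st.
rewrite ig_setU//; [exact: mset_upto|by apply: msetI; [exact: mset_I01|exact: mset_itv]|by move=> r []|].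
rewrite /upto setIACA setIid; apply/seteqP; split=> r //= [_]; rewrite !in_itv/= => -[rs /andP[sr _]].
by move: sr; rewrite ltNge rs.
Qed.

Lemma from_split s t f : s <= t -> L1 f ->
  ig (from s) f = ig (I01 `&` [set` `[s, t[]) f + ig (from t) f.
Proof.
move=> st hf; have -> : from s = (I01 `&` [set` `[s, t[]) `|` from t.
  rewrite /from -setIUr; congr (_ `&` _); apply/seteqP; split => r; rewrite /= !in_itv/= !andbT.
    by move=> sr; have [tr|tr] := leP t r; [right|left; rewrite sr].
  by case=> [/andP[]//|tr]; exact: le_trans st tr.
rewrite ig_setU//; [by apply: msetI; [exact: mset_I01|exact: mset_itv]|exact: mset_from|by move=> r []|].
rewrite /from setIACA setIid; apply/seteqP; split=> r //= [_]; rewrite !in_itv/= !andbT => -[/andP[_ rs] sr].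
by move: rs; rewrite ltNge sr.
Qed.

Let small_itv f (e : R) : L1 f -> 0 < e -> exists2 d : R, 0 < d &
  forall (s t : R) b1 b2, `|t - s| <= d -> `|ig (I01 `&` [set` Interval (BSide b1 s) (BSide b2 t)]) f| <= e.
Proof.
move=> hf e0; have [d d0 hd] := ig_abscont hf e0; exists d => // s t b1 b2 std.
have mI : mset (I01 `&` [set` Interval (BSide b1 s) (BSide b2 t)]).
  by apply: msetI; [exact: mset_I01|exact: mset_itv].
apply: le_trans (ig_norm mI _ hf) _ => //; apply: hd => //.
have [st|ts] := leP s t; last first.
  have -> : [set` Interval (BSide b1 s) (BSide b2 t)] = set0.
    apply/seteqP; split => r //; rewrite /= in_itv /=.
    move=> /andP[h1 h2].
    have : s <= r by case: (b1) h1 => //= /ltW.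
    have : r <= t by case: (b2) h2 => //= /ltW.
    by move=> rt sr; move: ts; rewrite ltNge (le_trans sr rt).
  by rewrite setI0 measure0/= ltW.
apply: le_trans std; rewrite ger0_norm ?subr_ge0//.
have -> : t - s = fine (@Leb R [set` Interval (BSide b1 s) (BSide b2 t)]) by rewrite Leb_itv.
apply: fine_le; last by apply: le_measure; rewrite ?inE//; exact: mset_itv.
- rewrite ge0_fin_numE//; apply: (@le_lt_trans _ _ (@Leb R I01)); last by rewrite Leb_I01 ltry.
  by apply: le_measure; rewrite ?inE//; exact: mset_I01.
- by rewrite Leb_itv.
Qed.

Lemma upto_cont f : L1 f -> continuous (fun t => ig (upto t) f).
Proof.
move=> hf t; apply/cvgrPdist_le => e e0.
have [d d0 hd] := small_itv hf e0.
near=> s; have std : `|t - s| <= d.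
  by near: s; apply: cvgr_dist_le.
have [st|ts] := leP s t.
  by rewrite (upto_split st hf) addrC addKr; exact: hd.
rewrite (upto_split (ltW ts) hf) opprD addNKr normrN; apply: hd.
by rewrite distrC.
Unshelve. all: by end_near. Qed.

Lemma from_cont f : L1 f -> continuous (fun t => ig (from t) f).
Proof.
move=> hf t; apply/cvgrPdist_le => e e0.
have [d d0 hd] := small_itv hf e0.
near=> s; have std : `|t - s| <= d.
  by near: s; apply: cvgr_dist_le.
have [ts|st] := leP t s.
  by rewrite (from_split ts hf) addrK; apply: hd; rewrite distrC.
by rewrite (from_split (ltW st) hf) opprD addrCA subrr addr0 normrN; apply: hd.
Unshelve. all: by end_near. Qed.

Lemma meas_continuous f : continuous f -> meas f.
Proof.
move=> /continuous_measurable_fun mf.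
move=> _ B mB; rewrite setTI; apply: mset_borel.
by rewrite -[X in measurable X]setTI; exact: mf.
Qed.

(* A set-valued map along which Volterra integral equations can be solved:
   [upto] for initial value problems, [from] for terminal value problems. *)
Definition sweep S : Prop :=
  [/\ forall t, mset (S t), forall t, S t `<=` I01 &
      forall f, L1 f -> continuous (fun t => ig (S t) f)].

Lemma sweep_upto : sweep upto.
Proof.
by split; [exact: mset_upto|move=> t s []|exact: upto_cont].
Qed.

Lemma sweep_from : sweep from.
Proof.
by split; [exact: mset_from|move=> t s []|exact: from_cont].
Qed.

(** A Bielecki weight: in the sup norm weighted by [W], the Volterra operator with kernel [l] along
    [S] has norm at most 1/2. The bounds 1 and [C] make this norm equivalent to the sup norm. *)
Definition weight S l W (C : R) : Prop :=
  [/\ meas W, forall t, I01 t -> 1 <= W t <= C &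
      forall t, I01 t -> ig (S t) (fun s => l s * W s) <= W t / 2].

(** The identity pushes the completed measure forward to the Borel Lebesgue measure, for which the
    fundamental theorem of calculus is stated. *)
Lemma ig_lebesgue (a b : R) f : 0 <= a -> b <= 1 -> continuous f ->
  (forall t, 0 <= f t) ->
  ig [set` `[a, b]] f = fine (\int[lebesgue_measure]_(x in `[a, b]) (f x)%:E)%E.
Proof.
move=> a0 b1 cf f0; congr fine.
have mid : @measurable_fun _ _ (lebT R) (measurableTypeR R) setT id.
  by move=> _ B mB; rewrite setTI; exact: mset_borel.
have h := @ge0_integral_pushforward _ _ (lebT R) (measurableTypeR R) R id mid (@Leb R) [set` `[a, b]]
  (EFin \o f).
rewrite -(h _ _ _).
- by apply: eq_measure_integral => A mA _.
- exact: measurable_itv.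
- by apply/measurable_EFinP; apply: measurable_funTS; exact: continuous_measurable_fun.
- by move=> t _ /=; rewrite lee_fin.
Qed.

Lemma ig_expR (a b c d : R) : 0 <= a -> a <= b -> b <= 1 -> c != 0 ->
  ig [set` `[a, b]] (fun s => expR (c * s + d)) = (expR (c * b + d) - expR (c * a + d)) / c.
Proof.
move=> a0 ab b1 c0.
have ce : continuous (fun s : R => expR (c * s + d)).
  move=> s; apply: continuous_comp; last exact: continuous_expR.
  by apply: cvgD; [apply: cvgM; [exact: cvg_cst|exact: cvg_id]|exact: cvg_cst].
rewrite ig_lebesgue//.
move: ab; rewrite le_eqVlt => /orP[/eqP->|ab].
  by rewrite subrr mul0r set_itv1 integral_set1.
pose F s := expR (c * s + d) / c.
have dF s : is_derive s (1 : R) (F : R -> R^o) (expR (c * s + d)).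
  have h : is_derive s (1 : R) (c \*: (id : R^o -> R^o) + cst d) (c *: 1 + 0).
    by apply: is_deriveD; apply: is_deriveZ; exact: is_derive_id.
  have h2 := @is_deriveZ _ _ _ _ c^-1 _ _ _ (is_derive1_comp (is_derive_expR _) h).
  have -> : F = c^-1 \*: (expR \o (c \*: id + cst d)).
    by apply/funext => r; rewrite /F mulrC.
  apply: (is_derive_eq h2).
  by rewrite addr0 /= /GRing.scale/= mulr1 mulrCA mulVf// mulr1.
rewrite (@continuous_FTC2 _ _ F a b ab).
- by rewrite -EFinB /= /F mulrBl.
- exact: continuous_subspaceT.
- split.
  + by move=> x _; case: (dF x).
  + by apply: cvg_at_right_filter; apply/differentiable_continuous/derivable1_diffP; case: (dF a).
  + by apply: cvg_at_left_filter; apply/differentiable_continuous/derivable1_diffP; case: (dF b).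
- by move=> x _; rewrite derive1E; case: (dF x).
Qed.

Lemma L1_tail l (e : R) : meas l -> L1 l -> 0 < e -> (forall t, 0 <= l t) ->
  exists2 M : R, 0 < M & ig I01 (fun t => l t * \1_[set t | M < l t] t) <= e.
Proof.
move=> ml hl e0 l0; have [d d0 hd] := ig_abscont hl e0.
pose A (k : nat) := [set t | k.+1%:R < l t].
have mA k : mset (A k) by apply: mset_lt => //; exact: meas_cst.
have h : (fun k => ig (A k `&` I01) l) @ \oo --> (0 : R).
  apply: ig_vanish => //.
  move=> t It; near=> k; rewrite /A /=; apply/negP; rewrite -leNgt.
  apply: (@le_trans _ _ k%:R); last by rewrite ler_nat.
  near: k; exact: nbhs_infty_ger.
have /cvgrPdist_le/(_ e e0)[k _ /(_ k (leqnn k))] := h.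
rewrite /= sub0r normrN => hk; exists k.+1%:R => //.
apply: le_trans hk; apply: le_trans (ler_norm _).
rewrite [leRHS]ig_mkcond; last by move=> t [].
rewrite le_eqVlt; apply/orP; left; apply/eqP/ig_eq => t It.
rewrite patchE indicE in_setI (mem_set It) andbT.
by rewrite /A; case: (t \in _); rewrite ?mulr1 ?mulr0.
Unshelve. all: by end_near. Qed.

(** Split [l] at the level [M]. Below it, [l] is replaced by [M] and the growth condition on [W]
    applies; above it, the integral of [l] is at most 1/4 and monotonicity along [S] lets [W t] out
    of the integral. Each part gives [W t / 4]. Thus a plain exponential is a weight for any
    integrable [l], and no primitive of [l] has to be differentiated. *)
Let weight_aux S l (M : R) W : sweep S -> meas l -> L1 l -> (forall t, 0 <= l t) ->
  0 < M -> ig I01 (fun t => l t * \1_[set t | M < l t] t) <= 4^-1 ->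
  meas W -> (exists C, forall t, I01 t -> 1 <= W t <= C) ->
  (forall t s, I01 t -> S t s -> W s <= W t) ->
  (forall t, I01 t -> ig (S t) W <= W t / (4 * M)) ->
  exists C, weight S l W C.
Proof.
move=> [mS SI _] ml hl l0 M0 hM mW [C hC] mono hW; exists C; split => // t It.
have hW1 : L1 W.
  apply: (@L1_bounded _ _ C) => // s Is; have /andP[W1 WC] := hC s Is.
  by rewrite ger0_norm// (le_trans ler01).
have W0 s : I01 s -> 0 <= W s by move=> /hC/andP[W1 _]; exact: le_trans W1.
have mi : meas (fun t => l t * \1_[set t | M < l t] t).
  by apply: measM => //; apply: meas_indic; apply: mset_lt => //; exact: meas_cst.
have h1 : L1 (fun t => l t * \1_[set t | M < l t] t).
  apply: (L1_dom mi hl) => s Is; rewrite ger0_norm; last by rewrite mulr_ge0// indicE ler0n.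
  by rewrite indicE; case: (_ \in _); rewrite ?mulr1// mulr0.
have hlW : L1 (fun s => l s * W s).
  apply: (@L1_eq _ (fun s => W s * l s)); first by move=> s _; rewrite mulrC.
  by apply: (L1_mulb mW ml hl (M := C)) => s Is; rewrite ger0_norm ?W0//; have /andP[] := hC s Is.
apply: (@le_trans _ _ (ig (S t) (fun s => M * W s + W t * (l s * \1_[set t | M < l t] s)))).
  apply: ig_le => //; first by apply: L1D; exact: L1Z.
  move=> s Sts; have Is := SI _ _ Sts.
  have hm := mono _ _ It Sts; have Ws := W0 _ Is; have ls := l0 s.
  rewrite indicE; have [Ml|lM] := ltP M (l s).
    rewrite mem_set// mulr1; apply: (@le_trans _ _ (W t * l s)).
      by rewrite mulrC ler_wpM2r.
    by rewrite lerDr mulr_ge0// ltW.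
  rewrite memNset; last by move=> /=; rewrite ltNge lM.
  by rewrite mulr0 mulr0 addr0 ler_wpM2r.
rewrite igD ?igZ//; [|exact: L1Z|exact: L1Z].
have Wt := W0 _ It.
have e1 : M * ig (S t) W <= W t / 4.
  have := hW t It; rewrite -(ler_pM2l M0) => /le_trans; apply.
  by rewrite invfM mulrCA (mulrCA M) mulfV ?gt_eqF// mulr1.
have e2 : W t * ig (S t) (fun s => l s * \1_[set t | M < l t] s) <= W t / 4.
  apply: ler_wpM2l => //; apply: le_trans hM; apply: ig_subset => //; first exact: mset_I01.
  by move=> s Is; rewrite mulr_ge0// indicE ler0n.
by apply: le_trans (lerD e1 e2) _; lra.
Qed.

Lemma weight_upto l : meas l -> L1 l -> (forall t, 0 <= l t) ->
  exists W C, weight upto l W C.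
Proof.
move=> ml hl l0.
have p4 : 0 < 4^-1 :> R by rewrite invr_gt0.
have [M M0 hM] := L1_tail ml hl p4 l0.
(* The rate is dictated by the condition [ig (upto t) W <= W t / (4 * M)]. *)
pose K := 4 * M; have K0 : 0 < K by rewrite mulr_gt0.
exists (fun t => expR (K * t + 0)).
apply: (weight_aux sweep_upto ml hl l0 M0 hM) => //.
- apply: meas_continuous => s; apply: continuous_comp; last exact: continuous_expR.
  by apply: cvgD; [apply: cvgM; [exact: cvg_cst|exact: cvg_id]|exact: cvg_cst].
- exists (expR K) => t; rewrite /I01 /= in_itv/= => /andP[t0 t1].
  by rewrite -{1}expR0 !ler_expR addr0 mulr_ge0//= ?ler_piMr// ltW.
- move=> t s _ [Is]; rewrite /= in_itv/= => st.
  by rewrite ler_expR lerD2r ler_pM2l.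
- move=> t It; rewrite upto_itv//.
  move: It; rewrite /I01 /= in_itv/= => /andP[t0 t1].
  rewrite ig_expR ?gt_eqF//; apply: ler_wpM2r; first by rewrite invr_ge0 ltW.
  by rewrite gerBl expR_ge0.
Qed.

Lemma weight_from l : meas l -> L1 l -> (forall t, 0 <= l t) ->
  exists W C, weight from l W C.
Proof.
move=> ml hl l0.
have p4 : 0 < 4^-1 :> R by rewrite invr_gt0.
have [M M0 hM] := L1_tail ml hl p4 l0.
pose K := 4 * M; have K0 : 0 < K by rewrite mulr_gt0.
(* Decreasing in time because [from t] looks forward; the shift by [K] keeps the weight above 1 on
   [[0,1]]. *)
exists (fun t => expR (- K * t + K)).
apply: (weight_aux sweep_from ml hl l0 M0 hM) => //.
- apply: meas_continuous => s; apply: continuous_comp; last exact: continuous_expR.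
  by apply: cvgD; [apply: cvgM; [exact: cvg_cst|exact: cvg_id]|exact: cvg_cst].
- exists (expR K) => t; rewrite /I01 /= in_itv/= => /andP[t0 t1].
  rewrite -{1}expR0 !ler_expR mulNr addrC subr_ge0 gerBl mulr_ge0 ?(ltW K0)//.
  by rewrite ger_pMr// t1.
- move=> t s _ [Is]; rewrite /= in_itv/= andbT => st.
  by rewrite ler_expR lerD2r !mulNr lerN2 ler_pM2l.
- move=> t It; rewrite from_itv//.
  move: It; rewrite /I01 /= in_itv/= => /andP[t0 t1].
  rewrite ig_expR ?oppr_eq0 ?gt_eqF// invrN mulrN -mulNr opprB; apply: ler_wpM2r; first by rewrite invr_ge0 ltW.
  by rewrite gerBl expR_ge0.
Qed.

End Weights.

(** * Volterra equations *)

Section Volterra.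
Context {R : realType}.

(** The l^1 norm: as a sum of absolute values it passes under the integral sign coordinate by
    coordinate, and its measurability and integrability are immediate. *)
Definition nrm (p : nat) (x : 'cV[R]_p) : R := \sum_i `|x i 0|.
Definition vmeas (p : nat) (x : R -> 'cV[R]_p) : Prop := forall i, meas (fun t => x t i 0).
Definition vL1 (p : nat) (x : R -> 'cV[R]_p) : Prop := forall i, L1 (fun t => x t i 0).

Lemma nrm_ge0 p (x : 'cV[R]_p) : 0 <= nrm x.
Proof. exact: sumr_ge0. Qed.

Lemma nrm0 p : nrm (0 : 'cV[R]_p) = 0.
Proof. by rewrite /nrm big1// => i _; rewrite mxE normr0. Qed.

Lemma ler_nrm p (x : 'cV[R]_p) i : `|x i 0| <= nrm x.
Proof. by rewrite /nrm (bigD1 i)//= lerDl sumr_ge0. Qed.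

Lemma cvBE p (x y : 'cV[R]_p) i : (x - y) i 0 = x i 0 - y i 0.
Proof. by rewrite !mxE. Qed.

Lemma cvZE p (c : R) (x : 'cV[R]_p) i : (c *: x) i 0 = c * x i 0.
Proof. by rewrite mxE. Qed.

Lemma nrmD p (x y : 'cV[R]_p) : nrm (x + y) <= nrm x + nrm y.
Proof.
by rewrite /nrm -big_split/=; apply: ler_sum => i _; rewrite mxE ler_normD.
Qed.

Lemma nrmN p (x : 'cV[R]_p) : nrm (- x) = nrm x.
Proof. by apply: eq_bigr => i _; rewrite mxE normrN. Qed.

Lemma nrmB p (x y : 'cV[R]_p) : nrm (x - y) <= nrm x + nrm y.
Proof. by rewrite -(nrmN y) nrmD. Qed.

Lemma nrmZ p (c : R) (x : 'cV[R]_p) : nrm (c *: x) = `|c| * nrm x.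
Proof. by rewrite /nrm mulr_sumr; apply: eq_bigr => i _; rewrite mxE normrM. Qed.

Lemma nrm_distr p (x y : 'cV[R]_p) : nrm (x - y) = nrm (y - x).
Proof. by rewrite -nrmN opprB. Qed.

Lemma ler_dist_nrm p (x y : 'cV[R]_p) : `|nrm x - nrm y| <= nrm (x - y).
Proof.
rewrite ler_norml; apply/andP; split.
  by have := nrmD (y - x) x; rewrite subrK nrm_distr; lra.
by have := nrmD (x - y) y; rewrite subrK; lra.
Qed.

Lemma nrm_eq0 p (x : 'cV[R]_p) : nrm x <= 0 -> x = 0.
Proof.
move=> x0; apply/colP => i; rewrite mxE; apply/eqP; rewrite -normr_le0.
exact: le_trans (ler_nrm x i) x0.
Qed.

Lemma meas_nrm p (x : R -> 'cV[R]_p) : vmeas x -> meas (fun t => nrm (x t)).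
Proof. by move=> mx; apply: meas_sum => i; apply: meas_norm; exact: mx. Qed.

Lemma L1_nrm p (x : R -> 'cV[R]_p) : vL1 x -> L1 (fun t => nrm (x t)).
Proof. by move=> mx; apply: L1_sum => i; apply: L1_norm; exact: mx. Qed.

Lemma vL1_dom p (x : R -> 'cV[R]_p) g : vmeas x -> L1 g ->
  (forall t, I01 t -> nrm (x t) <= g t) -> vL1 x.
Proof.
move=> mx hg xg i; apply: (L1_dom (mx i) hg) => t It.
exact: le_trans (ler_nrm _ _) (xg _ It).
Qed.

Lemma nrm_ig p D (G : R -> 'cV[R]_p) : mset D -> D `<=` I01 -> vL1 G ->
  nrm (\col_i ig D (fun s => G s i 0)) <= ig D (fun s => nrm (G s)).
Proof.
move=> mD DI hG; rewrite /nrm ig_sum//; last by move=> i; exact: L1_norm.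
by apply: ler_sum => i _; rewrite mxE ig_norm.
Qed.

Lemma vmeasD p (x y : R -> 'cV[R]_p) : vmeas x -> vmeas y -> vmeas (fun t => x t + y t).
Proof.
by move=> mx my i; under eq_fun do rewrite mxE; apply: measD; [exact: mx|exact: my].
Qed.

Lemma vmeasZ p c (x : R -> 'cV[R]_p) : meas c -> vmeas x -> vmeas (fun t => c t *: x t).
Proof.
by move=> mc mx i; under eq_fun do rewrite mxE; apply: measM => //; exact: mx.
Qed.

Lemma vmeas_cst p (c : 'cV[R]_p) : vmeas (fun _ => c).
Proof. by move=> i; exact: meas_cst. Qed.

Lemma vmeasN p (x : R -> 'cV[R]_p) : vmeas x -> vmeas (fun t => - x t).
Proof. by move=> mx i; under eq_fun do rewrite mxE; apply: measN; exact: mx. Qed.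

Lemma vmeasB p (x y : R -> 'cV[R]_p) : vmeas x -> vmeas y -> vmeas (fun t => x t - y t).
Proof. by move=> mx my; apply: vmeasD => //; exact: vmeasN. Qed.

(** The partial sums of the increments form a geometric tail. Besides convergence this gives an
    explicit rate, which makes the Picard iteration converge uniformly in time. *)
Lemma cvg_geometric_increments (u : nat -> R) (C : R) :
  (forall k, `|u k.+1 - u k| <= C / 2 ^+ k) ->
  exists l : R, (u @ \oo --> l) /\ forall k, `|u k - l| <= 2 * C / 2 ^+ k.
Proof.
move=> hu.
have C0 : 0 <= C by have := hu 0; rewrite expr0 divr1; exact: le_trans.
have dist k j : `|u (k + j)%N - u k| <= 2 * C / 2 ^+ k * (1 - 2^-1 ^+ j).
  elim: j => [|j ih]; first by rewrite addn0 !subrr normr0 mulr0.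
  rewrite addnS -(subrKA (u (k + j)%N)); apply: le_trans (ler_normD _ _) _.
  apply: le_trans (lerD (hu _) ih) _.
  rewrite exprD exprS invfM -exprVn -exprVn; set x := 2^-1 ^+ j; set z := 2^-1 ^+ k.
  lra.
have dist2 k j : (k <= j)%N -> `|u j - u k| <= 2 * C / 2 ^+ k.
  move=> /subnKC <-; apply: le_trans (dist _ _) _.
  apply: ler_piMr; first by rewrite !mulr_ge0// invr_ge0 exprn_ge0.
  by rewrite gerBl exprn_ge0// invr_ge0.
have small (e : R) : 0 < e -> \forall k \near \oo, 2 * C / 2 ^+ k <= e.
  move=> e0; have : geometric (2 * C) 2^-1 @ \oo --> (0 : R).
    by apply: sequences.cvg_geometric; rewrite ger0_norm ?invr_ge0// invf_lt1// ltr1n.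
  move=> /cvgrPdist_le/(_ e e0); apply: filterS => k /=.
  rewrite sub0r normrN => h; rewrite -exprVn; exact: le_trans (ler_norm _) h.
have : cvgn u.
  apply: cauchy_cvg; apply/cauchy_ballP => e e0.
  have [N _ hN] := small (e / 3) (divr_gt0 e0 (ltr0Sn R 2)).
  exists ([set u k | k in [set k | (N <= k)%N]], [set u k | k in [set k | (N <= k)%N]]).
    by split; exists N => // k Nk /=; exists k.
  move=> [_ _] [/= [j Nj <-] [k Nk <-]]; rewrite /ball /=.
  rewrite -(subrKA (u N)); apply: le_lt_trans (ler_normD _ _) _.
  rewrite (distrC (u N)).
  have hj := le_trans (dist2 _ _ Nj) (hN _ (leqnn _)).
  have hk := le_trans (dist2 _ _ Nk) (hN _ (leqnn _)).
  lra.
move=> /cvg_ex[l ul]; exists l; split => // k.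
apply/ler_addgt0Pr => e e0.
have /cvgrPdist_le/(_ e e0)[N _ hN] := ul.
have := hN _ (leq_maxl N k); have := dist2 _ _ (leq_maxr N k).
set z := u (maxn N k) => h1 h2.
rewrite -(subrKA z); apply: le_trans (ler_normD _ _) _.
by rewrite (distrC (u k)); apply: lerD => //; rewrite distrC.
Qed.

Section Gronwall.
Variables (S : R -> set R) (l W : R -> R) (C : R).
Hypotheses (hS : sweep S) (ml : meas l) (hl : L1 l) (l0 : forall t, 0 <= l t).
Hypothesis hW : weight S l W C.

Let W0 s : I01 s -> 0 <= W s.
Proof. by case: hW => _ h _ /h/andP[+ _]; exact: le_trans. Qed.

Let W1 s : I01 s -> 1 <= W s.
Proof. by case: hW => _ h _ /h/andP[]. Qed.

Let WC s : I01 s -> W s <= C.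
Proof. by case: hW => _ h _ /h/andP[]. Qed.

Lemma L1_weight : L1 (fun s => l s * W s).
Proof.
apply: (@L1_eq _ (fun s => W s * l s)); first by move=> s _; rewrite mulrC.
case: (hW) => mW _ _; apply: (L1_mulb mW ml hl (M := C)) => s Is.
by rewrite ger0_norm ?WC// W0.
Qed.

Lemma L1_lmul (e : R -> R) M : meas e -> (forall t, I01 t -> `|e t| <= M) ->
  L1 (fun s => l s * e s).
Proof.
move=> me eM; apply: (@L1_eq _ (fun s => e s * l s)); first by move=> s _; rewrite mulrC.
exact: (L1_mulb me ml hl (M := M)).
Qed.

(** Bootstrapping with the weight: from [e <= (2 * k + N) * W] the integral term is at most half the
    right side, and [k <= k * W], so [e <= (2 * k + N / 2) * W]. Starting at the a priori bound [M],
    the excess is halved at each round and disappears from the conclusion. *)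
Lemma Gronwall (e : R -> R) (k M : R) : meas e ->
  (forall t, I01 t -> 0 <= e t <= M) ->
  (forall t, I01 t -> e t <= k + ig (S t) (fun s => l s * e s)) ->
  0 <= k -> forall t, I01 t -> e t <= 2 * k * C.
Proof.
move=> me heM he k0; case: (hS) => mS SI _.
have e0 t : I01 t -> 0 <= e t by move=> /heM/andP[].
have eM t : I01 t -> e t <= M by move=> /heM/andP[].
have step j t : I01 t -> e t <= (2 * k + M / 2 ^+ j) * W t.
  elim: j t => [|j ih] t It.
    have M0 := le_trans (e0 _ It) (eM _ It).
    rewrite expr0 divr1; apply: le_trans (eM _ It) _.
    have := W1 It; nra.
  have M0 := le_trans (e0 _ It) (eM _ It).
  apply: le_trans (he _ It) _.
  have h1 : ig (S t) (fun s => l s * e s) <= (2 * k + M / 2 ^+ j) * (W t / 2).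
    apply: (@le_trans _ _ (ig (S t) (fun s => (2 * k + M / 2 ^+ j) * (l s * W s)))).
      apply: ig_le => //.
      - apply: (@L1_lmul e M) => // s Is; rewrite ger0_norm ?eM// e0//.
      - by apply: L1Z; exact: L1_weight.
      - by move=> s /SI Is; rewrite mulrCA ler_wpM2l// ih.
    rewrite igZ//; last exact: L1_weight.
    apply: ler_wpM2l; last by case: hW => _ _; exact.
    by rewrite addr_ge0 ?mulr_ge0// invr_ge0 exprn_ge0.
  apply: le_trans (lerD (lexx k) h1) _.
  rewrite exprS invfM; set z := (2 ^+ j)^-1.
  have z0 : 0 <= z by rewrite invr_ge0 exprn_ge0.
  have := W1 It; nra.
move=> t It; apply: (@le_trans _ _ (2 * k * W t)); last first.
  by apply: ler_wpM2l; rewrite ?mulr_ge0// WC.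
apply/ler_addgt0Pr => d d0.
have M0 := le_trans (e0 _ It) (eM _ It).
have : geometric (M * W t) 2^-1 @ \oo --> (0 : R).
  by apply: sequences.cvg_geometric; rewrite ger0_norm ?invr_ge0// invf_lt1// ltr1n.
move=> /cvgrPdist_le/(_ d d0)[j _ /(_ j (leqnn j))].
rewrite /= sub0r normrN => hj; apply: le_trans (step j _ It) _.
rewrite mulrDl lerD2l; apply: le_trans hj; apply: le_trans (ler_norm _).
by rewrite exprVn mulrAC.
Qed.

(** Picard iteration. In the weighted norm an integrable Lipschitz modulus still yields the
    contraction factor 1/2, so the iterates converge uniformly on the whole of [[0,1]] with no
    subdivision of the interval. The same proof serves initial and terminal value problems,
    according to the sweep. *)
Lemma Volterra_solution p (F : R -> 'cV[R]_p -> 'cV[R]_p) (x0 : 'cV[R]_p) :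
  (forall t x y, I01 t -> nrm (F t x - F t y) <= l t * nrm (x - y)) ->
  (forall x, vmeas x -> vmeas (fun t => F t (x t))) ->
  vL1 (fun t => F t x0) ->
  exists x : R -> 'cV[R]_p, [/\ vmeas x, exists M, forall t, nrm (x t) <= M,
    vL1 (fun t => F t (x t)) &
    forall t i, I01 t -> x t i 0 = x0 i 0 + ig (S t) (fun s => F s (x s) i 0)].
Proof.
move=> FL mF F0; case: (hS) => mS SI cS.
have FL1 (x : R -> 'cV[R]_p) M : vmeas x -> (forall t, I01 t -> nrm (x t - x0) <= M) ->
    vL1 (fun t => F t (x t)).
  move=> mx xM.
  apply: (@vL1_dom _ _ (fun t => nrm (F t x0) + M * l t)); first exact: mF.
    by apply: L1D; [exact: L1_nrm|exact: L1Z].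
  move=> t It; rewrite -[F t (x t)](subrK (F t x0)); apply: le_trans (nrmD _ _) _.
  rewrite addrC lerD2l; apply: le_trans (FL _ _ _ It) _.
  by rewrite mulrC ler_wpM2r// xM.
(* The indicator makes every iterate vanish outside [[0,1]], so that measurability on the line is
   preserved. *)
pose T (x : R -> 'cV[R]_p) : R -> 'cV[R]_p := fun t =>
  \1_I01 t *: (x0 + \col_i ig (S t) (fun s => F s (x s) i 0)).
have TE x t i : I01 t -> T x t i 0 = x0 i 0 + ig (S t) (fun s => F s (x s) i 0).
  by move=> It; rewrite /T !mxE indicE mem_set// mul1r.
have mT x M : vmeas x -> (forall t, I01 t -> nrm (x t - x0) <= M) -> vmeas (T x).
  move=> mx xM i; under eq_fun do rewrite /T !mxE.
  apply: measM; first by apply: meas_indic; exact: mset_I01.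
  apply: measD; first exact: meas_cst.
  by apply/meas_continuous/cS; exact: FL1 xM i.
pose K := ig I01 (fun t => nrm (F t x0)).
pose x (k : nat) : R -> 'cV[R]_p := iter k T (fun t => \1_I01 t *: x0).
have K0 : 0 <= K by apply: ig_ge0 => t _; exact: nrm_ge0.
have Tdiff a b M N : vmeas a -> (forall t, I01 t -> nrm (a t - x0) <= M) ->
    vmeas b -> (forall t, I01 t -> nrm (b t - x0) <= M) -> 0 <= N ->
    (forall t, I01 t -> nrm (a t - b t) <= N * W t) ->
    forall t, I01 t -> nrm (T a t - T b t) <= N / 2 * W t.
  move=> ma aM mb bM N0 ab t It.
  have hab : vL1 (fun s => F s (a s) - F s (b s)).
    by move=> i; under eq_fun do rewrite !mxE; apply: L1B; [exact: FL1 aM i|exact: FL1 bM i].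
  have -> : T a t - T b t = \col_i ig (S t) (fun s => (F s (a s) - F s (b s)) i 0).
    apply/colP => i; rewrite !mxE indicE mem_set// !mul1r opprD addrACA subrr add0r.
    rewrite -igB//; [|exact: FL1 aM i|exact: FL1 bM i].
    by apply: ig_eq => s _; rewrite !mxE.
  apply: le_trans (nrm_ig (mS t) (@SI t) hab) _.
  apply: (@le_trans _ _ (ig (S t) (fun s => N * (l s * W s)))).
    apply: ig_le => //; first exact: L1_nrm.
    - by apply: L1Z; exact: L1_weight.
    - move=> s /SI Is; apply: le_trans (FL _ _ _ Is) _.
      by rewrite mulrCA ler_wpM2l// ab.
  rewrite igZ//; last exact: L1_weight.
  rewrite -[leRHS]mulrA [_^-1 * _]mulrC ler_wpM2l//.
  by case: hW => _ _; exact.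
have hx k : [/\ vmeas (x k), (exists M, forall t, I01 t -> nrm (x k t - x0) <= M) &
    forall t, I01 t -> nrm (x k.+1 t - x k t) <= K / 2 ^+ k * W t].
  elim: k => [|k [mk [M kM] dk]].
    have m0 : vmeas (x 0).
      by apply: vmeasZ; [apply: meas_indic; exact: mset_I01|exact: vmeas_cst].
    have x0E t : I01 t -> x 0 t = x0 by move=> It; rewrite /x /= indicE mem_set// scale1r.
    split => //; first by exists 0 => t It; rewrite x0E// subrr nrm0.
    move=> t It; rewrite x0E//.
    have -> : x 1 t - x0 = \col_i ig (S t) (fun s => (F s x0) i 0).
      apply/colP => i; rewrite !mxE indicE mem_set// !mul1r addrAC subrr add0r.
      by apply: ig_eq => s /SI Is; rewrite indicE mem_set// scale1r.
    apply: le_trans (nrm_ig (mS t) (@SI t) F0) _.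
    rewrite expr0 divr1; apply: (@le_trans _ _ K).
      apply: ig_subset => //; [exact: mset_I01|exact: L1_nrm|].
      by move=> s _; exact: nrm_ge0.
    by have := W1 It; nra.
  have mk1 : vmeas (x k.+1) := mT _ _ mk kM.
  pose N := M + K / 2 ^+ k * C.
  have kN t : I01 t -> nrm (x k.+1 t - x0) <= N.
    move=> It; rewrite -(subrKA (x k t)); apply: le_trans (nrmD _ _) _.
    rewrite addrC lerD ?kM//; apply: le_trans (dk _ It) _.
    by rewrite ler_wpM2l ?WC// divr_ge0// exprn_ge0.
  have kN' t : I01 t -> nrm (x k t - x0) <= N.
    move=> It; apply: le_trans (kM _ It) _; rewrite lerDl mulr_ge0 ?divr_ge0 ?exprn_ge0//.
    exact: le_trans (W0 It) (WC It).
  split => //; first by exists N.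
  move=> t It; apply: le_trans (@Tdiff _ _ _ _ mk1 kN mk kN' _ dk t It) _.
    by rewrite divr_ge0// exprn_ge0.
  by rewrite exprS invfM [(2^-1 * _)]mulrC mulrA.
have cvgx t i : {r : R | ((fun k => x k t i 0) @ \oo --> r) /\ forall k, I01 t -> `|x k t i 0 - r| <= 2 * (K * C) / 2 ^+ k}.
  apply: cid; have [It|It] := pselect (I01 t).
    have [|r [h1 h2]] := @cvg_geometric_increments (fun k => x k t i 0) (K * C).
      move=> k; have [_ _ /(_ t It) dk] := hx k.
      have := ler_nrm (x k.+1 t - x k t) i; rewrite !mxE => /le_trans; apply.
      apply: le_trans dk _; rewrite mulrAC ler_wpM2r ?invr_ge0 ?exprn_ge0//.
      by rewrite ler_wpM2l// WC.
    by exists r.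
  exists 0; split => //; apply: cvg_near_cst; apply: nearW => -[|k] /=.
    by rewrite !mxE indicE memNset// mul0r.
  by rewrite /T !mxE indicE memNset// mul0r.
pose y : R -> 'cV[R]_p := fun t => \col_i sval (cvgx t i).
have xy t k : I01 t -> nrm (x k t - y t) <= p%:R * (2 * (K * C) / 2 ^+ k).
  move=> It; rewrite -[p in p%:R]card_ord mulr_natl -sumr_const.
  apply: ler_sum => i _; rewrite !mxE.
  by case: (cvgx t i) => r /= [_ h]; exact: h.
have my : vmeas y.
  move=> i; apply: (@meas_lim _ (fun k t => x k t i 0)).
    by move=> k; case: (hx k) => mk _ _; exact: mk.
  by move=> t; rewrite mxE; case: (cvgx t i) => r /= [].
have y0 t : ~ I01 t -> y t = 0.
  move=> It; apply/colP => i; rewrite !mxE.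
  case: (cvgx t i) => r /= [h _]; apply: (@cvg_unique _ (@Rhausdorff R) _ _ _ _ h).
  apply: cvg_near_cst; apply: nearW => -[|k] /=.
    by rewrite !mxE indicE memNset// mul0r.
  by rewrite /T !mxE indicE memNset// mul0r.
pose M0 := p%:R * (2 * (K * C)).
have yM t : I01 t -> nrm (y t - x0) <= M0.
  move=> It; rewrite nrm_distr; have := xy t 0 It.
  by rewrite expr0 divr1 /x /= indicE mem_set// scale1r.
exists y; split => //.
- exists (nrm x0 + M0) => t; have [It|It] := pselect (I01 t).
    rewrite -[y t](subrK x0) addrC; apply: le_trans (nrmD _ _) _.
    by rewrite lerD2l yM.
  rewrite y0// nrm0 addr_ge0 ?nrm_ge0//.
  have I0 : I01 (0 : R) by rewrite /I01 /= in_itv/= lexx ler01.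
  exact: le_trans (nrm_ge0 _) (yM _ I0).
- exact: FL1 yM.
move=> t i It; rewrite -TE//.
(* The limit is a fixed point because [y] and [T y] are both within a multiple of [2 ^- j] of the
   iterate [x j.+1 = T (x j)]. *)
suff : nrm (y t - T y t) <= 0.
  by move=> /nrm_eq0/subr0_eq; move=> /colP/(_ i).
apply/ler_addgt0Pr => d d0; rewrite add0r.
pose B := M0 + M0 * C.
have M00 : 0 <= M0 by rewrite !mulr_ge0//; exact: le_trans (W0 It) (WC It).
have : geometric B 2^-1 @ \oo --> (0 : R).
  by apply: sequences.cvg_geometric; rewrite ger0_norm ?invr_ge0// invf_lt1// ltr1n.
move=> /cvgrPdist_le/(_ d d0)[j _ /(_ j (leqnn j))].
rewrite /= sub0r normrN => hj; apply: le_trans hj; apply: le_trans (ler_norm _).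
rewrite -(subrKA (x j.+1 t)); apply: le_trans (nrmD _ _) _.
rewrite exprVn /B mulrDl; apply: lerD.
  rewrite nrm_distr; apply: le_trans (xy _ j.+1 It) _.
  rewrite mulrA -/M0 ler_wpM2l//.
  rewrite lef_pV2 ?posrE ?exprn_gt0//.
  by rewrite exprS ler_peMl ?exprn_ge0// ler1n.
have [mj [M jM] _] := hx j.
have N0 : 0 <= M0 / 2 ^+ j by rewrite divr_ge0// exprn_ge0.
have h1 s : I01 s -> nrm (x j s - y s) <= M0 / 2 ^+ j * W s.
  move=> Is; apply: le_trans (xy _ j Is) _; rewrite mulrA.
  by apply: ler_peMr; [exact: N0|exact: W1].
apply: le_trans (@Tdiff (x j) y (Num.max M M0) (M0 / 2 ^+ j) mj _ my _ N0 h1 t It) _.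
- by move=> s Is; rewrite le_max jM.
- by move=> s Is; rewrite le_max yM// orbT.
rewrite [leRHS]mulrAC; have := W1 It; have := WC It; move: N0.
by set z := M0 / 2 ^+ j; nra.
Qed.

End Gronwall.
End Volterra.

(** * Linearized directions *)

Section LinearControl.
Context {R : realType} {n m : nat}.

(* A field of matrices, measurable in time and uniformly bounded by C as
   operators for the l^1 norm. *)
Definition mxfield p q (M : R -> 'M[R]_(p, q)) (C : R) : Prop :=
  (forall x, vmeas x -> vmeas (fun t => M t *m x t)) /\
  (forall t x, nrm (M t *m x) <= C * nrm x).

Definition lform (a : R -> 'rV[R]_n) (b : R -> 'rV[R]_m)
    (y : R -> 'cV[R]_n) (v : R -> 'cV[R]_m) (t : R) : R :=
  (a t *m y t + b t *m v t) 0 0.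

Lemma lformE a b y v t : lform a b y v t = (a t *m y t) 0 0 + (b t *m v t) 0 0.
Proof. by rewrite /lform mxE. Qed.

Let mxNZE (s : R) (X : 'M[R]_1) : (- (s *: X)) 0 0 = - (s * X 0 0).
Proof. by rewrite !mxE. Qed.

Lemma lformD a b y v y' v' t :
  lform a b (fun t => y t + y' t) (fun t => v t + v' t) t = lform a b y v t + lform a b y' v' t.
Proof. by rewrite /lform !mulmxDr !mxE; ring. Qed.

Lemma lformZ a b y v (s : R) t :
  lform a b (fun t => s *: y t) (fun t => s *: v t) t = s * lform a b y v t.
Proof. by rewrite /lform -!scalemxAr !mxE mulrDr. Qed.

Lemma lform_bound a b Ca Cb y v t : mxfield a Ca -> mxfield b Cb ->
  `|lform a b y v t| <= Ca * nrm (y t) + Cb * nrm (v t).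
Proof.
move=> [_ ha] [_ hb]; rewrite /lform mxE; apply: le_trans (ler_normD _ _) _.
by apply: lerD; [apply: le_trans (ler_nrm _ _) (ha _ _)|apply: le_trans (ler_nrm _ _) (hb _ _)].
Qed.

Lemma meas_lform a b Ca Cb y v : mxfield a Ca -> mxfield b Cb -> vmeas y -> vmeas v ->
  meas (lform a b y v).
Proof.
move=> [ma _] [mb _] my mv; rewrite /lform; under eq_fun do rewrite mxE.
by apply: measD; [exact: ma|exact: mb].
Qed.

Section Directions.
Variables (A : R -> 'M[R]_(n, n)) (B : R -> 'M[R]_(n, m)).
Variables (a c : R -> 'rV[R]_n) (b d : R -> 'rV[R]_m) (gam : R -> R) (K0 : R).
Hypotheses (hA : mxfield A K0) (hB : mxfield B K0) (ha : mxfield a K0)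
  (hb : mxfield b K0) (hc : mxfield c K0) (hd : mxfield d K0) (K00 : 0 <= K0).

(** Controls are integrable and bounded on each [[tau,1]] only, since feedback corrections may grow
    like [1/omega] near 0. The state equation is kept in integral form, with zero initial value
    built in. *)
Record direction (y : R -> 'cV[R]_n) (v : R -> 'cV[R]_m) : Prop := Direction {
  dir_y : vmeas y;
  dir_v : vmeas v;
  dir_bd : exists M, forall t, nrm (y t) <= M;
  dir_L1 : vL1 v;
  dir_loc : forall tau, 0 < tau -> exists M, forall t, I01 t -> tau <= t -> nrm (v t) <= M;
  dir_eq : forall t i, I01 t ->
    y t i 0 = ig (upto t) (fun s => (A s *m y s + B s *m v s) i 0) }.

Definition J y v : R := ig I01 (lform c d y v).
Definition act (e : R) : set R := [set t | I01 t /\ - e <= gam t].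

Lemma dir_rhs_L1 y v : direction y v -> vL1 (fun s => A s *m y s + B s *m v s).
Proof.
move=> [my mv [M yM] hv _ _].
apply: (@vL1_dom _ _ _ (fun t => K0 * M + K0 * nrm (v t))).
- by apply: vmeasD; [exact: hA.1|exact: hB.1].
- by apply: L1D; [exact: L1_cst|apply: L1Z; exact: L1_nrm].
- move=> t _; apply: le_trans (nrmD _ _) _; apply: lerD; last exact: hB.2.
  by apply: le_trans (hA.2 _ _) _; rewrite ler_wpM2l.
Qed.

Lemma L1_lform y v a' b' C1 C2 : mxfield a' C1 -> mxfield b' C2 -> 0 <= C1 ->
  direction y v -> L1 (lform a' b' y v).
Proof.
move=> ha' hb' C10 [my mv [M yM] hv _ _].
apply: (@L1_dom _ _ (fun t => C1 * M + C2 * nrm (v t))).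
- exact: meas_lform ha' hb' my mv.
- by apply: L1D; [exact: L1_cst|apply: L1Z; exact: L1_nrm].
- move=> t _; apply: le_trans (lform_bound _ _ _ ha' hb') _.
  by rewrite lerD2r ler_wpM2l.
Qed.

Lemma directionD y v y' v' : direction y v -> direction y' v' ->
  direction (fun t => y t + y' t) (fun t => v t + v' t).
Proof.
move=> h h'; have hL := dir_rhs_L1 h; have hL' := dir_rhs_L1 h'.
case: h h' => [my mv [M yM] hv lv ey] [my' mv' [M' yM'] hv' lv' ey'].
split; [exact: vmeasD|exact: vmeasD| | | |].
- by exists (M + M') => t; apply: le_trans (nrmD _ _) _; exact: lerD.
- by move=> i; under eq_fun do rewrite mxE; apply: L1D; [exact: hv|exact: hv'].
- move=> tau tau0; have [N hN] := lv _ tau0; have [N' hN'] := lv' _ tau0.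
  exists (N + N') => t It ht; apply: le_trans (nrmD _ _) _.
  by apply: lerD; [exact: hN|exact: hN'].
- move=> t i It; rewrite mxE ey// ey'// -(igD (mset_upto t) (@upto_sub _ t) (hL i) (hL' i)).
  by apply: ig_eq => s _; rewrite !mulmxDr !mxE; ring.
Qed.

Lemma directionZ y v (s : R) : direction y v ->
  direction (fun t => s *: y t) (fun t => s *: v t).
Proof.
move=> h; have hL := dir_rhs_L1 h.
case: h => [my mv [M yM] hv lv ey].
split.
- by apply: vmeasZ => //; exact: meas_cst.
- by apply: vmeasZ => //; exact: meas_cst.
- by exists (`|s| * M) => t; rewrite nrmZ ler_wpM2l.
- by move=> i; under eq_fun do rewrite mxE; apply: L1Z; exact: hv.
- move=> tau tau0; have [N hN] := lv _ tau0.
  by exists (`|s| * N) => t It ht; rewrite nrmZ ler_wpM2l// hN.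
- move=> t i It; rewrite mxE ey// -(igZ s (mset_upto t) (@upto_sub _ t) (hL i)).
  by apply: ig_eq => r _; rewrite -!scalemxAr !mxE; ring.
Qed.

Lemma JD y v y' v' : direction y v -> direction y' v' ->
  J (fun t => y t + y' t) (fun t => v t + v' t) = J y v + J y' v'.
Proof.
move=> h h'; rewrite /J -(igD mset_I01 _ (L1_lform hc hd K00 h) (L1_lform hc hd K00 h'))//.
by apply: ig_eq => t _; rewrite lformD.
Qed.

Lemma JZ y v s : direction y v -> J (fun t => s *: y t) (fun t => s *: v t) = s * J y v.
Proof.
move=> h; rewrite /J -(igZ s mset_I01 _ (L1_lform hc hd K00 h))//.
by apply: ig_eq => t _; rewrite lformZ.
Qed.

(** The control [ch] moves the constraint at rate at least 1 on the almost active part of [[0,bb]],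
    and [rho] is its price. Integrability of [rho] near 0 is what the condition on [omega]
    supplies. *)
Record feedback (bb e : R) (ch : R -> 'cV[R]_m) (rho : R -> R) : Prop := Feedback {
  fb_ch : vmeas ch;
  fb_rho : meas rho;
  fb_L1 : L1 rho;
  fb_bound : forall t, nrm (ch t) <= rho t;
  fb_loc : forall tau, 0 < tau -> exists M, forall t, I01 t -> tau <= t -> rho t <= M;
  fb_off : forall t, bb < t -> ch t = 0;
  fb_on : ae_on (act e `&` [set` `]-oo, bb]]) (fun t => 1 <= (b t *m ch t) 0 0) }.

Section Feedback.
Variables (bb e0 : R) (ch : R -> 'cV[R]_m) (rho W : R -> R) (C : R).
(** Lipschitz modulus of the closed loop: [K0] for [A], and the bound [K0] of [B] times the gain
    [K0 * rho t] of the feedback. *)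
Let l t := K0 + K0 * K0 * rho t.
Hypotheses (hf : feedback bb e0 ch rho) (hW : weight upto l W C).

Let rho0 t : 0 <= rho t.
Proof. exact: le_trans (nrm_ge0 _) (fb_bound hf t). Qed.

Let ml : meas l.
Proof. by apply: measD; [exact: meas_cst|apply: measZ; exact: fb_rho hf]. Qed.

Let hl : L1 l.
Proof. by apply: L1D; [exact: L1_cst|apply: L1Z; exact: fb_L1 hf]. Qed.

Let l0 t : 0 <= l t.
Proof. by rewrite addr_ge0// !mulr_ge0. Qed.

(* The feedback term compensates the state part of the linearized constraint. *)
Let ctrl (tau : R) (V : R -> 'cV[R]_m) (Y : R -> 'cV[R]_n) (k : R -> R) t x :=
  \1_[set` `]tau, +oo[] t *: (V t - (k t + K0 * nrm (x - Y t)) *: ch t).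

(** The feedback law depends on the state only through a norm, so the closed loop is Lipschitz with
    modulus [l] and the Volterra theorem yields [y]; the control is then read off along [y]. *)
Let ctrl_ex tau V Y k M : vmeas V -> vL1 V ->
  (forall tau, 0 < tau -> exists M, forall t, I01 t -> tau <= t -> nrm (V t) <= M) ->
  vmeas Y -> (forall t, nrm (Y t) <= M) -> meas k -> (forall t, 0 <= k t <= M) ->
  exists y v, direction y v /\ forall t, v t = ctrl tau V Y k t (y t).
Proof.
move=> mV hV lV mY YM mk kM.
have mctrl x : vmeas x -> vmeas (fun t => ctrl tau V Y k t (x t)).
  move=> mx; apply: vmeasZ; first by apply: meas_indic; exact: mset_itv.
  apply: vmeasB => //; apply: vmeasZ; last exact: fb_ch hf.
  by apply: measD => //; apply: measZ; apply: meas_nrm; exact: vmeasB.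
have bctrl x (N : R) t : nrm x <= N ->
    nrm (ctrl tau V Y k t x) <= nrm (V t) + (M + K0 * (N + M)) * rho t.
  move=> xN; rewrite nrmZ indicE; have [k0 kM'] := andP (kM t).
  have -> : `|((t \in [set` `]tau, +oo[])%:R : R)| = (t \in [set` `]tau, +oo[])%:R by rewrite ger0_norm.
  have h0 : nrm (V t - (k t + K0 * nrm (x - Y t)) *: ch t) <= nrm (V t) + (M + K0 * (N + M)) * rho t.
    apply: le_trans (nrmB _ _) _; rewrite lerD2l nrmZ ger0_norm; last first.
      by rewrite addr_ge0// mulr_ge0// nrm_ge0.
    apply: ler_pM => //; rewrite ?nrm_ge0 ?addr_ge0 ?mulr_ge0 ?nrm_ge0//; last exact: fb_bound hf t.
    apply: lerD => //; rewrite ler_wpM2l//; apply: le_trans (nrmB _ _) _; exact: lerD.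
  case: (_ \in _); rewrite ?mul1r// mul0r; exact: le_trans (nrm_ge0 _) h0.
have ctrlL x y t : nrm (ctrl tau V Y k t x - ctrl tau V Y k t y) <= K0 * rho t * nrm (x - y).
  have -> : ctrl tau V Y k t x - ctrl tau V Y k t y =
      (\1_[set` `]tau, +oo[] t * (K0 * (nrm (y - Y t) - nrm (x - Y t)))) *: ch t.
    by apply/colP => i; rewrite /ctrl !mxE; ring.
  rewrite nrmZ !normrM (ger0_norm K00) indicE.
  have h1 : `|nrm (y - Y t) - nrm (x - Y t)| <= nrm (x - y).
    apply: le_trans (ler_dist_nrm _ _) _.
    by rewrite opprB addrA subrK nrm_distr.
  have h2 : K0 * `|nrm (y - Y t) - nrm (x - Y t)| * nrm (ch t) <= K0 * rho t * nrm (x - y).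
    rewrite mulrAC; apply: ler_pM; rewrite ?mulr_ge0 ?nrm_ge0//.
    by rewrite ler_wpM2l//; exact: fb_bound hf t.
  case: (_ \in _); rewrite ?normr1 ?normr0 ?mul1r// !mul0r.
  by rewrite !mulr_ge0// nrm_ge0.
have [|||y [my [N yN] hy ey]] := @Volterra_solution R upto l W C (sweep_upto) ml hl l0 hW n
   (fun t x => A t *m x + B t *m ctrl tau V Y k t x) 0.
- move=> t x y It.
  have -> : A t *m x + B t *m ctrl tau V Y k t x - (A t *m y + B t *m ctrl tau V Y k t y) =
    A t *m (x - y) + B t *m (ctrl tau V Y k t x - ctrl tau V Y k t y).
    by rewrite !mulmxBr; rewrite opprD addrACA.
  apply: le_trans (nrmD _ _) _; rewrite /l mulrDl; apply: lerD; first exact: hA.2.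
  apply: le_trans (hB.2 _ _) _; rewrite -!mulrA ler_wpM2l//.
  by rewrite mulrA.
- move=> x mx; apply: vmeasD; first exact: hA.1.
  by apply: hB.1; exact: mctrl.
- apply: (@vL1_dom _ _ _ (fun t => K0 * (nrm (V t) + (M + K0 * (0 + M)) * rho t))).
  + apply: vmeasD; [apply: hA.1; exact: vmeas_cst|apply: hB.1; apply: (mctrl (fun _ => 0)); exact: vmeas_cst].
  + by apply: L1Z; apply: L1D; [exact: L1_nrm|apply: L1Z; exact: fb_L1 hf].
  + move=> t _; rewrite mulmx0 add0r; apply: le_trans (hB.2 _ _) _.
    by rewrite ler_wpM2l// bctrl// nrm0.
exists y, (fun t => ctrl tau V Y k t (y t)); split => //; split.
- exact: my.
- exact: mctrl.
- by exists N.
- apply: (@vL1_dom _ _ _ (fun t => nrm (V t) + (M + K0 * (N + M)) * rho t)); first exact: mctrl.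
    by apply: L1D; [exact: L1_nrm|apply: L1Z; exact: fb_L1 hf].
  by move=> t _; exact: bctrl.
- move=> r r0; have [M1 h1] := lV _ r0; have [M2 h2] := fb_loc hf r0.
  exists (M1 + (M + K0 * (N + M)) * M2) => t It rt; apply: le_trans (@bctrl _ N _ (yN t)) _.
  apply: lerD; first exact: h1.
  have M0 := le_trans (nrm_ge0 _) (YM t); have N0 := le_trans (nrm_ge0 _) (yN t).
  by apply: ler_wpM2l; [rewrite addr_ge0// mulr_ge0// addr_ge0|exact: h2].
- by move=> t i It; rewrite ey// mxE add0r.
Qed.

Let L1_rhok k M : meas k -> (forall t, 0 <= k t <= M) -> L1 (fun t => rho t * k t).
Proof.
move=> mk kM; apply: (@L1_eq _ (fun t => k t * rho t)); first by move=> t _; rewrite mulrC.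
apply: (L1_mulb mk (fb_rho hf) (fb_L1 hf) (M := M)) => t _.
by have /andP[k0 ?] := kM t; rewrite ger0_norm.
Qed.

Let C0 : 0 <= C.
Proof.
case: hW => _ h _; have I0 : I01 (0 : R) by rewrite /I01 /= in_itv/= lexx ler01.
have /andP[h1 h2] := h 0 I0; lra.
Qed.

(** The feedback is run with demand [k] and reference state 0. The term [K0 * nrm y] compensates
    [a *m y], so a decrease of at least [k] remains. Gronwall bounds the state, hence the cost, by a
    multiple of the integral of [rho * k]. A price given by an integral against [rho], and not by
    the supremum of [k], is what makes the multiplier absolutely continuous before 1. *)
Lemma domination : exists2 N : R, 0 <= N & forall (k : R -> R) M, meas k ->
  (forall t, 0 <= k t <= M) -> exists y v, [/\ direction y v,
    ae_on (act e0 `&` [set` `]-oo, bb]]) (fun t => lform a b y v t <= - k t),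
    forall t, I01 t -> bb < t -> lform a b y v t <= N * ig I01 (fun t => rho t * k t) &
    J y v <= N * ig I01 (fun t => rho t * k t)].
Proof.
pose Ny := 2 * K0 * C.
pose N := K0 * Ny + K0 * (1 + Ny + K0 * Ny * ig I01 rho).
have Ny0 : 0 <= Ny by rewrite !mulr_ge0.
have irho0 : 0 <= ig I01 rho by apply: ig_ge0.
exists N; first by rewrite !(addr_ge0, mulr_ge0).
move=> k M mk kM; pose q := ig I01 (fun t => rho t * k t).
have hrk := L1_rhok mk kM.
have k0 t : 0 <= k t by have /andP[] := kM t.
have q0 : 0 <= q by apply: ig_ge0 => t _; rewrite mulr_ge0.
have M0 : 0 <= M by have /andP[h1 h2] := kM 0; exact: le_trans h1 h2.
(* With [tau = -1] the cut-off in the control is inactive on [[0,1]]. *)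
have [|||||y [v [dyv vE]]] := @ctrl_ex (-1) (fun _ => 0) (fun _ => 0) k M _ _ _ _ _ mk kM.
- exact: vmeas_cst.
- by move=> i; under eq_fun do rewrite mxE; exact: L1_cst.
- by move=> tau _; exists 0 => t _ _; rewrite nrm0.
- exact: vmeas_cst.
- by move=> t; rewrite nrm0.
have vI t : I01 t -> v t = - ((k t + K0 * nrm (y t)) *: ch t).
  rewrite /I01 /= in_itv/= => /andP[t0 _]; rewrite vE /ctrl subr0 sub0r indicE mem_set ?scale1r//=.
  by rewrite in_itv/= andbT; lra.
have vb t : I01 t -> nrm (v t) <= rho t * k t + K0 * (rho t * nrm (y t)).
  move=> It; rewrite vI// nrmN nrmZ ger0_norm; last by rewrite addr_ge0// mulr_ge0// nrm_ge0.
  apply: (@le_trans _ _ ((k t + K0 * nrm (y t)) * rho t)).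
    by apply: ler_wpM2l; [rewrite addr_ge0// mulr_ge0// nrm_ge0|exact: fb_bound hf t].
  by rewrite le_eqVlt; apply/orP; left; apply/eqP; ring.
have [Mb yM] := dir_bd dyv.
have mny := meas_nrm (dir_y dyv).
have hly : L1 (fun s => l s * nrm (y s)).
  by apply: (L1_lmul ml hl mny (M := Mb)) => t _; rewrite ger0_norm// nrm_ge0.
have yq t : I01 t -> nrm (y t) <= Ny * q.
  move=> It; apply: le_trans (@Gronwall R upto l W C sweep_upto ml hl l0 hW _ (K0 * q) Mb mny _ _ _ t It) _.
  - by move=> s _; rewrite nrm_ge0 yM.
  - move=> s Is.
    have -> : y s = \col_i ig (upto s) (fun r => (A r *m y r + B r *m v r) i 0).
      by apply/colP => i; rewrite mxE (dir_eq dyv).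
    apply: le_trans (nrm_ig (mset_upto s) (@upto_sub _ s) (dir_rhs_L1 dyv)) _.
    apply: (@le_trans _ _ (ig (upto s) (fun r => K0 * (rho r * k r) + l r * nrm (y r)))).
      apply: ig_le; [exact: mset_upto|exact: upto_sub|apply: L1_nrm; exact: dir_rhs_L1| |].
        by apply: L1D => //; exact: L1Z.
      move=> r /upto_sub Ir; apply: le_trans (nrmD _ _) _.
      apply: le_trans (lerD (hA.2 _ _) (hB.2 _ _)) _.
      have := ler_wpM2l K00 (vb _ Ir); rewrite /l; lra.
    rewrite igD ?igZ//; [|exact: mset_upto|exact: upto_sub|exact: mset_upto|exact: upto_sub|exact: L1Z].
    rewrite lerD2r ler_wpM2l//; apply: ig_subset => //; [exact: mset_upto|exact: mset_I01|exact: upto_sub|].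
    by move=> r _; rewrite mulr_ge0.
  - by rewrite mulr_ge0.
  - by rewrite /Ny; lra.
exists y, v; split => //.
- have := fb_on hf; apply: ae_on_filter => t [[It _] _] h.
  rewrite lformE vI// mulmxN -scalemxAr mxNZE.
  have h1 : (a t *m y t) 0 0 <= K0 * nrm (y t).
    by apply: le_trans (ler_norm _) _; apply: le_trans (ler_nrm _ _) (ha.2 _ _).
  have h2 : k t + K0 * nrm (y t) <= (k t + K0 * nrm (y t)) * (b t *m ch t) 0 0.
    by apply: ler_peMr => //; rewrite addr_ge0// mulr_ge0// nrm_ge0.
  lra.
- move=> t It bt; apply: le_trans (ler_norm _) _; apply: le_trans (lform_bound _ _ _ ha hb) _.
  rewrite vI// (fb_off hf)// scaler0 oppr0 nrm0 mulr0 addr0.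
  apply: (@le_trans _ _ (K0 * Ny * q)); first by rewrite -mulrA ler_wpM2l// yq.
  by apply: ler_wpM2r => //; rewrite lerDl !(addr_ge0, mulr_ge0).
- apply: le_trans (ler_norm _) _.
  apply: le_trans (@ig_norm_le _ _ _ (fun t => K0 * (Ny * q) + (K0 * (rho t * k t) +
    (K0 * (K0 * (Ny * q))) * rho t)) mset_I01 _ (L1_lform hc hd K00 dyv) _ _) _.
  + by [].
  + apply: L1D; first exact: L1_cst.
    by apply: L1D; apply: L1Z => //; exact: fb_L1 hf.
  + move=> t It; apply: le_trans (lform_bound _ _ _ hc hd) _.
    apply: lerD; first by rewrite ler_wpM2l// yq.
    have h1 : rho t * nrm (y t) <= (Ny * q) * rho t by rewrite mulrC ler_wpM2r// yq.
    have := ler_wpM2l K00 (vb _ It); have := ler_wpM2l K00 (ler_wpM2l K00 h1); lra.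
  have f1 := L1Z K0 hrk; have f2 := L1Z (K0 * (K0 * (Ny * q))) (fb_L1 hf).
  rewrite (ig1D (L1_cst (K0 * (Ny * q))) (L1D f1 f2)) (ig1D f1 f2) (ig1Z K0 hrk).
  rewrite (ig1Z _ (fb_L1 hf)) ig1_cst -/q /N.
  have h : 0 <= K0 * Ny * q by rewrite !mulr_ge0.
  lra.
Qed.

(* Cutting the control off near 0 and compensating the error by feedback. *)
Lemma truncated_direction Y V (e : R) : 0 < bb < 1 -> direction Y V -> 0 < e ->
  exists tau : R, 0 < tau < bb /\ exists y v, [/\ direction y v,
    exists M, forall t, I01 t -> nrm (v t) <= M,
    forall t, t <= tau -> v t = 0 &
    [/\ ae_on (act e0 `&` [set` `]tau, bb]]) (fun t => lform a b y v t <= lform a b Y V t),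
      forall t, I01 t -> tau < t -> bb < t -> lform a b y v t <= lform a b Y V t + e &
      J y v <= J Y V + e]].
Proof.
move=> /andP[bb0 bb1] dYV e_gt0.
have il0 : 0 <= ig I01 l by apply: ig_ge0.
(* When [K0] times the removed control mass is at most [k0], Gronwall bounds the state error by
   [2 * k0 * C]. [Q] collects the resulting changes of cost and constraint, and [k0] is fixed by
   [k0 * Q = e]. *)
pose Q := 1 + 2 * C * (K0 + ig I01 l).
have Q0 : 0 < Q by rewrite ltr_pwDl// !(mulr_ge0, addr_ge0).
pose k0 := e / Q.
have k00 : 0 < k0 by rewrite divr_gt0.
have k0Q : k0 * Q = e by rewrite /k0 divfK// gt_eqF.
have hV := L1_nrm (dir_L1 dYV).
(* Dividing by [1 + K0] instead of [K0] covers the case [K0 = 0]. *)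
have K1 : 0 < 1 + K0 by rewrite ltr_pwDl.
have [dl dl0 hdl] := ig_abscont hV (divr_gt0 k00 K1).
pose tau := Num.min dl (bb / 2).
have tau0 : 0 < tau by rewrite lt_min dl0 divr_gt0.
have taubb : tau < bb by rewrite gt_min; apply/orP; right; lra.
have tau1 : tau <= 1 by lra.
have It : I01 tau by rewrite /I01 /= in_itv/= tau1 ltW.
have hk : K0 * ig (upto tau) (fun t => nrm (V t)) <= k0.
  have : ig (upto tau) (fun t => `|nrm (V t)|) <= k0 / (1 + K0).
    apply: hdl; [exact: mset_upto|exact: upto_sub|].
    by rewrite upto_itv// (Leb_itv _ _ (ltW tau0))/= subr0 ge_min lexx.
  have -> : ig (upto tau) (fun t => `|nrm (V t)|) = ig (upto tau) (fun t => nrm (V t)).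
    by apply: ig_eq => t _; rewrite ger0_norm// nrm_ge0.
  have i0 : 0 <= ig (upto tau) (fun t => nrm (V t)) by apply: ig_ge0 => t _; exact: nrm_ge0.
  rewrite ler_pdivlMr// => h; nra.
have [M YM] := dir_bd dYV.
have M0 : 0 <= M by exact: le_trans (nrm_ge0 _) (YM 0).
have [|y [v [dyv vE]]] := @ctrl_ex tau V Y (fun _ => 0) M (dir_v dYV) (dir_L1 dYV) (dir_loc dYV)
  (dir_y dYV) YM (meas_cst 0).
  by move=> t; rewrite lexx.
have v0 t : t <= tau -> v t = 0.
  move=> ttau; rewrite vE /ctrl indicE memNset ?scale0r//= in_itv/= andbT.
  by apply/negP; rewrite -leNgt.
have v1 t : tau < t -> v t = V t - (K0 * nrm (y t - Y t)) *: ch t.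
  move=> ttau; rewrite vE /ctrl indicE mem_set ?scale1r ?add0r//=.
  by rewrite in_itv/= ttau.
pose E t := y t - Y t.
pose p t := \1_[set` `]-oo, tau]] t * nrm (V t).
have hp : L1 p.
  apply: (L1_mulb (meas_indic (mset_itv _)) (meas_nrm (dir_v dYV)) hV (M := 1)) => t _.
  by rewrite indicE; case: (_ \in _); rewrite ?normr1// normr0.
have p0 t : 0 <= p t by rewrite mulr_ge0 ?nrm_ge0// indicE ler0n.
have ip : K0 * ig I01 p <= k0.
  apply: le_trans hk; apply: ler_wpM2l => //; rewrite [leRHS]ig_mkcond; last exact: upto_sub.
  rewrite le_eqVlt; apply/orP; left; apply/eqP/ig_eq => t It'.
  rewrite patchE /p indicE /upto in_setI (mem_set It') /=.
  by case: (_ \in _); rewrite ?mul1r// mul0r.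
have vV t : nrm (v t - V t) <= p t + K0 * (rho t * nrm (E t)).
  have [tt|tt] := leP t tau.
    rewrite v0// sub0r nrmN /p indicE mem_set/= ?mul1r ?in_itv//= lerDl.
    by rewrite !mulr_ge0// nrm_ge0.
  rewrite v1// addrAC subrr sub0r nrmN nrmZ ger0_norm ?mulr_ge0 ?nrm_ge0//.
  apply: (@le_trans _ _ (K0 * nrm (E t) * rho t)).
    by rewrite ler_wpM2l ?mulr_ge0 ?nrm_ge0//; exact: fb_bound hf t.
  by rewrite -mulrA [_ * rho t]mulrC lerDr.
have [My yM] := dir_bd dyv.
have mE : vmeas E by apply: vmeasB; [exact: dir_y dyv|exact: dir_y dYV].
have mnE := meas_nrm mE.
have EM t : nrm (E t) <= My + M by apply: le_trans (nrmB _ _) _; exact: lerD.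
have hlE : L1 (fun s => l s * nrm (E s)).
  by apply: (L1_lmul ml hl mnE (M := My + M)) => t _; rewrite ger0_norm// nrm_ge0.
have Ek t : I01 t -> nrm (E t) <= 2 * k0 * C.
  apply: (@Gronwall R upto l W C sweep_upto ml hl l0 hW _ k0 (My + M) mnE); last exact: ltW.
    by move=> s _; rewrite nrm_ge0 EM.
  move=> s Is.
  have h1 := dir_rhs_L1 dyv; have h2 := dir_rhs_L1 dYV.
  pose G r := (A r *m y r + B r *m v r) - (A r *m Y r + B r *m V r).
  have hG : vL1 G.
    move=> i; under eq_fun do rewrite /G cvBE.
    by apply: L1B; [exact: h1|exact: h2].
  have -> : E s = \col_i ig (upto s) (fun r => G r i 0).
    apply/colP => i; rewrite !mxE (dir_eq dyv)// (dir_eq dYV)//.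
    rewrite -(igB (mset_upto s) (@upto_sub _ s) (h1 i) (h2 i)).
    by apply: ig_eq => r _; rewrite /G cvBE.
  apply: le_trans (nrm_ig (mset_upto s) (@upto_sub _ s) hG) _.
  apply: (@le_trans _ _ (ig (upto s) (fun r => K0 * p r + l r * nrm (E r)))).
    apply: ig_le; [exact: mset_upto|exact: upto_sub|exact: L1_nrm| |].
      by apply: L1D => //; exact: L1Z.
    move=> r _; have -> : G r = A r *m E r + B r *m (v r - V r).
      by rewrite /G !mulmxBr opprD addrACA.
    apply: le_trans (nrmD _ _) _; apply: le_trans (lerD (hA.2 _ _) (hB.2 _ _)) _.
    by have := ler_wpM2l K00 (vV r); rewrite /l; lra.
  rewrite igD ?igZ//; [|exact: mset_upto|exact: upto_sub|exact: mset_upto|exact: upto_sub|exact: L1Z].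
  rewrite lerD2r; apply: le_trans ip; apply: ler_wpM2l => //.
  by apply: ig_subset => //; [exact: mset_upto|exact: mset_I01|exact: upto_sub].
have aE t : (a t *m y t) 0 0 <= (a t *m Y t) 0 0 + K0 * nrm (E t).
  have -> : a t *m y t = a t *m Y t + a t *m E t by rewrite mulmxBr addrC subrK.
  rewrite mxE lerD2l; apply: le_trans (ler_norm _) _.
  by apply: le_trans (ler_nrm _ _) (ha.2 _ _).
exists tau; split; first by rewrite tau0.
exists y, v; split => //.
- have [M1 h1] := dir_loc dyv tau0; exists (Num.max M1 0) => t It'.
  have [tt|tt] := leP t tau; first by rewrite v0// nrm0 le_max lexx orbT.
  by rewrite le_max h1// ltW.
split.
- have : ae_on (act e0 `&` [set` `]tau, bb]]) (fun t => 1 <= (b t *m ch t) 0 0).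
    apply: ae_on_sub (fb_on hf) => t [h]; rewrite /= !in_itv/= => /andP[_ tb].
    by split.
  apply: ae_on_filter => t [[It' _]]; rewrite /= in_itv/= => /andP[tt _] h.
  rewrite !lformE v1// mulmxBr -scalemxAr.
  have -> : (b t *m V t - (K0 * nrm (y t - Y t)) *: (b t *m ch t)) 0 0 =
     (b t *m V t) 0 0 - K0 * nrm (E t) * (b t *m ch t) 0 0 by rewrite cvBE cvZE.
  have h2 : K0 * nrm (E t) <= K0 * nrm (E t) * (b t *m ch t) 0 0.
    by apply: ler_peMr => //; rewrite mulr_ge0// nrm_ge0.
  have := aE t; lra.
- move=> t It' tt bt; rewrite !lformE v1// (fb_off hf)// scaler0 subr0.
  have h2 : K0 * nrm (E t) <= e.
    apply: le_trans (ler_wpM2l K00 (Ek _ It')) _; rewrite -k0Q /Q.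
    have := mulr_ge0 (mulr_ge0 (ltW k00) C0) il0.
    by have := ltW k00; lra.
  have := aE t; lra.
- have hcd : J y v - J Y V = ig I01 (fun t => lform c d y v t - lform c d Y V t).
    by rewrite (igB mset_I01 _ (L1_lform hc hd K00 dyv) (L1_lform hc hd K00 dYV)).
  rewrite -lerBlDl hcd; apply: le_trans (ler_norm _) _.
  apply: le_trans (@ig_norm_le _ _ _ (fun t => K0 * p t + (2 * k0 * C) * l t) mset_I01 _ _ _ _) _ => //.
  + by apply: L1B; [exact: (L1_lform hc hd K00 dyv)|exact: (L1_lform hc hd K00 dYV)].
  + by apply: L1D; exact: L1Z.
  + move=> t It'.
    have -> : lform c d y v t - lform c d Y V t = lform c d E (fun t => v t - V t) t.
      by rewrite !lformE !mulmxBr !mxE; lra.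
    apply: le_trans (lform_bound _ _ _ hc hd) _.
    have h3 := ler_wpM2l (l0 t) (Ek _ It').
    by have := ler_wpM2l K00 (vV t); move: h3; rewrite /l; lra.
  rewrite ig1D ?ig1Z//; [|exact: L1Z|exact: L1Z].
  rewrite -k0Q /Q.
  have h4 := mulr_ge0 (mulr_ge0 (ltW k00) C0) K00.
  by have := ip; lra.
Qed.

End Feedback.
End Directions.
End LinearControl.

(** * The value function of the linearized problem and its linear minorant *)

Section MultiplierFunctional.
Context {R : realType} {n m : nat}.
Variables (A : R -> 'M[R]_(n, n)) (B : R -> 'M[R]_(n, m)).
Variables (a c : R -> 'rV[R]_n) (b d : R -> 'rV[R]_m) (gam : R -> R) (K0 : R).
Hypotheses (hA : mxfield A K0) (hB : mxfield B K0) (ha : mxfield a K0)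
  (hb : mxfield b K0) (hc : mxfield c K0) (hd : mxfield d K0) (K00 : 0 <= K0).
Hypothesis has_feedback : forall bb, 0 < bb < 1 ->
  exists e ch rho, 0 < e /\ feedback b gam bb e ch rho.
Variables (yh : R -> 'cV[R]_n) (vh : R -> 'cV[R]_m) (eh : R) (delta : R -> R).
Hypotheses (dirh : direction A B yh vh) (eh0 : 0 < eh)
  (wh_le0 : ae_on (act gam eh) (fun t => lform a b yh vh t <= 0))
  (wh_lt0 : forall eta, 0 < eta < 1 -> 0 < delta eta /\
     ae_on (act gam eh `&` [set` `[eta, 1]]) (fun t => lform a b yh vh t <= - delta eta)).
Hypothesis no_strict_descent : forall y v tau e k, direction A B y v ->
  (exists M, forall t, I01 t -> nrm (v t) <= M) -> 0 < tau < 1 ->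
  (forall t, t <= tau -> v t = 0) -> 0 < e -> 0 < k ->
  ae_on (act gam e `&` [set` `]tau, 1]]) (fun t => lform a b y v t <= - k) ->
  0 <= J c d y v.

Local Notation dir := (direction A B).
Local Notation w := (lform a b).
Local Notation Jcd := (J c d).
Local Notation acta := (act gam).

Let half01 : 0 < (2^-1 : R) < 1.
Proof. by rewrite invr_gt0 ltr0n/= invf_lt1// ltr1n. Qed.

Lemma feedback_weight bb e ch rho : feedback b gam bb e ch rho ->
  exists W C, weight upto (fun t => K0 + K0 * K0 * rho t) W C.
Proof.
move=> hf; have rho0 t : 0 <= rho t by exact: le_trans (nrm_ge0 _) (fb_bound hf t).
apply: weight_upto.
- by apply: measD; [exact: meas_cst|apply: measZ; exact: fb_rho hf].
- by apply: L1D; [exact: L1_cst|apply: L1Z; exact: fb_L1 hf].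
- by move=> t; rewrite addr_ge0// !mulr_ge0.
Qed.

(** Cut the control off near 0, with feedback up to 1/2. Before 1/2 the cut does not raise the
    linearized constraint on the almost active set; after 1/2 it raises it by at most [e3], chosen
    below half of the margin [s * delta 2^-1]. The truncated pair thus has a uniform margin on
    []tau,1]], and its cost exceeds the original one by at most [e1]. *)
Let no_descent_aux Y V (e s : R) : dir Y V -> 0 < e -> 0 < s ->
  (forall eta, 0 < eta < 1 ->
    ae_on (acta e `&` [set` `[eta, 1]]) (fun t => w Y V t <= - (s * delta eta))) ->
  0 <= Jcd Y V.
Proof.
move=> dYV e0 s0 hYV; apply/ler_addgt0Pr => e1 e10.
have h2 := half01.
have [d20 _] := wh_lt0 h2.
have [e2 [ch [rho [e20 hf]]]] := has_feedback h2.
have [W [C hW]] := feedback_weight hf.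
pose e3 := Num.min e1 (s * delta 2^-1 / 2).
have e30 : 0 < e3 by rewrite lt_min e10 !(mulr_gt0, invr_gt0).
have [tau [/andP[tau0 tau2] [y [v [dyv bv v0 [h3 h4 h5]]]]]] :=
  truncated_direction hA hB ha hc hd K00 hf hW h2 dYV e30.
have tau1 : 0 < tau < 1 by move: h2 => /andP[_ h2]; rewrite tau0 (lt_trans tau2 h2).
have [dt0 _] := wh_lt0 tau1.
pose k := Num.min (s * delta tau) (s * delta 2^-1 / 2).
have k0 : 0 < k by rewrite lt_min !(mulr_gt0, invr_gt0).
have ee0 : 0 < Num.min e e2 by rewrite lt_min e0.
have : 0 <= Jcd y v.
  apply: (no_strict_descent dyv bv tau1 v0 ee0 k0).
  have := hYV _ tau1; have := hYV _ h2; move: h3; rewrite /ae_on.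
  apply: filterS3 => t k3 k2 k1 [[It gt]]; rewrite /= in_itv/= => /andP[tt t1].
  have ge : acta e t by split=> //; apply: le_trans gt; rewrite lerN2 ge_min lexx.
  have ge2 : acta e2 t by split=> //; apply: le_trans gt; rewrite lerN2 ge_min lexx orbT.
  have [tb|tb] := leP t 2^-1.
    have i1 : (acta e2 `&` [set` `]tau, 2^-1]]) t by split => //; rewrite /= in_itv/= tt.
    have i2 : (acta e `&` [set` `[tau, 1]]) t by split => //; rewrite /= in_itv/= ltW.
    apply: le_trans (k3 i1) _; apply: le_trans (k1 i2) _.
    by rewrite lerN2 ge_min lexx.
  have i2 : (acta e `&` [set` `[2^-1, 1]]) t by split => //; rewrite /= in_itv/= ltW.
  apply: le_trans (h4 _ It tt tb) _.
  have : e3 <= s * delta 2^-1 / 2 by rewrite ge_min lexx orbT.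
  have : k <= s * delta 2^-1 / 2 by rewrite ge_min lexx orbT.
  have := k2 i2; lra.
move=> /le_trans/(_ h5)/le_trans; apply; rewrite lerD2l ge_min lexx//.
Qed.

(** A multiple [s] of the strictly feasible direction creates the margin [s * delta eta] on every
    [[eta,1]]; [s] is taken so small that the cost changes by at most [e1]. *)
Lemma no_descent Y V (e : R) : dir Y V -> 0 < e ->
  ae_on (acta e) (fun t => w Y V t <= 0) -> 0 <= Jcd Y V.
Proof.
move=> dYV e0 hYV; apply/ler_addgt0Pr => e1 e10.
pose s := e1 / (1 + `|Jcd yh vh|).
have N0 : 0 < 1 + `|Jcd yh vh| by rewrite ltr_pwDl.
have s0 : 0 < s by rewrite divr_gt0.
have dZ := directionZ hA hB K00 s dirh.
have dS := directionD hA hB K00 dYV dZ.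
have ee0 : 0 < Num.min e eh by rewrite lt_min e0.
have : 0 <= Jcd (fun t => Y t + s *: yh t) (fun t => V t + s *: vh t).
  apply: (no_descent_aux dS ee0 s0) => eta eta1.
  have [_ h1] := wh_lt0 eta1.
  move: h1 hYV; rewrite /ae_on; apply: filterS2 => t h1 h2 [[It gt] ht].
  rewrite lformD lformZ.
  have g1 : acta e t by split=> //; apply: le_trans gt; rewrite lerN2 ge_min lexx.
  have g2 : acta eh t by split=> //; apply: le_trans gt; rewrite lerN2 ge_min lexx orbT.
  have := h2 g1; have := ler_wpM2l (ltW s0) (h1 (conj g2 ht)); lra.
rewrite (JD hc hd K00 dYV dZ) (JZ hc hd K00 s dirh) => /le_trans; apply.
rewrite lerD2l; apply: (@le_trans _ _ (s * (1 + `|Jcd yh vh|))).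
  by rewrite ler_pM2l//; have := ler_norm (Jcd yh vh); lra.
by rewrite /s divfK// gt_eqF.
Qed.

(** Bounded everywhere rather than essentially: no quotient is formed, and functions equal almost
    everywhere are identified only by monotone functionals. *)
Definition bmeas (k : R -> R) : Prop := meas k /\ exists M, forall t, `|k t| <= M.

Lemma bmeasD k k' : bmeas k -> bmeas k' -> bmeas (fun t => k t + k' t).
Proof.
move=> [mk [M hM]] [mk' [M' hM']]; split; first exact: measD.
by exists (M + M') => t; apply: le_trans (ler_normD _ _) _; exact: lerD.
Qed.

Lemma bmeasZ s k : bmeas k -> bmeas (fun t => s * k t).
Proof.
move=> [mk [M hM]]; split; first exact: measZ.
by exists (`|s| * M) => t; rewrite normrM ler_wpM2l.
Qed.

Lemma bmeas_cst s : bmeas (fun=> s).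
Proof. by split; [exact: meas_cst|exists `|s|]. Qed.

Lemma bmeasM k k' : bmeas k -> bmeas k' -> bmeas (fun t => k t * k' t).
Proof.
move=> [mk [M hM]] [mk' [M' hM']]; split; first exact: measM.
by exists (M * M') => t; rewrite normrM ler_pM.
Qed.

Lemma bmeas_indic D : mset D -> bmeas (\1_D).
Proof.
move=> mD; split; first exact: meas_indic.
by exists 1 => t; rewrite indicE; case: (_ \in _); rewrite ?normr1// normr0.
Qed.

(** The level [e] is quantified existentially, so a demand is only tested on arbitrarily thin
    neighbourhoods of the active set. This is what forces the multiplier to live on [act e] for
    every [e]. *)
Let feas (k : R -> R) (r : R) : Prop := exists y v e,
  [/\ dir y v, 0 < e, ae_on (acta e) (fun t => w y v t <= - k t) & Jcd y v <= r].

Let feasD k k' r r' : feas k r -> feas k' r' -> feas (fun t => k t + k' t) (r + r').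
Proof.
move=> [y [v [e [dyv e0 h1 h2]]]] [y' [v' [e' [dyv' e0' h1' h2']]]].
exists (fun t => y t + y' t), (fun t => v t + v' t), (Num.min e e'); split.
- exact: (directionD hA hB K00 dyv dyv').
- by rewrite lt_min e0.
- move: h1 h1'; rewrite /ae_on; apply: filterS2 => t k1 k2 [It gt].
  have g1 : acta e t by split=> //; apply: le_trans gt; rewrite lerN2 ge_min lexx.
  have g2 : acta e' t by split=> //; apply: le_trans gt; rewrite lerN2 ge_min lexx orbT.
  by rewrite lformD; have := k1 g1; have := k2 g2; lra.
- by rewrite (JD hc hd K00 dyv dyv') lerD.
Qed.

Let feasZ s k r : 0 <= s -> feas k r -> feas (fun t => s * k t) (s * r).
Proof.
move=> s0 [y [v [e [dyv e0 h1 h2]]]].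
exists (fun t => s *: y t), (fun t => s *: v t), e; split => //.
- exact: (directionZ hA hB K00 s dyv).
- by apply: ae_on_filter h1 => t _ h; rewrite lformZ -mulrN ler_wpM2l.
- by rewrite (JZ hc hd K00 s dyv) ler_wpM2l.
Qed.

Let feas_le k k' r r' e : feas k r -> 0 < e -> ae_on (acta e) (fun t => k' t <= k t) ->
  r <= r' -> feas k' r'.
Proof.
move=> [y [v [e1 [dyv e10 h1 h2]]]] e0 kk rr; exists y, v, (Num.min e e1); split => //.
- by rewrite lt_min e0.
- move: h1 kk; rewrite /ae_on; apply: filterS2 => t k1 k2 [It gt].
  have g1 : acta e t by split=> //; apply: le_trans gt; rewrite lerN2 ge_min lexx.
  have g2 : acta e1 t by split=> //; apply: le_trans gt; rewrite lerN2 ge_min lexx orbT.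
  by have := k1 g2; have := k2 g1; lra.
- exact: le_trans h2 rr.
Qed.

Let feas_nonneg k r e : feas k r -> 0 < e -> ae_on (acta e) (fun t => 0 <= k t) -> 0 <= r.
Proof.
move=> hk e0 k0; have [y [v [e1 [dyv e10 h1 h2]]]] := feas_le hk e0 k0 (lexx r).
apply: le_trans h2; apply: (no_descent dyv e10).
by apply: ae_on_filter h1 => t _; rewrite oppr0.
Qed.

Let Jh := Jcd yh vh.

(** After [bb] the feedback direction may raise the constraint by as much as [N * q]. Adding
    [N * q / delta bb] times the strictly feasible direction absorbs this, at a cost again
    proportional to [q]. *)
Let feas_dominated bb : 0 < bb < 1 -> exists N rho, [/\ 0 <= N, meas rho, L1 rho,
  (forall t, 0 <= rho t) & forall k M, meas k -> (forall t, 0 <= k t <= M) ->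
  feas (fun t => k t * \1_[set` `]-oo, bb]] t) (N * ig I01 (fun t => rho t * k t))].
Proof.
move=> hbb; have [e [ch [rho [e0 hf]]]] := has_feedback hbb.
have [W [C hW]] := feedback_weight hf.
have [N N0 hN] := domination hA hB ha hb hc hd K00 hf hW.
have rho0 t : 0 <= rho t by exact: le_trans (nrm_ge0 _) (fb_bound hf t).
have [dl0 hdl] := wh_lt0 hbb.
exists (N * (1 + `|Jh| / delta bb)), rho; split => //.
- by rewrite mulr_ge0// addr_ge0// divr_ge0// ltW.
- exact: fb_rho hf.
- exact: fb_L1 hf.
move=> k M mk kM; have [y [v [dyv h1 h2 h3]]] := hN k M mk kM.
pose q := ig I01 (fun t => rho t * k t).
have q0 : 0 <= q by apply: ig_ge0 => t _; rewrite mulr_ge0//; have /andP[] := kM t.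
pose s := N * q / delta bb.
have s0 : 0 <= s by rewrite divr_ge0 ?mulr_ge0// ltW.
have dZ := directionZ hA hB K00 s dirh.
exists (fun t => y t + s *: yh t), (fun t => v t + s *: vh t), (Num.min e eh); split.
- exact: (directionD hA hB K00 dyv dZ).
- by rewrite lt_min e0.
- move: h1 wh_le0 hdl; rewrite /ae_on; apply: filterS3 => t k1 k2 k3 [It gt].
  have g1 : acta e t by split=> //; apply: le_trans gt; rewrite lerN2 ge_min lexx.
  have g2 : acta eh t by split=> //; apply: le_trans gt; rewrite lerN2 ge_min lexx orbT.
  rewrite lformD lformZ indicE; have [tb|tb] := leP t bb.
    rewrite mem_set/= ?in_itv//= mulr1.
    have := k1 (conj g1 (_ : [set` `]-oo, bb]] t)); rewrite /= in_itv/= => /(_ tb).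
    by have := ler_wpM2l s0 (k2 g2); lra.
  rewrite memNset/= ?in_itv/=; last by apply/negP; rewrite -ltNge.
  rewrite mulr0 oppr0.
  have i3 : (acta eh `&` [set` `[bb, 1]]) t.
    split => //; move: It; rewrite /I01 /= !in_itv/= => /andP[_ ->]; by rewrite ltW.
  have := ler_wpM2l s0 (k3 i3); have := h2 _ It tb.
  have : s * delta bb = N * q by rewrite /s divfK// gt_eqF.
  by rewrite -/q; lra.
- rewrite (JD hc hd K00 dyv dZ) (JZ hc hd K00 s dirh) -/q -/Jh.
  have h4 : s * Jh <= s * `|Jh| by rewrite ler_wpM2l// ler_norm.
  apply: le_trans (lerD h3 h4) _; rewrite -/q /s.
  by rewrite le_eqVlt; apply/orP; left; apply/eqP; ring.
Qed.

(** This makes the value function finite from above: a constant demand is met by the feedback up to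
    1/2 and by a multiple of the strictly feasible direction after 1/2. *)
Let feas_bounded k : bmeas k -> exists r, feas k r.
Proof.
move=> [mk [M kM]]; have h2 := half01.
have M0 : 0 <= M by exact: le_trans (normr_ge0 _) (kM 0).
have [N [rho [_ _ _ _ hN]]] := feas_dominated h2.
have MM (t : R) : 0 <= M <= M by rewrite M0 lexx.
have h1 := hN (fun _ => M) M (meas_cst M) MM.
have [dl0 hdl] := wh_lt0 h2.
have fh : feas (fun t => delta 2^-1 * \1_[set` `]2^-1, +oo[] t) Jh.
  exists yh, vh, eh; split => //.
  move: wh_le0 hdl; rewrite /ae_on; apply: filterS2 => t k1 k2 gt.
  rewrite indicE; have [tb|tb] := leP t 2^-1.
    by rewrite memNset/= ?in_itv/= ?mulr0 ?oppr0 ?k1//; apply/negP; rewrite andbT -leNgt.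
  rewrite mem_set/= ?in_itv/= ?tb// mulr1 k2//; split => //.
  by case: gt; rewrite /I01 /= !in_itv/= => /andP[_ ->] _; rewrite ltW.
exists (N * ig I01 (fun t => rho t * M) + M / delta 2^-1 * Jh).
have fM := feasD h1 (feasZ (divr_ge0 M0 (ltW dl0)) fh).
apply: (feas_le fM ltr01) => //.
apply: ae_onT => t _; apply: le_trans (ler_norm _) _; apply: le_trans (kM t) _.
rewrite mulrA divfK ?gt_eqF// !indicE; have [tb|tb] := leP t 2^-1.
  by rewrite mem_set/= ?in_itv//= mulr1 lerDl mulr_ge0.
have -> : t \in [set` `]2^-1, +oo[] by apply: mem_set; rewrite /= in_itv/= tb.
by rewrite mulr1 lerDr mulr_ge0.
Qed.

(** Every property comes from one rule: [mu k <= r] as soon as [r] is attainable for [k]. For the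
    identity, a direction and its opposite meet the demands [- w] and [w] exactly, at the costs [J]
    and [- J]; this gives both inequalities. *)
Theorem multiplier_functional : exists mu : (R -> R) -> R, [/\
  forall k k', bmeas k -> bmeas k' -> mu (fun t => k t + k' t) = mu k + mu k',
  forall s k, bmeas k -> mu (fun t => s * k t) = s * mu k,
  forall k e, bmeas k -> 0 < e -> ae_on (acta e) (fun t => k t <= 0) -> mu k <= 0,
  forall bb, 0 < bb < 1 -> exists N rho, [/\ 0 <= N, meas rho, L1 rho,
    forall t, 0 <= rho t & forall k, bmeas k -> (forall t, 0 <= k t) ->
    (forall t, bb < t -> k t = 0) -> mu k <= N * ig I01 (fun t => rho t * k t)] &
  forall y v, dir y v -> bmeas (w y v) -> Jcd y v + mu (w y v) = 0].
Proof.
pose p (k : R -> R^o) : R := inf [set r | feas k r].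
have hp k : bmeas k -> has_inf [set r | feas k r].
  move=> hk; split; first exact: feas_bounded.
  (* A bound attainable for [- k] limits those for [k] from below: their sum meets the zero demand
     and is therefore nonnegative. *)
  have [r' hr'] := feas_bounded (bmeasZ (-1) hk).
  exists (- r') => r hr; rewrite -subr_ge0 opprK.
  apply: (feas_nonneg (feasD hr hr') ltr01).
  by apply: ae_onT => t _; rewrite mulN1r subrr.
have p_le k r : bmeas k -> feas k r -> p k <= r.
  by move=> hk hr; apply: ge_inf => //; case: (hp _ hk).
have p_sub : sublinear_on bmeas p.
  split=> [k k' hk hk'|s k s0 hk].
    rewrite -lerBlDr; apply: lb_le_inf; first by case: (hp _ hk).
    move=> r hr; rewrite lerBlDr -lerBlDl; apply: lb_le_inf; first by case: (hp _ hk').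
    move=> r' hr'; rewrite lerBlDl; apply: p_le; first exact: bmeasD.
    exact: feasD.
  rewrite -ler_pdivrMl//; apply: lb_le_inf; first by case: (hp _ hk).
  move=> r hr; rewrite ler_pdivrMl//; apply: p_le; first exact: bmeasZ.
  by apply: feasZ => //; exact: ltW.
have [f [fD fZ fp]] := @Hahn_Banach R (R -> R^o) bmeas bmeasD bmeasZ (bmeas_cst 0) p p_sub.
have f_le k r : bmeas k -> feas k r -> f k <= r.
  by move=> hk hr; exact: le_trans (fp _ hk) (p_le _ _ hk hr).
have f0 : feas (fun=> 0) 0.
  exists (fun t => 0 *: yh t), (fun t => 0 *: vh t), 1; split => //.
  - exact: (directionZ hA hB K00 0 dirh).
  - by apply: ae_onT => t _; rewrite lformZ mul0r oppr0.
  - by rewrite (JZ hc hd K00 0 dirh) mul0r.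
exists f; split.
- exact: fD.
- exact: fZ.
- move=> k e hk e0 k0; apply: f_le => //; exact: feas_le f0 e0 k0 (lexx 0).
- move=> bb hbb; have [N [rho [N0 mrho hrho rho0 h]]] := feas_dominated hbb.
  exists N, rho; split => // k hk k0 koff; apply: f_le => //.
  have [mk [M kM]] := hk.
  have kM' t : 0 <= k t <= M by rewrite k0/=; exact: le_trans (ler_norm _) (kM t).
  apply: (feas_le (h k M mk kM') ltr01) => //; apply: ae_onT => t _.
  rewrite indicE; have [tb|tb] := leP t bb; last by rewrite koff// mul0r.
  by rewrite mem_set/= ?in_itv//= mulr1.
- move=> y v dyv hw; apply/eqP; rewrite eq_le; apply/andP; split; last first.
    have dN := directionZ hA hB K00 (-1) dyv.
    have h1 : feas (fun t => -1 * w y v t) (Jcd y v).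
      by exists y, v, 1; split => //; apply: ae_onT => t _; rewrite mulN1r opprK.
    have := f_le _ _ (bmeasZ (-1) hw) h1.
    by have := fZ (-1) _ hw; rewrite /GRing.scale/= => ->; lra.
  have h1 : feas (w y v) (- Jcd y v).
    exists (fun t => -1 *: y t), (fun t => -1 *: v t), 1; split => //.
    - exact: (directionZ hA hB K00 (-1) dyv).
    - by apply: ae_onT => t _; rewrite lformZ mulN1r.
    - by rewrite (JZ hc hd K00 (-1) dyv) mulN1r.
  by have := f_le _ _ hw h1; lra.
Qed.

End MultiplierFunctional.

(** * Decomposition of the multiplier *)

Section PositiveFunctionals.
Context {R : realType}.

Definition linear_on_bmeas (F : (R -> R) -> R) : Prop :=
  (forall k k', bmeas k -> bmeas k' -> F (fun t => k t + k' t) = F k + F k') /\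
  (forall s k, bmeas k -> F (fun t => s * k t) = s * F k).

(** Rounds [k + c] down to a multiple of [1 / (N + 1)], the shift [c] making it nonnegative. The
    layer-cake form, a sum over indicators of superlevel sets, lets a linear functional be evaluated
    term by term. *)
Definition step_approx (k : R -> R) (c : R) (N L : nat) (t : R) : R :=
  \sum_(i < L) (N.+1%:R^-1 * \1_[set s | i.+1%:R <= N.+1%:R * (k s + c)] t) - c.

Lemma mset_level k (c d e : R) : meas k -> mset [set s | e <= d * (k s + c)].
Proof.
move=> mk; apply: mset_le; first exact: meas_cst.
by apply: measZ; apply: measD => //; exact: meas_cst.
Qed.

Lemma step_approxP k (c M : R) N : (forall t, 0 <= k t + c <= M) -> exists L, forall t,
  step_approx k c N L t <= k t <= step_approx k c N L t + N.+1%:R^-1.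
Proof.
(* That many levels reach the top of the range, so the sum counts every level below [k t + c]. *)
move=> kM; exists (Num.truncn (N.+1%:R * M)) => t.
pose f := N.+1%:R * (k t + c).
have /andP[f0 f1] : 0 <= f <= N.+1%:R * M.
  by have /andP[h1 h2] := kM t; rewrite mulr_ge0 ?ler_pM2l.
have h i : \1_[set s | i.+1%:R <= N.+1%:R * (k s + c)] t = (i < Num.truncn f)%N%:R :> R.
  rewrite indicE truncn_gt_nat; congr (nat_of_bool _)%:R.
  by apply/idP/idP => [/set_mem|?]; [|apply: mem_set].
rewrite /step_approx; under eq_bigr do rewrite h.
rewrite -mulr_sumr -natr_sum.
have -> : (\sum_(i < Num.truncn (N.+1%:R * M)) (i < Num.truncn f) = Num.truncn f)%N.
  rewrite (eq_bigr (fun i : 'I_ _ => if (i < Num.truncn f)%N then 1%N else 0%N)); last first.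
    by move=> i _; case: ltnP.
  by rewrite -big_mkcond /= (big_ord_narrow (le_truncn f1)) sum1_card card_ord.
have N0 : 0 < N.+1%:R :> R by [].
have /andP[t1 t2] := truncn_itv f0.
have e : k t = N.+1%:R^-1 * f - c by rewrite /f mulrA mulVf ?mul1r ?addrK// gt_eqF.
rewrite e lerD2r ler_pM2l ?invr_gt0// t1/= addrAC lerD2r.
rewrite -[X in _ + X]mulr1 -mulrDr ler_pM2l ?invr_gt0//.
by rewrite natr1 ltW.
Qed.

Lemma linear_on0 F : linear_on_bmeas F -> F (fun=> 0) = 0.
Proof.
move=> [_ FZ]; have h := FZ 0 _ (bmeas_cst 0); rewrite [RHS]mul0r in h; rewrite -[RHS]h.
by congr F; apply/funext => t; rewrite mul0r.
Qed.

Lemma linear_onB F k k' : linear_on_bmeas F -> bmeas k -> bmeas k' ->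
  bmeas (fun t => k t - k' t) /\ F (fun t => k t - k' t) = F k - F k'.
Proof.
move=> [FD FZ] hk hk'; have hN := bmeasZ (-1) hk'.
have e : (fun t => k t - k' t) = (fun t => k t + -1 * k' t).
  by apply/funext => t; rewrite mulN1r.
by rewrite e FD// FZ// mulN1r; split => //; exact: bmeasD.
Qed.

Lemma linear_on_sum F (I : Type) (s : seq I) (h : I -> R -> R) : linear_on_bmeas F ->
  (forall i, bmeas (h i)) ->
  bmeas (fun t => \sum_(i <- s) h i t) /\
  F (fun t => \sum_(i <- s) h i t) = \sum_(i <- s) F (h i).
Proof.
move=> hF hh; have [FD FZ] := hF; elim: s => [|i s [ih1 ih2]].
  have e : (fun t => \sum_(i <- [::]) h i t) = (fun=> 0 : R) by apply/funext => t; rewrite big_nil.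
  by rewrite e big_nil linear_on0//; split => //; exact: bmeas_cst.
have e : (fun t => \sum_(i0 <- i :: s) h i0 t) = (fun t => h i t + \sum_(i0 <- s) h i0 t).
  by apply/funext => t; rewrite big_cons.
by rewrite e big_cons FD// ih2; split => //; exact: bmeasD.
Qed.

Lemma bmeas_step k c N L : meas k -> bmeas (step_approx k c N L).
Proof.
move=> mk; have lF : linear_on_bmeas (fun _ => 0 : R).
  by split=> [*|*]; rewrite ?addr0 ?mulr0.
have hb (i : 'I_L) : bmeas (fun t => N.+1%:R^-1 * \1_[set s | i.+1%:R <= N.+1%:R * (k s + c)] t).
  by apply: bmeasZ; apply: bmeas_indic; exact: mset_level.
by apply: bmeasD; [have [] := linear_on_sum (index_enum 'I_L) lF hb|exact: bmeas_cst].
Qed.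

(** A step function lies below [k] within [1 / (N + 1)]. It is a nonnegative combination of
    indicators, and the sup norm bound makes the error in [F] at most [C / (N + 1)]. *)
Lemma nonneg_ext F C : linear_on_bmeas F ->
  (forall k M, bmeas k -> (forall t, `|k t| <= M) -> `|F k| <= C * M) ->
  (forall A, mset A -> 0 <= F (\1_A)) ->
  forall k, bmeas k -> (forall t, 0 <= k t) -> 0 <= F k.
Proof.
move=> hF FC F1 k hk k0; have [FD FZ] := hF.
have [mk [M kM]] := hk.
have C0 : 0 <= C.
  have h1 (t : R) : `|1 : R| <= 1 by rewrite normr1.
  by have := le_trans (normr_ge0 _) (FC _ 1 (bmeas_cst 1) h1); rewrite mulr1.
have kM' t : 0 <= k t + 0 <= M.
  by rewrite addr0 k0/=; exact: le_trans (ler_norm _) (kM t).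
apply/ler_addgt0Pr => e e0.
pose N := Num.truncn (C / e).
have hN : C * N.+1%:R^-1 <= e.
  rewrite ler_pdivrMr// mulrC -ler_pdivrMr//.
  by apply/ltW/truncnS_gt.
have [L hL] := step_approxP N kM'.
have hs := bmeas_step 0 N L mk.
have Fs : 0 <= F (step_approx k 0 N L).
  have hb (i : 'I_L) : bmeas (fun t => N.+1%:R^-1 * \1_[set s | i.+1%:R <= N.+1%:R * (k s + 0)] t).
    by apply: bmeasZ; apply: bmeas_indic; exact: mset_level.
  have [_] := linear_on_sum (index_enum 'I_L) hF hb.
  have -> : (fun t => \sum_(i <- index_enum 'I_L) N.+1%:R^-1 *
       \1_[set s | i.+1%:R <= N.+1%:R * (k s + 0)] t) = step_approx k 0 N L.
    by apply/funext => t; rewrite /step_approx subr0.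
  move=> ->; apply: sumr_ge0 => i _; rewrite FZ ?mulr_ge0 ?F1//; first exact: mset_level.
  by apply: bmeas_indic; exact: mset_level.
have [hd ed] := linear_onB hF hk hs.
have := FC _ N.+1%:R^-1 hd.
rewrite ed => /(_ _)/le_trans/(_ hN) h.
have : `|F k - F (step_approx k 0 N L)| <= e.
  apply: h => t; have /andP[h1 h2] := hL t; by rewrite ger0_norm ?subr_ge0// lerBlDl.
rewrite ler_norml => /andP[h1 _]; lra.
Qed.

(** Both [F] and its opposite are nonnegative on nonnegative functions; adding a constant brings any
    bounded function to that case. *)
Lemma eq0_ext F C : linear_on_bmeas F ->
  (forall k M, bmeas k -> (forall t, `|k t| <= M) -> `|F k| <= C * M) ->
  (forall A, mset A -> F (\1_A) = 0) ->
  forall k, bmeas k -> F k = 0.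
Proof.
move=> hF FC F1 k hk; have [FD FZ] := hF.
have h0 k' : bmeas k' -> (forall t, 0 <= k' t) -> F k' = 0.
  move=> hk' k0; apply/eqP; rewrite eq_le; apply/andP; split; last first.
    by apply: (nonneg_ext hF FC) => // A mA; rewrite F1.
  rewrite -oppr_ge0; apply: (@nonneg_ext (fun k => - F k) C) => //.
  - by split=> [k1 k2 ? ?|s k1 ?]; rewrite ?FD ?FZ// ?opprD// mulrN.
  - by move=> *; rewrite normrN FC.
  - by move=> A mA; rewrite F1// oppr0.
have [mk [M kM]] := hk.
have hM := bmeas_cst M.
have M0 : 0 <= M by exact: le_trans (normr_ge0 _) (kM 0).
have := h0 _ (bmeasD hk hM); rewrite FD// [F (fun=> M)]h0// addr0; apply=> t.
by have := kM t; rewrite ler_norml => /andP[+ _]; lra.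
Qed.

(** The Radon-Nikodym theorem for a set function that becomes a measure only through the hypotheses;
    finiteness makes the density real valued. *)
Lemma finite_density (f : set (lebT R) -> \bar R) : f set0 = 0%E ->
  (forall A, 0 <= f A)%E -> measure_function.semi_sigma_additive f ->
  (f setT < +oo)%E ->
  (forall A, measurable A -> @Leb R A = 0%E -> f A = 0%E) ->
  exists z : R -> R, [/\ meas z, L1 z, forall t, 0 <= z t &
    forall A, mset A -> A `<=` I01 -> f A = (ig A z)%:E].
Proof.
move=> f0 fge fs fT fac.
pose M := isMeasure.Build _ _ _ f f0 fge fs.
pose nu0 : {measure set (lebT R) -> \bar R} := HB.pack f M.
have fin0 : measure_function.fin_num_fun nu0.
  move=> A mA; rewrite ge0_fin_numE//; apply: le_lt_trans fT.
  by apply: (le_measure nu0); rewrite ?inE.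
pose F := Measure_isFinite.Build _ _ _ nu0 fin0.
pose nu : {finite_measure set (lebT R) -> \bar R} := HB.pack (Measure.sort nu0) F.
have [A nA B mB BA|g [g0 gfin gi gE]] := @radon_nikodym_sigma_finite _ (lebT R) R (@Leb R) nu.
  by apply: fac => //; exact: nA.
have mg : meas (fine \o g).
  by apply: measurableT_comp => //; case/integrableP: gi.
have hz D : measurable D -> (@Leb R).-integrable D (fun t : lebT R => (fine (g t))%:E).
  move=> mD; apply: (@eq_integrable _ _ _ (@Leb R) D mD g); first by move=> t _; rewrite fineK.
  by apply: integrableS gi.
exists (fine \o g); split => //.
- by apply: hz; exact: mset_I01.
- by move=> t /=; rewrite fine_ge0.
- move=> A mA AI; rewrite /ig /Rintegral fineK; last first.
    by apply: integrable_fin_num => //; exact: hz.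
  by rewrite -[LHS]/(nu A) gE//; apply: eq_integral => t _ /=; rewrite fineK.
Qed.

Section Decomposition.
Variable mu : (R -> R) -> R.
Hypotheses (mu_lin : linear_on_bmeas mu)
  (mu_le0 : forall k, bmeas k -> ae_on I01 (fun t => k t <= 0) -> mu k <= 0)
  (mu_dom : forall bb, 0 < bb < 1 -> exists N rho, [/\ 0 <= N, meas rho, L1 rho,
    forall t, 0 <= rho t & forall k, bmeas k -> (forall t, 0 <= k t) ->
    (forall t, bb < t -> k t = 0) -> mu k <= N * ig I01 (fun t => rho t * k t)]).

Lemma mu_mono k k' : bmeas k -> bmeas k' -> ae_on I01 (fun t => k t <= k' t) -> mu k <= mu k'.
Proof.
move=> hk hk' kk; have [hB eB] := linear_onB mu_lin hk hk'.
rewrite -subr_le0 -eB; apply: mu_le0 => //.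
by apply: ae_on_filter kk => t _; rewrite subr_le0.
Qed.

Lemma mu_ge0 k : bmeas k -> ae_on I01 (fun t => 0 <= k t) -> 0 <= mu k.
Proof. by move=> hk k0; rewrite -(linear_on0 mu_lin) mu_mono//; exact: bmeas_cst. Qed.

Lemma mu_bound k M : bmeas k -> (forall t, `|k t| <= M) -> `|mu k| <= mu (fun=> 1) * M.
Proof.
move=> hk kM; have [muD muZ] := mu_lin.
have e : mu (fun=> M) = mu (fun=> 1) * M.
  rewrite mulrC -muZ; last exact: bmeas_cst.
  by congr mu; apply/funext => t; rewrite mulr1.
have e' : mu (fun=> - M) = - (mu (fun=> 1) * M).
  rewrite -e -[RHS]mulN1r -muZ; last exact: bmeas_cst.
  by congr mu; apply/funext => t; rewrite mulN1r.
rewrite ler_norml -e' -e; apply/andP; split.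
  by apply: mu_mono => //; [exact: bmeas_cst|apply: ae_onT => t _; have := kM t; rewrite ler_norml => /andP[]].
by apply: mu_mono => //; [exact: bmeas_cst|apply: ae_onT => t _; exact: le_trans (ler_norm _) (kM t)].
Qed.

(** The index [j.+2] keeps the endpoint strictly between 0 and 1, where domination is available. *)
Let B (j : nat) : set R := [set` `]-oo, 1 - j.+2%:R^-1]].
Let m (A : set R) : R := mu (\1_A).

Let mB j : mset (B j). Proof. exact: mset_itv. Qed.

Let m_ge0 A : mset A -> 0 <= m A.
Proof.
move=> mA; apply: mu_ge0; first exact: bmeas_indic.
by apply: ae_onT => t _; rewrite indicE ler0n.
Qed.

Let m_le A D : mset A -> mset D -> A `<=` D -> m A <= m D.
Proof.
move=> mA mD AD; apply: mu_mono; [exact: bmeas_indic|exact: bmeas_indic|].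
apply: ae_onT => t _; rewrite !indicE ler_nat.
have [At|At] := pselect (A t); last by rewrite memNset.
by rewrite !mem_set//; exact: AD.
Qed.

Let m_setU A D : mset A -> mset D -> A `&` D = set0 -> m (A `|` D) = m A + m D.
Proof.
move=> mA mD AD; rewrite /m -(mu_lin.1 _ _ (bmeas_indic mA) (bmeas_indic mD)).
congr mu; apply/funext => t; rewrite !indicE in_setU.
have [At|At] := pselect (A t); last by rewrite (memNset At)/= add0r.
have Dt : ~ D t by move=> Dt; have : (A `&` D) t by []; rewrite AD.
by rewrite (mem_set At) (memNset Dt)/= addr0.
Qed.

Let mT A : mset A -> m A <= m setT.
Proof. by move=> mA; apply: m_le => //; exact: measurableT. Qed.

Let sups (A : set R) : set R := [set m (A `&` B j) | j in setT].
(** The mass that [m] puts on [A] strictly before 1, which will turn out to be countably additive.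
    The value 0 on nonmeasurable sets is a convention making [nu] total. *)
Let nu (A : set R) : R := if `[< mset A >] then sup (sups A) else 0.

Let nuE A : mset A -> nu A = sup (sups A).
Proof. by move=> mA; rewrite /nu; case: asboolP. Qed.

Let has_sups A : mset A -> has_sup (sups A).
Proof.
move=> mA; split; first by exists (m (A `&` B 0)), 0%N.
by exists (m setT) => _ [j _ <-]; apply: mT; exact: msetI.
Qed.

Let nu_ub A j : mset A -> m (A `&` B j) <= nu A.
Proof. by move=> mA; rewrite nuE//; apply: sup_ubound; [case: (has_sups mA)|exists j]. Qed.

Let nu_le A x : mset A -> (forall j, m (A `&` B j) <= x) -> nu A <= x.
Proof.
move=> mA h; rewrite nuE//; apply: ge_sup; first by case: (has_sups mA).
by move=> _ [j _ <-].
Qed.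

Let B_sub i j : (i <= j)%N -> B i `<=` B j.
Proof.
move=> ij t; rewrite /B /= !in_itv/= => /le_trans; apply.
by rewrite lerD2l lerN2 lef_pV2 ?posrE// ler_nat.
Qed.

Let nu_ge0 A : 0 <= nu A.
Proof.
rewrite /nu; case: asboolP => // mA; rewrite -nuE//.
by apply: le_trans (nu_ub 0 mA); apply: m_ge0; exact: msetI.
Qed.

(** Since the sets [B j] increase, two almost optimal indices can be replaced by their maximum,
    which gives the superadditive half. *)
Let nu_setU A D : mset A -> mset D -> A `&` D = set0 -> nu (A `|` D) = nu A + nu D.
Proof.
move=> mA mD AD; have mAD : mset (A `|` D) by exact: measurableU.
have e j : m ((A `|` D) `&` B j) = m (A `&` B j) + m (D `&` B j).
  rewrite setIUl m_setU//; [exact: msetI|exact: msetI|].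
  by rewrite setIACA AD set0I.
apply/eqP; rewrite eq_le; apply/andP; split.
  by apply: nu_le => // j; rewrite e lerD// nu_ub.
rewrite -lerBrDr; apply: nu_le => // i; rewrite lerBrDr -lerBrDl.
apply: nu_le => // j; rewrite lerBrDl.
apply: le_trans (nu_ub (maxn i j) mAD); rewrite e; apply: lerD; apply: m_le; try exact: msetI.
  by apply: setIS; apply: B_sub; exact: leq_maxl.
by apply: setIS; apply: B_sub; exact: leq_maxr.
Qed.

Let nuB A j : mset A -> A `<=` B j -> nu A = m A.
Proof.
move=> mA AB; apply/eqP; rewrite eq_le; apply/andP; split.
  by apply: nu_le => // i; apply: m_le; [exact: msetI| |move=> t []].
by rewrite -[X in m X](setIidl AB); exact: nu_ub.
Qed.

Let nu_m A : mset A -> nu A <= m A.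
Proof. by move=> mA; apply: nu_le => // i; apply: m_le; [exact: msetI| |move=> t []]. Qed.

Let nu_mono A D : mset A -> mset D -> A `<=` D -> nu A <= nu D.
Proof.
move=> mA mD AD; apply: nu_le => // j; apply: le_trans (nu_ub j mD).
by apply: m_le; [exact: msetI|exact: msetI|exact: setSI].
Qed.

Let nu0 : nu set0 = 0.
Proof.
apply/eqP; rewrite eq_le nu_ge0 andbT; apply: le_trans (nu_m (@measurable0 _ (lebT R))) _.
by rewrite /m indic0 (linear_on0 mu_lin).
Qed.

Let bj j : 0 < (1 - j.+2%:R^-1 : R) < 1.
Proof. by rewrite subr_gt0 invf_lt1 ?ltr1n//= gerBl_lt. Qed.

(* The domination hypothesis makes [nu] continuous at the empty set. *)
Let nu_vanish (T : nat -> set R) : (forall k, mset (T k)) ->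
  (forall t, \forall k \near \oo, ~ T k t) -> (fun k => nu (T k)) @ \oo --> (0 : R).
Proof.
move=> mTk T0; apply/cvgrPdist_le => e e0.
have e20 : 0 < e / 2 by rewrite divr_gt0.
have [_ [j _ <-] hj] := sup_adherent e20 (has_sups (@measurableT _ (lebT R))).
have [N [rho [N0 mrho hrho rho0 hN]]] := mu_dom (bj j).
have hv := ig_vanish hrho mTk (fun t _ => T0 t).
have N1 : 0 < 1 + N by rewrite ltr_pwDl.
have /cvgrPdist_le/(_ _ (divr_gt0 e20 N1)) := hv.
apply: filterS => k hk; rewrite sub0r normrN ger0_norm ?nu_ge0//.
have mTB : mset (T k `&` B j) by exact: msetI.
have mTC : mset (T k `&` ~` B j) by apply: msetI => //; exact: msetC.
have -> : T k = (T k `&` B j) `|` (T k `&` ~` B j) by rewrite -setIUr setUv setIT.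
rewrite nu_setU//; last by rewrite setIACA setICr setI0.
rewrite (splitr e); apply: lerD.
  rewrite (nuB (j := j))//; apply: le_trans (hN _ (bmeas_indic mTB) _ _) _.
  - by move=> t; rewrite indicE ler0n.
  - by move=> t bt; rewrite indicE memNset// => -[_]; rewrite /B /= in_itv/= leNgt bt.
  have h1 : ig I01 (fun t => rho t * \1_(T k `&` B j) t) <= e / 2 / (1 + N).
    move: hk; rewrite sub0r normrN => /(le_trans (ler_norm _)); apply: le_trans.
    rewrite [leRHS]ig_mkcond; last by move=> t [].
    have mTI : mset (T k `&` I01) by apply: msetI => //; exact: mset_I01.
    apply: ig_le => //; first exact: mset_I01.
    + apply: (@L1_eq _ (fun t => \1_(T k `&` B j) t * rho t)); first by move=> t _; rewrite mulrC.
      apply: (L1_mulb (meas_indic mTB) mrho hrho (M := 1)) => t _.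
      by rewrite indicE; case: (_ \in _); rewrite ?normr1// normr0.
    + apply: (@L1_eq _ (fun t => \1_(T k `&` I01) t * rho t)).
        by move=> t _; rewrite patchE indicE; case: (_ \in _); rewrite ?mul1r// mul0r.
      apply: (L1_mulb (meas_indic mTI) mrho hrho (M := 1)) => t _.
      by rewrite indicE; case: (_ \in _); rewrite ?normr1// normr0.
    + move=> t It; rewrite patchE indicE !in_setI (mem_set It) andbT.
      by case: (t \in T k); case: (t \in B j); rewrite /= ?mulr1 ?mulr0.
  apply: le_trans (ler_wpM2l N0 h1) _; rewrite mulrA ler_pdivrMr// mulrC.
  by rewrite ler_pM2l// lerDr.
apply: le_trans (nu_mono mTC (msetC (mB j)) _) _; first by move=> t [].
have mTT : mset setT := @measurableT _ (lebT R).
have h := nu_setU (mB j) (msetC (mB j)) (setICr _).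
rewrite setUv (nuB (mB j) (@subset_refl _ (B j))) in h.
have : nu setT - e / 2 < m (B j) by rewrite (nuE mTT) -[B j]setTI.
by rewrite h; lra.
Qed.

Let nu_bigU (F : nat -> set R) k : (forall i, mset (F i)) -> trivIset setT F ->
  mset (\big[setU/set0]_(i < k) F i) /\ nu (\big[setU/set0]_(i < k) F i) = \sum_(0 <= i < k) nu (F i).
Proof.
move=> mF tF; elim: k => [|k [ih1 ih2]].
  by rewrite big_ord0 big_geq// nu0; split => //; exact: (@measurable0 _ (lebT R)).
rewrite big_ord_recr big_nat_recr//= nu_setU//; last first.
  rewrite -bigcup_mkord; apply/seteqP; split => t // [[i /= ik Fi] Fk].
  have e : i = k by apply: tF => //; exists t.
  by rewrite e ltnn in ik.
split; last by rewrite ih2.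
exact: (measurableU _ _ ih1 (mF k)).
Qed.

(** Finite additivity together with continuity at the empty set: every point eventually leaves the
    remainders [T k] of the union. *)
Let nu_sigma : measure_function.semi_sigma_additive (fun A : set (lebT R) => (nu A)%:E).
Proof.
move=> F mF tF mUF.
pose T k := (\bigcup_i F i) `\` (\big[setU/set0]_(i < k) F i).
have hU k := nu_bigU k mF tF.
have mTk k : mset (T k) by apply: measurableD => //; case: (hU k).
have T0 t : \forall k \near \oo, ~ T k t.
  have [[i _ Fit]|nF] := pselect ((\bigcup_i F i) t); last by apply: nearW => k [].
  exists i.+1 => // k /= ik [_]; apply.
  by rewrite -bigcup_mkord; exists i.
have hv := nu_vanish mTk T0.
have e k : \sum_(0 <= i < k) (nu (F i))%:E = (nu (\bigcup_i F i) - nu (T k))%:E.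
  have [h1 h2] := hU k; rewrite sumEFin -h2; congr EFin.
  have -> : nu (\bigcup_i F i) = nu ((\big[setU/set0]_(i < k) F i) `|` T k).
    congr nu; rewrite /T setDUK// -bigcup_mkord; apply: bigcup_sub => i _.
    exact: bigcup_sup.
  by rewrite nu_setU// ?addrK// /T setDIK.
under eq_fun do rewrite e.
apply: cvg_EFin; first exact: nearW.
rewrite -[X in _ --> X]subr0; apply: cvgB => //; exact: cvg_cst.
Qed.

(** [z] is the density of [nu] and [zh] is the remainder. It is nonnegative because [nu <= m], and
    it ignores functions vanishing after some [bb < 1] because [nu = m] on subsets of [B j]. Both
    facts are checked on indicators and extended by uniform approximation. *)
Theorem charge_decomposition : exists z zh, [/\ meas z, L1 z, forall t, 0 <= z t &
  [/\ forall k, bmeas k -> mu k = ig I01 (fun t => z t * k t) + zh k,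
    linear_on_bmeas zh,
    forall k, bmeas k -> ae_on I01 (fun t => k t <= 0) -> zh k <= 0 &
    forall bb k, bb < 1 -> bmeas k -> (forall t, bb < t -> k t = 0) -> zh k = 0]].
Proof.
have nu_fin : ((nu setT)%:E < +oo)%E by rewrite ltry.
have nu_ac (A : set (lebT R)) : measurable A -> @Leb R A = 0%E -> (nu A)%:E = 0%E.
  move=> mA A0; congr EFin; apply/eqP; rewrite eq_le nu_ge0 andbT.
  apply: le_trans (nu_m mA) _; apply: mu_le0; first exact: bmeas_indic.
  rewrite /ae_on; exists A; split => // t /=; apply: contra_notP => At _.
  by rewrite indicE memNset.
have nuE0 : (nu set0)%:E = 0%E by rewrite nu0.
have nuE_ge0 (A : set (lebT R)) : (0 <= (nu A)%:E)%E by rewrite lee_fin.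
have [z [mz hz z0 zE]] := finite_density nuE0 nuE_ge0 nu_sigma nu_fin nu_ac.
have mI : mset I01 := mset_I01.
have mI_off A : mset A -> A `<=` ~` I01 -> m A = 0.
  move=> mA AI; apply/eqP; rewrite eq_le m_ge0// andbT.
  apply: mu_le0; first exact: bmeas_indic.
  by apply: ae_onT => t It; rewrite indicE memNset// => /AI.
have zmu A : mset A -> ig I01 (fun t => z t * \1_A t) = nu A.
  move=> mA; have mAI : mset (A `&` I01) by exact: msetI.
  have mAC : mset (A `&` ~` I01) by apply: msetI => //; exact: msetC.
  have -> : nu A = nu (A `&` I01).
    have -> : nu A = nu ((A `&` I01) `|` (A `&` ~` I01)) by rewrite -setIUr setUv setIT.
    rewrite nu_setU//; last by rewrite setIACA setICr setI0.
    have -> : nu (A `&` ~` I01) = 0; last by rewrite addr0.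
    apply/eqP; rewrite eq_le nu_ge0 andbT; apply: le_trans (nu_m mAC) _.
    by rewrite mI_off// => t [].
  have [->] : (nu (A `&` I01))%:E = (ig (A `&` I01) z)%:E by apply: zE => // t [].
  rewrite [RHS]ig_mkcond; last by move=> t [].
  apply: ig_eq => t It; rewrite patchE indicE in_setI (mem_set It) andbT.
  by case: (t \in A); rewrite ?mulr1// mulr0.
have zk k : bmeas k -> L1 (fun t => z t * k t).
  move=> [mk [M kM]]; apply: (@L1_eq _ (fun t => k t * z t)); first by move=> t _; rewrite mulrC.
  by apply: (L1_mulb mk mz hz (M := M)) => t _.
pose zi k := ig I01 (fun t => z t * k t).
have zi_lin : linear_on_bmeas zi.
  split=> [k k' hk hk'|s k hk]; rewrite /zi.
    by rewrite -(ig1D (zk _ hk) (zk _ hk')); apply: ig_eq => t _; rewrite mulrDr.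
  by rewrite -(ig1Z s (zk _ hk)); apply: ig_eq => t _; rewrite mulrCA.
have [muD muZ] := mu_lin; have [ziD ziZ] := zi_lin.
have ziM k M : bmeas k -> (forall t, `|k t| <= M) -> `|zi k| <= ig I01 z * M.
  move=> hk kM; rewrite mulrC -ig1Z//; apply: ig_norm_le => //.
  - exact: zk.
  - exact: L1Z.
  - by move=> t _; rewrite normrM (ger0_norm (z0 t)) mulrC ler_wpM2r.
pose zh k := mu k - zi k.
have zh_lin : linear_on_bmeas zh.
  split=> [k k' hk hk'|s k hk]; rewrite /zh; first by rewrite muD// ziD//; ring.
  by rewrite muZ// ziZ//; ring.
pose C := mu (fun=> 1) + ig I01 z.
have zhC k M : bmeas k -> (forall t, `|k t| <= M) -> `|zh k| <= C * M.
  move=> hk kM; apply: le_trans (ler_normB _ _) _; rewrite mulrDl.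
  by apply: lerD; [exact: mu_bound|exact: ziM].
have zh_ge0 k : bmeas k -> (forall t, 0 <= k t) -> 0 <= zh k.
  apply: (nonneg_ext zh_lin zhC) => A mA.
  by rewrite /zh /zi zmu// subr_ge0 nu_m.
exists z, zh; split => //; split => //.
- by move=> k hk; rewrite /zh addrC subrK.
- move=> k hk k0; have [mk [M kM]] := hk.
  (* The positive part of [k] vanishes almost everywhere on [[0,1]]: [mu] is at most 0 on it and the
     integral at least 0, so the nonnegative [zh] is 0 on it and only minus the negative part
     counts. *)
  pose kp t := Num.max (k t) 0; pose kn t := kp t - k t.
  have hkp : bmeas kp.
    split; first by apply: meas_max => //; exact: meas_cst.
    exists M => t; apply: le_trans (kM t); rewrite /kp maxEle; case: ifP => // _.
    by rewrite normr0.
  have [hkn ekn] := linear_onB zh_lin hkp hk.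
  have h1 : zh kp = 0.
    apply/eqP; rewrite eq_le zh_ge0 ?andbT; [|by []|by move=> t; rewrite /kp le_max lexx orbT].
    rewrite /zh subr_le0; apply: (@le_trans _ _ 0).
      apply: mu_le0 => //; apply: ae_on_filter k0 => t _ kt.
      by rewrite /kp max_r.
    by apply: ig_ge0 => t _; rewrite mulr_ge0// /kp le_max lexx orbT.
  have := zh_ge0 _ hkn; rewrite ekn h1 sub0r oppr_ge0; apply => t.
  by rewrite subr_ge0 /kp le_max lexx.
- move=> bb k bb1 hk koff.
  have [j hj] : exists j, bb <= 1 - j.+2%:R^-1.
    exists (Num.truncn (1 - bb)^-1); rewrite lerBrDr -lerBrDl.
    rewrite invf_ple ?posrE ?subr_gt0//.
    by apply: le_trans (ltW (truncnS_gt _)) _; rewrite ler_nat.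
  pose F k := zh (fun t => k t * \1_(B j) t).
  have hB k' : bmeas k' -> bmeas (fun t => k' t * \1_(B j) t).
    by move=> hk'; apply: bmeasM => //; exact: bmeas_indic.
  have F_lin : linear_on_bmeas F.
    split=> [k1 k2 h1 h2|s k1 h1]; rewrite /F.
      rewrite -(zh_lin.1 _ _ (hB _ h1) (hB _ h2)).
      by congr zh; apply/funext => t; rewrite mulrDl.
    rewrite -(zh_lin.2 _ _ (hB _ h1)).
    by congr zh; apply/funext => t; rewrite mulrA.
  have FC k' M : bmeas k' -> (forall t, `|k' t| <= M) -> `|F k'| <= C * M.
    move=> hk' kM; apply: zhC => [|t]; first exact: hB.
    rewrite normrM indicE; apply: le_trans (kM t).
    by case: (_ \in _); rewrite ?normr1 ?mulr1// normr0 mulr0.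
  have -> : zh k = F k.
    congr zh; apply/funext => t; rewrite indicE.
    have [tB|tB] := pselect (B j t); first by rewrite mem_set// mulr1.
    rewrite memNset// mulr0 koff//.
    by apply: (le_lt_trans hj); move: tB => /negP; rewrite /B /= in_itv/= -ltNge.
  apply: (eq0_ext F_lin FC) => // A mA.
  have mAB : mset (A `&` B j) by exact: msetI.
  have -> : F \1_A = zh \1_(A `&` B j).
    by congr zh; apply/funext => t; rewrite !indicE in_setI -natrM mulnb.
  by rewrite /zh /zi zmu// (nuB (j := j))// subrr.
Qed.

End Decomposition.
End PositiveFunctionals.

(** * Charges induced by functionals, and their integrals *)

Section ChargeIntegral.
Context {R : realType}.
Variable zh : (R -> R) -> R.
Hypotheses (zh_lin : linear_on_bmeas zh)
  (zh_le0 : forall k, bmeas k -> ae_on I01 (fun t => k t <= 0) -> zh k <= 0).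

Let zh_mono k k' : bmeas k -> bmeas k' -> ae_on I01 (fun t => k t <= k' t) -> zh k <= zh k'.
Proof.
move=> hk hk' kk; have [hB eB] := linear_onB zh_lin hk hk'.
rewrite -subr_le0 -eB; apply: zh_le0 => //.
by apply: ae_on_filter kk => t _; rewrite subr_le0.
Qed.

Lemma zh_eq k k' : bmeas k -> bmeas k' -> ae_on I01 (fun t => k t = k' t) -> zh k = zh k'.
Proof.
move=> hk hk' kk; apply/eqP; rewrite eq_le !zh_mono//.
  by apply: ae_on_filter kk => t _ ->.
by apply: ae_on_filter kk => t _ ->.
Qed.

Lemma zh_dist k k' e : bmeas k -> bmeas k' -> ae_on I01 (fun t => `|k t - k' t| <= e) ->
  `|zh k - zh k'| <= e * zh (fun=> 1).
Proof.
move=> hk hk' kk; have he := bmeas_cst e.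
have [muD muZ] := zh_lin.
have ee : zh (fun=> e) = e * zh (fun=> 1).
  rewrite -muZ; last exact: bmeas_cst.
  by congr zh; apply/funext => t; rewrite mulr1.
rewrite ler_norml lerBlDr lerBrDr -ee; apply/andP; split.
  have [h1 h2] := linear_onB zh_lin hk' he.
  rewrite addrC -h2; apply: zh_mono => //; apply: ae_on_filter kk => t _.
  by rewrite ler_norml => /andP[+ _]; lra.
rewrite -muD//; apply: zh_mono => //; first exact: bmeasD.
by apply: ae_on_filter kk => t _; rewrite ler_norml => /andP[_]; lra.
Qed.

Definition charge_of (A : set (lebT R)) : \bar R := if `[< mset A >] then (zh (\1_A))%:E else 0%E.

Lemma charge_ofE A : mset A -> charge_of A = (zh (\1_A))%:E.
Proof. by move=> mA; rewrite /charge_of; case: asboolP. Qed.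

Let charge_of0 : charge_of set0 = 0%E.
Proof.
rewrite charge_ofE; last exact: (@measurable0 _ (lebT R)).
by rewrite indic0; congr EFin; exact: linear_on0.
Qed.

Lemma charge_of_ge0 A : (0 <= charge_of A)%E.
Proof.
rewrite /charge_of; case: asboolP => // mA; rewrite lee_fin.
rewrite -(linear_on0 zh_lin); apply: zh_mono; [exact: bmeas_cst|exact: bmeas_indic|].
by apply: ae_onT => t _; rewrite indicE ler0n.
Qed.

Lemma charge_of_fin : measure_function.fin_num_fun charge_of.
Proof. by move=> A mA; rewrite charge_ofE. Qed.

Lemma charge_of_additive : measure_function.semi_additive charge_of.
Proof.
apply/(measure_function.additive2P charge_of0) => A D mA mD AD.
have mAD : mset (A `|` D) by exact: measurableU.
rewrite !charge_ofE// -EFinD -(zh_lin.1 _ _ (bmeas_indic mA) (bmeas_indic mD)).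
congr (zh _)%:E; apply/funext => t; rewrite !indicE in_setU.
have [At|At] := pselect (A t); last by rewrite (memNset At)/= add0r.
have Dt : ~ D t by move=> Dt; have : (A `&` D) t by []; rewrite AD.
by rewrite (mem_set At) (memNset Dt)/= addr0.
Qed.

Definition zeta_charge : {additive_charge set (lebT R) -> \bar R} :=
  HB.pack charge_of (isFinite.Build _ _ _ charge_of charge_of_fin)
    (isAdditiveCharge.Build _ _ _ charge_of charge_of_additive).

Lemma zeta_chargeE A : mset A -> zeta_charge A = (zh (\1_A))%:E.
Proof. exact: charge_ofE. Qed.

Lemma bmeas_sfun (s : {sfun lebT R >-> R}) : bmeas s.
Proof.
split; first exact: measurable_funPT.
exists (\sum_(y <- finmap.enum_fset (fset_set (range s))) `|y|) => t.
rewrite (bigD1_seq (s t)) ?finmap.fset_uniq//=; first by rewrite lerDl sumr_ge0.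
by rewrite in_fset_set//; apply: mem_set; exists t.
Qed.

(** The sum over all real values reduces to the finite range of [s], the other level sets being
    empty; linearity of [zh] reassembles [s]. *)
Lemma sintegral_zeta (s : {sfun lebT R >-> R}) : sintegral zeta_charge s = (zh s)%:E.
Proof.
have -> : sintegral zeta_charge s = (\sum_(x \in range s) x%:E * zeta_charge (s @^-1` [set x]))%E.
  rewrite (fsbig_widen (range s) setT)//= => x [_ Nfx] /=.
  by rewrite preimage10// [charge_of _]charge_of0 mule0.
rewrite fsbig_finite//=.
have mlev (y : R) : mset (s @^-1` [set y]).
  by rewrite -[X in mset X]setTI; apply: (@measurable_funPT _ _ _ _ s).
have hb (y : R) : bmeas (fun t => y * \1_(s @^-1` [set y]) t).
  by apply: bmeasZ; exact: bmeas_indic.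
have [_ e] := linear_on_sum (finmap.enum_fset (fset_set (range s))) zh_lin hb.
transitivity (\sum_(y <- finmap.enum_fset (fset_set (range s))) (zh (fun t => y * \1_(s @^-1` [set y]) t))%:E)%E.
  apply: eq_bigr => y _; rewrite (charge_ofE (mlev y)) (zh_lin.2 _ _ (bmeas_indic (mlev y))).
  by rewrite EFinM.
rewrite sumEFin -e; congr (zh _)%:E; apply/funext => t.
by rewrite [RHS]fimfunE fsbig_finite.
Qed.

Lemma step_sfun k c N L : meas k -> exists s : {sfun lebT R >-> R}, s = step_approx k c N L :> (R -> R).
Proof.
move=> mk; pose f := step_approx k c N L : lebT R -> R.
have [mf _] := bmeas_step c N L mk.
have ff : finite_set (range f).
  apply: (@sub_finite_set _ _ ((fun j : nat => N.+1%:R^-1 * j%:R - c) @` `I_L.+1)).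
    move=> _ [t _ <-]; exists (\sum_(i < L) (t \in [set s | (i.+1%:R <= N.+1%:R * (k s + c))%R]))%N.
      rewrite /= ltnS -[leqRHS]card_ord -sum1_card; apply: leq_sum => i _; exact: leq_b1.
    rewrite /f /step_approx natr_sum mulr_sumr; congr (_ - c).
  by apply: finite_image; exact: finite_II.
pose M1 := isMeasurableFun.Build _ _ _ _ f mf.
pose M2 := FiniteImage.Build _ _ f ff.
pose s : {sfun lebT R >-> R} := HB.pack f M1 M2.
by exists s.
Qed.

(** The charge integral is a chosen limit, so uniqueness comes first: along any approximating simple
    functions the integrals are values of [zh], which is continuous for uniform convergence almost
    everywhere. Step functions then provide one approximating sequence. Agreement of [k] with [k']
    almost everywhere suffices, which allows coefficients cut off on null sets. *)
Lemma charge_integralE E k k' : mset E -> E `<=` I01 -> bmeas k' ->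
  ae_on I01 (fun t => k t = k' t) ->
  charge_integral zeta_charge E k = zh (fun t => k' t * \1_E t).
Proof.
move=> mE EI hk' kk'; pose h t := k' t * \1_E t.
have hh : bmeas h by apply: bmeasM => //; exact: bmeas_indic.
have kh : ae_on I01 (fun t => (k \_ E) t = h t).
  apply: ae_on_filter kk' => t _ e; rewrite patchE /h indicE -e.
  by case: (t \in E); rewrite ?mulr1// mulr0.
have uniq_c c : is_charge_integral zeta_charge E k c -> c = zh h.
  move=> [s [hs sc]].
  apply: (@cvg_unique _ (@Rhausdorff R) _ _ _ _ sc).
  apply/cvgrPdist_le => e e0.
  have z1 : 0 <= zh (fun=> 1).
    rewrite -(linear_on0 zh_lin); apply: zh_mono; [exact: bmeas_cst|exact: bmeas_cst|].
    by apply: ae_onT => t _.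
  have Q0 : 0 < 1 + zh (fun=> 1) by rewrite ltr_pwDl.
  have := hs _ (divr_gt0 e0 Q0); apply: filterS => j hj.
  rewrite sintegral_zeta /= distrC.
  apply: (@le_trans _ _ (e / (1 + zh (fun=> 1)) * zh (fun=> 1))).
    apply: zh_dist => //; first exact: bmeas_sfun.
    by move: hj kh; rewrite /ae_on; apply: filterS2 => t h1 h2 It; rewrite -h2//; exact: h1.
  rewrite mulrAC ler_pdivrMr// ler_pM2l//; lra.
apply: uniq_c; rewrite /charge_integral; apply: (@getPex _ (is_charge_integral zeta_charge E k)).
exists (zh h).
have [mh [M hM]] := hh.
have hM' t : 0 <= h t + M <= 2 * M by have := hM t; rewrite ler_norml => /andP[]; lra.
have hs N : exists s : {sfun lebT R >-> R}, forall t, `|s t - h t| <= N.+1%:R^-1.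
  have [L hL] := step_approxP N hM'.
  have [s es] := step_sfun M N L mh; exists s => t; rewrite es distrC.
  by have /andP[h1 h2] := hL t; rewrite ger0_norm ?subr_ge0// lerBlDl.
have /choice[s ss] := hs.
have small (e : R) : 0 < e -> \forall j \near \oo, j.+1%:R^-1 <= e.
  by move=> e0; near=> j; apply/ltW; near: j; exact: near_infty_natSinv_lt (PosNum e0).
have hse (e : R) : 0 < e -> \forall j \near \oo, ae_on I01 (fun t => `|s j t - h t| <= e).
  move=> e0; have := small _ e0; apply: filterS => j hj.
  by apply: ae_onT => t _; exact: le_trans (ss j t) hj.
exists s; split.
- move=> e e0; have := hse _ e0; apply: filterS => j.
  by move: kh; rewrite /ae_on; apply: filterS2 => t h2 h1 It; rewrite h2//; exact: h1.
- apply/cvgrPdist_le => e e0.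
  have z1 : 0 <= zh (fun=> 1).
    rewrite -(linear_on0 zh_lin); apply: zh_mono; [exact: bmeas_cst|exact: bmeas_cst|].
    by apply: ae_onT => t _.
  have Q0 : 0 < 1 + zh (fun=> 1) by rewrite ltr_pwDl.
  have := hse _ (divr_gt0 e0 Q0); apply: filterS => j hj.
  rewrite sintegral_zeta /= distrC.
  apply: (@le_trans _ _ (e / (1 + zh (fun=> 1)) * zh (fun=> 1))).
    by apply: zh_dist => //; exact: bmeas_sfun.
  rewrite mulrAC ler_pdivrMr// ler_pM2l//; lra.
Unshelve. all: by end_near. Qed.

End ChargeIntegral.

(** * Adjoint arc *)

Section Fubini.
Context {R : realType}.

Lemma ig_nonneg_eq0 (f : R -> R) : meas f -> L1 f -> (forall t, 0 <= f t) ->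
  ig I01 f = 0 -> ae_on I01 (fun t => f t = 0).
Proof.
move=> mf hf f0 if0.
have hfin := integrable_fin_num mset_I01 hf.
have e : (\int[@Leb R]_(x in I01) `|(f x)%:E| = 0)%E.
  under eq_integral do rewrite gee0_abs ?lee_fin//.
  by rewrite -(fineK hfin); congr EFin.
have := (ae_eq_integral_abs (@Leb R) mset_I01 _).1 e.
rewrite /ae_on => h.
have : ae_eq (@Leb R) I01 (EFin \o f) (cst 0%E).
  by apply: h; apply/measurable_EFinP; exact: measurable_funTS.
by apply: filterS => t h1 It; have /(_ It) [] := h1.
Qed.

(** Both sides integrate [f t * g s] over the triangle [t <= s] of the unit square. It serves as
    integration by parts between an arc and its adjoint. *)
Lemma ig_Fubini (f g : R -> R) : meas f -> meas g -> L1 f -> L1 g ->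
  ig I01 (fun t => f t * ig (from t) g) = ig I01 (fun s => g s * ig (upto s) f).
Proof.
move=> mf mg hf hg.
pose F t := f t * \1_I01 t; pose G t := g t * \1_I01 t.
have mI : meas (\1_(@I01 R)) by apply: meas_indic; exact: mset_I01.
have mF : meas F by exact: measM.
have mG : meas G by exact: measM.
have FI t : I01 t -> F t = f t by move=> It; rewrite /F indicE mem_set// mulr1.
have GI t : I01 t -> G t = g t by move=> It; rewrite /G indicE mem_set// mulr1.
pose h (x : lebT R * lebT R) : R := F x.1 * (G x.2 * \1_[set x : lebT R * lebT R | x.1 <= x.2 :> R] x).
have mid : @measurable_fun _ _ (lebT R) (measurableTypeR R) setT id.
  by move=> _ D mD; rewrite setTI; exact: mset_borel.
have m1 : measurable_fun setT (fun x : lebT R * lebT R => (x.1 : measurableTypeR R)).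
  exact: (measurableT_comp mid measurable_fst).
have m2 : measurable_fun setT (fun x : lebT R * lebT R => (x.2 : measurableTypeR R)).
  exact: (measurableT_comp mid measurable_snd).
have mE : measurable [set x : lebT R * lebT R | x.1 <= x.2 :> R].
  by have := @measurable_fun_le _ _ R setT _ _ measurableT m1 m2; rewrite setTI.
have mh : measurable_fun setT h.
  apply: measurable_funM; first exact: (measurableT_comp mF measurable_fst).
  apply: measurable_funM; first exact: (measurableT_comp mG measurable_snd).
  exact: measurable_indic.
have intT k D : mset D -> D `<=` I01 -> L1 k -> (@Leb R).-integrable setT (EFin \o (k \_ D)).
  move=> mD DI hk; have := L1S mD DI hk => /(integrable_mkcond _ mD).
  by rewrite restrict_EFin.
have hFT : (@Leb R).-integrable setT (EFin \o F).
  have -> : F = f \_ I01; last exact: intT mset_I01 (@subset_refl _ _) hf.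
  by apply/funext => t; rewrite /F patchE indicE; case: (_ \in _); rewrite ?mulr1// mulr0.
have hGT : (@Leb R).-integrable setT (EFin \o G).
  have -> : G = g \_ I01; last exact: intT mset_I01 (@subset_refl _ _) hg.
  by apply/funext => t; rewrite /G patchE indicE; case: (_ \in _); rewrite ?mulr1// mulr0.
have mEh : measurable_fun setT (EFin \o h) by exact/measurable_EFinP.
have hFn : (@Leb R).-integrable setT (fun x => `|F x|%:E) := integrable_norm hFT.
have hGn : (@Leb R).-integrable setT (fun x => `|G x|%:E) := integrable_norm hGT.
have h_int : ((@Leb R) \x (@Leb R))%E.-integrable setT (EFin \o h).
  apply/(integrable12ltyP (@Leb R) (@Leb R) mEh).
  pose cG := \int[@Leb R]_y `|G y|.
  have inner_le x : (\int[@Leb R]_y `|(EFin \o h) (x, y)| <= (cG * `|F x|)%:E)%E.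
    have hZ : (@Leb R).-integrable setT (fun y => (`|F x| * `|G y|)%:E).
      by have := integrableZl measurableT (`|F x|) hGn.
    have -> : (cG * `|F x|)%:E = (\int[@Leb R]_y (`|F x| * `|G y|)%:E)%E.
      rewrite -(fineK (integrable_fin_num measurableT hZ)); congr EFin.
      by rewrite mulrC -RintegralZl.
    apply: ge0_le_integral.
    - exact: measurableT.
    - by move=> y _; exact: abse_ge0.
    - apply: measurableT_comp; first exact: abse_measurable.
      apply/measurable_EFinP; exact: (measurableT_comp mh (measurable_pair1 x)).
    - by case/integrableP: hZ.
    - move=> y _ /=; rewrite lee_fin /h /= normrM ler_wpM2l// normrM indicE.
      by case: (_ \in _); rewrite ?normr1 ?mulr1// normr0 mulr0.
  have hZF : (@Leb R).-integrable setT (fun x => (cG * `|F x|)%:E).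
    by have := integrableZl measurableT cG hFn.
  apply: (@le_lt_trans _ _ (\int[@Leb R]_x (cG * `|F x|)%:E)%E).
    apply: ge0_le_integral.
    - exact: measurableT.
    - by move=> x _; apply: integral_ge0 => y _; exact: abse_ge0.
    - apply: (measurable_fun_fubini_tonelli_F (abse \o (EFin \o h))).
        by apply: measurableT_comp; [exact: abse_measurable|exact: mEh].
      by move=> y; exact: abse_ge0.
    - by case/integrableP: hZF.
    - by move=> x _; exact: inner_le.
  by have := integrable_fin_num measurableT hZF; rewrite fin_numElt => /andP[].
have innerx x : (\int[@Leb R]_y (h (x, y))%:E)%E = (F x * ig (from x) g)%:E.
  have hk := intT g (from x) (mset_from x) (fun t => @proj1 _ _) hg.
  have e y : h (x, y) = F x * (g \_ (from x)) y.
    rewrite /h /= patchE !indicE /from in_setI; congr (F x * _).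
    have -> : (y \in [set` `[x, +oo[]) = ((x, y) \in [set x : lebT R * lebT R | x.1 <= x.2 :> R]).
      by apply/idP/idP => /set_mem/=; rewrite ?in_itv/= ?andbT => ?; apply: mem_set; rewrite /= ?in_itv/= ?andbT.
    rewrite /G indicE; case: (y \in I01); case: (_ \in _); by rewrite /= ?mulr1 ?mulr0.
  under eq_integral do rewrite e.
  have hZ : (@Leb R).-integrable setT (fun y => (F x * (g \_ (from x)) y)%:E).
    by have := integrableZl measurableT (F x) hk.
  rewrite -(fineK (integrable_fin_num measurableT hZ)).
  congr EFin; rewrite -/(Rintegral (@Leb R) setT (fun y => F x * (g \_ (from x)) y)).
  by rewrite RintegralZl// -Rintegral_mkcond.
have innery y : (\int[@Leb R]_x (h (x, y))%:E)%E = (G y * ig (upto y) f)%:E.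
  have hk := intT f (upto y) (mset_upto y) (@upto_sub _ y) hf.
  have e x : h (x, y) = G y * (f \_ (upto y)) x.
    rewrite /h /= patchE !indicE /upto in_setI mulrCA; congr (G y * _).
    have -> : (x \in [set` `]-oo, y]]) = ((x, y) \in [set x : lebT R * lebT R | x.1 <= x.2 :> R]).
      by apply/idP/idP => /set_mem/=; rewrite ?in_itv/= ?andbT => ?; apply: mem_set; rewrite /= ?in_itv/= ?andbT.
    rewrite /F indicE; case: (x \in I01); case: (_ \in _); by rewrite /= ?mulr1 ?mulr0 ?mul0r.
  under eq_integral do rewrite e.
  have hZ : (@Leb R).-integrable setT (fun x => (G y * (f \_ (upto y)) x)%:E).
    by have := integrableZl measurableT (G y) hk.
  rewrite -(fineK (integrable_fin_num measurableT hZ)).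
  congr EFin; rewrite -/(Rintegral (@Leb R) setT (fun x => G y * (f \_ (upto y)) x)).
  by rewrite RintegralZl// -Rintegral_mkcond.
have := @Fubini _ _ _ _ R (@Leb R) (@Leb R) _ h_int.
under eq_integral do rewrite /= innerx.
under [in X in _ = X]eq_integral do rewrite /= innery.
move=> /(congr1 fine) e.
have e1 : ig I01 (fun t => f t * ig (from t) g) = \int[@Leb R]_x (F x * ig (from x) g).
  rewrite [LHS]Rintegral_mkcond; congr Rintegral; apply/funext => t.
  by rewrite patchE /F indicE; case: (_ \in _); rewrite ?mulr1// mulr0 mul0r.
have e2 : ig I01 (fun t => g t * ig (upto t) f) = \int[@Leb R]_x (G x * ig (upto x) f).
  rewrite [LHS]Rintegral_mkcond; congr Rintegral; apply/funext => t.
  by rewrite patchE /G indicE; case: (_ \in _); rewrite ?mulr1// mulr0 mul0r.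
by rewrite e1 e2; exact: e.
Qed.

End Fubini.

(** * Entries and transposes of bounded matrix fields *)

Section MatrixFields.
Context {R : realType}.

Lemma mulmx_delta p q (M : 'M[R]_(p, q)) i j : (M *m (delta_mx j 0 : 'cV_q)) i 0 = M i j.
Proof. by rewrite -colE mxE. Qed.

Lemma nrm_delta q (j : 'I_q) : nrm (delta_mx j 0 : 'cV[R]_q) = 1.
Proof.
rewrite /nrm (bigD1 j)//= big1 ?addr0; first by rewrite mxE !eqxx normr1.
by move=> i ij; rewrite mxE (negbTE ij) normr0.
Qed.

Lemma mxfield_entry p q (M : R -> 'M[R]_(p, q)) C i j : mxfield M C ->
  meas (fun t => M t i j) /\ forall t, `|M t i j| <= C.
Proof.
move=> [mM hM]; split.
  have := mM _ (vmeas_cst (delta_mx j 0)) i.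
  by under eq_fun do rewrite mulmx_delta.
move=> t; have := ler_nrm (M t *m delta_mx j 0) i; rewrite mulmx_delta => /le_trans; apply.
by have := hM t (delta_mx j 0); rewrite nrm_delta mulr1.
Qed.

Lemma bmeas_entry p q (M : R -> 'M[R]_(p, q)) C i j : mxfield M C -> bmeas (fun t => M t i j).
Proof. by move=> /mxfield_entry-/(_ i j)[? ?]; split => //; exists C. Qed.

Lemma mxfield_of_entries p q (M : R -> 'M[R]_(p, q)) C : 0 <= C ->
  (forall i j, meas (fun t => M t i j)) -> (forall t i j, `|M t i j| <= C) ->
  mxfield M (p%:R * C).
Proof.
move=> C0 mM hM; split=> [x mx i|t x].
  under eq_fun do rewrite mxE.
  by apply: meas_sum => j; apply: measM; [exact: mM|exact: mx].
rewrite /nrm -mulrA mulr_natl -[in leRHS](card_ord p) -sumr_const; apply: ler_sum => i _.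
rewrite mxE; apply: le_trans (ler_norm_sum _ _ _) _; rewrite mulr_sumr.
by apply: ler_sum => j _; rewrite normrM ler_wpM2r// hM.
Qed.

Lemma mxfield_tr p q (M : R -> 'M[R]_(p, q)) C : 0 <= C -> mxfield M C ->
  mxfield (fun t => (M t)^T) (q%:R * C).
Proof.
move=> C0 hM; apply: mxfield_of_entries => // [i j|t i j].
  by under eq_fun do rewrite mxE; case: (mxfield_entry j i hM).
by rewrite mxE; case: (mxfield_entry j i hM).
Qed.

Lemma mxfield_row_tr q (M : R -> 'rV[R]_q) C : mxfield M C ->
  vmeas (fun t => (M t)^T) /\ forall t, nrm (M t)^T <= q%:R * C.
Proof.
move=> hM; split=> [i|t].
  by under eq_fun do rewrite mxE; case: (mxfield_entry 0 i hM).
rewrite /nrm mulr_natl -[in leRHS](card_ord q) -sumr_const; apply: ler_sum => i _.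
by rewrite mxE; case: (mxfield_entry 0 i hM).
Qed.

End MatrixFields.

(** * Stationarity of the charge part *)

Section Adjoint.
Context {R : realType} {n m : nat}.
Variables (A : R -> 'M[R]_(n, n)) (B : R -> 'M[R]_(n, m)).
Variables (a c : R -> 'rV[R]_n) (b d : R -> 'rV[R]_m) (K0 : R).
Hypotheses (hA : mxfield A K0) (hB : mxfield B K0) (ha : mxfield a K0)
  (hb : mxfield b K0) (hc : mxfield c K0) (hd : mxfield d K0) (K00 : 0 <= K0).
Variables (z : R -> R) (zh : (R -> R) -> R).
Hypotheses (mz : meas z) (hz : L1 z) (z0 : forall t, 0 <= z t)
  (zh_lin : linear_on_bmeas zh)
  (zh_le0 : forall k, bmeas k -> ae_on I01 (fun t => k t <= 0) -> zh k <= 0)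
  (zh_conc : forall bb k, bb < 1 -> bmeas k -> (forall t, bb < t -> k t = 0) -> zh k = 0).
Local Notation dir := (direction A B).
Local Notation w := (lform a b).
Hypothesis stationary : forall y v, dir y v -> bmeas (w y v) ->
  J c d y v + (ig I01 (fun t => z t * w y v t) + zh (w y v)) = 0.

Definition bvec q (v : R -> 'cV[R]_q) : Prop := vmeas v /\ exists M, forall t, nrm (v t) <= M.

Lemma bvec_entry q (v : R -> 'cV[R]_q) i : bvec v -> bmeas (fun t => v t i 0).
Proof.
by move=> [mv [M hM]]; split; [exact: mv|exists M => t; exact: le_trans (ler_nrm _ _) (hM t)].
Qed.

(** The state is controlled by the integral of the control alone, so a bounded control supported on
    a short final interval has a small state. *)
Lemma direction_exists : exists2 Cy : R, 0 <= Cy & forall v, bvec v ->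
  exists2 y, dir y v & forall t, I01 t -> nrm (y t) <= Cy * ig I01 (fun t => nrm (v t)).
Proof.
have l0 (t : R) : 0 <= K0 by [].
have [W [C hW]] := weight_upto (meas_cst K0) (L1_cst K0) l0.
have C0 : 0 <= C.
  case: hW => _ h _; have I0 : I01 (0 : R) by rewrite /I01 /= in_itv/= lexx ler01.
  by have /andP[h1 h2] := h 0 I0; exact: le_trans (le_trans ler01 h1) h2.
exists (2 * K0 * C); first by rewrite !mulr_ge0.
move=> v [mv [M vM]].
have hv : vL1 v by apply: (vL1_dom mv (L1_cst M)) => t _.
have hBv : vL1 (fun t => B t *m v t).
  apply: (@vL1_dom _ _ _ (fun t => K0 * M)); [exact: hB.1|exact: L1_cst|].
  by move=> t _; apply: le_trans (hB.2 _ _) _; rewrite ler_wpM2l.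
have [|||y [my [N yN] hy ey]] := @Volterra_solution R upto (fun _ => K0) W C sweep_upto
    (meas_cst K0) (L1_cst K0) l0 hW n (fun t x => A t *m x + B t *m v t) 0.
- move=> t x y _; have -> : A t *m x + B t *m v t - (A t *m y + B t *m v t) = A t *m (x - y).
    by rewrite mulmxBr opprD addrACA subrr addr0.
  exact: hA.2.
- by move=> x mx; apply: vmeasD; [exact: hA.1|exact: hB.1].
- by move=> i; under eq_fun do rewrite mulmx0 add0r; exact: hBv.
have dy : dir y v.
  split => //; first by exists N.
  - by move=> tau _; exists M => t _ _; exact: vM.
  - by move=> t i It; rewrite ey// mxE add0r.
exists y => // t It.
have k0 : 0 <= K0 * ig I01 (fun t => nrm (v t)).
  by rewrite mulr_ge0// ig_ge0// => s _; exact: nrm_ge0.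
have mny := meas_nrm my.
apply: le_trans (@Gronwall R upto (fun _ => K0) W C sweep_upto (meas_cst K0) (L1_cst K0) l0 hW
   _ (K0 * ig I01 (fun t => nrm (v t))) N mny _ _ k0 t It) _.
- by move=> s _; rewrite nrm_ge0 yN.
- move=> s Is.
  have -> : y s = \col_i ig (upto s) (fun r => (A r *m y r + B r *m v r) i 0).
    by apply/colP => i; rewrite mxE (dir_eq dy).
  have hR := dir_rhs_L1 hA hB K00 dy.
  apply: le_trans (nrm_ig (mset_upto s) (@upto_sub _ s) hR) _.
  have hlin : L1 (fun r => K0 * nrm (y r)).
    by apply: (@L1_bounded _ _ (K0 * N)) => [|r _]; [exact: measZ|
      rewrite ger0_norm ?mulr_ge0 ?nrm_ge0// ler_wpM2l].
  apply: (@le_trans _ _ (ig (upto s) (fun r => K0 * nrm (v r) + K0 * nrm (y r)))).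
    apply: ig_le; [exact: mset_upto|exact: upto_sub|exact: L1_nrm| |].
      by apply: L1D => //; apply: L1Z; exact: L1_nrm.
    move=> r _; apply: le_trans (nrmD _ _) _.
    by rewrite addrC; apply: lerD; [exact: hB.2|exact: hA.2].
  have hnv := L1_nrm hv.
  rewrite (igD (mset_upto s) (@upto_sub _ s) (L1Z K0 hnv) hlin) (igZ K0 (mset_upto s) (@upto_sub _ s) hnv).
  rewrite lerD2r ler_wpM2l//; apply: ig_subset; [exact: mset_upto|exact: mset_I01|exact: upto_sub|by []|exact: hnv|].
  by move=> r _; exact: nrm_ge0.
by rewrite le_eqVlt; apply/orP; left; apply/eqP; ring.
Qed.

Lemma zh1_ge0 : 0 <= zh (fun=> 1).
Proof.
have := zh_le0 (bmeasZ (-1) (bmeas_cst 1)) (ae_onT (fun t _ => _)).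
have -> : zh (fun t => -1 * 1) = - zh (fun=> 1) by rewrite (zh_lin.2 _ _ (bmeas_cst 1)) mulN1r.
by rewrite oppr_le0; apply => t; lra.
Qed.

Lemma zh_bound k M : bmeas k -> (forall t, I01 t -> `|k t| <= M) -> `|zh k| <= M * zh (fun=> 1).
Proof.
move=> hk kM; rewrite -[zh k]subr0 -(linear_on0 zh_lin).
apply: zh_dist => //; first exact: bmeas_cst.
by apply: ae_onT => t It; rewrite subr0 kM.
Qed.

(** Cutting [k] off before [bb] does not change [zh k], and the remaining function is bounded by [M]
    everywhere on [[0,1]]. *)
Lemma zh_tail_bound k M bb : bb < 1 -> bmeas k -> (forall t, I01 t -> bb < t -> `|k t| <= M) ->
  0 <= M -> `|zh k| <= M * zh (fun=> 1).
Proof.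
move=> bb1 hk kM M0.
have mb : mset [set` `]-oo, bb]] by exact: mset_itv.
have mc : mset [set` `]bb, +oo[] by exact: mset_itv.
have h1 := bmeasM hk (bmeas_indic mb); have h2 := bmeasM hk (bmeas_indic mc).
have e : k = (fun t => k t * \1_[set` `]-oo, bb]] t + k t * \1_[set` `]bb, +oo[] t).
  apply/funext => t; rewrite -mulrDr !indicE; have [tb|tb] := leP t bb.
    by rewrite mem_set/= ?in_itv//= memNset/= ?in_itv/= ?addr0 ?mulr1//; apply/negP; rewrite andbT -leNgt.
  by rewrite memNset/= ?in_itv/=; [rewrite mem_set/= ?in_itv/= ?tb// add0r mulr1|apply/negP; rewrite -ltNge].
rewrite e (zh_lin.1 _ _ h1 h2) (zh_conc bb1 h1) ?add0r.
  apply: zh_bound => // t It; rewrite indicE; have [tb|tb] := leP t bb.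
    by rewrite memNset/= ?in_itv/= ?mulr0 ?normr0//; apply/negP; rewrite andbT -leNgt.
  by rewrite mem_set/= ?in_itv/= ?tb// mulr1 kM.
by move=> t tb; rewrite indicE memNset ?mulr0//= in_itv/=; apply/negP; rewrite -ltNge.
Qed.

Let abound (y : R -> 'cV[R]_n) M t : nrm (y t) <= M -> `|(a t *m y t) 0 0| <= K0 * M.
Proof.
move=> yM; apply: le_trans (ler_nrm _ _) _; apply: le_trans (ha.2 _ _) _.
by rewrite ler_wpM2l.
Qed.

Let bmeas_mul q (M : R -> 'rV[R]_q) v : mxfield M K0 -> bvec v -> bmeas (fun t => (M t *m v t) 0 0).
Proof.
move=> hM [mv [N vN]]; split; first exact: hM.1.
by exists (K0 * N) => t; apply: le_trans (ler_nrm _ _) _; apply: le_trans (hM.2 _ _) _; rewrite ler_wpM2l.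
Qed.

Let dir_bvec y v : dir y v -> bvec y.
Proof. by move=> dy; split; [exact: dir_y dy|exact: dir_bd dy]. Qed.

Let lform_bmeas y v : dir y v -> bvec v -> bmeas (w y v).
Proof.
move=> dy hv; rewrite /lform; under eq_fun do rewrite mxE.
by apply: bmeasD; apply: bmeas_mul => //; exact: dir_bvec dy.
Qed.

Let iz0 : 0 <= ig I01 z. Proof. exact: ig_ge0. Qed.

(* Controls acting only near 1 see the charge but neither the cost nor [z]. *)
Lemma charge_stationary v : bvec v -> zh (fun t => (b t *m v t) 0 0) = 0.
Proof.
move=> hv; have [mv [M vM]] := hv.
have M0 : 0 <= M by exact: le_trans (nrm_ge0 _) (vM 0).
apply/eqP; rewrite -normr_le0; apply/ler_addgt0Pr => e e0; rewrite add0r.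
have [Cy Cy0 hCy] := direction_exists.
(* The sum of the coefficients of [k0] in the bounds for the cost, for the [z] term and for the
   state part of the charge; the summand 1 keeps it positive. *)
pose Q := 1 + K0 * Cy + K0 + K0 * Cy * ig I01 z + K0 * M + K0 * Cy * zh (fun=> 1).
have Q0 : 0 < Q.
  by rewrite /Q -!addrA ltr_pwDl// !(addr_ge0, mulr_ge0)// ?zh1_ge0.
pose k0 := e / Q.
have k00 : 0 < k0 by rewrite divr_gt0.
have M1 : 0 < 1 + M by rewrite ltr_pwDl.
have [dl dl0 hdl] := ig_abscont hz k00.
(* Length of the final interval carrying the control: at most 1/2 to stay inside [[0,1]], at most
   [dl] so that [z] has small mass there, and at most [k0 / (1 + M)] so that the control has small
   mass. *)
pose dd := Num.min (2^-1) (Num.min dl (k0 / (1 + M))).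
have dd0 : 0 < dd by rewrite !lt_min dl0 divr_gt0// invr_gt0 ltr0n.
have dd1 : dd <= 2^-1 by rewrite ge_min lexx.
have dd2 : dd <= dl by rewrite !ge_min lexx !orbT.
have dd3 : dd <= k0 / (1 + M) by rewrite !ge_min lexx !orbT.
pose bb := 1 - dd.
have bb1 : bb < 1 by rewrite gtrBl.
pose D : set R := [set` `]bb, 1]].
have mD : mset D by exact: mset_itv.
have DI : D `<=` I01.
  move=> t; rewrite /D /I01 /= !in_itv/= => /andP[bt ->]; rewrite andbT.
  by apply/ltW; apply: le_lt_trans bt; rewrite /bb; lra.
have LD : fine (@Leb R D) = dd by rewrite Leb_itv ?ltW//= /bb; lra.
pose u t := \1_D t *: v t.
have hu : bvec u.
  split; first by apply: vmeasZ => //; exact: meas_indic.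
  exists M => t; rewrite nrmZ indicE; case: (_ \in _).
    by rewrite normr1 mul1r.
  by rewrite normr0 mul0r.
have uM t : nrm (u t) <= M * \1_D t.
  by rewrite nrmZ mulrC indicE; case: (_ \in _); rewrite ?normr1 ?mulr1// normr0 !mulr0.
have hD1 : L1 (\1_D : R -> R).
  apply: (@L1_bounded _ _ 1) => [|t _]; first exact: meas_indic.
  by rewrite indicE; case: (_ \in _); rewrite ?normr1// normr0.
have iD k : ig I01 (fun t => k t * \1_D t) = ig D k.
  rewrite [RHS]ig_mkcond//; apply: ig_eq => t _; rewrite patchE indicE.
  by case: (_ \in _); rewrite ?mulr1// mulr0.
have hun : L1 (fun t => nrm (u t)).
  apply: L1_nrm; apply: (vL1_dom hu.1 (L1Z M hD1)) => t _; exact: uM.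
have iu : ig I01 (fun t => nrm (u t)) <= k0.
  apply: (@le_trans _ _ (M * ig I01 (fun t => 1 * \1_D t))).
    have -> : (fun t => 1 * \1_D t) = \1_D :> (R -> R) by apply/funext => t; rewrite mul1r.
    by rewrite -ig1Z//; apply: ig_le => //; [exact: mset_I01|exact: L1Z].
  rewrite iD ig_cst// mul1r LD; apply: le_trans (ler_wpM2l M0 dd3) _.
  by rewrite mulrA ler_pdivrMr// mulrC ler_pM2l// lerDr.
have iu0 : 0 <= ig I01 (fun t => nrm (u t)) by apply: ig_ge0 => t _; exact: nrm_ge0.
have [y dy yb] := hCy _ hu.
have yk t : I01 t -> nrm (y t) <= Cy * k0.
  by move=> It; apply: le_trans (yb _ It) _; rewrite ler_wpM2l.
have Cyk : 0 <= Cy * k0 by rewrite mulr_ge0// ltW.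
have hw := lform_bmeas dy hu.
have hay := bmeas_mul ha (dir_bvec dy).
have hbu := bmeas_mul hb hu.
have hst := stationary dy hw.
have hJ : `|J c d y u| <= K0 * Cy * k0 + K0 * k0.
  have hcd := L1_lform hc hd K00 dy.
  have h1 := L1_cst (K0 * (Cy * k0)); have h2 := L1Z K0 hun.
  apply: (@le_trans _ _ (ig I01 (fun t => K0 * (Cy * k0) + K0 * nrm (u t)))).
    apply: ig_norm_le => //; [exact: mset_I01|exact: L1D|] => t It.
    apply: le_trans (lform_bound _ _ _ hc hd) _; apply: lerD => //.
    by rewrite ler_wpM2l// yk.
  by rewrite ig1D// ig1_cst ig1Z// mulrA lerD2l ler_wpM2l.
have hzw : `|ig I01 (fun t => z t * w y u t)| <= K0 * Cy * k0 * ig I01 z + K0 * M * k0.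
  have h1 := L1Z (K0 * (Cy * k0)) hz.
  have h2 : L1 (fun t => z t * \1_D t).
    apply: (@L1_eq _ (fun t => \1_D t * z t)); first by move=> t _; rewrite mulrC.
    apply: (L1_mulb (meas_indic mD) mz hz (M := 1)) => t _.
    by rewrite indicE; case: (_ \in _); rewrite ?normr1// normr0.
  have h3 : L1 (fun t => z t * w y u t).
    have [mw [N wN]] := hw.
    apply: (@L1_eq _ (fun t => w y u t * z t)); first by move=> t _; rewrite mulrC.
    exact: (L1_mulb mw mz hz (M := N)).
  apply: (@le_trans _ _ (ig I01 (fun t => K0 * (Cy * k0) * z t + K0 * M * (z t * \1_D t)))).
    apply: ig_norm_le => //; [exact: mset_I01|by apply: L1D => //; exact: L1Z|] => t It.
    rewrite normrM (ger0_norm (z0 t)) mulrC.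
    have hh : `|w y u t| <= K0 * (Cy * k0) + K0 * (M * \1_D t).
      apply: le_trans (lform_bound _ _ _ ha hb) _.
      by apply: lerD; rewrite ler_wpM2l// ?yk.
    by apply: le_trans (ler_wpM2r (z0 t) hh) _; lra.
  rewrite ig1D ?ig1Z//; last exact: L1Z.
  rewrite mulrA lerD2l ler_wpM2l ?mulr_ge0// iD.
  have -> : ig D z = ig D (fun t => `|z t|) by apply: ig_eq => t _; rewrite ger0_norm.
  by apply: hdl => //; rewrite LD.
have hza : `|zh (fun t => (a t *m y t) 0 0)| <= K0 * (Cy * k0) * zh (fun=> 1).
  by apply: zh_bound => // t It; apply: abound; exact: yk.
have ew : w y u = (fun t => (a t *m y t) 0 0 + (b t *m u t) 0 0).
  by apply/funext => t; rewrite lformE.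
have eu : zh (fun t => (b t *m u t) 0 0) = zh (fun t => (b t *m v t) 0 0).
  have hbv := bmeas_mul hb hv.
  apply/eqP; rewrite -subr_eq0; have [h1 h2] := linear_onB zh_lin hbu hbv.
  rewrite -h2 -normr_le0.
  have := @zh_tail_bound (fun t => (b t *m u t) 0 0 - (b t *m v t) 0 0) 0 bb bb1 h1.
  rewrite mul0r; apply=> // t It bt.
  have -> : u t = v t.
    rewrite /u indicE mem_set ?scale1r// /D /= in_itv/= bt/=.
    by move: It; rewrite /I01 /= in_itv/= => /andP[].
  by rewrite subrr normr0.
have ez : zh (w y u) = zh (fun t => (a t *m y t) 0 0) + zh (fun t => (b t *m v t) 0 0).
  by rewrite ew (zh_lin.1 _ _ hay hbu) eu.
have k0Q : k0 * Q = e by rewrite /k0 divfK// gt_eqF.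
rewrite -k0Q /Q.
move: hst; rewrite ez => hst.
set X := zh (fun t => (b t *m v t) 0 0) in hst *.
have hX : `|X| <= `|J c d y u| + `|ig I01 (fun t => z t * w y u t)| + `|zh (fun t => (a t *m y t) 0 0)|.
  have -> : X = - (J c d y u + ig I01 (fun t => z t * w y u t) + zh (fun t => (a t *m y t) 0 0)) by lra.
  rewrite normrN; apply: le_trans (ler_normD _ _) _; rewrite lerD2r; exact: ler_normD.
have : k0 * 1 > 0 by rewrite mulr1.
by lra.
Qed.

End Adjoint.

Lemma meas_sg {R : realType} (f : R -> R) : meas f -> meas (fun t => Num.sg (f t)).
Proof.
move=> mf.
have hI (g h : R -> R) t : \1_[set t | g t < h t] t = ((g t < h t)%R)%:R :> R.
  by rewrite indicE; congr ((nat_of_bool _)%:R); apply/idP/idP; rewrite in_setE.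
have -> : (fun t => Num.sg (f t)) = (fun t => \1_[set t | cst 0 t < f t] t - \1_[set t | f t < cst 0 t] t).
  apply/funext => t; rewrite !hI/=.
  by have [h|h|<-] := ltgtP 0 (f t); rewrite ?(gtr0_sg h) ?(ltr0_sg h) ?sgr0 ?subr0 ?sub0r.
have m0 : meas (cst 0 : R -> R) by exact: meas_cst.
by apply: measB; apply: meas_indic; exact: mset_lt.
Qed.

(** * The backward adjoint equation *)

Section AdjointSolution.
Context {R : realType} {n m : nat}.
Variables (A : R -> 'M[R]_(n, n)) (B : R -> 'M[R]_(n, m)).
Variables (a c : R -> 'rV[R]_n) (b d : R -> 'rV[R]_m) (K0 : R).
Hypotheses (hA : mxfield A K0) (hB : mxfield B K0) (ha : mxfield a K0)
  (hb : mxfield b K0) (hc : mxfield c K0) (hd : mxfield d K0) (K00 : 0 <= K0).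
Variables (z : R -> R) (zh : (R -> R) -> R).
Hypotheses (mz : meas z) (hz : L1 z) (z0 : forall t, 0 <= z t)
  (zh_lin : linear_on_bmeas zh)
  (zh_le0 : forall k, bmeas k -> ae_on I01 (fun t => k t <= 0) -> zh k <= 0)
  (zh_conc : forall bb k, bb < 1 -> bmeas k -> (forall t, bb < t -> k t = 0) -> zh k = 0).
Local Notation dir := (direction A B).
Local Notation w := (lform a b).
Hypothesis stationary : forall y v, dir y v -> bmeas (w y v) ->
  J c d y v + (ig I01 (fun t => z t * w y v t) + zh (w y v)) = 0.

Let I1 : I01 (1 : R).
Proof. by rewrite /I01 /= in_itv/= lexx ler01. Qed.

Lemma direction_left_cont y v (e : R) : dir y v -> 0 < e -> exists2 bb : R, bb < 1 &
  forall t, I01 t -> bb < t -> nrm (y t - y 1) <= e.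
Proof.
move=> dy e0; have hG := dir_rhs_L1 hA hB K00 dy.
have [dl dl0 hdl] := ig_abscont (L1_nrm hG) e0.
exists (1 - dl); first by rewrite gtrBl.
move=> t It bt; have t1 : t <= 1 by move: It; rewrite /I01 /= in_itv/= => /andP[].
pose D : set R := I01 `&` [set` `]t, 1]].
have mD : mset D by apply: msetI; [exact: mset_I01|exact: mset_itv].
have DI : D `<=` I01 by move=> s [].
have e1 : y 1 - y t = \col_i ig D (fun r => (A r *m y r + B r *m v r) i 0).
  apply/colP => i; rewrite cvBE (dir_eq dy _ I1) (dir_eq dy _ It) mxE.
  by rewrite (upto_split t1 (hG i)) addrC addKr.
rewrite nrm_distr e1; apply: le_trans (nrm_ig mD DI hG) _.
have -> : ig D (fun r => nrm (A r *m y r + B r *m v r)) = ig D (fun r => `|nrm (A r *m y r + B r *m v r)|).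
  by apply: ig_eq => s _; rewrite ger0_norm// nrm_ge0.
apply: hdl => //.
have eD : D = [set` `]t, 1]].
  apply/seteqP; split=> [s []//|s st]; split => //.
  move: st It; rewrite /I01 /= !in_itv/= => /andP[ts ->] /andP[t0 _].
  by rewrite (le_trans t0 (ltW ts)).
by rewrite eD Leb_itv//=; lra.
Qed.

(** [zh] only sees times arbitrarily close to 1, where the state is close to [y 1]; freezing the
    state there, linearity takes it out. The charge thus acts on the state only through the vector
    of the numbers [zh (fun t => a t 0 i)]. *)
Lemma charge_endpoint y v : dir y v ->
  zh (fun t => (a t *m y t) 0 0) = \sum_i zh (fun t => a t 0 i) * y 1 i 0.
Proof.
move=> dy; have bq i : bmeas (fun t => a t 0 i) := bmeas_entry 0 i ha.
have bmul (x : R -> 'cV[R]_n) : bvec x -> bmeas (fun t => (a t *m x t) 0 0).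
  move=> [mx [N xN]]; split; first exact: ha.1.
  by exists (K0 * N) => t; apply: le_trans (ler_nrm _ _) _; apply: le_trans (ha.2 _ _) _; rewrite ler_wpM2l.
have by1 : bvec (fun=> y 1) by split; [exact: vmeas_cst|exists (nrm (y 1))].
have byv : bvec y by split; [exact: dir_y dy|exact: dir_bd dy].
have h1 := bmul _ byv; have h2 := bmul _ by1.
have -> : zh (fun t => (a t *m y t) 0 0) = zh (fun t => (a t *m y 1) 0 0).
  apply/eqP; rewrite -subr_eq0; have [h3 h4] := linear_onB zh_lin h1 h2.
  rewrite -h4 -normr_le0; apply/ler_addgt0Pr => e e0; rewrite add0r.
  have Q0 : 0 < 1 + K0 * zh (fun=> 1) by rewrite ltr_pwDl// mulr_ge0// (zh1_ge0 zh_lin zh_le0).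
  have [bb bb1 hbb] := direction_left_cont dy (divr_gt0 e0 Q0).
  apply: le_trans (@zh_tail_bound _ _ zh_lin zh_le0 zh_conc _ (K0 * (e / (1 + K0 * zh (fun=> 1)))) bb bb1 h3 _ _) _.
  - move=> t It bt.
    have -> : (a t *m y t) 0 0 - (a t *m y 1) 0 0 = (a t *m (y t - y 1)) 0 0 by rewrite mulmxBr cvBE.
    apply: le_trans (ler_nrm _ _) _; apply: le_trans (ha.2 _ _) _.
    by rewrite ler_wpM2l// hbb.
  - by rewrite mulr_ge0// ltW// divr_gt0.
  rewrite mulrAC mulrA ler_pdivrMr// mulrC ler_pM2l// lerDr//.
have bs (i : 'I_n) : bmeas (fun t => y 1 i 0 * a t 0 i) by apply: bmeasZ.
have [_ e] := linear_on_sum (index_enum 'I_n) zh_lin bs.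
have -> : (fun t => (a t *m y 1) 0 0) = (fun t => \sum_(i <- index_enum 'I_n) y 1 i 0 * a t 0 i).
  by apply/funext => t; rewrite mxE; apply: eq_bigr => i _; rewrite mulrC.
by rewrite e; apply: eq_bigr => i _; rewrite (zh_lin.2 _ _ (bq i)) mulrC.
Qed.

(** The control part of the charge term vanishes by its stationarity, and the state part becomes a
    linear form in the endpoint. *)
Lemma reduced_stationary y v : dir y v -> bvec v ->
  J c d y v + ig I01 (fun t => z t * w y v t) + \sum_i zh (fun t => a t 0 i) * y 1 i 0 = 0.
Proof.
move=> dy hv.
have bmul q (M : R -> 'rV[R]_q) x : mxfield M K0 -> bvec x -> bmeas (fun t => (M t *m x t) 0 0).
  move=> hM [mx [N xN]]; split; first exact: hM.1.
  by exists (K0 * N) => t; apply: le_trans (ler_nrm _ _) _; apply: le_trans (hM.2 _ _) _; rewrite ler_wpM2l.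
have byv : bvec y by split; [exact: dir_y dy|exact: dir_bd dy].
have h1 := bmul _ _ _ ha byv; have h2 := bmul _ _ _ hb hv.
have ew : w y v = (fun t => (a t *m y t) 0 0 + (b t *m v t) 0 0).
  by apply/funext => t; rewrite lformE.
have hw : bmeas (w y v) by rewrite ew; exact: bmeasD.
have := stationary dy hw; rewrite [in zh _]ew (zh_lin.1 _ _ h1 h2).
rewrite (charge_stationary hA hB ha hb hc hd K00 mz hz z0 zh_lin zh_le0 zh_conc stationary hv).
by rewrite addr0 (charge_endpoint dy) addrA.
Qed.

Let dotE q (x y : 'cV[R]_q) : (x^T *m y) 0 0 = \sum_i x i 0 * y i 0.
Proof. by rewrite mxE; apply: eq_bigr => i _; rewrite mxE. Qed.

(** Pure algebra. The last bracket is the derivative of the scalar product of [p] and [y] when [p]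
    solves the adjoint equation, so its integral is a terminal term. *)
Let adjoint_identity (A' : 'M[R]_n) (B' : 'M[R]_(n, m)) (a' c' : 'rV[R]_n) (b' d' : 'rV[R]_m)
    (s : R) (p y : 'cV[R]_n) (v : 'cV[R]_m) :
  \sum_j (B'^T *m p + d'^T + s *: b'^T) j 0 * v j 0 =
  (c' *m y + d' *m v) 0 0 + s * (a' *m y + b' *m v) 0 0
  + (\sum_i p i 0 * (A' *m y + B' *m v) i 0
     - \sum_i (A'^T *m p + c'^T + s *: a'^T) i 0 * y i 0).
Proof.
have D1 (X Y : 'M[R]_1) : (X + Y) 0 0 = X 0 0 + Y 0 0 by rewrite mxE.
have Z1 k (X : 'M[R]_1) : (k *: X) 0 0 = k * X 0 0 by rewrite mxE.
rewrite -!dotE !raddfD/= !linearZ/= !trmx_mul !trmxK.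
rewrite !(mulmxDl, mulmxDr) -!scalemxAl !mulmxA !D1 !Z1; ring.
Qed.

(** Solve backward from the terminal value given by the charge. Integration by parts turns
    stationarity along directions into orthogonality of [psi] to every bounded control, and the
    control formed by the signs of [psi] then forces [psi = 0] almost everywhere. *)
Theorem adjoint_solution : exists p : R -> 'cV[R]_n,
  let G t := (A t)^T *m p t + (c t)^T + z t *: (a t)^T in
  [/\ bvec p, vL1 G, vmeas G,
    forall t i, I01 t -> p t i 0 = zh (fun s => a s 0 i) + ig (from t) (fun s => G s i 0) &
    ae_on I01 (fun t => (B t)^T *m p t + (d t)^T + z t *: (b t)^T = 0)].
Proof.
pose K1 := n%:R * K0; have K10 : 0 <= K1 by rewrite mulr_ge0.
have hAT := mxfield_tr K00 hA.
have l0 (t : R) : 0 <= K1 by [].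
have [W [C hW]] := weight_from (meas_cst K1) (L1_cst K1) l0.
have [mcT bcT] := mxfield_row_tr hc; have [maT baT] := mxfield_row_tr ha.
have [mdT bdT] := mxfield_row_tr hd; have [mbT bbT] := mxfield_row_tr hb.
pose q : 'cV[R]_n := \col_i zh (fun s => a s 0 i).
pose F t (x : 'cV[R]_n) := (A t)^T *m x + (c t)^T + z t *: (a t)^T.
have mF x : vmeas x -> vmeas (fun t => F t (x t)).
  move=> mx; apply: vmeasD; first by apply: vmeasD => //; exact: hAT.1.
  exact: vmeasZ.
have [|||p [mp [N pN] hG ep]] := @Volterra_solution R from (fun _ => K1) W C sweep_from
    (meas_cst K1) (L1_cst K1) l0 hW n F q.
- move=> t x y _; have -> : F t x - F t y = (A t)^T *m (x - y).
    by rewrite /F mulmxBr opprD addrACA subrr addr0 opprD addrACA subrr addr0.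
  exact: hAT.2.
- exact: mF.
- apply: (@vL1_dom _ _ _ (fun t => (K1 * nrm q + n%:R * K0) + n%:R * K0 * z t)).
  + by apply: (mF (fun _ => q)); exact: vmeas_cst.
  + by apply: L1D; [exact: L1_cst|exact: L1Z].
  + move=> t _; apply: le_trans (nrmD _ _) _; apply: lerD.
      by apply: le_trans (nrmD _ _) _; apply: lerD => //; exact: hAT.2.
    by rewrite nrmZ (ger0_norm (z0 t)) mulrC ler_wpM2r.
have bp : bvec p by split => //; exists N.
exists p; split => //; first exact: mF.
  by move=> t i It; rewrite ep// mxE.
pose psi t := (B t)^T *m p t + (d t)^T + z t *: (b t)^T.
have hBT := mxfield_tr K00 hB.
have mpsi : vmeas psi.
  by apply: vmeasD; [apply: vmeasD => //; exact: hBT.1|exact: vmeasZ].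
have hpsi : vL1 psi.
  apply: (@vL1_dom _ _ _ (fun t => (m%:R * K0 * N + m%:R * K0) + m%:R * K0 * z t)) => //.
    by apply: L1D; [exact: L1_cst|exact: L1Z].
  move=> t _; apply: le_trans (nrmD _ _) _; apply: lerD.
    apply: le_trans (nrmD _ _) _; apply: lerD => //; apply: le_trans (hBT.2 _ _) _.
    by rewrite ler_wpM2l// mulr_ge0.
  by rewrite nrmZ (ger0_norm (z0 t)) mulrC ler_wpM2r.
have key v : bvec v -> ig I01 (fun t => \sum_j psi t j 0 * v t j 0) = 0.
  move=> hv.
  have [Cy _ hCy] := direction_exists hA hB K00.
  have [y dy _] := hCy _ hv.
  have hst := reduced_stationary dy hv.
  have hL := dir_rhs_L1 hA hB K00 dy.
  have mL : vmeas (fun s => A s *m y s + B s *m v s).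
    by apply: vmeasD; [apply: hA.1; exact: dir_y dy|apply: hB.1; case: hv].
  have byv : bvec y by split; [exact: dir_y dy|exact: dir_bd dy].
  have L1mul (k1 k2 : R -> R) : bmeas k1 -> meas k2 -> L1 k2 -> L1 (fun t => k1 t * k2 t).
    move=> [mk [M kM]] mk2 hk2; exact: (L1_mulb mk mk2 hk2 (M := M)).
  have hpL i : L1 (fun t => p t i 0 * (A t *m y t + B t *m v t) i 0).
    by apply: L1mul => //; exact: bvec_entry.
  have hGy i : L1 (fun t => F t (p t) i 0 * y t i 0).
    apply: (@L1_eq _ (fun t => y t i 0 * F t (p t) i 0)); first by move=> t _; rewrite mulrC.
    by apply: L1mul; [exact: bvec_entry|exact: (mF _ mp)|exact: hG].
  have hqi i : zh (fun t => a t 0 i) * y 1 i 0 =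
      ig I01 (fun t => p t i 0 * (A t *m y t + B t *m v t) i 0) - ig I01 (fun t => F t (p t) i 0 * y t i 0).
    have e1 : ig I01 (fun t => F t (p t) i 0 * y t i 0) =
        ig I01 (fun t => F t (p t) i 0 * ig (upto t) (fun s => (A s *m y s + B s *m v s) i 0)).
      by apply: ig_eq => t It; rewrite (dir_eq dy).
    have hfG : L1 (fun t => ig (from t) (fun s => F s (p s) i 0) * (A t *m y t + B t *m v t) i 0).
      apply: (L1mul (fun t => ig (from t) (fun s => F s (p s) i 0)) (fun t => (A t *m y t + B t *m v t) i 0) _ (mL i) (hL i)).
      split; first by apply: meas_continuous; exact: from_cont.
      exists (ig I01 (fun s => `|F s (p s) i 0|)) => t.
      apply: le_trans (ig_norm (mset_from t) _ (hG i)) _; first by move=> s [].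
      by apply: ig_subset; [exact: mset_from|exact: mset_I01|move=> s []|by []|apply: L1_norm; exact: hG|].
    have e2 : ig I01 (fun t => p t i 0 * (A t *m y t + B t *m v t) i 0) =
        zh (fun t => a t 0 i) * y 1 i 0 +
        ig I01 (fun t => (A t *m y t + B t *m v t) i 0 * ig (from t) (fun s => F s (p s) i 0)).
      have -> : y 1 i 0 = ig I01 (fun s => (A s *m y s + B s *m v s) i 0).
        by rewrite (dir_eq dy _ I1) upto_itv.
      rewrite -ig1Z// -ig1D; [|exact: L1Z|by apply: L1_eq hfG => t _; rewrite mulrC].
      by apply: ig_eq => t It; rewrite ep// mxE; ring.
    rewrite e2 e1 ig_Fubini; [|exact: mL|exact: (mF _ mp)|exact: hL|exact: hG].
    by rewrite addrK.
  move: hst; rewrite (eq_bigr _ (fun i _ => hqi i)) sumrB.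
  rewrite -(ig_sum _ mset_I01 (@subset_refl _ _) hpL) -(ig_sum _ mset_I01 (@subset_refl _ _) hGy).
  have f1 := L1_lform hc hd K00 dy.
  have f2 : L1 (fun t => z t * w y v t).
    have [mw [M wM]] : bmeas (w y v).
      split; first exact: meas_lform ha hb (dir_y dy) hv.1.
      have [M1 h1] := dir_bd dy; have [_ [M2 h2]] := hv.
      exists (K0 * M1 + K0 * M2) => t; apply: le_trans (lform_bound _ _ _ ha hb) _.
      by apply: lerD; rewrite ler_wpM2l.
    apply: (@L1_eq _ (fun t => w y v t * z t)); first by move=> t _; rewrite mulrC.
    exact: (L1_mulb mw mz hz (M := M)).
  have f3 := L1_sum (index_enum 'I_n) hpL; have f4 := L1_sum (index_enum 'I_n) hGy.
  rewrite /J -(ig1D f1 f2) -(ig1B f3 f4) -(ig1D (L1D f1 f2) (L1B f3 f4)) => h0; rewrite -[RHS]h0.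
  by apply: ig_eq => t _; rewrite /psi (adjoint_identity (A t) _ (a t) (c t) _ _ _ _ (y t)).
have mn := meas_nrm mpsi.
have : ig I01 (fun t => nrm (psi t)) = 0.
  rewrite -(key (fun t => \col_j Num.sg (psi t j 0))).
    by apply: ig_eq => t _; apply: eq_bigr => j _; rewrite [X in _ * X]mxE mulrC -normrEsg.
  split=> [j|].
    under eq_fun do rewrite mxE.
    exact: (meas_sg (mpsi j)).
  exists m%:R => t; rewrite /nrm -[m in m%:R](card_ord m) -sumr_const; apply: ler_sum => j _.
  by rewrite mxE normr_sg; case: (_ == _); rewrite ?ler01.
move=> /(ig_nonneg_eq0 mn (L1_nrm hpsi) (fun t => nrm_ge0 _)).
by apply: ae_on_filter => t _ h; apply: nrm_eq0; rewrite h.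
Qed.

End AdjointSolution.

(** * Smooth data *)

Section ContinuousData.
Context {R : realType} {n m : nat}.
Local Notation T := (R * 'cV[R]_n * 'cV[R]_m)%type.
Implicit Types (Phi : R -> 'cV[R]_n -> 'cV[R]_m -> R).

(** Retraction of the line onto [[0,1]]: composing the data with it turns continuity within the
    domain into continuity everywhere without changing meaningful values. *)
Definition clamp (t : R) : R := Num.max 0 (Num.min 1 t).

Lemma clamp_I01 t : I01 (clamp t).
Proof.
by rewrite /I01 /= in_itv/= /clamp le_max lexx/= ge_max ler01/= ge_min lexx.
Qed.

Lemma clampE t : I01 t -> clamp t = t.
Proof. by rewrite /I01 /= in_itv/= /clamp => /andP[t0 t1]; rewrite min_r// max_r. Qed.

Lemma clamp_cont : continuous clamp.
Proof.
move=> t; apply: (@continuous_max R R (cst 0) (fun t => Num.min 1 t)); first exact: cst_continuous.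
apply: (@continuous_min R R (cst 1) id); first exact: cst_continuous.
exact: cvg_id.
Qed.

Definition extc Phi (q : T) : R := Phi (clamp q.1.1) q.1.2 q.2.

Lemma extc_cont Phi : {within dom, continuous (fun q : T => Phi q.1.1 q.1.2 q.2)} ->
  continuous (extc Phi).
Proof.
rewrite continuous_subspace_in => hPhi q.
pose r (q : T) : T := (clamp q.1.1, q.1.2, q.2).
have rc : {for q, continuous r}.
  apply: (@cvg_pair _ _ _ _ (nbhs _) (nbhs _)); last exact: cvg_snd.
  apply: (@cvg_pair _ _ _ _ (nbhs _) (nbhs _)).
    apply: (@continuous_comp _ _ _ (fun q : T => q.1.1) clamp); last exact: clamp_cont.
    apply: (@continuous_comp _ _ _ (fun q : T => q.1) fst); exact: cvg_fst.
  apply: (@continuous_comp _ _ _ (fun q : T => q.1) snd); first exact: cvg_fst.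
  exact: cvg_snd.
have rd p : (dom : set T) (r p) by exact: clamp_I01.
have := hPhi (r q) (mem_set (rd q)).
move=> h B hB.
have : nbhs_subspace (r q : subspace (dom : set T)) ((fun q : T => Phi q.1.1 q.1.2 q.2) @^-1` B) := h B hB.
rewrite -nbhs_subspace_in// => hw.
have hr : nbhs q (fun p => (dom : set T) (r p) -> B (Phi (r p).1.1 (r p).1.2 (r p).2)) := rc _ hw.
suff : nbhs q (fun p => B (extc Phi p)) by [].
by apply: filterS hr => p; apply; exact: rd.
Qed.

Lemma norm_le_nrm p (x : 'cV[R]_p) : `|x| <= nrm x.
Proof.
rewrite [leLHS]mx_normrE; apply: bigmax_le; first exact: nrm_ge0.
by move=> [i j] _ /=; rewrite ord1; exact: ler_nrm.
Qed.

(* A Caratheodory integrand is a limit of its values along countably valued approximations. *)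
Lemma caratheodory_meas (X : Type) (K : countType) (F : R -> X -> R)
    (c : nat -> R -> K) (val : nat -> K -> X) (x : R -> X) :
  (forall y, meas (F ^~ y)) -> (forall j k, mset [set t | c j t = k]) ->
  (forall t, (fun j => F t (val j (c j t))) @ \oo --> F t (x t)) ->
  meas (fun t => F t (x t)).
Proof.
move=> mF mc cvF; apply: (@meas_lim _ (fun j t => F t (val j (c j t)))) => // j.
rewrite /meas => _ Y mY; rewrite setTI.
have -> : (fun t => F t (val j (c j t))) @^-1` Y =
    \bigcup_(k : K) ([set t | c j t = k] `&` (F ^~ (val j k)) @^-1` Y).
  apply/seteqP; split=> [t Yt|t [k _ [/= <-]]//]; by exists (c j t).
apply: countable_bigcupT_measurable; first exact: countableP.
move=> k; apply: (measurableI _ _ (mc j k)).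
by have := mF (val j k) measurableT Y mY; rewrite setTI.
Qed.

Lemma grid_meas (p j : nat) (x : R -> 'cV[R]_p) (k : {ffun 'I_p -> int}) : vmeas x ->
  mset [set t | [ffun i => Num.floor (2 ^+ j * x t i 0)] = k].
Proof.
move=> mx.
have -> : [set t | [ffun i => Num.floor (2 ^+ j * x t i 0)] = k] =
    \bigcap_(i : 'I_p) ([set t | (k i)%:~R <= 2 ^+ j * x t i 0] `&`
                        [set t | 2 ^+ j * x t i 0 < (k i + 1)%:~R]).
  apply/seteqP; split=> [t <- i _ /=|t h].
    by rewrite ffunE; split; [exact: floor_le_tmp|exact: floorD1_gt].
  apply/ffunP => i; rewrite ffunE; have [/= h1 h2] := h i I.
  by apply/eqP; rewrite floor_eq h1 h2.
apply: fin_bigcap_measurable; first exact: finite_finset.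
move=> i _; apply: measurableI.
  by apply: mset_le; [exact: meas_cst|apply: measZ; exact: mx].
by apply: mset_lt; [apply: measZ; exact: mx|exact: meas_cst].
Qed.

(** Integer codes are decoded to the grid of mesh [2 ^- j]. Dyadic rounding keeps the approximations
    countably valued, as the measurability argument requires. *)
Definition grid_val (p j : nat) (k : {ffun 'I_p -> int}) : 'cV[R]_p :=
  \col_i ((k i)%:~R / 2 ^+ j).

Lemma grid_cvg p (x : 'cV[R]_p) :
  (fun j => grid_val j [ffun i => Num.floor (2 ^+ j * x i 0)]) @ \oo --> x.
Proof.
apply/cvgrPdist_le => e e0.
have : geometric (p%:R : R) 2^-1 @ \oo --> (0 : R).
  by apply: sequences.cvg_geometric; rewrite ger0_norm ?invr_ge0// invf_lt1// ltr1n.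
move=> /cvgrPdist_le/(_ e e0); apply: filterS => j /=.
rewrite sub0r normrN => h; apply: le_trans (norm_le_nrm _) (le_trans _ (le_trans (ler_norm _) h)).
rewrite /nrm mulr_natl -[in leRHS](card_ord p) -sumr_const; apply: ler_sum => i _.
rewrite !mxE ffunE; set y := 2 ^+ j * x i 0.
have p0 : 0 < 2 ^+ j :> R by rewrite exprn_gt0.
have h1 := floor_le_tmp y; have h2 := floorD1_gt y; rewrite intrD in h2.
have -> : x i 0 = y / 2 ^+ j by rewrite /y mulrC mulKf// gt_eqF.
rewrite -mulrBl normrM exprVn [X in _ * X]ger0_norm ?invr_ge0 ?(ltW p0)//.
by rewrite ler_piMl ?invr_ge0 ?(ltW p0)// ger0_norm; lra.
Qed.

Lemma extc_meas Phi (x : R -> 'cV[R]_n) (u : R -> 'cV[R]_m) : continuous (extc Phi) ->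
  vmeas x -> vmeas u -> meas (fun t => extc Phi (t, x t, u t)).
Proof.
move=> cPhi mx mu.
apply: (@caratheodory_meas ('cV[R]_n * 'cV[R]_m)%type ({ffun 'I_n -> int} * {ffun 'I_m -> int})%type
  (fun t p => extc Phi (t, p.1, p.2))
  (fun j t => ([ffun i => Num.floor (2 ^+ j * x t i 0)], [ffun i => Num.floor (2 ^+ j * u t i 0)]))
  (fun j k => (grid_val j k.1, grid_val j k.2)) (fun t => (x t, u t))).
- move=> [y v] /=; apply: meas_continuous => t.
  apply: (@continuous_comp _ _ _ (fun t : R => (t, y, v)) (extc Phi)); last exact: cPhi.
  apply: (@cvg_pair _ _ _ _ (nbhs _) (nbhs _)); last exact: cvg_cst.
  by apply: (@cvg_pair _ _ _ _ (nbhs _) (nbhs _)); [exact: cvg_id|exact: cvg_cst].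
- move=> j [k1 k2].
  have -> : [set t | ([ffun i => Num.floor (2 ^+ j * x t i 0)], [ffun i => Num.floor (2 ^+ j * u t i 0)]) = (k1, k2)]
      = [set t | [ffun i => Num.floor (2 ^+ j * x t i 0)] = k1] `&` [set t | [ffun i => Num.floor (2 ^+ j * u t i 0)] = k2].
    by apply/seteqP; split=> [t [<- <-]//|t [/= <- <-]].
  by apply: msetI; exact: grid_meas.
- move=> t /=.
  have h : (fun j => (t, grid_val j [ffun i => Num.floor (2 ^+ j * x t i 0)],
      grid_val j [ffun i => Num.floor (2 ^+ j * u t i 0)])) @ \oo --> (t, x t, u t).
    apply: (@cvg_pair _ _ _ _ (nbhs _) (nbhs _)); last exact: grid_cvg.
    by apply: (@cvg_pair _ _ _ _ (nbhs _) (nbhs _)); [exact: cvg_cst|exact: grid_cvg].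
  by move=> B /cPhi hB; exact: h hB.
Qed.

Lemma cv_box_compact p (M : R) : compact [set x : 'cV[R]_p | forall i, `|x i 0| <= M].
Proof.
have := @rV_compact R p (fun _ => [set r | -M <= r <= M]).
have hc : compact [set r : R | - M <= r <= M].
  have -> : [set r : R | - M <= r <= M] = [set` `[-M, M]].
    by apply/seteqP; split=> r /=; rewrite in_itv.
  exact: segment_compact.
move=> /(_ (fun _ => hc)) h.
have trc : continuous (trmx : 'rV[R]_p -> 'cV[R]_p).
  move=> x B [Q hQ sub]; exists (fun i j => Q j i) => [i j|y hy].
    by have := hQ j i; rewrite mxE.
  by apply: sub => i j; rewrite mxE; exact: hy.
have := continuous_compact (continuous_subspaceT trc) h.
congr compact; apply/seteqP; split=> [_ [x xM <-] i|x xM]/=.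
  by rewrite mxE ler_norml; exact: xM.
exists x^T; last exact: trmxK.
by move=> i /=; rewrite mxE -ler_norml.
Qed.

Definition box (M : R) : set T := [set q | [/\ I01 q.1.1, nrm q.1.2 <= M & nrm q.2 <= M]].

Lemma box_subcompact M : exists2 K : set T, compact K & box M `<=` K.
Proof.
exists ((I01 `*` [set x : 'cV[R]_n | forall i, `|x i 0| <= M]) `*`
        [set x : 'cV[R]_m | forall i, `|x i 0| <= M]).
  apply: compact_setX; last exact: cv_box_compact.
  by apply: compact_setX; [exact: segment_compact|exact: cv_box_compact].
move=> [[t x] u] [/= It xM uM]; split; first split => //=.
  by move=> i; exact: le_trans (ler_nrm _ _) xM.
by move=> i; exact: le_trans (ler_nrm _ _) uM.
Qed.

Lemma extc_bounded Phi M : continuous (extc Phi) ->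
  exists C, forall q, box M q -> `|extc Phi q| <= C.
Proof.
move=> cPhi; have [K cK bK] := box_subcompact M.
have := compact_bounded (continuous_compact (continuous_subspaceT cPhi) cK).
move=> [C [_ hC]]; exists (C + 1) => q /bK Kq.
by apply: (hC (C + 1)); [rewrite ltrDl|exists q].
Qed.

(** The near-covering form of compactness gives one radius valid at all points of a compact set.
    Only the first point has to lie in the box; the second is merely close to it. *)
Lemma extc_unif Phi M (e : R) : continuous (extc Phi) -> 0 < e ->
  exists2 d, 0 < d & forall t x u x' u', box M (t, x, u) -> nrm (x - x') <= d -> nrm (u - u') <= d ->
    `|extc Phi (t, x, u) - extc Phi (t, x', u')| <= e.
Proof.
move=> cPhi e0; have [K /compact_near_coveringP cK bK] := box_subcompact M.
have := cK R (0^'+) (fun d q => forall q' : T, `|q - q'| <= d -> `|extc Phi q - extc Phi q'| <= e) _.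
case=> [q Kq|d /= d0 hd].
  have /cvgrPdist_le/(_ (e / 2) (divr_gt0 e0 (ltr0n _ 2))) := cPhi q.
  move=> /nbhs_ballP[r r0 hr].
  have r20 : 0 < r / 2 by rewrite divr_gt0.
  exists (ball q (r / 2), [set d | d < r / 2]).
    split => /=; first exact: nbhsx_ballx.
    exact: nbhs_right_lt.
  move=> [q1 d] /= [q1b dr] q' q'd.
  have b1 : ball q r q1 by apply: le_ball q1b; lra.
  have b2 : ball q r q'.
    have -> : r = r / 2 + r / 2 by lra.
    apply: ball_triangle q1b _; rewrite -ball_normE /=; exact: le_lt_trans q'd dr.
  have h1 := hr _ b1; have h2 := hr _ b2; rewrite /= in h1 h2.
  rewrite -(subrKA (extc Phi q)); apply: le_trans (ler_normD _ _) _.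
  by rewrite (distrC (extc Phi q1)); lra.
exists (d / 2); first by rewrite divr_gt0.
move=> t x u x' u' bq xd ud.
have := hd (d / 2) _ _ _ (bK _ bq) (t, x', u').
apply.
- rewrite /ball_/= sub0r normrN gtr0_norm ?divr_gt0//; lra.
- by rewrite divr_gt0.
- rewrite prod_normE/= prod_normE/= !ge_max subrr normr0 (divr_ge0 (ltW d0) (ler0n _ 2))/=.
  by rewrite (le_trans (norm_le_nrm _) xd) (le_trans (norm_le_nrm _) ud).
Qed.

End ContinuousData.

(** * Differentiability of the data and mean value formulas *)

Section SmoothData.
Context {R : realType} {n m : nat}.
Local Notation V := ('cV[R]_n * 'cV[R]_m)%type.

(** Isolates what the estimates use: continuity after clamping of time, and a mean value formula
    along segments in terms of the two partial gradients. *)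
Record smooth (G : R -> 'cV[R]_n -> 'cV[R]_m -> R)
    (Gx : R -> 'cV[R]_n -> 'cV[R]_m -> 'rV[R]_n)
    (Gu : R -> 'cV[R]_n -> 'cV[R]_m -> 'rV[R]_m) : Prop := Smooth {
  sm_cont : continuous (extc G);
  sm_contx : forall j, continuous (extc (fun t x u => Gx t x u 0 j));
  sm_contu : forall j, continuous (extc (fun t x u => Gu t x u 0 j));
  sm_mvt : forall t x u h k, I01 t -> exists2 s, 0 <= s <= 1 &
    G t (x + h) (u + k) - G t x u =
    (Gx t (x + s *: h) (u + s *: k) *m h + Gu t (x + s *: h) (u + s *: k) *m k) 0 0 }.

Section Partial.
Variable W : normedModType R.
Variable f : 'cV[R]_n -> 'cV[R]_m -> W.
Let F (p : V) := f p.1 p.2.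

Let quot_fst x u h : (fun s : R => s^-1 *: (((f ^~ u) \o shift x) (s *: h) - f x u)) =
  (fun s : R => s^-1 *: ((F \o shift (x, u)) (s *: (h, 0)) - F (x, u))).
Proof. by apply/funext => s; rewrite /F/= scaler0 add0r. Qed.

Let quot_snd x u k : (fun s : R => s^-1 *: ((f x \o shift u) (s *: k) - f x u)) =
  (fun s : R => s^-1 *: ((F \o shift (x, u)) (s *: (0, k)) - F (x, u))).
Proof. by apply/funext => s; rewrite /F/= scaler0 add0r. Qed.

Lemma derive_fst x u h : differentiable F (x, u) -> 'D_h (f ^~ u) x = 'd F (x, u) (h, 0).
Proof. by move=> dF; rewrite -deriveE// /derive quot_fst. Qed.

Lemma derive_snd x u k : differentiable F (x, u) -> 'D_k (f x) u = 'd F (x, u) (0, k).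
Proof. by move=> dF; rewrite -deriveE// /derive quot_snd. Qed.

Lemma derivable_fst x u h : differentiable F (x, u) -> derivable (f ^~ u) x h.
Proof. by move=> dF; have := @diff_derivable _ _ _ F (x, u) (h, 0) dF; rewrite /derivable quot_fst. Qed.

Lemma derivable_snd x u k : differentiable F (x, u) -> derivable (f x) u k.
Proof. by move=> dF; have := @diff_derivable _ _ _ F (x, u) (0, k) dF; rewrite /derivable quot_snd. Qed.

End Partial.

Lemma cv_sum_delta p (h : 'cV[R]_p) : h = \sum_i h i 0 *: delta_mx i 0.
Proof.
apply/colP => i; rewrite summxE (bigD1 i)//= big1 => [|j ji].
  by rewrite !mxE !eqxx mulr1 addr0.
by rewrite !mxE eq_sym (negbTE ji) mulr0.
Qed.

Lemma linear_cv_sum p (f : 'cV[R]_p -> R) (h : 'cV[R]_p) :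
  (forall x y, f (x + y) = f x + f y) -> (forall c x, f (c *: x) = c * f x) ->
  f h = \sum_i h i 0 * f (delta_mx i 0).
Proof.
move=> fD fZ; have f0 : f 0 = 0 by rewrite -(scale0r 0) fZ mul0r.
rewrite [in LHS](cv_sum_delta h) (big_morph f fD f0).
by apply: eq_bigr => i _; rewrite fZ.
Qed.

Lemma diff_gradient (f : 'cV[R]_n -> 'cV[R]_m -> R) x u h k :
  differentiable (fun p : V => f p.1 p.2 : R^o) (x, u) ->
  'd (fun p : V => f p.1 p.2 : R^o) (x, u) (h, k) =
  (gradient (f ^~ u) x *m h + gradient (f x) u *m k) 0 0.
Proof.
move=> df; set D := 'd _ _.
have -> : ((h, k) : V) = (h, 0) + (0, k) by congr pair; rewrite ?addr0 ?add0r.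
rewrite linearD/= mxE; congr (_ + _).
  rewrite (@linear_cv_sum _ (fun h => D (h, 0))).
  - rewrite mxE; apply: eq_bigr => i _; rewrite mxE mulrC; congr (_ * _).
    by rewrite (derive_fst _ df).
  - by move=> y z; rewrite -linearD/=; congr (D (_, _)); rewrite addr0.
  - by move=> c y; rewrite -[RHS]/(c *: D (y, 0)) -linearZ/=; congr (D (_, _)); rewrite scaler0.
rewrite (@linear_cv_sum _ (fun k => D (0, k))).
- rewrite mxE; apply: eq_bigr => i _; rewrite mxE mulrC; congr (_ * _).
  by rewrite (derive_snd _ df).
- by move=> y z; rewrite -linearD/=; congr (D (_, _)); rewrite addr0.
- by move=> c y; rewrite -[RHS]/(c *: D (0, y)) -linearZ/=; congr (D (_, _)); rewrite scaler0.
Qed.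

Lemma is_derive_segment (F : V -> R^o) (p q : V) (s : R) : differentiable F (s *: q + p) ->
  is_derive s 1 (fun s : R => F (s *: q + p) : R^o) ('d F (s *: q + p) q).
Proof.
move=> dF; have hd : derivable F (s *: q + p) q by exact: diff_derivable.
have e : (fun h : R => h^-1 *: (((fun s : R => F (s *: q + p) : R^o) \o shift s) (h *: 1) - F (s *: q + p)))
    = (fun h : R => h^-1 *: ((F \o shift (s *: q + p)) (h *: q) - F (s *: q + p))).
  apply/funext => h; congr (_ *: (F _ - _)).
  by rewrite /= -[h *: 1]/(h * 1) mulr1 scalerDl addrA.
split; first by rewrite /derivable e.
by rewrite -deriveE// /derive e.
Qed.

(** The one-dimensional mean value theorem along the segment from [(x, u)] to [(x + h, u + k)]; the
    joint differential is expressed through the partial gradients, which inherit its continuity. *)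
Lemma smooth_of_C1 (G : R -> 'cV[R]_n -> 'cV[R]_m -> R) :
  C1_data (G : _ -> _ -> _ -> R^o) ->
  smooth G (fun t x u => gradient (G t ^~ u) x) (fun t x u => gradient (G t x) u).
Proof.
move=> [cG dG cdG].
have cd h : continuous (extc (fun t x u => 'd (fun p : V => G t p.1 p.2 : R^o) (x, u) h)).
  by apply: (@extc_cont _ _ _ (fun t x u => 'd (fun p : V => G t p.1 p.2 : R^o) (x, u) h)); exact: cdG.
split.
- exact: extc_cont.
- move=> j; rewrite (_ : extc _ = extc (fun t x u => 'd (fun p : V => G t p.1 p.2 : R^o) (x, u) (delta_mx j 0, 0)))//.
  apply/funext => -[[t x] u]; rewrite /extc mxE/= (@derive_fst R^o (G (clamp t)))//.
  by apply: dG; exact: clamp_I01.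
- move=> j; rewrite (_ : extc _ = extc (fun t x u => 'd (fun p : V => G t p.1 p.2 : R^o) (x, u) (0, delta_mx j 0)))//.
  apply/funext => -[[t x] u]; rewrite /extc mxE/= (@derive_snd R^o (G (clamp t)))//.
  by apply: dG; exact: clamp_I01.
- move=> t x u h k It; pose F (p : V) : R^o := G t p.1 p.2.
  pose q : V := (h, k); pose p : V := (x, u).
  have ders (s : R) : is_derive s (1 : R) (fun s : R => F (s *: q + p)) ('d F (s *: q + p) q).
    by apply: is_derive_segment; exact: dG.
  have hc : {within `[0, 1], continuous (fun s : R => F (s *: q + p))}.
    by apply: derivable_within_continuous => s _; exact: (ders s).(@ex_derive _ _ _ _ _ _ _).
  have [s + e] := MVT_segment ler01 (fun s _ => ders s) hc.
  rewrite in_itv/= => /andP[s0 s1]; exists s; first by rewrite s0 s1.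
  move: e; rewrite subr0 mulr1 scale1r scale0r add0r (_ : s *: q + p = (x + s *: h, u + s *: k)).
    rewrite diff_gradient; last exact: dG.
    by move=> <-; rewrite /F/= ![_ + x]addrC ![_ + u]addrC.
  by congr pair; rewrite /= addrC.
Qed.

Lemma C1_coord (F : R -> 'cV[R]_n -> 'cV[R]_m -> 'cV[R]_n) i : C1_data F ->
  C1_data ((fun t x u => F t x u i 0) : _ -> _ -> _ -> R^o).
Proof.
move=> [cF dF cdF].
have cc : continuous (fun M : 'cV[R]_n => M i 0 : R^o) by exact: coord_continuous.
have e t x u h : I01 t -> 'd (fun p : V => F t p.1 p.2 i 0 : R^o) (x, u) h =
    ('d (fun p : V => F t p.1 p.2) (x, u) h) i 0.
  move=> It; rewrite -!deriveE; [|exact: dF|].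
    by rewrite derive_mx ?mxE//; apply: diff_derivable; exact: dF.
  apply: (@differentiable_comp _ _ _ _ (fun p : V => F t p.1 p.2) (fun M : 'cV[R]_n => M i 0 : R^o)).
    exact: dF.
  exact: differentiable_coord.
split.
- by move=> q; apply: (@continuous_comp _ _ _ _ (fun M : 'cV[R]_n => M i 0)); [exact: cF|exact: cc].
- move=> t p It.
  apply: (@differentiable_comp _ _ _ _ (fun p : V => F t p.1 p.2) (fun M : 'cV[R]_n => M i 0 : R^o)).
    exact: dF.
  exact: differentiable_coord.
- move=> h.
  have hc : {within dom, continuous (fun q : R * 'cV[R]_n * 'cV[R]_m => ('d (fun p : V => F q.1.1 p.1 p.2) (q.1.2, q.2) h) i 0)}.
    by move=> q; exact: (continuous_comp (cdF h q) (cc _)).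
  apply: subspace_eq_continuous hc.
  by move=> [[t x] u] /set_mem It; exact/esym/(e t x u h It).
Qed.

(** The mean value formula holds for scalar functions, each coordinate having its own intermediate
    point; hence the dynamics are treated row by row. *)
Lemma smooth_of_C1_row (F : R -> 'cV[R]_n -> 'cV[R]_m -> 'cV[R]_n) i : C1_data F ->
  smooth (fun t x u => F t x u i 0) (fun t x u => gradient (fun x => F t x u i 0) x)
    (fun t x u => gradient (fun u => F t x u i 0) u) /\
  forall t x u, I01 t ->
    row i (jacobian_mx (F t ^~ u) x) = gradient (fun x => F t x u i 0) x /\
    row i (jacobian_mx (F t x) u) = gradient (fun u => F t x u i 0) u.
Proof.
move=> hF; split; first exact: smooth_of_C1 (C1_coord i hF).
case: hF => [_ dF _] t x u It; split; apply/rowP => j; rewrite !mxE.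
  by rewrite derive_mx ?mxE//; apply: (@derivable_fst _ (F t)); exact: dF.
by rewrite derive_mx ?mxE//; apply: (@derivable_snd _ (F t)); exact: dF.
Qed.

End SmoothData.

(** * Uniform first-order estimates *)

Section Estimates.
Context {R : realType} {n m : nat}.

(** Serves to choose a single radius valid for all coordinates. *)
Lemma fin_pos p (Q : 'I_p -> R -> Prop) :
  (forall j d d', Q j d -> 0 < d' -> d' <= d -> Q j d') ->
  (forall j, exists2 d, 0 < d & Q j d) -> exists2 d, 0 < d & forall j, Q j d.
Proof.
move=> mono ex.
have h (s : seq 'I_p) : exists2 d, 0 < d & forall j, j \in s -> Q j d.
  elim: s => [|j s [d d0 hd]]; first by exists 1.
  have [d' d'0 hd'] := ex j.
  exists (Num.min d d'); first by rewrite lt_min d0.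
  move=> i; rewrite inE => /orP[/eqP ->|/hd].
    by apply: mono hd' _ _; [rewrite lt_min d0|rewrite ge_min lexx orbT].
  by move=> hi; apply: mono hi _ _; [rewrite lt_min d0|rewrite ge_min lexx].
have [d d0 hd] := h (enum 'I_p).
by exists d => // j; apply: hd; rewrite mem_enum.
Qed.

Lemma fin_bound p (Q : 'I_p -> R -> Prop) :
  (forall j c c', Q j c -> c <= c' -> Q j c') ->
  (forall j, exists c, Q j c) -> exists2 c, 0 <= c & forall j, Q j c.
Proof.
move=> mono /choice[c hc]; exists (\sum_j `|c j|); first exact: sumr_ge0.
move=> j; apply: mono (hc j) _; apply: le_trans (ler_norm _) _.
by rewrite (bigD1 j)//= lerDl sumr_ge0.
Qed.

Lemma mx11D (X Y : 'M[R]_1) : (X + Y) 0 0 = X 0 0 + Y 0 0.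
Proof. by rewrite mxE. Qed.

Lemma mx11B (X Y : 'M[R]_1) : (X - Y) 0 0 = X 0 0 - Y 0 0.
Proof. by rewrite !mxE. Qed.

Lemma mx11Z c (X : 'M[R]_1) : (c *: X) 0 0 = c * X 0 0.
Proof. by rewrite mxE. Qed.

Lemma row_bound p (r : 'rV[R]_p) (h : 'cV[R]_p) C : (forall j, `|r 0 j| <= C) ->
  `|(r *m h) 0 0| <= C * nrm h.
Proof.
move=> rC; rewrite mxE mulr_sumr; apply: le_trans (ler_norm_sum _ _ _) _.
by apply: ler_sum => j _; rewrite normrM ler_wpM2r.
Qed.

Variables (G : R -> 'cV[R]_n -> 'cV[R]_m -> R) (Gx : R -> 'cV[R]_n -> 'cV[R]_m -> 'rV[R]_n)
  (Gu : R -> 'cV[R]_n -> 'cV[R]_m -> 'rV[R]_m).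
Hypothesis hG : smooth G Gx Gu.

Lemma smooth_grad_bound M : exists2 C, 0 <= C & forall t x u, I01 t -> nrm x <= M -> nrm u <= M ->
  (forall j, `|Gx t x u 0 j| <= C) /\ (forall j, `|Gu t x u 0 j| <= C).
Proof.
have [|j|C1 C10 h1] := @fin_bound n (fun j C => forall t x u, I01 t -> nrm x <= M -> nrm u <= M -> `|Gx t x u 0 j| <= C).
- by move=> j c c' h cc t x u It xM uM; apply: le_trans cc; exact: h.
- have [C hC] := extc_bounded M (sm_contx hG (j := j)).
  exists C => t x u It xM uM.
  by have := hC (t, x, u) (And3 It xM uM); rewrite /extc /= clampE.
have [|j|C2 C20 h2] := @fin_bound m (fun j C => forall t x u, I01 t -> nrm x <= M -> nrm u <= M -> `|Gu t x u 0 j| <= C).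
- by move=> j c c' h cc t x u It xM uM; apply: le_trans cc; exact: h.
- have [C hC] := extc_bounded M (sm_contu hG (j := j)).
  exists C => t x u It xM uM.
  by have := hC (t, x, u) (And3 It xM uM); rewrite /extc /= clampE.
exists (C1 + C2); first exact: addr_ge0.
move=> t x u It xM uM; split=> j.
  by apply: le_trans (h1 _ _ _ _ It xM uM) _; rewrite lerDl.
by apply: le_trans (h2 _ _ _ _ It xM uM) _; rewrite lerDr.
Qed.

Lemma smooth_lip M : exists2 C, 0 <= C & forall t x u h k, I01 t ->
  nrm x + nrm h <= M -> nrm u + nrm k <= M ->
  `|G t (x + h) (u + k) - G t x u| <= C * (nrm h + nrm k).
Proof.
have [C C0 hC] := smooth_grad_bound M.
exists C => // t x u h k It xM uM.
have [s /andP[s0 s1] ->] := sm_mvt hG x u h k It.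
have b p (q r : 'cV[R]_p) : nrm q + nrm r <= M -> nrm (q + s *: r) <= M.
  move=> qr; apply: le_trans (nrmD _ _) (le_trans _ qr); rewrite lerD2l nrmZ ger0_norm//.
  by rewrite ler_piMl// nrm_ge0.
have [h1 h2] := hC t _ _ It (b _ _ _ xM) (b _ _ _ uM).
rewrite mxE; apply: le_trans (ler_normD _ _) _; rewrite mulrDr.
by apply: lerD; exact: row_bound.
Qed.

(** The gradients at the intermediate point of the mean value formula differ from those at the base
    point by at most [e], by uniform continuity near the compact box. *)
Lemma smooth_lin M e : 0 < e -> exists2 d, 0 < d & forall t x u h k, I01 t ->
  nrm x <= M -> nrm u <= M -> nrm h <= d -> nrm k <= d ->
  `|G t (x + h) (u + k) - G t x u - (Gx t x u *m h + Gu t x u *m k) 0 0| <= e * (nrm h + nrm k).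
Proof.
move=> e0.
have [|j|d1 d10 h1] := @fin_pos n (fun j d => forall t x u x' u', I01 t -> nrm x <= M -> nrm u <= M ->
  nrm (x - x') <= d -> nrm (u - u') <= d -> `|Gx t x u 0 j - Gx t x' u' 0 j| <= e).
- move=> j d d' h d'0 dd t x u x' u' It xM uM xd ud.
  by apply: h => //; exact: le_trans dd.
- have [d d0 hd] := extc_unif M (sm_contx hG (j := j)) e0.
  exists d => // t x u x' u' It xM uM xd ud.
  by have := hd t x u x' u' (And3 It xM uM) xd ud; rewrite /extc /= clampE.
have [|j|d2 d20 h2] := @fin_pos m (fun j d => forall t x u x' u', I01 t -> nrm x <= M -> nrm u <= M ->
  nrm (x - x') <= d -> nrm (u - u') <= d -> `|Gu t x u 0 j - Gu t x' u' 0 j| <= e).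
- move=> j d d' h d'0 dd t x u x' u' It xM uM xd ud.
  by apply: h => //; exact: le_trans dd.
- have [d d0 hd] := extc_unif M (sm_contu hG (j := j)) e0.
  exists d => // t x u x' u' It xM uM xd ud.
  by have := hd t x u x' u' (And3 It xM uM) xd ud; rewrite /extc /= clampE.
exists (Num.min d1 d2); first by rewrite lt_min d10.
move=> t x u h k It xM uM; rewrite !le_min => /andP[hd1 hd2] /andP[kd1 kd2].
have [s /andP[s0 s1] ->] := sm_mvt hG x u h k It.
have b p (q r : 'cV[R]_p) (d : R) : nrm r <= d -> nrm (q - (q + s *: r)) <= d.
  move=> rd; rewrite opprD addrA subrr add0r nrmN nrmZ ger0_norm//.
  by apply: le_trans rd; rewrite ler_piMl// nrm_ge0.
set gx' := Gx t (x + _) _; set gu' := Gu t (x + _) _.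
have -> : (gx' *m h + gu' *m k) 0 0 - (Gx t x u *m h + Gu t x u *m k) 0 0 =
    ((gx' - Gx t x u) *m h) 0 0 + ((gu' - Gu t x u) *m k) 0 0.
  by rewrite !mulmxBl !(mx11B, mx11D); ring.
apply: le_trans (ler_normD _ _) _; rewrite mulrDr.
apply: lerD; apply: row_bound => j; rewrite mxE [X in _ + X]mxE distrC.
  by apply: h1 => //; exact: b.
by apply: h2 => //; exact: b.
Qed.

(** The order of quantifiers matters: [C] is fixed before [e]. It multiplies the gap between the
    true state increment [h] and its linearization [s *: y], and becomes the modulus in the Gronwall
    estimate of that gap. *)
Lemma smooth_perturb M : exists2 C, 0 <= C & forall e, 0 < e -> exists2 d, 0 < d &
  forall t x u h k y v s, I01 t -> nrm x <= M -> nrm u <= M -> nrm h <= d -> nrm k <= d -> k = s *: v ->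
  `|G t (x + h) (u + k) - G t x u - s * (Gx t x u *m y + Gu t x u *m v) 0 0| <=
    e * (nrm h + nrm k) + C * nrm (h - s *: y).
Proof.
have [C C0 hC] := smooth_grad_bound M.
exists C => // e e0; have [d d0 hd] := smooth_lin M e0.
exists d => // t x u h k y v s It xM uM xd ud ek.
have -> : s * (Gx t x u *m y + Gu t x u *m v) 0 0 =
    (Gx t x u *m h + Gu t x u *m k) 0 0 - (Gx t x u *m (h - s *: y)) 0 0.
  by rewrite ek mulmxBr -!scalemxAr !(mx11B, mx11D) !mx11Z; ring.
rewrite opprB addrA [_ + _ - _]addrAC; apply: le_trans (ler_normD _ _) _.
apply: lerD; first exact: hd.
by apply: row_bound; case: (hC t x u It xM uM).
Qed.

End Estimates.

(** * Truncation in value and in time *)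

Section Clip.
Context {R : realType}.

(** Componentwise truncation, nonexpansive for [nrm] and the identity on its unit ball: it makes
    locally Lipschitz dynamics globally Lipschitz. *)
Definition clip p (x : 'cV[R]_p) : 'cV[R]_p := \col_i Num.max (-1) (Num.min 1 (x i 0)).

Lemma clip_lip p (x y : 'cV[R]_p) : nrm (clip x - clip y) <= nrm (x - y).
Proof.
have maxl (a r s : R) : `|Num.max a r - Num.max a s| <= `|r - s|.
  have h := ler_norm (r - s); have h' := ler_norm (s - r); rewrite (distrC s r) in h'.
  by rewrite ler_norml; case: (leP a r); case: (leP a s) => *; apply/andP; split; lra.
have minl (a r s : R) : `|Num.min a r - Num.min a s| <= `|r - s|.
  have h := ler_norm (r - s); have h' := ler_norm (s - r); rewrite (distrC s r) in h'.
  by rewrite ler_norml; case: (leP a r); case: (leP a s) => *; apply/andP; split; lra.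
by apply: ler_sum => i _; rewrite !mxE; exact: le_trans (maxl _ _ _) (minl _ _ _).
Qed.

Lemma clip_bound p (x : 'cV[R]_p) : nrm (clip x) <= p%:R.
Proof.
rewrite /nrm -[p in p%:R](card_ord p) -sumr_const; apply: ler_sum => i _.
rewrite mxE ler_norml; apply/andP; split; first by rewrite le_max lexx.
by rewrite ge_max ge_min lexx/= andbT; lra.
Qed.

Lemma clip_id p (x : 'cV[R]_p) : nrm x <= 1 -> clip x = x.
Proof.
move=> x1; apply/colP => i; rewrite mxE.
have := le_trans (ler_nrm x i) x1; rewrite ler_norml => /andP[h1 h2].
by rewrite min_r// max_r.
Qed.

Lemma clip_le p (x : 'cV[R]_p) : nrm (clip x) <= nrm x.
Proof.
by have := clip_lip x 0; rewrite [clip 0]clip_id ?nrm0// !subr0.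
Qed.

Lemma clip_meas p (x : R -> 'cV[R]_p) : vmeas x -> vmeas (fun t => clip (x t)).
Proof.
move=> mx i; under eq_fun do rewrite mxE.
apply: meas_max; first exact: meas_cst.
by apply: measurable_minr; [exact: meas_cst|exact: mx].
Qed.

(** Used to replace coefficients by 0 off a good set of full measure, so that bounds and
    measurability hold at every time and not only almost everywhere. *)
Definition zoff (V : zmodType) (D : set R) (X : R -> V) (t : R) : V := if t \in D then X t else 0.

Lemma zoff_in (V : zmodType) D (X : R -> V) t : D t -> zoff D X t = X t.
Proof. by move=> Dt; rewrite /zoff mem_set. Qed.

Lemma zoff_out (V : zmodType) D (X : R -> V) t : ~ D t -> zoff D X t = 0.
Proof. by move=> Dt; rewrite /zoff memNset. Qed.

Lemma vmeas_zoff p D (x : R -> 'cV[R]_p) : mset D -> vmeas x -> vmeas (zoff D x).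
Proof.
move=> mD mx i; have := meas_if mD (mx i) (meas_cst 0).
congr meas; apply/funext => t; rewrite /zoff; case: (_ \in _) => //; by rewrite mxE.
Qed.

Lemma nrm_zoff p D (x : R -> 'cV[R]_p) M t : (forall t, D t -> nrm (x t) <= M) -> 0 <= M ->
  nrm (zoff D x t) <= M.
Proof.
move=> xM M0; have [Dt|Dt] := pselect (D t); first by rewrite zoff_in// xM.
by rewrite zoff_out// nrm0.
Qed.

End Clip.

(** * Nonlinear perturbations *)

Lemma nrm_le {R : realType} p (x : 'cV[R]_p) c : (forall i, `|x i 0| <= c) -> nrm x <= p%:R * c.
Proof.
move=> xc; rewrite mulr_natl -[in leRHS](card_ord p) -sumr_const.
by apply: ler_sum => i _.
Qed.

Section Perturbation.
Context {R : realType} {n m : nat}.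
Variables (f : R -> 'cV[R]_n -> 'cV[R]_m -> 'cV[R]_n)
  (fx : R -> 'cV[R]_n -> 'cV[R]_m -> 'M[R]_(n, n)) (fu : R -> 'cV[R]_n -> 'cV[R]_m -> 'M[R]_(n, m)).
Hypothesis hf : forall i, smooth (fun t x u => f t x u i 0)
  (fun t x u => row i (fx t x u)) (fun t x u => row i (fu t x u)).
Variables (D : set R) (xb : R -> 'cV[R]_n) (ub : R -> 'cV[R]_m) (M : R).
Hypotheses (mD : mset D) (DI : D `<=` I01) (mxb : vmeas xb) (mub : vmeas ub)
  (xM : forall t, nrm (xb t) <= M) (uM : forall t, nrm (ub t) <= M) (M0 : 0 <= M).
Variables (v : R -> 'cV[R]_m) (tau : R).
Hypotheses (mv : vmeas v) (vM : forall t, D t -> nrm (v t) <= M)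
  (v0 : forall t, t <= tau -> v t = 0).

Local Notation vv := (zoff D v).
Let mvv : vmeas vv. Proof. exact: vmeas_zoff. Qed.
Let vvM t : nrm (vv t) <= M. Proof. exact: nrm_zoff. Qed.

(** The equation is written for the increment of the state, with clipped argument; the clip is
    inactive along the small solutions finally obtained. *)
Let rhs s t (xi : 'cV[R]_n) := zoff D (fun t => f t (xb t + clip xi) (ub t + s *: vv t) - f t (xb t) (ub t)) t.

Let f_meas x u : vmeas x -> vmeas u -> vmeas (zoff D (fun t => f t (x t) (u t))).
Proof.
move=> mx mu.
have -> : zoff D (fun t => f t (x t) (u t)) = zoff D (fun t => \col_i extc (fun t x u => f t x u i 0) (t, x t, u t)).
  apply/funext => t; have [Dt|Dt] := pselect (D t); last by rewrite !zoff_out.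
  by rewrite !zoff_in//; apply/colP => i; rewrite mxE /extc/= clampE//; exact: DI.
apply: vmeas_zoff => // i; under eq_fun do rewrite mxE.
by apply: extc_meas => //; exact: (sm_cont (hf i)).
Qed.

Let rhs_meas s x : vmeas x -> vmeas (fun t => rhs s t (x t)).
Proof.
move=> mx.
have h1 : vmeas (fun t => xb t + clip (x t)) by apply: vmeasD => //; exact: clip_meas.
have h2 : vmeas (fun t => ub t + s *: vv t) by apply: vmeasD => //; apply: vmeasZ => //; exact: meas_cst.
have := vmeasB (f_meas h1 h2) (f_meas mxb mub); congr vmeas; apply/funext => t.
by rewrite /rhs /zoff; case: (_ \in _) => //; rewrite subrr.
Qed.

(** Room for [xb + clip y] plus a difference of two clipped vectors, at most [M + 3 n], and for
    [ub + s v], at most [2 M]. *)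
Let M2 : R := 2 * M + 3 * n%:R + 1.

Let f_lip : exists2 L, 0 <= L & forall t x u h k, I01 t -> nrm x + nrm h <= M2 -> nrm u + nrm k <= M2 ->
  nrm (f t (x + h) (u + k) - f t x u) <= L * (nrm h + nrm k).
Proof.
have [|i|C C0 hC] := @fin_bound R n (fun i C => forall t x u h k, I01 t -> nrm x + nrm h <= M2 -> nrm u + nrm k <= M2 ->
  `|f t (x + h) (u + k) i 0 - f t x u i 0| <= C * (nrm h + nrm k)).
- move=> i c c' h cc t x u h' k It x1 u1; apply: le_trans (h _ _ _ _ _ It x1 u1) _.
  by rewrite ler_wpM2r// addr_ge0// nrm_ge0.
- by have [C _ hC] := smooth_lip (hf i) M2; exists C.
exists (n%:R * C); first by rewrite mulr_ge0.
move=> t x u h k It x1 u1; rewrite -mulrA; apply: nrm_le => i.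
by rewrite cvBE; exact: hC.
Qed.

Let rhs_lip : exists2 L, 0 <= L & forall s t, 0 <= s <= 1 ->
  (forall x y, nrm (rhs s t x - rhs s t y) <= L * nrm (x - y)) /\
  (forall x, nrm (rhs s t x) <= L * (nrm x + s * nrm (vv t))).
Proof.
have [L L0 hL] := f_lip; exists L => // s t /andP[s0 s1].
have svM : nrm (s *: vv t) <= M.
  by rewrite nrmZ ger0_norm//; apply: le_trans (vvM t); rewrite ler_piMl// nrm_ge0.
have p0 : 0 <= n%:R :> R by [].
have [Dt|Dt] := pselect (D t); last first.
  split=> [x y|x]; rewrite /rhs !zoff_out ?subrr ?nrm0//; first by rewrite mulr_ge0 ?nrm_ge0.
  by rewrite mulr_ge0 ?addr_ge0 ?mulr_ge0 ?nrm_ge0.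
have xt := xM t; have ut := uM t.
have vt : vv t = v t by rewrite zoff_in.
rewrite vt in svM *; split=> [x y|x]; rewrite /rhs !zoff_in//.
  rewrite opprB addrA subrK.
  have -> : xb t + clip x = xb t + clip y + (clip x - clip y) by rewrite -addrA subrKC.
  have := hL t (xb t + clip y) (ub t + s *: v t) (clip x - clip y) 0 (DI Dt).
  rewrite addr0 nrm0 !addr0 => h; apply: le_trans (h _ _) _.
  - have := nrmD (xb t) (clip y); have := nrmB (clip x) (clip y).
    have := clip_bound x; have := clip_bound y; have := M0; rewrite /M2; lra.
  - by have := nrmD (ub t) (s *: v t); have := M0; rewrite /M2; lra.
  - by rewrite ler_wpM2l// clip_lip.
apply: le_trans (hL t _ _ _ _ (DI Dt) _ _) _.
- by have := clip_bound x; have := M0; rewrite /M2; lra.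
- by have := M0; rewrite /M2; lra.
- by rewrite ler_wpM2l// nrmZ ger0_norm// lerD2r clip_le.
Qed.

(** Gronwall bounds the solution by [s * C1], so under [s * C1 <= 1] the clip disappears and the
    true nonlinear equation holds. Up to [tau] the control is unperturbed and the forcing is 0,
    whence [xi = 0] there. *)
Lemma perturbation : exists2 C1, 0 <= C1 & forall s, 0 < s <= 1 -> s * C1 <= 1 ->
  exists xi F, [/\ vmeas xi, vL1 F, (forall t i, I01 t -> xi t i 0 = ig (upto t) (fun r => F r i 0)),
    forall t, D t -> F t = f t (xb t + xi t) (ub t + s *: vv t) - f t (xb t) (ub t) &
    [/\ forall t, ~ D t -> F t = 0, forall t, I01 t -> nrm (xi t) <= s * C1 &
        forall t, I01 t -> t <= tau -> xi t = 0]].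
Proof.
have [L L0 hL] := rhs_lip.
have l0 (t : R) : 0 <= L by [].
have [W [C hW]] := weight_upto (meas_cst L) (L1_cst L) l0.
have C0 : 0 <= C.
  case: hW => _ h _; have I0 : I01 (0 : R) by rewrite /I01 /= in_itv/= lexx ler01.
  by have /andP[h1 h2] := h 0 I0; exact: le_trans (le_trans ler01 h1) h2.
exists (2 * (L * M) * C); first by rewrite !mulr_ge0.
move=> s /andP[s0 s1] sC.
have sI : 0 <= s <= 1 by rewrite ltW.
have [|||xi [mxi [N xiN] hF exi]] := @Volterra_solution R upto (fun _ => L) W C sweep_upto
    (meas_cst L) (L1_cst L) l0 hW n (rhs s) 0.
- by move=> t x y _; exact: (hL s t sI).1.
- exact: rhs_meas.
- apply: (@vL1_dom _ _ _ (fun t => L * (s * M))).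
  + exact: (@rhs_meas s (fun _ => 0) (vmeas_cst 0)).
  + exact: L1_cst.
  + move=> t _; apply: le_trans ((hL s t sI).2 _) _; rewrite nrm0 add0r ler_wpM2l//.
    by rewrite ler_wpM2l// ltW.
have ex0 t i : I01 t -> xi t i 0 = ig (upto t) (fun r => rhs s r (xi r) i 0).
  by move=> It; rewrite exi// mxE add0r.
have mn := meas_nrm mxi.
have hn : L1 (fun t => L * nrm (xi t)).
  apply: L1Z; apply: (@L1_bounded _ _ N) => // t _; by rewrite ger0_norm ?nrm_ge0.
have step t : I01 t -> nrm (xi t) <= ig (upto t) (fun r => nrm (rhs s r (xi r))).
  move=> It; have -> : xi t = \col_i ig (upto t) (fun r => rhs s r (xi r) i 0).
    by apply/colP => i; rewrite mxE ex0.
  by apply: nrm_ig hF; [exact: mset_upto|exact: upto_sub].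
have sLM : 0 <= L * (s * M) by rewrite !mulr_ge0// ltW.
have xiC t : I01 t -> nrm (xi t) <= s * (2 * (L * M) * C).
  move=> It; have -> : s * (2 * (L * M) * C) = 2 * (L * (s * M)) * C by ring.
  apply: (@Gronwall R upto (fun _ => L) W C sweep_upto (meas_cst L) (L1_cst L) l0 hW
    _ (L * (s * M)) N mn _ _ sLM t It).
    by move=> r _; rewrite nrm_ge0 xiN.
  move=> r Ir; apply: le_trans (step r Ir) _.
  apply: (@le_trans _ _ (ig (upto r) (fun q => L * (s * M) + L * nrm (xi q)))).
    apply: ig_le; [exact: mset_upto|exact: upto_sub|exact: L1_nrm|by apply: L1D => //; exact: L1_cst|].
    move=> q _; apply: le_trans ((hL s q sI).2 _) _; rewrite mulrDr addrC lerD2r ler_wpM2l//.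
    by rewrite ler_wpM2l// ltW.
  rewrite (igD (mset_upto r) (@upto_sub _ r) (L1_cst _) hn) lerD2r.
  apply: (@le_trans _ _ (ig I01 (fun _ => L * (s * M)))).
    apply: ig_subset; [exact: mset_upto|exact: mset_I01|exact: upto_sub|by []|exact: L1_cst|by move=> q _].
  by rewrite ig1_cst.
have cxi t : I01 t -> clip (xi t) = xi t.
  by move=> It; apply: clip_id; apply: le_trans (xiC t It) sC.
exists xi, (fun t => rhs s t (xi t)); split => //.
  by move=> t Dt; rewrite /rhs zoff_in// cxi//; exact: DI.
split => //; first by move=> t Dt; rewrite /rhs zoff_out.
(* The part of [nrm (xi t)] before [tau], extended by 0: it satisfies the Gronwall inequality with
   constant 0 on all of [[0,1]]. *)
pose e t := if t \in [set r : R | r <= tau] then nrm (xi t) else 0.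
have mtau : mset [set r : R | r <= tau].
  have -> : [set r : R | r <= tau] = [set` `]-oo, tau]] by apply/seteqP; split=> r /=; rewrite in_itv.
  exact: mset_itv.
have me : meas e by apply: meas_if => //; exact: meas_cst.
have ein t : t <= tau -> e t = nrm (xi t) by move=> tt; rewrite /e mem_set.
have e0 t : 0 <= e t by rewrite /e; case: ifP; rewrite ?nrm_ge0.
have N0 : 0 <= N by exact: le_trans (nrm_ge0 _) (xiN 0).
have eN t : e t <= N by rewrite /e; case: ifP.
have he : L1 (fun t => L * e t).
  by apply: L1Z; apply: (@L1_bounded _ _ N) => // t _; rewrite ger0_norm.
move=> t It tt; apply: nrm_eq0; rewrite -ein//.
have := @Gronwall R upto (fun _ => L) W C sweep_upto (meas_cst L) (L1_cst L) l0 hW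
    e 0 N me _ _ (lexx 0) t It.
rewrite mulr0 mul0r; apply.
  by move=> r _; rewrite e0 eN.
move=> r Ir; rewrite add0r; have [rt|rt] := leP r tau; last first.
  rewrite {1}/e memNset/=; last by apply/negP; rewrite -ltNge.
  by apply: ig_ge0 => q _; rewrite mulr_ge0.
rewrite (ein _ rt); apply: le_trans (step r Ir) _.
apply: ig_le; [exact: mset_upto|exact: upto_sub|exact: L1_nrm|exact: he|].
move=> q [Iq]; rewrite /= in_itv/= => qr; have qt := le_trans qr rt.
apply: le_trans ((hL s q sI).2 _) _.
have -> : vv q = 0 by rewrite /zoff v0//; case: ifP.
by rewrite nrm0 mulr0 addr0 ein.
Qed.

(** The gap [xi - s *: y] satisfies an integral inequality whose forcing is [n * e1 * s * (C1 + M)].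
    Gronwall multiplies it by [2 * C], and [Q] is chosen so that the result stays below [e * s]. *)
Lemma perturbation_linearized y : vmeas y -> (forall t, I01 t -> nrm (y t) <= M) ->
  vL1 (fun s => zoff D (fun t => fx t (xb t) (ub t)) s *m y s +
                zoff D (fun t => fu t (xb t) (ub t)) s *m v s) ->
  (forall t i, I01 t -> y t i 0 =
     ig (upto t) (fun s => (zoff D (fun t => fx t (xb t) (ub t)) s *m y s +
                            zoff D (fun t => fu t (xb t) (ub t)) s *m v s) i 0)) ->
  forall C1 e, 0 <= C1 -> 0 < e -> exists2 s1, 0 < s1 & forall s xi F, 0 < s <= s1 -> s <= 1 ->
    vmeas xi -> vL1 F -> (forall t i, I01 t -> xi t i 0 = ig (upto t) (fun r => F r i 0)) ->
    (forall t, D t -> F t = f t (xb t + xi t) (ub t + s *: vv t) - f t (xb t) (ub t)) ->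
    (forall t, ~ D t -> F t = 0) -> (forall t, I01 t -> nrm (xi t) <= s * C1) ->
    forall t, I01 t -> nrm (xi t - s *: y t) <= e * s.
Proof.
move=> my yM hy ey C1 e C10 e0.
have hC1 : C1 <= 1 + (C1 + M) by rewrite addrCA lerDl addr_ge0.
have hM1 : M <= 1 + (C1 + M) by rewrite addrA lerDr addr_ge0.
pose A := zoff D (fun t => fx t (xb t) (ub t)); pose B := zoff D (fun t => fu t (xb t) (ub t)).
have [|i|L L0 hL] := @fin_bound R n (fun i C => forall e, 0 < e -> exists2 d, 0 < d &
  forall t x u h k y v s, I01 t -> nrm x <= M -> nrm u <= M -> nrm h <= d -> nrm k <= d -> k = s *: v ->
  `|f t (x + h) (u + k) i 0 - f t x u i 0 - s * (row i (fx t x u) *m y + row i (fu t x u) *m v) 0 0| <=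
    e * (nrm h + nrm k) + C * nrm (h - s *: y)).
- move=> i c c' h cc e' e'0; have [d d0 hd] := h e' e'0; exists d => //.
  move=> t x u h' k y' v' s It x1 u1 h1 k1 kv; apply: le_trans (hd _ _ _ _ _ y' _ _ It x1 u1 h1 k1 kv) _.
  by rewrite lerD2l ler_wpM2r// nrm_ge0.
- by have [C _ hC] := smooth_perturb (hf i) M; exists C.
pose LL := n%:R * L; have LL0 : 0 <= LL by rewrite mulr_ge0.
have l0 (t : R) : 0 <= LL by [].
have [W [C hW]] := weight_upto (meas_cst LL) (L1_cst LL) l0.
have C0 : 0 <= C.
  case: hW => _ h _; have I0 : I01 (0 : R) by rewrite /I01 /= in_itv/= lexx ler01.
  by have /andP[h1 h2] := h 0 I0; exact: le_trans (le_trans ler01 h1) h2.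
pose Q := 1 + 2 * n%:R * (C1 + M) * C.
have Q0 : 0 < Q by rewrite ltr_pwDl// !mulr_ge0// addr_ge0.
pose e1 := e / Q; have e10 : 0 < e1 by rewrite divr_gt0.
have [|i|d d0 hd] := @fin_pos R n (fun i d => forall t x u h k y v s, I01 t -> nrm x <= M -> nrm u <= M -> nrm h <= d -> nrm k <= d -> k = s *: v ->
  `|f t (x + h) (u + k) i 0 - f t x u i 0 - s * (row i (fx t x u) *m y + row i (fu t x u) *m v) 0 0| <=
    e1 * (nrm h + nrm k) + L * nrm (h - s *: y)).
- move=> i d d' h d'0 dd t x u h' k y' v' s It x1 u1 h1 k1 kv.
  by apply: h => //; exact: le_trans dd.
- exact: hL i e1 e10.
have CM : 0 < 1 + (C1 + M) by rewrite ltr_pwDl// addr_ge0.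
exists (d / (1 + (C1 + M))); first by rewrite divr_gt0.
move=> s xi F /andP[s0 sd] s1 mxi hF exi FD Fout xiC t It.
have sd' : s * (1 + (C1 + M)) <= d by rewrite -ler_pdivlMr.
have sC1 : s * C1 <= d by apply: le_trans sd'; rewrite ler_pM2l.
have sM : s * M <= d by apply: le_trans sd'; rewrite ler_pM2l.
have svM r : nrm (s *: vv r) <= s * M by rewrite nrmZ gtr0_norm// ler_pM2l.
have k0 : 0 <= n%:R * (e1 * (s * (C1 + M))) by rewrite mulr_ge0// mulr_ge0 ?(ltW e10)// mulr_ge0 ?(ltW s0)// addr_ge0.
pose E r := F r - s *: (A r *m y r + B r *m v r).
have Eb r : I01 r -> nrm (E r) <= n%:R * (e1 * (s * (C1 + M))) + LL * nrm (xi r - s *: y r).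
  move=> Ir; have [Dr|Dr] := pselect (D r); last first.
    rewrite /E /A /B !zoff_out// !mul0mx addr0 scaler0 subr0 Fout// nrm0.
    by rewrite addr_ge0// mulr_ge0// nrm_ge0.
  rewrite /LL -mulrA -mulrDr; apply: nrm_le => i.
  have vr : vv r = v r by rewrite zoff_in.
  have -> : E r i 0 = f r (xb r + xi r) (ub r + s *: vv r) i 0 - f r (xb r) (ub r) i 0
      - s * (row i (fx r (xb r) (ub r)) *m y r + row i (fu r (xb r) (ub r)) *m vv r) 0 0.
    rewrite /E cvBE cvZE FD// cvBE /A /B !zoff_in// -!row_mul -linearD/=.
    by congr (_ - _ * _); rewrite [RHS]mxE.
  apply: le_trans (hd i _ _ _ _ _ (y r) (vv r) s Ir (xM r) (uM r) _ _ erefl) _.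
  - exact: le_trans (xiC r Ir) sC1.
  - exact: le_trans (svM r) sM.
  - by rewrite lerD2r ler_pM2l// mulrDr lerD// xiC.
have hE : vL1 E.
  by move=> i; under eq_fun do rewrite cvBE cvZE; apply: L1B => //; exact: L1Z.
pose er r := nrm (xi r - s *: y r).
have mer : meas er by apply: meas_nrm; apply: vmeasB => //; apply: vmeasZ => //; exact: meas_cst.
have erM r : I01 r -> 0 <= er r <= s * C1 + s * M.
  move=> Ir; rewrite nrm_ge0/=; apply: le_trans (nrmB _ _) _; apply: lerD; first exact: xiC.
  by rewrite nrmZ gtr0_norm// ler_pM2l// yM.
have her : L1 (fun r => LL * er r).
  apply: L1Z; apply: (@L1_bounded _ _ (s * C1 + s * M)) => // r Ir.
  by have /andP[h1 h2] := erM r Ir; rewrite ger0_norm.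
have := @Gronwall R upto (fun _ => LL) W C sweep_upto (meas_cst LL) (L1_cst LL) l0 hW
  er (n%:R * (e1 * (s * (C1 + M)))) (s * C1 + s * M) mer erM _ k0 t It.
move=> h; apply: le_trans (h _) _; last first.
  have -> : e * s = e1 * Q * s by rewrite /e1 divfK// gt_eqF.
  have : 0 <= e1 * s by rewrite mulr_ge0// ltW.
  have -> : e1 * Q * s = e1 * s + 2 * (n%:R * (e1 * (s * (C1 + M)))) * C by rewrite /Q; ring.
  by rewrite lerDr.
move=> r Ir.
have -> : er r = nrm (\col_i ig (upto r) (fun q => E q i 0)).
  congr nrm; apply/colP => i; rewrite mxE cvBE cvZE exi// ey//.
  rewrite -(igZ s (mset_upto r) (@upto_sub _ r) (hy i)).
  rewrite -(igB (mset_upto r) (@upto_sub _ r) (hF i) (L1Z s (hy i))).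
  by apply: ig_eq => q _; rewrite /E cvBE cvZE.
apply: le_trans (nrm_ig (mset_upto r) (@upto_sub _ r) hE) _.
apply: (@le_trans _ _ (ig (upto r) (fun q => n%:R * (e1 * (s * (C1 + M))) + LL * er q))).
  apply: ig_le; [exact: mset_upto|exact: upto_sub|exact: L1_nrm|by apply: L1D => //; exact: L1_cst|].
  by move=> q [Iq _]; exact: Eb.
rewrite (igD (mset_upto r) (@upto_sub _ r) (L1_cst _) her) lerD2r.
apply: (@le_trans _ _ (ig I01 (fun _ => n%:R * (e1 * (s * (C1 + M)))))).
  apply: ig_subset; [exact: mset_upto|exact: mset_I01|exact: upto_sub|by []|exact: L1_cst|by move=> q _].
by rewrite ig1_cst.
Qed.

End Perturbation.

(** * First-order necessary condition along bounded directions *)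

Section FirstOrderExpansion.
Context {R : realType} {n m : nat}.
Variables (D : set R) (xb : R -> 'cV[R]_n) (ub : R -> 'cV[R]_m) (M : R).
Hypotheses (mD : mset D) (DI : D `<=` I01) (mxb : vmeas xb) (mub : vmeas ub)
  (xM : forall t, nrm (xb t) <= M) (uM : forall t, nrm (ub t) <= M) (M0 : 0 <= M).

Lemma mxfield_le p q (X : R -> 'M[R]_(p, q)) C C' : C <= C' -> mxfield X C -> mxfield X C'.
Proof.
move=> CC [mX bX]; split=> // t x; apply: le_trans (bX t x) _.
by rewrite ler_wpM2r// nrm_ge0.
Qed.

Lemma mxfield_zoff p q (X : R -> 'cV[R]_n -> 'cV[R]_m -> 'M[R]_(p, q)) :
  (forall i j, continuous (extc (fun t x u => X t x u i j))) ->
  exists2 K, 0 <= K & mxfield (zoff D (fun t => X t (xb t) (ub t))) K.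
Proof.
move=> cX.
have [|i|K K0 hK] := @fin_bound R p (fun i K => forall j t, D t -> `|X t (xb t) (ub t) i j| <= K).
- by move=> i K K' h KK j t Dt; apply: le_trans KK; exact: h.
- have [|j|K K0 hK] := @fin_bound R q (fun j K => forall t, D t -> `|X t (xb t) (ub t) i j| <= K).
  + by move=> j K K' h KK t Dt; apply: le_trans KK; exact: h.
  + have [C hC] := extc_bounded M (cX i j); exists C => t Dt.
    by have := hC (t, xb t, ub t) (And3 (DI Dt) (xM t) (uM t)); rewrite /extc/= clampE//; exact: DI.
  + by exists K.
exists (p%:R * K); first by rewrite mulr_ge0.
apply: mxfield_of_entries => // [i j|t i j].
  have := meas_if mD (extc_meas (cX i j) mxb mub) (meas_cst 0).
  congr meas; apply/funext => t; rewrite /zoff; case: ifPn => [/set_mem Dt|_]; last by rewrite mxE.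
  by rewrite /extc/= clampE//; exact: DI.
have [Dt|Dt] := pselect (D t); first by rewrite zoff_in// hK.
by rewrite zoff_out// mxE normr0.
Qed.

Lemma zoff_meas (G : R -> 'cV[R]_n -> 'cV[R]_m -> R) x u : continuous (extc G) -> vmeas x -> vmeas u ->
  meas (zoff D (fun t => G t (x t) (u t))).
Proof.
move=> cG mx mu; have := meas_if mD (extc_meas cG mx mu) (meas_cst 0).
congr meas; apply/funext => t; rewrite /zoff; case: ifPn => // /set_mem Dt.
by rewrite /extc/= clampE//; exact: DI.
Qed.

Lemma zoff_L1 (G : R -> 'cV[R]_n -> 'cV[R]_m -> R) x u N : continuous (extc G) -> vmeas x -> vmeas u ->
  (forall t, D t -> nrm (x t) <= N /\ nrm (u t) <= N) -> L1 (zoff D (fun t => G t (x t) (u t))).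
Proof.
move=> cG mx mu hN; have [C hC] := extc_bounded N cG.
apply: (@L1_bounded _ _ `|C|); first exact: zoff_meas.
move=> t _; have [Dt|Dt] := pselect (D t); last by rewrite zoff_out// normr0.
have [h1 h2] := hN t Dt; rewrite zoff_in//; apply: le_trans (ler_norm C).
by have := hC (t, x t, u t) (And3 (DI Dt) h1 h2); rewrite /extc/= clampE//; exact: DI.
Qed.

Variables (f : R -> 'cV[R]_n -> 'cV[R]_m -> 'cV[R]_n)
  (fx : R -> 'cV[R]_n -> 'cV[R]_m -> 'M[R]_(n, n)) (fu : R -> 'cV[R]_n -> 'cV[R]_m -> 'M[R]_(n, m)).
Hypothesis hf : forall i, smooth (fun t x u => f t x u i 0)
  (fun t x u => row i (fx t x u)) (fun t x u => row i (fu t x u)).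
Variables (L g : R -> 'cV[R]_n -> 'cV[R]_m -> R) (Lx gx : R -> 'cV[R]_n -> 'cV[R]_m -> 'rV[R]_n)
  (Lu gu : R -> 'cV[R]_n -> 'cV[R]_m -> 'rV[R]_m).
Hypotheses (hL : smooth L Lx Lu) (hg : smooth g gx gu).
Local Notation A := (zoff D (fun t => fx t (xb t) (ub t))).
Local Notation B := (zoff D (fun t => fu t (xb t) (ub t))).
Local Notation a := (zoff D (fun t => gx t (xb t) (ub t))).
Local Notation b := (zoff D (fun t => gu t (xb t) (ub t))).
Local Notation c := (zoff D (fun t => Lx t (xb t) (ub t))).
Local Notation d := (zoff D (fun t => Lu t (xb t) (ub t))).

Lemma fields_exist : exists2 K, 0 <= K &
  [/\ mxfield A K, mxfield B K, mxfield a K & [/\ mxfield b K, mxfield c K & mxfield d K]].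
Proof.
have rowE p q (X : R -> 'cV[R]_n -> 'cV[R]_m -> 'M[R]_(p, q)) i j :
    (fun t x u => row i (X t x u) 0 j) = (fun t x u => X t x u i j).
  by apply/funext => t; apply/funext => x; apply/funext => u; rewrite mxE.
have [|K1 K10 h1] := @mxfield_zoff _ _ fx.
  by move=> i j; have := sm_contx (hf i) (j := j); rewrite rowE.
have [|K2 K20 h2] := @mxfield_zoff _ _ fu.
  by move=> i j; have := sm_contu (hf i) (j := j); rewrite rowE.
have [|K3 K30 h3] := @mxfield_zoff _ _ gx; first by move=> i j; rewrite ord1; exact: (sm_contx hg).
have [|K4 K40 h4] := @mxfield_zoff _ _ gu; first by move=> i j; rewrite ord1; exact: (sm_contu hg).
have [|K5 K50 h5] := @mxfield_zoff _ _ Lx; first by move=> i j; rewrite ord1; exact: (sm_contx hL).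
have [|K6 K60 h6] := @mxfield_zoff _ _ Lu; first by move=> i j; rewrite ord1; exact: (sm_contu hL).
exists (K1 + K2 + K3 + K4 + K5 + K6); first by rewrite !addr_ge0.
by split; [|..|split]; (apply: mxfield_le; [|eassumption]); lra.
Qed.

Variables (K0 : R) (gam : R -> R).
Hypotheses (hA : mxfield A K0) (hB : mxfield B K0) (ha : mxfield a K0)
  (hb : mxfield b K0) (hc : mxfield c K0) (hd : mxfield d K0) (K00 : 0 <= K0).
Hypotheses (gamE : forall t, D t -> gam t = g t (xb t) (ub t)) (gam_le0 : forall t, D t -> gam t <= 0).
Hypothesis opt : exists2 r, 0 < r & forall xi u' F, vmeas xi -> vmeas u' -> vL1 F ->
  (forall t i, I01 t -> xi t i 0 = ig (upto t) (fun r => F r i 0)) ->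
  (forall t, D t -> F t = f t (xb t + xi t) (ub t + u' t) - f t (xb t) (ub t)) ->
  (forall t, I01 t -> nrm (xi t) <= r) -> (forall t, nrm (u' t) <= r) ->
  ae_on D (fun t => g t (xb t + xi t) (ub t + u' t) <= 0) ->
  ig I01 (zoff D (fun t => L t (xb t) (ub t))) <=
  ig I01 (zoff D (fun t => L t (xb t + xi t) (ub t + u' t))).

(** A small step [s] along the direction is feasible, in three regimes: up to [tau] nothing changes;
    where [gam < - e] the change is at most [s * Z <= e] and cannot reach 0; on the almost active
    part the decrease [s * k] outweighs the linearization error. Minimality and the expansion of the
    cost then give [0 <= s * (J + eps)]. *)
Theorem no_strict_descent y v tau e k : direction A B y v ->
  (exists N, forall t, I01 t -> nrm (v t) <= N) -> 0 < tau < 1 ->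
  (forall t, t <= tau -> v t = 0) -> 0 < e -> 0 < k ->
  ae_on (act gam e `&` [set` `]tau, 1]]) (fun t => lform a b y v t <= - k) ->
  0 <= J c d y v.
Proof.
(* Linear arithmetic separated from the terms it is applied to; [aux3] settles the inactive regime
   and [aux4] the almost active one. *)
have aux1 (x1 x2 x3 x4 x5 : R) : x3 <= x4 + x5 -> x1 + x2 + x3 <= 1 + x1 + x2 + x4 + x5 by lra.
have aux2 (x1 x2 x3 x4 : R) : 0 <= x1 -> 0 <= x2 -> 0 <= x3 -> 0 <= x4 ->
  [/\ x1 <= 1 + x1 + x2 + x3 + x4, x2 <= 1 + x1 + x2 + x3 + x4 & x3 + x4 <= 1 + x1 + x2 + x3 + x4].
  by move=> *; split; lra.
have aux3 (p p' w sK sk sm Z q : R) : w <= sK -> sm <= sk -> sK + sk <= Z -> Z <= q ->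
  p < - q -> p' - p - w <= sm -> p' <= 0 by lra.
have aux4 (p p' w sk sm : R) : w <= - sk -> sm <= sk -> p <= 0 -> p' - p - w <= sm -> p' <= 0 by lra.
move=> dy [Nv vN] _ v0 e0 k0 hw; have [Ny yN] := dir_bd dy.
pose N := M + `|Nv| + `|Ny|.
have MN : M <= N by rewrite /N -addrA lerDl addr_ge0.
have NvN : Nv <= N by apply: le_trans (ler_norm _) _; rewrite /N; have := normr_ge0 Ny; have := M0; lra.
have NyN : Ny <= N by apply: le_trans (ler_norm _) _; rewrite /N; have := normr_ge0 Nv; have := M0; lra.
have N0 : 0 <= N by exact: le_trans MN.
have xN t : nrm (xb t) <= N by exact: le_trans MN.
have uN t : nrm (ub t) <= N by exact: le_trans MN.
have vN' t : D t -> nrm (v t) <= N by move=> Dt; apply: le_trans (vN _ (DI Dt)) NvN.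
have yN' t : nrm (y t) <= N by exact: le_trans (yN t) NyN.
have [C1 C10 pert] := perturbation hf mD DI mxb mub xN uN N0 (dir_v dy) vN' v0.
have lin e' := perturbation_linearized hf xN uN N0 vN' (dir_y dy)
  (fun t _ => yN' t) (dir_rhs_L1 hA hB K00 dy) (dir_eq dy) (e := e') C10.
have [CL CL0 pL] := smooth_perturb hL N; have [Cg Cg0 pg] := smooth_perturb hg N.
have [r r0 hopt] := opt.
apply/ler_addgt0Pr => eps eps0.
pose Q := 1 + C1 + N + Cg + CL.
have Q0 : 0 < Q by rewrite /Q -!addrA ltr_pwDl// !addr_ge0.
(* The relative error must stay below [k] to preserve the constraint and below [eps] for the cost;
   [Q] gathers the constants that multiply [e1] in the expansions. *)
pose e1 := Num.min k eps / Q.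
have e10 : 0 < e1 by rewrite divr_gt0// lt_min k0.
have e1Q : e1 * Q = Num.min k eps by rewrite /e1 divfK// gt_eqF.
have [dL dL0 hdL] := pL e1 e10; have [dg dg0 hdg] := pg e1 e10.
have [s1 s10 hs1] := lin e1 e10.
pose Z := 1 + C1 + N + K0 * (N + N) + k.
have Z0 : 0 < Z by rewrite /Z -!addrA ltr_pwDl// !addr_ge0// ?mulr_ge0 ?addr_ge0// ltW.
(* [s * Z] bounds the increments of state and control as well as the change of the constraint. It is
   kept below 1, below the radius of optimality, below both linearization radii and below the slack
   [e]. *)
pose s := Num.min s1 (Num.min 1 (Num.min 1 (Num.min r (Num.min dL (Num.min dg e))) / Z)).
have q0 : 0 < Num.min 1 (Num.min r (Num.min dL (Num.min dg e))) by rewrite !lt_min ltr01 r0 dL0 dg0.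
have s0 : 0 < s by rewrite /s !lt_min s10 ltr01 divr_gt0.
have ss1 : s <= s1 by rewrite /s ge_min lexx.
have s_1 : s <= 1 by rewrite /s !ge_min lexx !orbT.
have sZ : s * Z <= Num.min 1 (Num.min r (Num.min dL (Num.min dg e))).
  by rewrite -ler_pdivlMr// /s !ge_min lexx !orbT.
move: sZ; rewrite !le_min => /and5P[sZ1 sZr sZL sZg sZe].
have sle X : X <= Z -> s * X <= s * Z by rewrite ler_pM2l.
have KN : 0 <= K0 * (N + N) by rewrite mulr_ge0// addr_ge0.
have [Z1 Z2 Z3] := aux2 _ _ _ _ C10 N0 KN (ltW k0).
have C1Z : s * C1 <= s * Z := sle _ Z1.
have NZ : s * N <= s * Z := sle _ Z2.
have sC1 : s * C1 <= 1 by exact: le_trans sZ1.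
have [xi [F [mxi hF exi FD [Fout xiC xi0]]]] := pert s (introT andP (conj s0 s_1)) sC1.
have xiy := hs1 s xi F (introT andP (conj s0 ss1)) s_1 mxi hF exi FD Fout xiC.
have vvN t : nrm (zoff D v t) <= N by exact: nrm_zoff.
have svN t : nrm (s *: zoff D v t) <= s * N by rewrite nrmZ gtr0_norm// ler_pM2l.
have mvv : vmeas (fun t => s *: zoff D v t).
  by apply: vmeasZ; [exact: meas_cst|apply: vmeas_zoff => //; exact: dir_v dy].
have est (H : R -> 'cV[R]_n -> 'cV[R]_m -> R) Hx Hu CH dH : 0 <= CH -> CH <= Cg + CL -> s * Z <= dH ->
    (forall t x u h k y v s, I01 t -> nrm x <= N -> nrm u <= N -> nrm h <= dH -> nrm k <= dH -> k = s *: v ->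
    `|H t (x + h) (u + k) - H t x u - s * (Hx t x u *m y + Hu t x u *m v) 0 0| <=
    e1 * (nrm h + nrm k) + CH * nrm (h - s *: y)) ->
    forall t, D t -> `|H t (xb t + xi t) (ub t + s *: zoff D v t) - H t (xb t) (ub t)
      - s * lform (zoff D (fun t => Hx t (xb t) (ub t))) (zoff D (fun t => Hu t (xb t) (ub t))) y v t|
      <= s * Num.min k eps.
  move=> CH0 CHQ sdH hdH t Dt; have It := DI Dt.
  have := hdH t (xb t) (ub t) (xi t) (s *: zoff D v t) (y t) (zoff D v t) s It (xN t) (uN t) _ _ erefl.
  rewrite /lform !(zoff_in _ Dt) => h; apply: le_trans (h _ _) _.
  - exact: le_trans (xiC t It) (le_trans C1Z sdH).
  - by have := svN t; rewrite zoff_in// => /le_trans; apply; exact: le_trans sdH.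
  have h1 := xiC t It; have h2 := svN t; have h3 := xiy t It; rewrite zoff_in// in h2.
  apply: (@le_trans _ _ (e1 * (s * C1 + s * N) + CH * (e1 * s))).
    by apply: lerD; [rewrite ler_pM2l// lerD|rewrite ler_wpM2l].
  rewrite -e1Q; have -> : e1 * (s * C1 + s * N) + CH * (e1 * s) = s * e1 * (C1 + N + CH) by ring.
  rewrite [leRHS]mulrA; apply: (ler_wpM2l (ltW (mulr_gt0 s0 e10))).
  exact: (aux1 C1 N CH Cg CL CHQ).
have estL := est _ _ _ _ _ CL0 (_ : CL <= Cg + CL) sZL hdL.
have {estL} estL := estL (ler_wpDl Cg0 (lexx _)).
have estg := est _ _ _ _ _ Cg0 (ler_wpDr CL0 (lexx _)) sZg hdg.
have wb t : D t -> `|lform a b y v t| <= K0 * (N + N).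
  move=> Dt; apply: le_trans (lform_bound _ _ _ ha hb) _; rewrite -mulrDr ler_wpM2l//.
  by apply: lerD; [exact: yN'|exact: vN'].
have feas : ae_on D (fun t => g t (xb t + xi t) (ub t + s *: zoff D v t) <= 0).
  move: hw; rewrite /ae_on; apply: filterS => t ht Dt; have It := DI Dt.
  have ge := gamE Dt; have gl := gam_le0 Dt.
  have [tt|tt] := leP t tau.
    have -> : zoff D v t = 0 by rewrite zoff_in// v0.
    by rewrite (xi0 _ It tt) scaler0 !addr0 -ge.
  have := estg t Dt; rewrite ler_norml => /andP[_]; rewrite -ge.
  have [gt|gt] := ltP (gam t) (- e).
    apply: (aux3 (gam t) _ _ (s * (K0 * (N + N))) (s * k) (s * Num.min k eps) (s * Z) e) => //.
    - by rewrite ler_pM2l//; have := wb t Dt; rewrite ler_norml => /andP[_].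
    - by rewrite ler_pM2l// ge_min lexx.
    - by rewrite -mulrDr; exact: sle.
  have h1 : lform a b y v t <= - k.
    apply: ht; split; first by split.
    by rewrite /= in_itv/= tt; move: It; rewrite /I01 /= in_itv/= => /andP[].
  apply: (aux4 (gam t) _ _ (s * k) (s * Num.min k eps)) => //.
    by rewrite -mulrN ler_pM2l.
  by rewrite ler_pM2l// ge_min lexx.
have := hopt xi (fun t => s *: zoff D v t) F mxi mvv hF exi FD _ _ feas.
have l1 := zoff_L1 (sm_cont hL) mxb mub (fun t _ => conj (xN t) (uN t)).
have l2 : L1 (zoff D (fun t => L t (xb t + xi t) (ub t + s *: zoff D v t))).
  apply: (@zoff_L1 _ _ _ (N + s * C1 + s * N) (sm_cont hL)).
  - exact: vmeasD.
  - exact: vmeasD.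
  - have sN : 0 <= s * N by rewrite mulr_ge0// ltW.
    have sC : 0 <= s * C1 by rewrite mulr_ge0// ltW.
    move=> t Dt; split; apply: le_trans (nrmD _ _) _.
      by rewrite -[leLHS]addr0; apply: lerD => //; apply: lerD => //; exact: xiC t (DI Dt).
    by rewrite addrAC -[leLHS]addr0; apply: lerD => //; exact: lerD.
move=> /(_ (fun t It => le_trans (xiC t It) (le_trans C1Z sZr)) (fun t => le_trans (svN t) (le_trans NZ sZr))).
rewrite -subr_ge0 -ig1B// => h.
have lJ := L1_lform hc hd K00 dy.
rewrite -(@pmulr_rge0 _ s)//; apply: le_trans h _.
rewrite mulrDr /J -ig1Z// -[X in _ + X]ig1_cst -ig1D//; [|exact: L1Z|exact: L1_cst].
apply: ig_le; [exact: mset_I01|by []|exact: L1B|by apply: L1D; [exact: L1Z|exact: L1_cst]|].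
move=> t It; have [Dt|Dt] := pselect (D t); last first.
  rewrite !zoff_out// subrr /lform !zoff_out// !mul0mx addr0 mxE mulr0 add0r.
  by rewrite mulr_ge0// ltW.
rewrite !(zoff_in (fun t => L _ _ _) Dt) -lerBlDl; apply: le_trans (ler_norm _) _.
by apply: le_trans (estL t Dt) _; rewrite ler_pM2l// ge_min lexx orbT.
Qed.

End FirstOrderExpansion.

(** * Completeness of the measure and comparison of norms *)

Section Completeness.
Context {R : realType}.

(** Trades exceptional null sets, once and for all, for a measurable set of full measure on which
    one can argue pointwise. *)
Lemma ae_on_good (Q : R -> Prop) : ae_on I01 Q ->
  exists D : set R, [/\ mset D, D `<=` I01, forall t, D t -> Q t & ae_on I01 (fun t => D t)].
Proof.
move=> [N [mN N0 sub]]; exists (I01 `&` ~` N); split.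
- by apply: msetI; [exact: mset_I01|exact: msetC].
- by move=> t [].
- by move=> t [It Nt]; apply: contrapT => Qt; apply/Nt/sub => /(_ It).
- exists N; split => // t /= h; apply: contrapT => Nt; apply: h => It; by split.
Qed.

Lemma mset_negligible (N : set R) : (@Leb R).-negligible N -> mset N.
Proof. exact: completed_lebesgue_measure_is_complete. Qed.

(** Inside [[0,1]] the two sets differ by a part of a null set, which is measurable because the
    measure is complete. *)
Lemma mset_ae (A B : set R) : mset B -> A `<=` I01 -> B `<=` I01 ->
  ae_on I01 (fun t => A t <-> B t) -> mset A.
Proof.
move=> mB AI BI h.
have mN : mset [set t | ~ (I01 t -> (A t <-> B t))] by exact: mset_negligible.
set N := [set t | _] in mN.
have mAN : mset (A `&` N).
  apply: mset_negligible; move: h => [N' [mN' N0 sub]]; exists N'; split => //.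
  by move=> t [_ Nt]; exact: sub.
have -> : A = (B `\` N) `|` (A `&` N).
  apply/seteqP; split=> [t At|t [[Bt Nt]|[]//]].
    have [Nt|Nt] := pselect (N t); [by right|left; split => //].
    by have /(_ (AI _ At)) [+ _] := contrapT Nt; apply.
  by have /(_ (BI _ Bt)) [_] := contrapT Nt; apply.
by apply: measurableU => //; exact: measurableD.
Qed.

Lemma ae_on_eq (f g : R -> R) : ae_on I01 (fun t => f t = g t) -> ae_eq (@Leb R) I01 (EFin \o f) (EFin \o g).
Proof. by rewrite /ae_on; apply: filterS => t h It /=; rewrite h. Qed.

Lemma meas_ae (f g : R -> R) : meas g -> ae_on I01 (fun t => f t = g t) ->
  measurable_fun (I01 : set (lebT R)) (f : lebT R -> R).
Proof.
move=> mg fg; apply/measurable_EFinP.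
apply: (@ae_measurable_fun _ _ R (@Leb R) completed_lebesgue_measure_is_complete _ (EFin \o g)).
  by apply: ae_on_eq; apply: ae_on_filter fg => t _ ->.
by apply/measurable_EFinP; exact: measurable_funTS.
Qed.

Lemma L1_ae (f g : R -> R) : meas g -> L1 g -> ae_on I01 (fun t => f t = g t) -> L1 f.
Proof.
move=> mg hg fg; have mf := meas_ae mg fg.
apply/integrableP; split; first exact/measurable_EFinP.
have /integrableP[_] := hg; congr (_ < _)%E; apply/esym.
apply: ae_eq_integral; first exact: mset_I01.
- by apply: (measurableT_comp (@abse_measurable R setT)); exact/measurable_EFinP.
- by apply: (measurableT_comp (@abse_measurable R setT)); apply/measurable_EFinP; exact: measurable_funTS.
- by move: fg; rewrite /ae_on; apply: filterS => t h It; rewrite h.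
Qed.

Lemma ig_ae (f g : R -> R) : meas g -> L1 g -> ae_on I01 (fun t => f t = g t) -> ig I01 f = ig I01 g.
Proof. by move=> mg hg fg; apply: ig_ae_eq => //; [exact: mset_I01|exact: (L1_ae mg)]. Qed.

Lemma ig_upto0 (f : R -> R) : L1 f -> ig (upto 0) f = 0.
Proof.
move=> hf; rewrite upto_itv; last by rewrite /I01 /= in_itv/= lexx ler01.
have sub : [set` `[(0 : R), 0]] `<=` I01.
  by move=> t; rewrite /I01 /= !in_itv/= => /andP[-> h]; rewrite (le_trans h)// ler01.
rewrite (@ig_ae_eq _ _ _ (fun _ => 0) (mset_itv _) sub hf (L1_cst 0)).
  by rewrite ig_cst ?mul0r//; exact: mset_itv.
exists [set` `[(0 : R), 0]]; split; [exact: mset_itv|by rewrite Leb_itv// subrr|].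
by move=> t /= h; apply: contrapT => h'; apply: h => /h'.
Qed.

Lemma enorm_ge0 p (x : 'cV[R]_p) : 0 <= enorm x. Proof. exact: sqrtr_ge0. Qed.

Lemma enorm_le_nrm p (x : 'cV[R]_p) : enorm x <= nrm x.
Proof.
rewrite /enorm -(ler_pXn2r (n := 2))// ?nnegrE ?sqrtr_ge0 ?nrm_ge0//.
rewrite sqr_sqrtr; last by apply: sumr_ge0 => i _; exact: sqr_ge0.
rewrite expr2 {1}/nrm mulr_suml; apply: ler_sum => i _.
by rewrite -[x i 0 ^+ 2]real_normK ?num_real// expr2 ler_wpM2l// ler_nrm.
Qed.

Lemma entry_le_enorm p (x : 'cV[R]_p) i : `|x i 0| <= enorm x.
Proof.
rewrite -sqrtr_sqr ler_wsqrtr// (bigD1 i)//= lerDl.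
by apply: sumr_ge0 => j _; exact: sqr_ge0.
Qed.

Lemma nrm_le_enorm p (x : 'cV[R]_p) : nrm x <= p%:R * enorm x.
Proof. by apply: nrm_le => i; exact: entry_le_enorm. Qed.

Lemma normC_le p (x : R -> 'cV[R]_p) r : (forall t, I01 t -> enorm (x t) <= r) -> normC x <= r.
Proof.
move=> xr; apply: ge_sup; first by exists (enorm (x 0)); exists 0 => //; rewrite /I01 /= in_itv/= lexx ler01.
by move=> _ [t It <-]; exact: xr.
Qed.

Lemma normLinfty_le p (x : R -> 'cV[R]_p) r : 0 <= r -> ae_on I01 (fun t => enorm (x t) <= r) ->
  (normLinfty x <= r%:E)%E.
Proof.
move=> r0 h; apply/ess_supP; move: h; rewrite /ae_on; apply: filterS => t h.
by rewrite patchE; case: ifPn => [/set_mem It|_]; rewrite lee_fin// h.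
Qed.

End Completeness.

(** * Reduction to everywhere bounded representatives *)

Section Reduction.
Context {R : realType} {n m : nat}.
Variables (P : problem R n m) (xb : R -> 'cV[R]_n) (ub : R -> 'cV[R]_m).

Lemma smooth_eq (G : R -> 'cV[R]_n -> 'cV[R]_m -> R) Gx Gu Gx' Gu' : smooth G Gx Gu ->
  (forall t x u, I01 t -> Gx' t x u = Gx t x u /\ Gu' t x u = Gu t x u) -> smooth G Gx' Gu'.
Proof.
move=> [h1 h2 h3 h4] e; split => //.
- move=> j; rewrite (_ : extc _ = extc (fun t x u => Gx t x u 0 j))//.
  by apply/funext => q; rewrite /extc; case: (e _ q.1.2 q.2 (clamp_I01 q.1.1)) => ->.
- move=> j; rewrite (_ : extc _ = extc (fun t x u => Gu t x u 0 j))//.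
  by apply/funext => q; rewrite /extc; case: (e _ q.1.2 q.2 (clamp_I01 q.1.1)) => _ ->.
- move=> t x u h k It; have [s s01 es] := h4 t x u h k It; exists s => //.
  by rewrite es; have [-> ->] := e t (x + s *: h) (u + s *: k) It.
Qed.

(** The bound on the control, the dynamics and the constraint hold almost everywhere; [D] is a
    common set of validity, off which the control is set to 0. The state is bounded because it is
    the integral of an integrable function. *)
Lemma regular_process : admissible P xb ub -> exists D xdot xg ug M, [/\ mset D, D `<=` I01,
    ae_on I01 (fun t => D t), 0 <= M & [/\ vmeas xg, vmeas ug, forall t, nrm (xg t) <= M,
    forall t, nrm (ug t) <= M & [/\ forall t, I01 t -> xg t = xb t, forall t, D t -> ug t = ub t,
    forall t, D t -> g_bar P xb ub t <= 0, vL1 xdot &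
    (forall t i, I01 t -> xb t i 0 = xb 0 i 0 + ig (upto t) (fun s => xdot s i 0)) /\
    forall t, D t -> xdot t = dyn P t (xb t) (ub t)]]].
Proof.
move=> [[mu [M hM]] [xdot hx ex] gle x0].
have [D [mD DI hD fD]] := ae_on_good (ae_on_and hM (ae_on_and ex gle)).
pose xg := zoff I01 xb; pose ug := zoff D ub.
have xgE t : I01 t -> xg t = xb t by move=> It; rewrite /xg zoff_in.
have ugE t : D t -> ug t = ub t by move=> Dt; rewrite /ug zoff_in.
have hxd i : L1 (fun t => xdot t i 0) by case: (hx i).
have exb t i : I01 t -> xb t i 0 = xb 0 i 0 + ig (upto t) (fun s => xdot s i 0).
  by move=> It; have [_ h] := hx i; rewrite h// upto_itv.
have mxg : vmeas xg.
  move=> i.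
  have mc : meas (fun t => xb 0 i 0 + ig (upto t) (fun s => xdot s i 0)).
    by apply: measD; [exact: meas_cst|apply: meas_continuous; exact: upto_cont].
  have := meas_if mset_I01 mc (meas_cst 0); congr meas; apply/funext => t.
  rewrite /xg /zoff; case: ifPn => [/set_mem It|_]; last by rewrite mxE.
  by rewrite [RHS](exb t i It).
have mug : vmeas ug.
  move=> i.
  have h : measurable_fun (D : set (lebT R)) (fun t : lebT R => ub t i 0).
    by apply: measurable_funS (mu i) => //; exact: mset_I01.
  have := meas_restrict mD h; congr meas; apply/funext => t.
  by rewrite patchE /ug /zoff; case: ifP => //; rewrite mxE.
pose M' := n%:R * \sum_i (`|xb 0 i 0| + ig I01 (fun s => `|xdot s i 0|)) + m%:R * `|M|.
have S0 : 0 <= \sum_i (`|xb 0 i 0| + ig I01 (fun s => `|xdot s i 0|)).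
  by apply: sumr_ge0 => i _; rewrite addr_ge0// ig_ge0.
have M'0 : 0 <= M' by rewrite addr_ge0// mulr_ge0.
have xgM t : nrm (xg t) <= M'.
  apply: nrm_zoff => // s Is; apply: (@le_trans _ _ (n%:R * \sum_i (`|xb 0 i 0| + ig I01 (fun s => `|xdot s i 0|)))).
    apply: nrm_le => i; rewrite exb// (bigD1 i)//=; apply: ler_wpDr.
      by apply: sumr_ge0 => j _; rewrite addr_ge0// ig_ge0.
    apply: le_trans (ler_normD _ _) _; rewrite lerD2l.
    apply: le_trans (ig_norm (mset_upto s) (@upto_sub _ s) (hxd i)) _.
    by apply: ig_subset; [exact: mset_upto|exact: mset_I01|exact: upto_sub|by []|exact: L1_norm|].
  by rewrite lerDl mulr_ge0.
have ubM t : D t -> nrm (ub t) <= m%:R * `|M|.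
  move=> Dt; have [h _] := hD t Dt; apply: le_trans (nrm_le_enorm _) _.
  by rewrite ler_wpM2l//; exact: le_trans (ler_norm _).
have ugM t : nrm (ug t) <= M'.
  apply: nrm_zoff => // s Ds; apply: le_trans (ubM s Ds) _.
  by rewrite lerDr mulr_ge0.
exists D, xdot, xg, ug, M'; split => //; split => //; split => //.
  by move=> t Dt; have [_ []] := hD t Dt.
by split => // t Dt; have [_ []] := hD t Dt.
Qed.

Hypotheses (P_smooth : smooth_problem P) (xu_min : weak_local_minimizer P xb ub).

Let hf i : smooth (fun t x u => dyn P t x u i 0)
  (fun t x u => row i (jacobian_mx (dyn P t ^~ u) x)) (fun t x u => row i (jacobian_mx (dyn P t x) u)).
Proof. by have [_ h _] := P_smooth; have [h1 h2] := smooth_of_C1_row i h; apply: smooth_eq h1 h2. Qed.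

Let hL := let: And3 h _ _ := P_smooth in smooth_of_C1 h.
Let hg := let: And3 _ _ h := P_smooth in smooth_of_C1 h.

Section Optimality.
Variables (D : set R) (xdot xg : R -> 'cV[R]_n) (ug : R -> 'cV[R]_m) (M : R).
Hypotheses (mD : mset D) (DI : D `<=` I01) (fD : ae_on I01 (fun t => D t)) (M0 : 0 <= M)
  (mxg : vmeas xg) (mug : vmeas ug) (xgM : forall t, nrm (xg t) <= M) (ugM : forall t, nrm (ug t) <= M)
  (xgE : forall t, I01 t -> xg t = xb t) (ugE : forall t, D t -> ug t = ub t) (hxd : vL1 xdot)
  (exb : forall t i, I01 t -> xb t i 0 = xb 0 i 0 + ig (upto t) (fun s => xdot s i 0))
  (xdE : forall t, D t -> xdot t = dyn P t (xb t) (ub t)).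

Let Dfull Q : (forall t, D t -> Q t) -> ae_on I01 Q.
Proof. by move=> h; apply: ae_on_filter fD => t _; exact: h. Qed.

Lemma objective_zoff x u N x' u' : vmeas x -> vmeas u ->
  (forall t, D t -> nrm (x t) <= N /\ nrm (u t) <= N) ->
  (forall t, D t -> x' t = x t /\ u' t = u t) ->
  objective P x' u' = ig I01 (zoff D (fun t => cost P t (x t) (u t))).
Proof.
move=> mx mu hN e'; apply: ig_ae; first exact: zoff_meas (sm_cont hL) mx mu.
  exact: zoff_L1 (sm_cont hL) mx mu hN.
by apply: Dfull => t Dt; rewrite zoff_in//; have [-> ->] := e' t Dt.
Qed.

Lemma perturbed_admissible r xi u' F : vmeas xi -> vmeas u' -> vL1 F ->
  (forall t i, I01 t -> xi t i 0 = ig (upto t) (fun r => F r i 0)) ->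
  (forall t, D t -> F t = dyn P t (xg t + xi t) (ug t + u' t) - dyn P t (xg t) (ug t)) ->
  (forall t, nrm (u' t) <= r) ->
  ae_on D (fun t => constr P t (xg t + xi t) (ug t + u' t) <= 0) ->
  admissible P (fun t => xb t + xi t) (fun t => ub t + u' t).
Proof.
move=> mxi mu' hF exi FD ur feas; have [[[mu _] _ _ x0] _] := xu_min.
have I0 : I01 (0 : R) by rewrite /I01 /= in_itv/= lexx ler01.
have xi0 : xi 0 = 0 by apply/colP => i; rewrite exi// ig_upto0 ?mxE.
split.
- split=> [i|].
    have -> : (fun t : lebT R => (ub t + u' t) i 0) = (fun t : lebT R => ub t i 0 + u' t i 0).
      by apply/funext => t; rewrite mxE.
    by apply: measurable_funD; [exact: mu|apply: measurable_funTS; exact: mu'].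
  exists (M + r); apply: Dfull => t Dt.
  apply: le_trans (enorm_le_nrm _) (le_trans (nrmD _ _) _); apply: lerD; last exact: ur.
  by rewrite -ugE.
- exists (fun t => xdot t + F t).
    move=> i; split.
      have -> : (fun t => (xdot t + F t) i 0) = (fun t => xdot t i 0 + F t i 0).
        by apply/funext => t; rewrite mxE.
      exact: L1D (hxd i) (hF i).
    move=> t It; rewrite mxE [in RHS]mxE exb// exi// xi0 mxE addr0 -addrA; congr (_ + _).
    rewrite -upto_itv// -(igD (mset_upto t) (@upto_sub _ t) (hxd i) (hF i)).
    by apply: ig_eq => s _; rewrite mxE.
  apply: Dfull => t Dt; rewrite xdE// FD// xgE ?ugE//; last exact: DI.
  by rewrite subrKC.
- move: fD feas; rewrite /ae_on; apply: filterS2 => t h1 h2 It.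
  by have := h2 (h1 It); rewrite xgE// ugE//; exact: h1.
- by rewrite xi0 addr0.
Qed.

(** Since [enorm <= nrm], smallness in [nrm] controls both norms in the definition of a weak local
    minimizer. The radius is half of the given one because that definition asks for strict
    inequalities. *)
Lemma local_optimality : exists2 r, 0 < r & forall xi u' F, vmeas xi -> vmeas u' -> vL1 F ->
  (forall t i, I01 t -> xi t i 0 = ig (upto t) (fun r => F r i 0)) ->
  (forall t, D t -> F t = dyn P t (xg t + xi t) (ug t + u' t) - dyn P t (xg t) (ug t)) ->
  (forall t, I01 t -> nrm (xi t) <= r) -> (forall t, nrm (u' t) <= r) ->
  ae_on D (fun t => constr P t (xg t + xi t) (ug t + u' t) <= 0) ->
  ig I01 (zoff D (fun t => cost P t (xg t) (ug t))) <=
  ig I01 (zoff D (fun t => cost P t (xg t + xi t) (ug t + u' t))).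
Proof.
have [_ [eps eps0 hmin]] := xu_min.
have e20 : 0 < eps / 2 by rewrite divr_gt0.
have e2 : eps / 2 < eps by rewrite ltr_pdivrMr// ltr_pMr// ltr1n.
exists (eps / 2) => // xi u' F mxi mu' hF exi FD xir ur feas.
have adm := perturbed_admissible mxi mu' hF exi FD ur feas.
have hb (t : R) : D t -> nrm (xg t) <= M /\ nrm (ug t) <= M by [].
rewrite -(@objective_zoff _ _ _ xb ub mxg mug hb); last first.
  by move=> t Dt; rewrite (xgE (DI Dt)) (ugE Dt).
rewrite -(@objective_zoff (fun t => xg t + xi t) (fun t => ug t + u' t) (M + eps / 2) (fun t => xb t + xi t) (fun t => ub t + u' t)).
- apply: hmin => //.
    apply: le_lt_trans e2; apply: normC_le => t It; rewrite addrAC subrr add0r.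
    by apply: le_trans (enorm_le_nrm _) (xir t It).
  apply: (@le_lt_trans _ _ (eps / 2)%:E); last by rewrite lte_fin.
  apply: normLinfty_le; first exact: ltW.
  apply: ae_onT => t It; rewrite addrAC subrr add0r.
  by apply: le_trans (enorm_le_nrm _) (ur t).
- exact: vmeasD.
- exact: vmeasD.
- move=> t Dt; split; apply: le_trans (nrmD _ _) _; apply: lerD => //.
  by apply: xir; exact: DI.
- by move=> t Dt; rewrite (xgE (DI Dt)) (ugE Dt).
Qed.

End Optimality.

(** Packages the process as coefficient fields vanishing off [D], together with the one consequence
    of minimality that the linear theory needs. *)
Lemma reduction : exists D K, [/\ mset D, D `<=` I01, ae_on I01 (fun t => D t),
    (forall t, D t -> g_bar P xb ub t <= 0) & 0 <= K /\
  let A := zoff D (fx_bar P xb ub) in let B := zoff D (fu_bar P xb ub) in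
  let a := zoff D (gx_bar P xb ub) in let b := zoff D (gu_bar P xb ub) in
  let c := zoff D (Lx_bar P xb ub) in let d := zoff D (Lu_bar P xb ub) in
  [/\ mxfield A K, mxfield B K, mxfield a K & [/\ mxfield b K, mxfield c K, mxfield d K, 
     meas (zoff D (g_bar P xb ub)) &
    forall y v tau e k, direction A B y v ->
      (exists N, forall t, I01 t -> nrm (v t) <= N) -> 0 < tau < 1 ->
      (forall t, t <= tau -> v t = 0) -> 0 < e -> 0 < k ->
      ae_on (act (g_bar P xb ub) e `&` [set` `]tau, 1]]) (fun t => lform a b y v t <= - k) ->
      0 <= J c d y v]]].
Proof.
have [D [xdot [xg [ug [M' [mD DI fD M'0 [mxg mug xgM ugM [xgE ugE hgle hxd [exb xdE]]]]]]]]] :=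
  regular_process xu_min.1.
have opt := local_optimality mD DI fD mxg mug xgM ugM xgE ugE hxd exb xdE.
have [K K0] := fields_exist mD DI mxg mug xgM ugM hf hL hg.
have zx (W : zmodType) (H : R -> 'cV[R]_n -> 'cV[R]_m -> W) :
    zoff D (fun t => H t (xg t) (ug t)) = zoff D (fun t => H t (xb t) (ub t)).
  by apply/funext => t; rewrite /zoff; case: ifPn => // /set_mem Dt; rewrite (xgE _ (DI _ Dt)) (ugE _ Dt).
have zA := zx _ (fun t x u => jacobian_mx (dyn P t ^~ u) x).
have zB := zx _ (fun t x u => jacobian_mx (dyn P t x) u).
have za := zx _ (fun t x u => gradient (constr P t ^~ u) x).
have zb := zx _ (fun t x u => gradient (constr P t x) u).
have zc := zx _ (fun t x u => gradient (cost P t ^~ u) x).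
have zd := zx _ (fun t x u => gradient (cost P t x) u).
move=> -[hA hB ha [hb hc hd]].
exists D, K; rewrite /fx_bar /fu_bar /gx_bar /gu_bar /Lx_bar /Lu_bar -zA -zB -za -zb -zc -zd.
have mg : meas (zoff D (g_bar P xb ub)).
  have := zoff_meas mD DI (sm_cont hg) mxg mug; congr meas; exact: (zx _ (constr P)).
split; [exact: mD|exact: DI|exact: fD|exact: hgle|split; [exact: K0|]].
split; [exact: hA|exact: hB|exact: ha|split; [exact: hb|exact: hc|exact: hd|exact: mg|]].
apply: (no_strict_descent mD DI mxg mug xgM ugM M'0 hf hL hg hA hB ha hb hc hd K0 _ hgle opt).
by move=> t Dt; rewrite (xgE _ (DI _ Dt)) (ugE _ Dt).
Qed.

End Reduction.

(** * Hypotheses on the process *)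

Section Hypotheses.
Context {R : realType} {n m : nat}.

Lemma meas_inv (g : R -> R) : meas g -> (forall t, 0 < g t) -> meas (fun t => (g t)^-1).
Proof.
move=> mg g0; have -> : (fun t => (g t)^-1) = (fun t => expR (- ln (g t))).
  by apply/funext => t; rewrite expRN lnK// posrE.
apply: (measurableT_comp (@measurable_expR R)); apply: measN.
exact: (measurableT_comp (@measurable_ln R)).
Qed.

Lemma meas_nondecreasing (h : R -> R) : {homo h : s t / s <= t} -> meas h.
Proof.
move=> hh _ Y mY; rewrite setTI; apply: mset_borel.
by have := nondecreasing_measurable (@measurableT _ (measurableTypeR R)) hh measurableT mY; rewrite setTI.
Qed.

Lemma enorm_sqr p (x : 'cV[R]_p) : enorm x ^+ 2 = \sum_i x i 0 ^+ 2.
Proof. by rewrite sqr_sqrtr//; apply: sumr_ge0 => i _; exact: sqr_ge0. Qed.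

Variables (D : set R) (gu : R -> 'rV[R]_m) (gam : R -> R).
Hypotheses (mD : mset D) (DI : D `<=` I01) (fD : ae_on I01 (fun t => D t)).
Local Notation b := (zoff D gu).
Hypothesis mb : forall j, meas (fun t => b t 0 j).

(** On []0,e0]] the gradient is inverted: the transpose of [b] divided by its squared length gives
    the product 1, with size at most [m / omega], which is integrable. On []e0,bb]] a bounded
    control from the nondegeneracy hypothesis takes over. Monotonicity of [omega] bounds the gain
    away from 0. *)
Lemma feedback_exists (e0 e2 : R) (omega : R -> R) :
  0 < e0 < 1 -> 0 < e2 -> (forall t, 0 < t <= e0 -> 0 < omega t) ->
  (forall s t, 0 < s -> s <= t -> t <= e0 -> omega s <= omega t) ->
  (\int[@Leb R]_(t in `]0%R, e0]) ((omega t)^-1)%:E < +oo)%E ->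
  ae_on (act gam e2 `&` `[0, e0]) (fun t => omega t <= enorm (gu t)^T) ->
  (forall a b : R, 0 < a -> a < b -> b < 1 ->
     exists2 e : R, 0 < e & exists2 v0 : R -> 'cV[R]_m, Linfty a b v0 &
       ae_on (act gam e `&` `[a, b]) (fun t => 1 <= (gu t *m v0 t) 0 0)) ->
  forall bb, 0 < bb < 1 -> exists e ch rho, 0 < e /\ feedback b gam bb e ch rho.
Proof.
move=> /andP[e00 e01] e20 om0 omh omi hom H1 bb /andP[bb0 bb1].
(* The nondegeneracy hypothesis is used on an interval starting at [e0] and ending beyond [bb] but
   before 1; the maximum covers the case [bb <= e0]. *)
pose b' := (Num.max bb e0 + 1) / 2.
have m1 : Num.max bb e0 < 1 by rewrite gt_max bb1.
have mb' : Num.max bb e0 < b' by rewrite /b'; lra.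
have b'1 : b' < 1 by rewrite /b'; lra.
have bbb' : bb < b' by apply: le_lt_trans mb'; rewrite le_max lexx.
have e0b' : e0 < b' by apply: le_lt_trans mb'; rewrite le_max lexx orbT.
have [e1 e10 [v0 [mv0 [M0 hM0]] hv0]] := H1 e0 b' e00 e0b' b'1.
have sub' : [set` `[e0, b']] `<=` I01.
  by move=> t; rewrite /I01 /= !in_itv/= => /andP[h1 h2]; rewrite (ltW (lt_le_trans e00 h1)) (le_trans h2 (ltW b'1)).
(* A nondecreasing extension of [omega] to the line, from which measurability follows. *)
pose om t := if t <= 0 then 0 else omega (Num.min t e0).
have omp t : 0 < t -> 0 < Num.min t e0 <= e0 by move=> t0; rewrite lt_min t0 e00 ge_min lexx orbT.
have mom : meas om.
  apply: meas_nondecreasing => s t st; rewrite /om; case: (leP s 0) => s0; case: (leP t 0) => t0 //.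
  - by apply/ltW/om0/omp.
  - by have := lt_le_trans s0 (le_trans st t0); rewrite ltxx.
  - have /andP[h1 _] := omp _ s0; apply: omh => //; last by rewrite ge_min lexx orbT.
    by rewrite le_min ge_min st/= ge_min lexx orbT.
have mP : mset [set` `]0, +oo[] := mset_itv _.
pose g t := if t \in [set` `](0 : R), +oo[] then om t else 1.
have inP t : (t \in [set` `](0 : R), +oo[]) = (0 < t).
  by apply/idP/idP; rewrite inE /= in_itv/= andbT.
have mg : meas g by apply: meas_if => //; exact: meas_cst.
have gE t : 0 < t -> t <= e0 -> g t = omega t.
  by move=> t0 te; rewrite /g inP t0 /om leNgt t0/= min_l.
have g0 t : 0 < g t.
  by rewrite /g inP; case: (ltP 0 t) => // t0; rewrite /om leNgt t0/=; apply/om0/omp.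
have mJ : mset [set` `]0, e0]] := mset_itv _.
pose f t := if t \in [set` `]0, e0]] then (g t)^-1 else 0.
have mf : meas f by apply: meas_if => //; [exact: meas_inv|exact: meas_cst].
have f0 t : 0 <= f t by rewrite /f; case: ifP => // _; rewrite invr_ge0 ltW.
have inJ t : (t \in [set` `]0, e0]]) = (0 < t <= e0).
  by apply/idP/idP; rewrite inE /= in_itv.
have hf : L1 f.
  apply/integrableP; split; first by apply/measurable_EFinP; exact: measurable_funTS.
  rewrite (_ : (\int[_]_(x in _) _ = \int[@Leb R]_(t in `]0%R, e0]) ((omega t)^-1)%:E)%E)//.
  have JI : [set` `]0, e0]] `<=` I01.
    by move=> t; rewrite /I01 /= !in_itv/= => /andP[/ltW -> h]; exact: le_trans h (ltW e01).
  rewrite -[in RHS](setIidr JI) integral_mkcondr; apply: eq_integral => t _.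
  rewrite patchE /f inJ; case: ifP => [/andP[t0 te]|_]; last by rewrite /= normr0.
  by rewrite gE// gee0_abs// lee_fin invr_ge0 ltW// om0// t0.
pose nb2 t := \sum_j b t 0 j ^+ 2.
have mnb2 : meas nb2.
  by apply: meas_sum => j; under eq_fun do rewrite expr2; apply: measM; exact: mb.
have nbE t : nb2 t = enorm (b t)^T ^+ 2.
  by rewrite enorm_sqr; apply: eq_bigr => j _; rewrite mxE.
(* The times of []0,e0]] up to [bb] at which the gradient is at least [omega] in length; the form
   with [f = 1/omega] and squares shows measurability and excludes a zero gradient. *)
pose S := [set t | 1 <= f t ^+ 2 * nb2 t] `&` [set` `]-oo, bb]].
have mS : mset S.
  apply: msetI; last exact: mset_itv.
  apply: mset_le; first exact: meas_cst.
  by apply: measM => //; under eq_fun do rewrite expr2; exact: measM.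
pose G t := if t \in S then nb2 t else 1.
have Sin t : S t -> [/\ 0 < t <= e0, t <= bb & 0 < nb2 t].
  move=> [/= h]; rewrite in_itv/= => tb.
  have nb0 : 0 <= nb2 t by rewrite nbE sqr_ge0.
  have [tJ|tJ] := boolP (0 < t <= e0).
    split => //; rewrite lt_neqAle nb0 andbT; apply: contraTneq h => <-.
    by rewrite mulr0 -ltNge.
  by move: h; rewrite /f inJ (negbTE tJ) expr2 !mul0r ler10.
have G0 t : 0 < G t by rewrite /G; case: ifP => // /set_mem/Sin[].
have mG : meas G by apply: meas_if => //; exact: meas_cst.
(* [N] is a null set outside which [v0] obeys its essential bound; the control is put to 0 on it so
   that the bound holds everywhere. *)
have [N [mN N0 subN]] := hM0.
pose T := [set` `]e0, bb]] `&` ~` N.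
have mT : mset T by apply: msetI; [exact: mset_itv|exact: msetC].
have Tin t : T t -> [/\ e0 < t, t <= bb & enorm (v0 t) <= M0].
  move=> [/= + Nt]; rewrite in_itv/= => /andP[h1 h2]; split => //.
  apply: contrapT => hh; apply: Nt; apply: subN => /= h; apply/hh/h.
  by rewrite in_itv/= (ltW h1) (le_trans h2 (ltW bbb')).
pose v1 := zoff T v0.
have mv1 : vmeas v1.
  move=> j; have h : measurable_fun (T : set (lebT R)) (fun t : lebT R => v0 t j 0).
    apply: measurable_funS (mv0 j); first exact: mset_itv.
    by move=> t /Tin[h1 h2 _]; rewrite /= in_itv/= (ltW h1) (le_trans h2 (ltW bbb')).
  have := meas_restrict mT h; congr meas; apply/funext => t.
  by rewrite patchE /v1 /zoff; case: ifP => //; rewrite mxE.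
pose ch t := if t \in S then (G t)^-1 *: (b t)^T else v1 t.
pose rho t := m%:R * f t + m%:R * `|M0|.
have Sf t : S t -> 0 < t <= e0 by case/Sin.
exists (Num.min e1 e2), ch, rho; split; first by rewrite lt_min e10.
have rho0 t : 0 <= rho t by rewrite /rho addr_ge0// mulr_ge0.
split.
- move=> j; have h1 : meas (fun t => (G t)^-1 * b t 0 j) by apply: measM; [exact: meas_inv|exact: mb].
  have := meas_if mS h1 (mv1 j); congr meas; apply/funext => t.
  by rewrite /ch; case: ifP => // _; rewrite !mxE.
- by apply: measD; [exact: measZ|exact: meas_cst].
- by apply: L1D; [exact: L1Z|exact: L1_cst].
- move=> t; rewrite /ch; case: ifPn => [/set_mem St|_].
    have [tJ tb nb0] := Sin t St.
    rewrite /G mem_set// nrmZ ger0_norm ?invr_ge0 ?(ltW nb0)//.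
    apply: ler_wpDr; first by rewrite mulr_ge0.
    have E0 : 0 < enorm (b t)^T.
      by rewrite lt_neqAle enorm_ge0 andbT; apply: contraTneq nb0 => e; rewrite nbE -e expr2 mul0r ltxx.
    rewrite mulrC ler_pdivrMr//; apply: le_trans (nrm_le_enorm _) _.
    rewrite -mulrA ler_wpM2l// nbE expr2 mulrA -[leLHS]mul1r ler_pM2r//.
    rewrite -(ler_pXn2r (n := 2))// ?nnegrE ?mulr_ge0// ?enorm_ge0// expr1n exprMn -nbE.
    by case: St.
  apply: ler_wpDl; first by rewrite mulr_ge0.
  apply: nrm_zoff; last by rewrite mulr_ge0.
  move=> s /Tin[_ _ h]; apply: le_trans (nrm_le_enorm _) _; rewrite ler_wpM2l//.
  exact: le_trans (ler_norm _).
- move=> tau tau0; exists (m%:R * f (Num.min tau e0) + m%:R * `|M0|) => t It tt.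
  rewrite lerD2r ler_wpM2l// {1}/f inJ; case: ifP => [/andP[t0 te]|_]; last exact: f0.
  have /andP[h1 h2] := omp _ tau0.
  rewrite /f inJ h1 h2/= lef_pV2 ?posrE// !gE//.
  by apply: omh => //; rewrite ge_min tt.
- move=> t bt; rewrite /ch; case: ifPn => [/set_mem/Sin[_ h _]|_]; first by move: (lt_le_trans bt h); rewrite ltxx.
  by rewrite /v1 zoff_out// => /Tin[_ h _]; move: (lt_le_trans bt h); rewrite ltxx.
- have z0 : ae_on I01 (fun t : R => t <> 0).
    exists [set` `[(0 : R), 0]]; split; [exact: mset_itv|by rewrite Leb_itv// subrr|].
    move=> t /= h; apply: contrapT => h'; apply: h => It t0; apply: h'.
    by rewrite t0 in_itv/= lexx.
  have h0 : ae_on I01 (fun t => D t /\ t <> 0) by exact: ae_on_and.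
  have h1 : ae_on I01 (fun t => ~ N t).
    by exists N; split => // t /= h; apply: contrapT => Nt; apply: h.
  have := ae_on_and h0 h1; move: hv0 hom; rewrite /ae_on.
  apply: filterS3 => t h2 h3 h4 [[It gt]]; rewrite /= in_itv/= => tb.
  have [[Dt t0] Nt] := h4 It.
  have tp : 0 < t.
    rewrite lt_neqAle; apply/andP; split; first by apply/eqP => e; exact: t0.
    by move: It; rewrite /I01 /= in_itv/= => /andP[].
  have ge1 : act gam e1 t by split=> //; apply: le_trans gt; rewrite lerN2 ge_min lexx.
  have ge2 : act gam e2 t by split=> //; apply: le_trans gt; rewrite lerN2 ge_min lexx orbT.
  have [te|te] := leP t e0.
    have i1 : (act gam e2 `&` `[0, e0]) t by split => //; rewrite /= in_itv/= ltW.
    have oe := h3 i1.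
    have otp : 0 < omega t by apply: om0; rewrite tp.
    have St : S t.
      split; last by rewrite /= in_itv.
      rewrite /= /f inJ tp te gE// nbE zoff_in// -exprMn -[X in X <= _](expr1n _ 2).
      rewrite ler_pXn2r// ?nnegrE ?mulr_ge0 ?enorm_ge0// ?invr_ge0 ?(ltW otp)//.
      by rewrite mulrC ler_pdivlMr// mul1r.
    rewrite /ch /G mem_set// -scalemxAr mx11Z.
    have -> : (b t *m (b t)^T) 0 0 = nb2 t.
      by rewrite mxE; apply: eq_bigr => j _; rewrite mxE expr2.
    by have [_ _ nb0] := Sin t St; rewrite mulVf// gt_eqF.
  have Tt : T t by split => //; rewrite /= in_itv/= te.
  have i2 : (act gam e1 `&` `[e0, b']) t.
    by split => //; rewrite /= in_itv/= (ltW te) (le_trans tb (ltW bbb')).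
  rewrite /ch memNset; last by move=> /Sf/andP[_]; rewrite leNgt te.
  by rewrite /v1 !zoff_in//; exact: h2.
Qed.

End Hypotheses.

(** * Solutions of the linearized system as directions *)

Section Conversion.
Context {R : realType} {n m : nat}.
Variables (P : problem R n m) (xb : R -> 'cV[R]_n) (ub : R -> 'cV[R]_m) (D : set R) (K : R).
Hypotheses (mD : mset D) (DI : D `<=` I01) (fD : ae_on I01 (fun t => D t)) (K0 : 0 <= K).
Local Notation A := (zoff D (fx_bar P xb ub)).
Local Notation B := (zoff D (fu_bar P xb ub)).
Local Notation a := (zoff D (gx_bar P xb ub)).
Local Notation b := (zoff D (gu_bar P xb ub)).
Local Notation c := (zoff D (Lx_bar P xb ub)).
Local Notation d := (zoff D (Lu_bar P xb ub)).
Hypotheses (hA : mxfield A K) (hB : mxfield B K).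

Lemma direction_of_linearized y v : linearized_process P xb ub y v -> exists yh vh,
  [/\ direction A B yh vh, bvec vh,
     ae_on I01 (fun t => lform a b yh vh t = lin_constr P xb ub y v t) &
     ae_on I01 (fun t => lform c d yh vh t = lin_cost P xb ub y v t)].
Proof.
move=> [[mv [M hM]] [yd hy ey] y0].
have [D' [mD' DI' hD' fD']] := ae_on_good (ae_on_and fD (ae_on_and hM ey)).
pose yh := zoff I01 y; pose vh := zoff D' v.
have yhE t : I01 t -> yh t = y t by move=> It; rewrite /yh zoff_in.
have vhE t : D' t -> vh t = v t by move=> Dt; rewrite /vh zoff_in.
have hyd i : L1 (fun t => yd t i 0) by case: (hy i).
have exy t i : I01 t -> y t i 0 = ig (upto t) (fun s => yd s i 0).
  by move=> It; have [_ h] := hy i; rewrite h// y0 mxE add0r upto_itv.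
have myh : vmeas yh.
  move=> i; have mc : meas (fun t => ig (upto t) (fun s => yd s i 0)) by apply: meas_continuous; exact: upto_cont.
  have := meas_if mset_I01 mc (meas_cst 0); congr meas; apply/funext => t.
  rewrite /yh /zoff; case: ifPn => [/set_mem It|_]; last by rewrite mxE.
  by rewrite [RHS](exy t i It).
have mvh : vmeas vh.
  move=> i; have h : measurable_fun (D' : set (lebT R)) (fun t : lebT R => v t i 0).
    by apply: measurable_funS (mv i) => //; exact: mset_I01.
  have := meas_restrict mD' h; congr meas; apply/funext => t.
  by rewrite patchE /vh /zoff; case: ifP => //; rewrite mxE.
have S0 : 0 <= \sum_i (ig I01 (fun s => `|yd s i 0|)) by apply: sumr_ge0 => i _; exact: ig_ge0.
have yM t : nrm (yh t) <= n%:R * \sum_i (ig I01 (fun s => `|yd s i 0|)).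
  apply: nrm_zoff; last by rewrite mulr_ge0.
  move=> s Is; apply: nrm_le => i; rewrite exy// (bigD1 i)//=; apply: ler_wpDr.
    by apply: sumr_ge0 => j _; exact: ig_ge0.
  apply: le_trans (ig_norm (mset_upto s) (@upto_sub _ s) (hyd i)) _.
  by apply: ig_subset; [exact: mset_upto|exact: mset_I01|exact: upto_sub|by []|exact: L1_norm|].
have vM t : nrm (vh t) <= m%:R * `|M|.
  apply: nrm_zoff; last by rewrite mulr_ge0.
  move=> s Ds; have [_ [h _]] := hD' s Ds; apply: le_trans (nrm_le_enorm _) _.
  by rewrite ler_wpM2l//; exact: le_trans (ler_norm _).
have Dfull Q : (forall t, D' t -> Q t) -> ae_on I01 Q.
  by move=> h; apply: ae_on_filter fD' => t _; exact: h.
have mrhs : vmeas (fun s => A s *m yh s + B s *m vh s) by apply: vmeasD; [exact: hA.1|exact: hB.1].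
have L1c (k : R) : L1 (fun _ => k) := L1_cst k.
have hrhs : vL1 (fun s => A s *m yh s + B s *m vh s).
  apply: (vL1_dom mrhs (L1c (K * (n%:R * \sum_i (ig I01 (fun s => `|yd s i 0|))) + K * (m%:R * `|M|)))) => t _.
  apply: le_trans (nrmD _ _) _; apply: lerD.
    by apply: le_trans (hA.2 _ _) _; rewrite ler_wpM2l.
  by apply: le_trans (hB.2 _ _) _; rewrite ler_wpM2l.
exists yh, vh; split; last 2 first.
- apply: Dfull => t Dt; have [Dt' _] := hD' t Dt.
  by rewrite /lform /lin_constr !zoff_in// yhE ?vhE//; exact: DI'.
- apply: Dfull => t Dt; have [Dt' _] := hD' t Dt.
  by rewrite /lform /lin_cost !zoff_in// yhE ?vhE//; exact: DI'.
- split => //.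
  + by eexists => t; exact: yM.
  + by apply: (vL1_dom mvh (L1c (m%:R * `|M|))) => t _.
  + by move=> tau _; exists (m%:R * `|M|) => t _ _.
  + move=> t i It; rewrite yhE// exy//.
    apply: ig_ae_eq; [exact: mset_upto|exact: upto_sub|exact: hyd|exact: hrhs|].
    apply: (ae_on_sub (@upto_sub _ t)); apply: Dfull => s Ds.
    have [Ds' [_ ->]] := hD' s Ds; rewrite yhE; last exact: DI'.
    by rewrite vhE// !zoff_in.
- by split => //; exists (m%:R * `|M|).
Qed.

End Conversion.

(** * Assembling the multiplier *)

Section StieltjesCharges.
Context {R : realType}.

Lemma ig_point (t : R) (f : R -> R) D : D `<=` [set t] -> D `<=` I01 -> mset D -> L1 f -> ig D f = 0.
Proof.
move=> Dt DI mD hf.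
rewrite (@ig_ae_eq _ _ _ (fun _ => 0) mD DI hf (L1_cst 0)).
  by rewrite ig_cst ?mul0r.
exists [set` `[t, t]]; split; [exact: mset_itv|by rewrite Leb_itv// subrr|].
move=> s /= h; apply: contrapT => h'; apply: h => /Dt st; apply: contra_notP h' => _.
by rewrite st in_itv/= lexx.
Qed.

(** The Stieltjes charges of the adjoint equation live on Borel sets whereas the densities are
    integrated on Lebesgue measurable sets; Borel sets being among the latter, restriction
    suffices. *)
Lemma borel_restriction (nu : {charge set (lebT R) -> \bar R}) :
  exists nu' : {charge set (measurableTypeR R) -> \bar R}, forall A, nu' A = nu A.
Proof.
pose f (A : set (measurableTypeR R)) : \bar R := nu A.
have f0 : f set0 = 0%E by exact: charge0.
have ffin (A : set (measurableTypeR R)) : measurable A -> f A \is a fin_num.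
  by move=> mA; apply: fin_num_measure; exact: mset_borel.
have fs : semi_sigma_additive f.
  move=> F mF tF mUF; apply: (@charge_semi_sigma_additive _ _ _ nu) => //.
    by move=> i; exact: mset_borel.
  exact: mset_borel.
pose nu' : {charge set (measurableTypeR R) -> \bar R} :=
  HB.pack f (isCharge.Build _ _ _ f f0 ffin fs).
by exists nu'.
Qed.

(** The charge [f dt] plus a Dirac mass [k] at 1, the only atom that the two arcs of the multiplier
    can have. *)
Lemma density_charge (f : R -> R) (k : R) : L1 f ->
  exists nu : {charge set (measurableTypeR R) -> \bar R},
    forall A : set (measurableTypeR R), measurable A -> A `<=` I01 -> nu A = (ig A f + k * \1_A 1)%:E.
Proof.
move=> hf.
have intf : (@Leb R).-integrable setT ((EFin \o f) \_ I01) by apply/(integrable_mkcond _ mset_I01).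
have [nu1 nu1E] := borel_restriction (induced_charge intf).
exists (cadd nu1 (cscale k (charge_of_finite_measure (@dirac _ (measurableTypeR R) (1 : R) R)))).
move=> A mA AI.
transitivity (nu1 A + k%:E * @dirac _ (measurableTypeR R) (1 : R)%R R A)%E; first by [].
rewrite nu1E /dirac/=.
rewrite EFinD EFinM; congr (_ + _)%E.
rewrite /induced_charge -integral_mkcondr (setIidl AI) /ig /Rintegral fineK//.
apply: integrable_fin_num; first exact: mset_borel.
by apply: L1S => //; exact: mset_borel.
Qed.

(** An arc with derivative [- f] that ends at 0 after a jump of height [- q] at 1; both arcs of the
    multiplier have this form. *)
Definition jump_density (f : R -> R) (q t : R) : R := ig (from t) f + (if t < 1 then q else 0).

(** Writing [f] as [(|f| + f) - |f|] exhibits the integral as a difference of monotone functions;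
    the jump term is itself monotone. *)
Lemma jump_density_BV f q : L1 f -> bounded_variation 0 1 (jump_density f q).
Proof.
move=> hf; have hn := L1_norm hf.
have h1 : L1 (fun t => `|f t| + f t) by exact: L1D.
have bvn (g : R -> R) : L1 g -> (forall t, 0 <= g t) -> bounded_variation 0 1 (fun t => ig (from t) g).
  move=> hg g0; rewrite (_ : (fun t => _) = \- (fun t => - ig (from t) g)).
    apply: bounded_variationN; apply: nondecreasing_bounded_variation => s t _ _ st.
    rewrite lerN2; apply: ig_subset; [exact: mset_from|exact: mset_from| |by move=> r []|exact: hg|by []].
    by move=> r [Ir]; rewrite /= !in_itv/= !andbT => tr; split => //; rewrite /= in_itv/= andbT (le_trans st).
  by apply/funext => t; rewrite /= opprK.
have bvs : bounded_variation 0 1 (fun t : R => if t < 1 then q else 0).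
  have hs (c : R) : 0 <= c -> bounded_variation 0 1 (fun t : R => if t < 1 then - c else 0).
    move=> c0; apply: nondecreasing_bounded_variation => s t _ _ st.
    case: (ltP s 1) => s1; case: (ltP t 1) => t1 //; first by rewrite oppr_le0.
    by have := le_lt_trans (le_trans s1 st) t1; rewrite ltxx.
  have [q0|q0] := leP 0 q; last by have := hs (- q); rewrite opprK; apply; rewrite oppr_ge0 ltW.
  rewrite (_ : (fun t => _) = \- (fun t : R => if t < 1 then - q else 0)).
    by apply: bounded_variationN; exact: hs.
  by apply/funext => t /=; case: ifP; rewrite ?opprK ?oppr0.
rewrite (_ : jump_density f q = ((fun t => ig (from t) (fun t => `|f t| + f t)) \+
    (\- (fun t => ig (from t) (fun t => `|f t|)))) \+ (fun t : R => if t < 1 then q else 0)).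
  apply: bounded_variationD => //; apply: bounded_variationD => //.
    by apply: bvn => // t; have := ler_norm (- f t); rewrite normrN; lra.
  by apply: bounded_variationN; exact: bvn.
apply/funext => t; rewrite /jump_density /=; congr (_ + _).
have fI : from t `<=` I01 by move=> s [].
by rewrite (igD (mset_from t) fI hn hf) addrC addKr.
Qed.

Lemma jump_density_rcont f q t : L1 f -> 0 < t < 1 ->
  (fun s => jump_density f q s) @ t^'+ --> jump_density f q t.
Proof.
move=> hf /andP[t0 t1]; apply: cvgD.
  by apply: cvg_at_right_filter; exact: from_cont.
rewrite t1; apply: cvg_near_cst.
have : \forall s \near t^'+, s < 1 by exact: nbhs_right_lt.
by apply: filterS => s ->.
Qed.

(** Points have measure zero, so the integral over [[0,t]] is the total one minus that over
    [from t]; the atom at 1 is counted exactly when [t = 1]. *)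
Lemma jump_density_stieltjes f q (nu : {charge set (measurableTypeR R) -> \bar R}) : L1 f ->
  (forall A : set (measurableTypeR R), measurable A -> A `<=` I01 -> nu A = (ig A (fun t => - f t) + - q * \1_A 1)%:E) ->
  stieltjes (jump_density f q) nu.
Proof.
move=> hf nuE t /andP[t0 t1].
have It : I01 t by rewrite /I01 /= in_itv/= ltW.
have sub : [set` `[0, t]] `<=` I01 by rewrite -upto_itv// => s [].
rewrite nuE//; congr EFin.
rewrite (igN (mset_itv _) sub hf) /jump_density ltr01.
have m1 : mset (I01 `&` [set` `[0, t[]) by apply: msetI; [exact: mset_I01|exact: mset_itv].
have e : ig `[0, t] f = ig (I01 `&` [set` `[0, t[]) f.
  have ptI : [set` `[t, t]] `<=` I01.
    by move=> s; rewrite /= in_itv/= => /andP[h1 h2]; apply: sub; rewrite /= in_itv/= h2 (le_trans (ltW t0) h1).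
  have pt0 : ig [set` `[t, t]] f = 0.
    apply: (@ig_point t) => //; last exact: mset_itv.
    by move=> s; rewrite /= in_itv/= => /andP[h1 h2]; apply/eqP; rewrite eq_le h1 h2.
  have eU : [set` `[0, t]] = (I01 `&` [set` `[0, t[]) `|` [set` `[t, t]].
    apply/seteqP; split=> s.
      rewrite /= !in_itv/= => /andP[s0 st].
      have [st'|st'] := ltP s t; [left|right].
        by split; [rewrite /I01 /= in_itv/= s0 (le_trans st t1)|rewrite s0].
      by rewrite st.
    case=> [[_]|]; rewrite /= !in_itv/=; first by move=> /andP[-> /ltW].
    by move=> /andP[ts ->]; rewrite (le_trans (ltW t0) ts).
  rewrite eU ig_setU ?pt0 ?addr0//; first exact: mset_itv.
  apply/seteqP; split=> // s [[_]]; rewrite /= !in_itv/= => /andP[_ st] /andP[ts _].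
  by move: (lt_le_trans st ts); rewrite ltxx.
rewrite e (from_split (ltW t0) hf) indicE.
have -> : (1 \in [set` `[0, t]]) = (1 <= t).
  by apply/idP/idP; rewrite inE /= in_itv/= ler01.
have [tl|tl] := ltP t 1; first by rewrite mulr0; ring.
by rewrite mulr1; ring.
Qed.

End StieltjesCharges.

(** * Purity and concentration of the charge *)

Section PureCharge.
Context {R : realType}.
Variable zh : (R -> R) -> R.
Hypotheses (zh_lin : linear_on_bmeas zh)
  (zh_le0 : forall k, bmeas k -> ae_on I01 (fun t => k t <= 0) -> zh k <= 0)
  (zh_conc : forall bb k, bb < 1 -> bmeas k -> (forall t, bb < t -> k t = 0) -> zh k = 0).
Local Notation zeta := (zeta_charge zh_lin).

Lemma ae_neq (s : R) : ae_on I01 (fun t => t <> s).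
Proof.
exists [set` `[s, s]]; split; [exact: mset_itv|by rewrite Leb_itv// subrr|].
move=> t /= h; apply: contrapT => h'; apply: h => _ ts; apply: h'.
by rewrite ts in_itv/= lexx.
Qed.

Lemma zh_tail k k' bb : bb < 1 -> bmeas k -> bmeas k' ->
  ae_on I01 (fun t => bb < t -> k t = k' t) -> zh k = zh k'.
Proof.
move=> bb1 hk hk' kk.
have mI : mset [set` `]bb, +oo[] := mset_itv _.
have inI t : \1_[set` `]bb, +oo[] t = (bb < t)%R%:R :> R.
  by rewrite indicE; congr (nat_of_bool _)%:R; apply/idP/idP; rewrite inE /= in_itv/= andbT.
have tail j : bmeas j -> zh j = zh (fun t => j t * \1_[set` `]bb, +oo[] t).
  move=> hj; have hj' := bmeasM hj (bmeas_indic mI).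
  apply/eqP; rewrite -subr_eq0; have [h1 h2] := linear_onB zh_lin hj hj'.
  rewrite -h2 (zh_conc bb1 h1)// => t bt.
  by rewrite inI bt mulr1 subrr.
rewrite (tail k hk) (tail k' hk'); apply: zh_eq => //; [exact: bmeasM (bmeas_indic mI)|exact: bmeasM (bmeas_indic mI)|].
apply: ae_on_filter kk => t It h; rewrite inI; case: (ltP bb t) => bt; last by rewrite !mulr0.
by rewrite h.
Qed.

Lemma zeta_ba : ba zeta.
Proof.
split.
  exists (zh (fun=> 1)) => A mA; rewrite zeta_chargeE//= lee_fin.
  rewrite -[leRHS]mul1r; apply: zh_bound => //; first exact: bmeas_indic.
  by move=> t _; rewrite indicE; case: (_ \in _); rewrite ?normr1// normr0.
move=> N mN N0; rewrite zeta_chargeE// (zh_eq zh_lin zh_le0 (bmeas_indic mN) (bmeas_cst 0)) ?(linear_on0 zh_lin)//.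
exists (N `&` I01); split; [by apply: msetI => //; exact: mset_I01|by []|].
move=> t /= h; apply: contrapT => h'; apply: h => It.
by rewrite indicE memNset// => Nt; apply: h'; split.
Qed.

(** A countably additive measure below [zeta] gives no mass to []-oo, 1 - 1/(k+1)]], which [zeta]
    does not charge, nor to [[1,+oo[], which meets [[0,1]] in one point. These countably many sets
    cover the line. *)
Lemma zeta_pure : pure_charge zeta.
Proof.
move=> nu nuz A mA.
have neg (E : set R) : mset E -> zh (\1_E) = 0 -> nu.-negligible E.
  move=> mE zE; apply/negligibleP => //; apply/eqP; rewrite eq_le measure_ge0 andbT.
  by apply: le_trans (nuz E mE) _; rewrite zeta_chargeE// zE.
have n1 : nu.-negligible [set` `[(1 : R), +oo[].
  apply: neg; first exact: mset_itv.
  rewrite (zh_eq zh_lin zh_le0 (bmeas_indic (mset_itv _)) (bmeas_cst 0)) ?(linear_on0 zh_lin)//.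
  apply: ae_on_filter (ae_neq 1) => t; rewrite /I01 /= in_itv/= => /andP[_ t1] tn.
  rewrite indicE memNset//= in_itv/= andbT; apply/negP; rewrite -ltNge.
  by rewrite lt_neqAle t1 andbT; apply/eqP.
have n2 : nu.-negligible (\bigcup_k [set` `]-oo, 1 - k.+1%:R^-1 : R]]).
  apply: negligible_bigcup => k; apply: neg; first exact: mset_itv.
  have k0 : 0 < k.+1%:R^-1 :> R by rewrite invr_gt0.
  apply: (zh_conc (_ : 1 - k.+1%:R^-1 < 1)); [by rewrite gtrBl|exact: bmeas_indic (mset_itv _)|].
  by move=> t kt; rewrite indicE memNset//= in_itv/=; apply/negP; rewrite -ltNge.
apply/negligibleP => //; apply: negligibleS (negligibleU n1 n2) => t _.
have [t1|t1] := leP 1 t; [by left; rewrite /= in_itv/= t1|right].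
exists (Num.truncn (1 - t)^-1) => //=; rewrite in_itv/=.
have u0 : 0 < 1 - t by rewrite subr_gt0.
rewrite lerBrDr -lerBrDl -[leRHS]invrK lef_pV2 ?posrE ?invr_gt0//.
by apply/ltW/truncnS_gt.
Qed.

Lemma zeta_tail (E : set R) bb : bb < 1 -> mset E -> E `<=` I01 -> (forall t, bb < t -> I01 t -> t <> 1 -> E t) ->
  zh (\1_E) = zh (\1_(@I01 R)).
Proof.
move=> bb1 mE EI hE; apply: (zh_tail bb1); [exact: bmeas_indic|exact: bmeas_indic mset_I01|].
apply: ae_on_filter (ae_neq 1) => t It t1 bt.
by rewrite !indicE mem_set ?mem_set//; exact: hE.
Qed.

(** Compared with [[0,1]], the interval only misses the point 1 and times up to [1 - e], and [zh]
    sees neither. *)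
Lemma zeta_left : left_concentrated zeta 1.
Proof.
move=> e e0; have mE : mset ([set` `](1 - e), 1[] `&` I01) by apply: msetI; [exact: mset_itv|exact: mset_I01].
rewrite [LHS](zeta_chargeE zh_lin mE) [RHS](zeta_chargeE zh_lin mset_I01).
congr EFin; apply: (@zeta_tail _ (1 - e)) => //; first by rewrite gtrBl.
move=> t et It t1; split => //; rewrite /= in_itv/= et/=.
by move: It; rewrite /I01 /= in_itv/= => /andP[_ h]; rewrite lt_neqAle h andbT; apply/eqP.
Qed.

End PureCharge.

(** * The conditions on the multiplier tuple *)

Section Assembly.
Context {R : realType} {n m : nat}.
Variables (P : problem R n m) (xb : R -> 'cV[R]_n) (ub : R -> 'cV[R]_m) (D : set R) (K : R).
Hypotheses (mD : mset D) (DI : D `<=` I01) (fD : ae_on I01 (fun t => D t)) (K0 : 0 <= K).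
Local Notation A := (zoff D (fx_bar P xb ub)).
Local Notation B := (zoff D (fu_bar P xb ub)).
Local Notation a := (zoff D (gx_bar P xb ub)).
Local Notation b := (zoff D (gu_bar P xb ub)).
Local Notation c := (zoff D (Lx_bar P xb ub)).
Local Notation d := (zoff D (Lu_bar P xb ub)).
Hypotheses (hA : mxfield A K) (hB : mxfield B K) (ha : mxfield a K)
  (hb : mxfield b K) (hc : mxfield c K) (hd : mxfield d K)
  (mg : meas (zoff D (g_bar P xb ub))) (gle : forall t, D t -> g_bar P xb ub t <= 0).
Variables (z : R -> R) (zh : (R -> R) -> R).
Hypotheses (mz : meas z) (hz : L1 z) (z0 : forall t, 0 <= z t)
  (zh_lin : linear_on_bmeas zh)
  (zh_le0 : forall k, bmeas k -> ae_on I01 (fun t => k t <= 0) -> zh k <= 0)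
  (zh_conc : forall bb k, bb < 1 -> bmeas k -> (forall t, bb < t -> k t = 0) -> zh k = 0).
Hypothesis stationary : forall y v, direction A B y v -> bmeas (lform a b y v) ->
  J c d y v + (ig I01 (fun t => z t * lform a b y v t) + zh (lform a b y v)) = 0.
Hypothesis support : forall (e : R) (E : set R), 0 < e -> mset E -> E `<=` I01 ->
  (forall t, D t -> E t -> g_bar P xb ub t < - e) ->
  ig I01 (fun t => z t * \1_E t) = 0 /\ zh (\1_E) = 0.
Local Notation zeta := (zeta_charge zh_lin).

Let Dfull Q : (forall t, D t -> Q t) -> ae_on I01 Q.
Proof. by move=> h; apply: ae_on_filter fD => t _; exact: h. Qed.

(** Built from the measurable representative of the constraint. The set in the charge condition
    agrees with it almost everywhere and becomes measurable by completeness. *)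
Let slack (e : R) : set R := I01 `&` [set t | zoff D (g_bar P xb ub) t < - e].

Let mslack e : mset (slack e).
Proof. by apply: msetI; [exact: mset_I01|apply: mset_lt => //; exact: meas_cst]. Qed.

Let slackE e t : D t -> slack e t -> g_bar P xb ub t < - e.
Proof. by move=> Dt [_ /=]; rewrite zoff_in. Qed.

(** On [D] the times with negative constraint are exhausted by the slack sets of levels [1/(k+1)].
    On each of these the nonnegative [z] has integral 0, so it vanishes almost everywhere. *)
Lemma complementarity : ae_on I01 (fun t => z t * g_bar P xb ub t = 0).
Proof.
have h (k : nat) : ae_on I01 (fun t => z t * \1_(slack k.+1%:R^-1) t = 0).
  have k0 : 0 < k.+1%:R^-1 :> R by rewrite invr_gt0.
  have [e _] := support k0 (mslack _) (@subIsetl _ _ _) (@slackE _).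
  have m1 : meas (fun t => z t * \1_(slack k.+1%:R^-1) t) by apply: measM => //; exact: meas_indic (mslack _).
  apply: (ig_nonneg_eq0 m1 _ _ e).
    apply: (@L1_dom _ _ z) => // t _; rewrite ger0_norm ?mulr_ge0// indicE ?ler0n//.
    by case: (_ \in _); rewrite ?mulr1// mulr0.
  by move=> t; rewrite mulr_ge0// indicE ler0n.
have hh : ae_on I01 (fun t => forall k : nat, z t * \1_(slack k.+1%:R^-1) t = 0).
  have := ae_foralln h; rewrite /ae_on; apply: filterS => t h1 It k; exact: h1.
apply: ae_on_filter (ae_on_and fD hh) => t It [Dt zk].
have [->|gn] := eqVneq (g_bar P xb ub t) 0; first by rewrite mulr0.
have g0 : 0 < - g_bar P xb ub t by rewrite oppr_gt0 lt_neqAle gn gle.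
have := zk (Num.truncn (- g_bar P xb ub t)^-1).
rewrite indicE mem_set; first by rewrite mulr1 => ->; rewrite mul0r.
split => //=; rewrite zoff_in// ltrNr -[ltRHS]invrK ltf_pV2 ?posrE ?invr_gt0//.
exact: truncnS_gt.
Qed.

Lemma charge_complementarity : null_charge_ae zeta (g_bar P xb ub).
Proof.
move=> e e0; pose E := [set t | I01 t /\ `|g_bar P xb ub t| > e].
have aeE : ae_on I01 (fun t => E t <-> slack e t).
  apply: Dfull => t Dt; have It := DI Dt; rewrite /E /slack /= zoff_in//.
  by rewrite ler0_norm ?gle// ltrNr; split=> -[].
have mE : mset E by apply: (mset_ae (mslack e)) aeE => t [].
rewrite [LHS](zeta_chargeE zh_lin mE) (zh_eq zh_lin zh_le0 (bmeas_indic mE) (bmeas_indic (mslack e))).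
  by have [_ ->] := support e0 (mslack e) (@subIsetl _ _ _) (@slackE _).
apply: ae_on_filter aeE => t _ [h1 h2]; rewrite !indicE; congr (nat_of_bool _)%:R.
by apply/idP/idP => /set_mem ?; apply/mem_set; [exact: h1|exact: h2].
Qed.

Let q (i : 'I_n) : R := zh (fun t => a t 0 i).

Let ba_ i : bmeas (fun t => a t 0 i) := bmeas_entry 0 i ha.

(** All sets containing a left neighbourhood of 1, up to the point 1 itself, give the same value;
    this makes [beta] constant before 1. *)
Lemma charge_integral_gx (E : set R) bb i : bb < 1 -> mset E -> E `<=` I01 ->
  (forall t, bb < t -> I01 t -> t <> 1 -> E t) ->
  charge_integral zeta E (fun t => (gx_bar P xb ub t)^T i 0) = q i.
Proof.
move=> bb1 mE EI hE.
rewrite (charge_integralE zh_lin zh_le0 mE EI (ba_ i)); last first.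
  by apply: Dfull => t Dt; rewrite zoff_in// mxE.
apply: (zh_tail zh_lin zh_le0 zh_conc bb1); [exact: bmeasM (ba_ i) (bmeas_indic mE)|exact: ba_|].
apply: ae_on_filter (ae_neq 1) => t It t1 bt.
by rewrite indicE mem_set ?mulr1//; exact: hE.
Qed.

(** A component of the charge integral over [E] is [zh] evaluated along the control equal to a basis
    vector on [E] and to 0 elsewhere, where stationarity is known. *)
Lemma charge_stationarity (E : set (lebT R)) : measurable E -> E `<=` I01 ->
  charge_integral_vec zeta E (fun t => (gu_bar P xb ub t)^T) = 0.
Proof.
move=> mE EI; apply/colP => j; rewrite [LHS]mxE [RHS]mxE.
have bb_ : bmeas (fun t => b t 0 j) := bmeas_entry 0 j hb.
rewrite (charge_integralE zh_lin zh_le0 mE EI bb_); last first.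
  by apply: Dfull => t Dt; rewrite zoff_in// mxE.
pose v t : 'cV[R]_m := \1_E t *: delta_mx j 0.
have hv : bvec v.
  split; first by apply: vmeasZ; [exact: meas_indic|exact: vmeas_cst].
  exists 1 => t; rewrite nrmZ nrm_delta mulr1 indicE.
  by case: (_ \in _); rewrite ?normr1// normr0.
rewrite -[RHS](charge_stationary hA hB ha hb hc hd K0 mz hz z0 zh_lin zh_le0 zh_conc stationary hv).
congr zh; apply/funext => t.
by rewrite /v -scalemxAr mx11Z mulmx_delta mulrC.
Qed.

Variable p : R -> 'cV[R]_n.
Let G t : 'cV[R]_n := (A t)^T *m p t + (c t)^T + z t *: (a t)^T.
Hypotheses (hG : vL1 G) (mG : vmeas G)
  (pE : forall t i, I01 t -> p t i 0 = zh (fun s => a s 0 i) + ig (from t) (fun s => G s i 0))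
  (p_stat : ae_on I01 (fun t => (B t)^T *m p t + (d t)^T + z t *: (b t)^T = 0)).

(** It coincides with [p] before 1, but the multiplier must satisfy [lam 1 = 0] while [p 1] is the
    vector of charge integrals [q]; the discrepancy is the jump at 1, matched by the jump of
    [jump_arc]. *)
Definition adjoint_arc t : 'cV[R]_n := \col_i jump_density (fun s => G s i 0) (q i) t.
Definition jump_arc t : 'cV[R]_n := \col_i jump_density (fun=> 0) (- q i) t.

Lemma adjoint_arcE t : I01 t -> t <> 1 -> adjoint_arc t = p t.
Proof.
move=> It t1; have tl : t < 1.
  by move: It; rewrite /I01 /= in_itv/= => /andP[_ h]; rewrite lt_neqAle h andbT; apply/eqP.
by apply/colP => i; rewrite mxE /jump_density tl pE// addrC.
Qed.

Lemma jump_arcE t : t < 1 -> jump_arc t = - \col_i q i.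
Proof.
move=> t1; apply/colP => i; rewrite !mxE /jump_density t1.
have fI : from t `<=` I01 by move=> s [].
rewrite (_ : ig (from t) (fun=> 0) = 0) ?add0r//.
by rewrite ig_cst ?mul0r//; exact: mset_from.
Qed.

Lemma density_ae : ae_on I01 (fun t => adjoint_density P xb ub adjoint_arc 1 z t = G t).
Proof.
apply: ae_on_filter (ae_on_and fD (ae_neq 1)) => t It [Dt t1].
by rewrite /adjoint_density /G !zoff_in// adjoint_arcE// scale1r.
Qed.

Lemma jump_density_charge (f : R -> R) r : L1 f -> exists nu : {charge set (measurableTypeR R) -> \bar R},
  stieltjes (jump_density f r) nu /\
  forall E : set (measurableTypeR R), measurable E -> E `<=` I01 ->
    nu E = (ig E (fun t => - f t) + - r * \1_E 1)%:E.
Proof.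
move=> hf; have [nu nuE] := density_charge (- r) (L1N hf).
by exists nu; split => //; exact: jump_density_stieltjes nuE.
Qed.

(** The charges of [- lam] and of [beta] carry the same atom [q i] at 1, and what remains of the
    first is [G dt]. The value of the density at [t = 1], where [adjoint_arc] and [p] may differ,
    does not affect the integral. *)
Lemma adjoint_equationP : adjoint_equation P xb ub adjoint_arc jump_arc 1 z.
Proof.
move=> i.
have [dl [sl dlE]] := jump_density_charge (q i) (hG i).
have [db [sb dbE]] := jump_density_charge (- q i) (L1_cst 0).
exists dl, db; split.
- by rewrite (_ : (fun t => _) = jump_density (fun s => G s i 0) (q i))//; apply/funext => t; rewrite mxE.
- by rewrite (_ : (fun t => _) = jump_density (fun=> 0) (- q i))//; apply/funext => t; rewrite mxE.
move=> E mE EI; have mE' : mset E := mset_borel mE.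
rewrite dlE// dbE//.
have -> : (\int[@Leb R]_(t in E) (adjoint_density P xb ub adjoint_arc 1 z t i 0)%:E = (ig E (fun t => G t i 0))%:E)%E.
  have ae : ae_on I01 (fun t => adjoint_density P xb ub adjoint_arc 1 z t i 0 = G t i 0).
    by apply: ae_on_filter density_ae => t _ ->.
  rewrite /ig /Rintegral fineK; last by apply: (integrable_fin_num mE'); exact: L1S mE' EI (hG i).
  apply: (ae_eq_integral _ _ mE').
  - by apply/measurable_EFinP; apply: measurable_funS (meas_ae (mG i) ae) => //; exact: mset_I01.
  - by apply/measurable_EFinP; apply: measurable_funTS; exact: mG.
  - by move: ae; rewrite /ae_on; apply: filterS => t h Et /=; rewrite h//; exact: EI.
rewrite -EFinN -EFinD; congr EFin.
rewrite (igN mE' EI (hG i)) (igN mE' EI (L1_cst 0)) ig_cst// mul0r; ring.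
Qed.

Let jump_BV (f : 'I_n -> R -> R) r : (forall i, L1 (f i)) -> BV (fun t => \col_i jump_density (f i) (r i) t).
Proof.
move=> hf i; rewrite (_ : (fun t => _) = jump_density (f i) (r i)); last by apply/funext => t; rewrite mxE.
split; first exact: jump_density_BV.
by move=> t t01; rewrite mxE; exact: jump_density_rcont.
Qed.

Let jump1 (f : 'I_n -> R -> R) r : (forall i, L1 (f i)) -> \col_i jump_density (f i) (r i) 1 = 0 :> 'cV_n.
Proof.
move=> hf; apply/colP => i; rewrite !mxE /jump_density ltxx addr0.
apply: (@ig_point _ 1) => //; [|by move=> s []|exact: mset_from].
move=> s []; rewrite /I01 /= !in_itv/= andbT => /andP[_ s1] ts.
by apply/eqP; rewrite eq_le s1.
Qed.

Theorem multiplier_exists : multiplier P xb ub adjoint_arc jump_arc 1 z zeta.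
Proof.
have bq : - \col_i q i = jump_arc 0 by rewrite jump_arcE ?ltr01.
split.
- exact: ler01.
- exact: hz.
- by apply: ae_onT => t _.
- exact: zeta_ba.
- exact: zeta_pure.
- by move=> E mE; exact: charge_of_ge0.
- exact: jump_BV.
- by apply: jump_BV => i; exact: L1_cst.
- rewrite -addrA ltr_pwDl// addr_ge0//; first exact: ig_ge0.
  by apply: fine_ge0; exact: charge_of_ge0.
- exact: complementarity.
- exact: charge_complementarity.
- exact: jump1.
- by apply: jump1 => i; exact: L1_cst.
- exact: adjoint_equationP.
- rewrite -bq; congr (- _); apply/colP => i; rewrite !mxE (@charge_integral_gx _ 0)//.
  exact: mset_I01.
(* The sequence is eventually constant: once [t + 1/(k+1) < 1] the interval of integration contains
   a left neighbourhood of 1. *)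
- move=> t /andP[t0 t1]; apply: cvg_near_cst.
  have t10 : 0 < 1 - t by rewrite subr_gt0.
  exists (Num.truncn (1 - t)^-1) => // k /= hk; rewrite jump_arcE//; congr (- _).
  apply/colP => i; rewrite !mxE.
  have tk : t + k.+1%:R^-1 < 1.
    rewrite -ltrBrDl -[ltRHS]invrK ltf_pV2 ?posrE ?invr_gt0//.
    by apply: lt_le_trans (truncnS_gt _) _; rewrite ler_nat.
  rewrite (@charge_integral_gx _ (t + k.+1%:R^-1))//; first exact: mset_itv.
    move=> s; rewrite /I01 /= !in_itv/= => /andP[h1 ->]; rewrite andbT; apply: le_trans h1.
    by rewrite addr_ge0// ltW.
  by move=> s h1 Is _; move: Is; rewrite /I01 /= !in_itv/= (ltW h1) => /andP[].
- apply: ae_on_filter (ae_on_and fD (ae_on_and (ae_neq 1) p_stat)) => t It [Dt [t1 h]].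
  by rewrite adjoint_arcE// scale1r -[LHS]h !zoff_in.
- exact: charge_stationarity.
Qed.

End Assembly.

Theorem theorem4p11 (R : realType) (n m : nat) (P : problem R n m)
  (xb : R -> 'cV[R]_n) (ub : R -> 'cV[R]_m)
  (P_smooth : smooth_problem P)
  (xu_min : weak_local_minimizer P xb ub)
  (g0 : has_ess_lim (g_bar P xb ub) 0 0)
  (gu0 : forall j : 'I_m, has_ess_lim (fun t => gu_bar P xb ub t 0 j) 0 0)
  (H1 : forall a b : R, 0 < a -> a < b -> b < 1 ->
     exists2 e : R, 0 < e & exists2 v0 : R -> 'cV[R]_m, Linfty a b v0 &
       ae_on (active P xb ub e `&` `[a, b])
         (fun t => 1 <= (gu_bar P xb ub t *m v0 t) 0 0))
  (H2 : exists (e0 e : R) (omega : R -> R),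
     [/\ 0 < e0 < 1, 0 < e,
         (forall t, 0 < t <= e0 -> 0 < omega t) /\
         (forall s t, 0 < s -> s <= t -> t <= e0 -> omega s <= omega t),
         (\int[@Leb R]_(t in `]0%R, e0]) ((omega t)^-1)%:E < +oo)%E
       & ae_on (active P xb ub e `&` `[0, e0])
           (fun t => omega t <= enorm (gu_bar P xb ub t)^T)])
  (e3 : R) (y : R -> 'cV[R]_n) (v : R -> 'cV[R]_m) (delta : R -> R)
  (e3_gt0 : 0 < e3)
  (yv_lin : linearized_process P xb ub y v)
  (w_le0 : ae_on (active P xb ub e3) (fun t => lin_constr P xb ub y v t <= 0))
  (w_lt0 : forall eta : R, 0 < eta < 1 ->
     0 < delta eta /\
     ae_on (active P xb ub e3 `&` `[eta, 1])
       (fun t => lin_constr P xb ub y v t <= - delta eta)) :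
  exists (lam beta : R -> 'cV[R]_n) (lam0 : R) (z : R -> R)
         (zeta : {additive_charge set (lebT R) -> \bar R}),
    [/\ multiplier P xb ub lam beta lam0 z zeta,
        0 < lam0,
        (forall A : set (lebT R), measurable A -> zeta A = 0%E) \/
        left_concentrated zeta 1
      & forall eta : R, 0 < eta < 1 ->
          fine (zeta I01) + \int[@Leb R]_(t in `[eta, 1]) z t <=
          lam0 / delta eta *
          \int[@Leb R]_(t in I01) `|lin_cost P xb ub y v t|].
Proof.
have [D [K [mD DI fD gle [K0 [hA hB ha [hb hc hd mg nsd]]]]]] := reduction P_smooth xu_min.
set A := zoff D (fx_bar P xb ub) in hA nsd *; set B := zoff D (fu_bar P xb ub) in hB nsd *.
set a := zoff D (gx_bar P xb ub) in ha nsd *; set b := zoff D (gu_bar P xb ub) in hb nsd *.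
set c := zoff D (Lx_bar P xb ub) in hc nsd *; set d := zoff D (Lu_bar P xb ub) in hd nsd *.
pose gam := g_bar P xb ub.
have actI e : act gam e `<=` I01 by move=> t [].
have fb bb : 0 < bb < 1 -> exists e ch rho, 0 < e /\ feedback b gam bb e ch rho.
  have [e0 [e [omega [e01 e_gt0 [om0 omh] omi hom]]]] := H2.
  have mb j : meas (fun t => b t 0 j) by case: (mxfield_entry 0 j hb).
  exact: (feedback_exists fD mb e01 e_gt0 om0 omh omi hom H1).
have [yh [vh [dh bvh wE cE]]] := direction_of_linearized fD K0 hA hB yv_lin.
have wh_le0 : ae_on (act gam e3) (fun t => lform a b yh vh t <= 0).
  apply: ae_on_filter (ae_on_and w_le0 (ae_on_sub (@actI e3) wE)) => t _ [h1 h2].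
  by rewrite h2.
have wh_lt0 eta : 0 < eta < 1 -> 0 < delta eta /\
    ae_on (act gam e3 `&` [set` `[eta, 1]]) (fun t => lform a b yh vh t <= - delta eta).
  move=> he; have [d0 h] := w_lt0 eta he; split => //.
  have sub : act gam e3 `&` [set` `[eta, 1]] `<=` I01 by move=> t [/actI].
  apply: ae_on_filter (ae_on_and h (ae_on_sub sub wE)) => t _ [h1 h2].
  by rewrite h2.
have [mu [muD muZ mule mudom must]] :=
  multiplier_functional hA hB ha hb hc hd K0 fb dh e3_gt0 wh_le0 wh_lt0 nsd.
have mule' k : bmeas k -> ae_on I01 (fun t => k t <= 0) -> mu k <= 0.
  by move=> hk k0; apply: (mule k e3 hk e3_gt0); exact: ae_on_sub (@actI e3) k0.
have [z [zh [mz hz z0 [muE zh_lin zh_le0 zh_conc]]]] := charge_decomposition (conj muD muZ) mule' mudom.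
have stat y' v' : direction A B y' v' -> bmeas (lform a b y' v') ->
    J c d y' v' + (ig I01 (fun t => z t * lform a b y' v' t) + zh (lform a b y' v')) = 0.
  by move=> d' b'; rewrite -muE//; exact: must.
have z1 (E : set R) : mset E -> 0 <= ig I01 (fun t => z t * \1_E t) /\ 0 <= zh (\1_E).
  move=> mE; split; first by apply: ig_ge0 => t _; rewrite mulr_ge0// indicE ler0n.
  by rewrite -lee_fin -(zeta_chargeE zh_lin mE); exact: charge_of_ge0.
(* The indicator of [E] vanishes almost everywhere on [act e], so [mu] is at most 0 on it; its value
   is the sum of two nonnegative parts, which are therefore both 0. *)
have supp (e : R) (E : set R) : 0 < e -> mset E -> E `<=` I01 ->
    (forall t, D t -> E t -> gam t < - e) ->
    ig I01 (fun t => z t * \1_E t) = 0 /\ zh (\1_E) = 0.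
  move=> e0 mE EI hE; have [h1 h2] := z1 E mE.
  have : mu (\1_E) <= 0.
    apply: (mule _ e (bmeas_indic mE) e0).
    apply: ae_on_filter (ae_on_sub (@actI e) fD) => t [_ gt] Dt.
    by rewrite indicE memNset// => Et; move: (hE t Dt Et); rewrite ltNge gt.
  by rewrite (muE _ (bmeas_indic mE)) => h3; split; lra.
have [p [bp hG mG pE pst]] :=
  adjoint_solution hA hB ha hb hc hd K0 mz hz z0 zh_lin zh_le0 zh_conc stat.
exists (adjoint_arc P xb ub D z zh p), (jump_arc P xb ub D zh), 1, z, (zeta_charge zh_lin); split => //.
- exact: (multiplier_exists DI fD K0 hA hB ha hb hc hd mg gle mz hz z0 zh_lin zh_le0 zh_conc stat supp hG mG pE pst).
(* The identity defining left concentration also holds for the zero charge, so this alternative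
   covers both cases. *)
- by right; exact: zeta_left.
move=> eta heta; have [d0 wlt] := wh_lt0 eta heta; have /andP[eta0 eta1] := heta.
pose E : set R := [set` `[eta, 1]].
have mE : mset E := mset_itv _.
have EI : E `<=` I01.
  by move=> t; rewrite /E /I01 /= !in_itv/= => /andP[h1 ->]; rewrite (le_trans (ltW eta0) h1).
have hw : bmeas (lform a b yh vh).
  split; first exact: meas_lform ha hb (dir_y dh) bvh.1.
  have [M1 h1] := dir_bd dh; have [_ [M2 h2]] := bvh.
  exists (K * M1 + K * M2) => t; apply: le_trans (lform_bound _ _ _ ha hb) _.
  by apply: lerD; rewrite ler_wpM2l.
have hEd : bmeas (fun t => delta eta * \1_E t) := bmeasZ (delta eta) (bmeas_indic mE).
(* On the almost active set [w] is at most [- delta eta] on [E] and at most 0 elsewhere, so adding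
   [delta eta] times the indicator of [E] leaves it nonpositive. Since [mu w = - J], this bounds
   [delta eta * mu (\1_E)] by the linearized cost. *)
have neg : mu (lform a b yh vh) + delta eta * mu (\1_E) <= 0.
  rewrite -(muZ _ _ (bmeas_indic mE)) -(muD _ _ hw hEd).
  apply: (mule _ e3 (bmeasD hw hEd) e3_gt0).
  move: wlt wh_le0; rewrite /ae_on; apply: filterS2 => t h1 h2 ta.
  rewrite indicE; have [Et|Et] := pselect (E t); last by rewrite memNset// mulr0 addr0; exact: h2.
  by rewrite mem_set// mulr1 -lerBrDr sub0r; apply: h1; split.
have hJ := must _ _ dh hw.
(* The whole charge sits in [E], because nothing before [eta] is charged; hence the total mass
   appears in the final bound. *)
have zI : fine (zeta_charge zh_lin I01) = zh (\1_E).
  rewrite zeta_chargeE; last exact: mset_I01.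
  apply/esym/(zeta_tail zh_lin zh_le0 zh_conc eta1 mE EI) => t et It _.
  by move: It; rewrite /E /I01 /= !in_itv/= (ltW et) => /andP[].
have muE1 : mu (\1_E) = ig E z + zh (\1_E).
  rewrite muE; last exact: bmeas_indic.
  congr (_ + _); rewrite [RHS]ig_mkcond//; apply: ig_eq => t _.
  by rewrite patchE indicE; case: (_ \in _); rewrite ?mulr1// mulr0.
have mc : meas (lform c d yh vh) := meas_lform hc hd (dir_y dh) bvh.1.
have lc := L1_lform hc hd K0 dh.
have Jle : J c d yh vh <= ig I01 (fun t => `|lin_cost P xb ub y v t|).
  rewrite (@ig_ae _ _ (fun t => `|lform c d yh vh t|)).
  - exact: le_trans (ler_norm _) (ig_norm mset_I01 (@subset_refl _ _) lc).
  - exact: meas_norm.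
  - exact: L1_norm.
  - by apply: ae_on_filter cE => t _ ->.
rewrite zI div1r mulrC ler_pdivlMr// mulrC.
apply: le_trans Jle; rewrite addrC -[X in _ * X]muE1.
have -> : J c d yh vh = - mu (lform a b yh vh) by apply/eqP; rewrite -subr_eq0 opprK hJ.
by rewrite -subr_le0 opprK addrC.
Qed.
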